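(* Let $H$, $h$, $g$ be as in the context and suppose that the assumptions (h-regularity), (g-structure), (g-compactness), (H-growth), (H-smoothness) and (monotonicity), all formulated in the context, are satisfied. Then there exists a weak solution $(m,u)\in\mathcal{D}'(\mathbb{T}^d)\times\mathcal{D}'(\mathbb{T}^d)$, with $m\ge 0$, to the mean-field game system $$\begin{cases}-u-H(x,Du,D^2u,m,h(m))=0,\\ m-\operatorname{div}\big(mD_pH(x,Du,D^2u,m,h(m))\big)+\big(mD_{M_{ij}}H(x,Du,D^2u,m,h(m))\big)_{x_ix_j}=1\end{cases}$$ on $\mathbb{T}^d$. Moreover, $(m,u)\in\mathcal{M}_{ac}(\mathbb{T}^d)\times W^{1,\gamma}(\mathbb{T}^d)$ and $\int_{\mathbb{T}^d}m\,dx=1$.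
   Context: Setting. $\mathbb{T}^d=\mathbb{R}^d/\mathbb{Z}^d$, $d\ge1$; $\mathbb{E}$ is a fixed set, either $(0,\infty)$ or $[0,\infty)$. $\mathcal{M}_{ac}(\mathbb{T}^d)$ is the space of positive measures on $\mathbb{T}^d$ absolutely continuous with respect to Lebesgue measure; such a measure is identified with its density $m\in L^1(\mathbb{T}^d)$, $m\ge0$ a.e. Given are $H:\mathbb{T}^d\times\mathbb{R}^d\times\mathbb{R}^{d\times d}\times\mathbb{E}\times\mathbb{R}\to\mathbb{R}$, $(x,p,M,m,\theta)\mapsto H(x,p,M,m,\theta)$, a (possibly nonlinear) operator $h:\mathcal{M}_{ac}(\mathbb{T}^d)\to C(\mathbb{T}^d)$ ($h(m)$ is its value at the measure with density $m$), and a continuous function $g:\mathbb{T}^d\times\mathbb{E}\times\mathbb{R}\to\mathbb{R}$. $H(x,Du,D^2u,m,h(m))$ denotes $x\mapsto H(x,Du(x),D^2u(x),m(x),h(m)(x))$, and similarly for derivatives of $H$ and for $g,g_1,g_2$. Repeated indices $i,j\in\{1,\dots,d\}$ are summed; $M_1:M_2=\operatorname{tr}(M_1M_2)$ for symmetric matrices. Conditions over $m\in\mathcal{M}_{ac}(\mathbb{T}^d)$ involving $g$ or $H$ are understood for densities with values in $\mathbb{E}$ a.e. (h-regularity) For all $\kappa>\frac d2+1$: $h(m)\in W^{\kappa,2}(\mathbb{T}^d)$ for every $m\in W^{\kappa,2}(\mathbb{T}^d)$ ($m\geq 0$), and $m\mapsto h(m)$ is a Fréchet differentiable map from (nonnegative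 elements of) $W^{\kappa,2}(\mathbb{T}^d)$ to $W^{\kappa,2}(\mathbb{T}^d)$. (g-structure) (1) There are functions $g_1,g_2$ with $g=g_1+g_2$ on $\mathbb{T}^d\times\mathbb{E}\times\mathbb{R}$ and $g_2(x,m(x),h(m)(x))\ge0$ for all $m\in\mathcal{M}_{ac}(\mathbb{T}^d)$. (2) There is $c>0$ with $\int_{\mathbb{T}^d} g_2(x,m,h(m))\,dx\le c\,(1+\int_{\mathbb{T}^d} m\,dx)$ for all $m\in\mathcal{M}_{ac}(\mathbb{T}^d)$. (3) For all $\delta>0$ there is $C_\delta>0$ with $\max\{\int_{\mathbb{T}^d} g_1(x,m,h(m))\,dx,\int_{\mathbb{T}^d} m\,dx\}\le\delta\int_{\mathbb{T}^d} m g_1(x,m,h(m))\,dx+C_\delta$ for all $m\in\mathcal{M}_{ac}(\mathbb{T}^d)$. (4) There is $R\ge0$ with $\int_{\mathbb{T}^d} mg_1(x,m,h(m))\,dx\ge-R$ for all $m\in\mathcal{M}_{ac}(\mathbb{T}^d)$. (g-compactness) If $(m_j)\subset\mathcal{M}_{ac}(\mathbb{T}^d)$ and $\sup_j\int_{\mathbb{T}^d} m_jg_1(x,m_j,h(m_j))\,dx<+\infty$, then a subsequence of $(m_j)$ converges weakly in $L^1(\mathbb{T}^d)$. (H-growth) There are constants $\gamma>1$, $0\le\tau<1$, $C_1,C_2,C_3,C_4>0$ such that, with the given continuous function $g:\mathbb{T}^d\times\mathbb{E}\times\mathbb{R}\to\mathbb{R}$ (the same $g=g_1+g_2$ as in (g-structure)):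 (a) for all $(x,p,M,m,\theta)$, $-H+D_pH\cdot p+D_MH:M\ge\frac1{C_1}m^{-\tau}|p|^\gamma+C_2g(x,m,\theta)-C_1$, with $H$ and derivatives evaluated at $(x,p,M,m,\theta)$; (b) for all $(m,u)\in\mathcal{M}_{ac}(\mathbb{T}^d)\times W^{1,\gamma}(\mathbb{T}^d)$ with $D^2u$ a measurable function, $$-C_3\int_{\mathbb{T}^d} g(x,m,h(m))dx+\frac1{C_1}\int_{\mathbb{T}^d}|Du|^\gamma m^{-\tau}dx-C_1\le\int_{\mathbb{T}^d} H(x,Du,D^2u,m,h(m))dx\le-C_4\int_{\mathbb{T}^d} g(x,m,h(m))dx+C_1\Big(1+\int_{\mathbb{T}^d}|Du|^\gamma m^{-\tau}dx\Big).$$ (H-smoothness) $H$ is of class $C^\infty$ on $\mathbb{T}^d\times\mathbb{R}^d\times\mathbb{R}^{d\times d}\times\mathbb{E}\times\mathbb{R}$. Operator $A$. For $(\eta,v)\in C^\infty(\mathbb{T}^d;\mathbb{E})\times C^\infty(\mathbb{T}^d)$, $A(\eta,v)$ is the pair with components $-v-H(x,Dv,D^2v,\eta,h(\eta))$ and $\eta-\operatorname{div}(\eta D_pH(x,Dv,D^2v,\eta,h(\eta)))+(\eta D_{M_{ij}}H(x,Dv,D^2v,\eta,h(\eta)))_{x_ix_j}-1$. (monotonicity) For all $(\eta,v),(\bar\eta,\bar v)\in C^\infty(\mathbb{T}^d;\mathbb{E})\times C^\infty(\mathbb{T}^d)$, $\big(A(\eta,v)-A(\bar\eta,\bar v),(\eta,v)-(\bar\eta,\bar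 v)\big)_{L^2(\mathbb{T}^d)\times L^2(\mathbb{T}^d)}\ge0$. Weak solution. A pair $(m,u)\in\mathcal{D}'(\mathbb{T}^d)\times\mathcal{D}'(\mathbb{T}^d)$ with $m\ge0$ is a weak solution of the system if $\langle(\eta,v)-(m,u),A(\eta,v)\rangle\ge0$ for all $(\eta,v)\in C^\infty(\mathbb{T}^d;\mathbb{E})\times C^\infty(\mathbb{T}^d)$, where $\langle\cdot,\cdot\rangle$ is the duality between $\mathcal{D}'(\mathbb{T}^d)\times\mathcal{D}'(\mathbb{T}^d)$ and $C^\infty(\mathbb{T}^d)\times C^\infty(\mathbb{T}^d)$. *)

(* Defs.v *)
From HB Require Import structures.
From mathcomp Require Import all_boot all_order all_algebra.
From mathcomp Require Import all_classical all_reals all_analysis.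
Import Order.TTheory GRing.Theory Num.Theory numFieldNormedType.Exports.

Set Implicit Arguments.
Unset Strict Implicit.
Unset Printing Implicit Defensive.

Local Open Scope classical_set_scope.
Local Open Scope ring_scope.

(* A function on the torus R^d / Z^d is a Z^d-periodic function on R^d
   ('rV[R]_d).  An element of L^p or W^(k,p) is given by a Borel
   representative; the predicates below are invariant under a.e. equality. *)
Definition periodic (R : realType) (d : nat) (T : Type) (f : 'rV[R]_d -> T) :=
  forall x (k : 'rV[int]_d), f (x + map_mx intr k) = f x.

(* Lebesgue measure of the torus: the d-fold product of the uniform probability
   on [0, 1].  The library makes tuples, but not matrices, measurable spaces,
   hence the passage through tuples. *)
Definition cons_tuple (R : realType) (n : nat)
    (z : measurableTypeR R * n.-tuple (measurableTypeR R)) :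
  n.+1.-tuple (measurableTypeR R) := [the n.+1.-tuple _ of z.1 :: z.2].

Lemma measurable_cons_tuple (R : realType) (n : nat) :
  measurable_fun setT (@cons_tuple R n).
Proof. exact: measurable_cons. Qed.

HB.instance Definition _ (R : realType) (n : nat) :=
  isMeasurableFun.Build _ _ _ _ (@cons_tuple R n) (@measurable_cons_tuple R n).

Fixpoint torus_leb (R : realType) (n : nat) :
    probability (n.-tuple (measurableTypeR R)) R :=
  match n with
  | 0 => dirac [tuple]
  | n'.+1 => distribution
      ((uniform_prob (@ltr01 R) \x torus_leb R n')%E : probability _ R)
      (@cons_tuple R n')
  end.

Definition row_of (R : realType) (d : nat)
  (t : d.-tuple (measurableTypeR R)) : 'rV[R]_d := \row_i tnth t i.

(* Extended-real integral over the torus; when the positive and negative parts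
   both have infinite integral its value is -oo. *)
Definition eint (R : realType) (d : nat) (f : 'rV[R]_d -> \bar R) : \bar R :=
  (\int[torus_leb R d]_t f (row_of t))%E.

Definition tint (R : realType) (d : nat) (f : 'rV[R]_d -> R) : R :=
  \int[torus_leb R d]_t f (row_of t).

Definition has_int (R : realType) (d : nat) (f : 'rV[R]_d -> \bar R) :=
  (eint (f^\+)%E < +oo)%E \/ (eint (f^\-)%E < +oo)%E.

Definition ae_torus (R : realType) (d : nat) (P : 'rV[R]_d -> Prop) :=
  {ae torus_leb R d, forall t, P (row_of t)}.

(* Lebesgue measurability: the product sigma-algebra is not complete. *)
Definition lmeas (R : realType) (d : nat) (f : 'rV[R]_d -> R) :=
  exists f' : 'rV[R]_d -> R,
    measurable_fun setT (f' \o @row_of R d) /\ ae_torus (fun x => f x = f' x).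

Definition torusLp (R : realType) (d : nat) (p : \bar R) (f : 'rV[R]_d -> R) :=
  periodic f /\ (f \o @row_of R d) \in Lfun (torus_leb R d) p.

Definition partial (R : realType) (d : nat) (i : 'I_d) (f : 'rV[R]_d -> R) :
  'rV[R]_d -> R := fun x => 'D_(delta_mx 0 i) f x.

Definition partials (R : realType) (d : nat) (s : seq 'I_d)
  (f : 'rV[R]_d -> R) : 'rV[R]_d -> R := foldr (@partial R d) f s.

Definition grad (R : realType) (d : nat) (f : 'rV[R]_d -> R) (x : 'rV[R]_d) :
  'rV[R]_d := \row_i partial i f x.

Definition hess (R : realType) (d : nat) (f : 'rV[R]_d -> R) (x : 'rV[R]_d) :
  'M[R]_d := \matrix_(i, j) partials [:: i; j] f x.

(* In finite dimension, continuity of all iterated directional derivatives of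
   order at most n on the open set U is the usual C^n regularity. *)
Fixpoint class_C (R : realType) (V : normedModType R) (U : set V) (n : nat)
    (f : V -> R) : Prop :=
  (forall x, U x -> {for x, continuous f}) /\
  match n with
  | 0 => True
  | n'.+1 => forall v, (forall x, U x -> derivable f x v) /\
                       class_C U n' (fun x => 'D_v f x)
  end.

(* On a set S that need not be open, C^oo means being the restriction of a
   C^oo function on an open neighborhood of S. *)
Definition smooth_on (R : realType) (V : normedModType R) (S : set V)
    (f : V -> R) :=
  exists (U : set V) (F : V -> R), [/\ open U, S `<=` U,
    (forall n, class_C U n F) & forall x, S x -> F x = f x].

Definition Cinfty (R : realType) (d : nat) (f : 'rV[R]_d -> R) :=
  periodic f /\ smooth_on setT f.

Definition CinftyE (R : realType) (d : nat) (E : set R) (f : 'rV[R]_d -> R) :=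
  Cinfty f /\ forall x, E (f x).

(* w is the weak derivative of f along the multi-index listed by s, in L^p. *)
Definition wderiv (R : realType) (d : nat) (p : \bar R) (s : seq 'I_d)
    (f w : 'rV[R]_d -> R) :=
  torusLp p w /\
  forall phi, Cinfty phi ->
    tint (fun x => f x * partials s phi x) =
    (-1) ^+ size s * tint (fun x => w x * phi x).

Definition sobolev (R : realType) (d : nat) (k : nat) (p : R)
    (f : 'rV[R]_d -> R) :=
  torusLp p%:E f /\
  forall s : seq 'I_d, (size s <= k)%N -> exists w, wderiv p%:E s f w.

Definition wder2 (R : realType) (d : nat) (s : seq 'I_d) (f : 'rV[R]_d -> R) :
  'rV[R]_d -> R := xget (fun=> 0) [set w | wderiv 2%:E s f w].

(* Summing over all index sequences rather than over multi-indices only weights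
   the terms by multinomial coefficients, which gives an equivalent norm. *)
Definition sobolev_norm (R : realType) (d : nat) (k : nat)
    (f : 'rV[R]_d -> R) : R :=
  Num.sqrt (\sum_(j < k.+1) \sum_(s : j.-tuple 'I_d)
    tint (fun x => wder2 s f x ^+ 2)).

(* A measure in M_ac is given by its density. *)
Definition Mac (R : realType) (d : nat) (m : 'rV[R]_d -> R) :=
  torusLp 1%:E m /\ ae_torus (fun x => 0 <= m x).

Definition MacE (R : realType) (d : nat) (E : set R) (m : 'rV[R]_d -> R) :=
  Mac m /\ ae_torus (fun x => E (m x)).

(* h is an operator from M_ac to C(T^d): the value at a measure does not depend
   on the representative chosen for its density. *)
Definition operator_Mac_C (R : realType) (d : nat)
    (h : ('rV[R]_d -> R) -> 'rV[R]_d -> R) :=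
  (forall m, Mac m -> periodic (h m) /\ continuous (h m)) /\
  (forall m m', Mac m -> Mac m' -> ae_torus (fun x => m x = m' x) ->
    h m =1 h m').

Definition sobolev_cone (R : realType) (d k : nat) (m : 'rV[R]_d -> R) :=
  sobolev k 2 m /\ ae_torus (fun x => 0 <= m x).

Definition frechet_differentiable_cone (R : realType) (d k : nat)
    (h : ('rV[R]_d -> R) -> 'rV[R]_d -> R) :=
  forall m, sobolev_cone k m ->
  exists L : ('rV[R]_d -> R) -> 'rV[R]_d -> R,
  [/\ (forall f, sobolev k 2 f -> sobolev k 2 (L f)),
      (forall (a : R) f1 f2, sobolev k 2 f1 -> sobolev k 2 f2 ->
        ae_torus (fun x =>
          L (fun y => a * f1 y + f2 y) x = a * L f1 x + L f2 x)),
      (exists C : R, forall f, sobolev k 2 f ->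
        sobolev_norm k (L f) <= C * sobolev_norm k f) &
      forall e : R, 0 < e -> exists2 delta : R, 0 < delta &
        forall m', sobolev_cone k m' ->
        sobolev_norm k (fun x => m' x - m x) < delta ->
        sobolev_norm k (fun x =>
          h m' x - h m x - L (fun y => m' y - m y) x)
        <= e * sobolev_norm k (fun x => m' x - m x)].

Definition h_regularity (R : realType) (d : nat)
    (h : ('rV[R]_d -> R) -> 'rV[R]_d -> R) :=
  forall k : nat, d%:R / 2 + 1 < k%:R :> R ->
    (forall m, sobolev_cone k m -> sobolev k 2 (h m)) /\
    frechet_differentiable_cone k h.

Definition g_continuous (R : realType) (d : nat) (E : set R)
    (g : 'rV[R]_d -> R -> R -> R) :=
  (forall m th, E m -> periodic (fun x => g x m th)) /\
  {within [set z : 'rV[R]_d * R * R | E z.1.2],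
    continuous (fun z : 'rV[R]_d * R * R => g z.1.1 z.1.2 z.2)}.

Definition comp_g (R : realType) (d : nat)
    (h : ('rV[R]_d -> R) -> 'rV[R]_d -> R) (g : 'rV[R]_d -> R -> R -> R)
    (m : 'rV[R]_d -> R) : 'rV[R]_d -> R := fun x => g x (m x) (h m x).

(* Measurability of the second summand is part of the meaning of its integral;
   for the first it then follows from the continuity of g. *)
Definition g_structure (R : realType) (d : nat) (E : set R)
    (h : ('rV[R]_d -> R) -> 'rV[R]_d -> R) (g g1 g2 : 'rV[R]_d -> R -> R -> R) :=
  [/\ (forall x m th, E m -> g x m th = g1 x m th + g2 x m th),
      (forall m th, E m ->
        periodic (fun x => g1 x m th) /\ periodic (fun x => g2 x m th)),
      (forall m, MacE E m -> lmeas (comp_g h g2 m) /\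
        ae_torus (fun x => 0 <= comp_g h g2 m x)) &
      [/\ (exists2 c : R, 0 < c & forall m, MacE E m ->
            (eint (EFin \o comp_g h g2 m) <=
             c%:E * (1 + eint (EFin \o m)))%E),
          (forall delta : R, 0 < delta -> exists2 C : R, 0 < C &
            forall m, MacE E m ->
            (maxe (eint (EFin \o comp_g h g1 m)) (eint (EFin \o m)) <=
             delta%:E * eint (fun x => (m x * comp_g h g1 m x)%:E) + C%:E)%E) &
          (exists2 r : R, 0 <= r & forall m, MacE E m ->
            ((- r)%:E <= eint (fun x => (m x * comp_g h g1 m x)%:E))%E)]].

Definition g_compactness (R : realType) (d : nat) (E : set R)
    (h : ('rV[R]_d -> R) -> 'rV[R]_d -> R) (g1 : 'rV[R]_d -> R -> R -> R) :=
  forall m_ : nat -> 'rV[R]_d -> R, (forall j, MacE E (m_ j)) ->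
  (ereal_sup (range (fun j =>
     eint (fun x => (m_ j x * comp_g h g1 (m_ j) x)%:E))) < +oo)%E ->
  exists (sigma : nat -> nat) (m : 'rV[R]_d -> R),
  [/\ {homo sigma : i j / (i < j)%N}, torusLp 1%:E m &
      forall psi, torusLp +oo%E psi ->
        tint (fun x => m_ (sigma j) x * psi x) @[j --> \oo] -->
        tint (fun x => m x * psi x)].

Definition Hamiltonian (R : realType) (d : nat) :=
  'rV[R]_d -> 'rV[R]_d -> 'M[R]_d -> R -> R -> R.

Definition DpH (R : realType) (d : nat) (H : Hamiltonian R d) (i : 'I_d) :
    Hamiltonian R d := fun x p M m th =>
  'D_(delta_mx 0 i) (fun q : 'rV[R]_d => H x q M m th) p.

Definition DMH (R : realType) (d : nat) (H : Hamiltonian R d) (i j : 'I_d) :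
    Hamiltonian R d := fun x p M m th =>
  'D_(delta_mx i j) (fun N : 'M[R]_d => H x p N m th) M.

Definition H_smoothness (R : realType) (d : nat) (E : set R)
    (H : Hamiltonian R d) :=
  (forall p M m th, E m -> periodic (fun x => H x p M m th)) /\
  smooth_on
    [set z : 'rV[R]_d * 'rV[R]_d * 'M[R]_d * R * R | E z.1.2]
    (fun z => H z.1.1.1.1 z.1.1.1.2 z.1.1.2 z.1.2 z.2).

(* The norm of the library on 'rV[R]_d is the sup norm. *)
Definition enorm (R : realType) (d : nat) (p : 'rV[R]_d) : R :=
  Num.sqrt (\sum_i p 0 i ^+ 2).

(* m ^ (- tau), equal to +oo for m = 0 < tau. *)
Definition npow (R : realType) (m tau : R) : \bar R :=
  if (m == 0) && (0 < tau) then +oo%E else (m `^ (- tau))%:E.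

Definition H_growth_pointwise (R : realType) (d : nat) (E : set R)
    (H : Hamiltonian R d) (g : 'rV[R]_d -> R -> R -> R)
    (gamma tau C1 C2 : R) :=
  forall x p (M : 'M[R]_d) m th, E m ->
  ((C1^-1)%:E * (npow m tau * (enorm p `^ gamma)%:E)
     + (C2 * g x m th - C1)%:E <=
   (- H x p M m th + \sum_i DpH H i x p M m th * p 0 i
     + \tr ((\matrix_(i, j) DMH H i j x p M m th) *m M))%:E)%E.

(* The two bounds are imposed whenever they are meaningful, that is unless
   the integral of g is undefined or they take the form +oo - oo. *)
Definition H_growth_integral (R : realType) (d : nat) (E : set R)
    (h : ('rV[R]_d -> R) -> 'rV[R]_d -> R) (H : Hamiltonian R d)
    (g : 'rV[R]_d -> R -> R -> R) (gamma tau C1 C3 C4 : R) :=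
  forall (m u : 'rV[R]_d -> R) (Du : 'rV[R]_d -> 'rV[R]_d)
    (D2u : 'rV[R]_d -> 'M[R]_d),
  MacE E m -> sobolev 1 gamma u ->
  (forall i, wderiv gamma%:E [:: i] u (fun x => Du x 0 i)) ->
  (forall i j, wderiv 1%:E [:: i; j] u (fun x => D2u x i j)) ->
  let G := eint (EFin \o comp_g h g m) in
  let P := eint (fun x => ((enorm (Du x) `^ gamma)%:E * npow (m x) tau)%E) in
  let I := eint (fun x => (H x (Du x) (D2u x) (m x) (h m x))%:E) in
  has_int (EFin \o comp_g h g m) -> ~ (G = +oo%E /\ P = +oo%E) ->
  (- C3%:E * G + (C1^-1)%:E * P - C1%:E <= I)%E /\
  (I <= - C4%:E * G + C1%:E * (1 + P))%E.

Definition H_growth (R : realType) (d : nat) (E : set R)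
    (h : ('rV[R]_d -> R) -> 'rV[R]_d -> R) (H : Hamiltonian R d)
    (g : 'rV[R]_d -> R -> R -> R) (gamma tau : R) :=
  [/\ 1 < gamma, 0 <= tau < 1 &
    exists C1 C2 C3 C4 : R, [/\ [/\ 0 < C1, 0 < C2, 0 < C3 & 0 < C4],
      H_growth_pointwise E H g gamma tau C1 C2 &
      H_growth_integral E h H g gamma tau C1 C3 C4]].

Definition A1 (R : realType) (d : nat)
    (h : ('rV[R]_d -> R) -> 'rV[R]_d -> R) (H : Hamiltonian R d)
    (eta v : 'rV[R]_d -> R) : 'rV[R]_d -> R := fun x =>
  - v x - H x (grad v x) (hess v x) (eta x) (h eta x).

Definition A2 (R : realType) (d : nat)
    (h : ('rV[R]_d -> R) -> 'rV[R]_d -> R) (H : Hamiltonian R d)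
    (eta v : 'rV[R]_d -> R) : 'rV[R]_d -> R := fun x =>
  eta x
  - \sum_i partial i (fun y =>
      eta y * DpH H i y (grad v y) (hess v y) (eta y) (h eta y)) x
  + \sum_i \sum_j partials [:: i; j] (fun y =>
      eta y * DMH H i j y (grad v y) (hess v y) (eta y) (h eta y)) x
  - 1.

Definition A_monotone (R : realType) (d : nat) (E : set R)
    (h : ('rV[R]_d -> R) -> 'rV[R]_d -> R) (H : Hamiltonian R d) :=
  forall eta v eta' v' : 'rV[R]_d -> R,
  CinftyE E eta -> Cinfty v -> CinftyE E eta' -> Cinfty v' ->
  0 <= tint (fun x => (A1 h H eta v x - A1 h H eta' v' x) * (eta x - eta' x))
     + tint (fun x => (A2 h H eta v x - A2 h H eta' v' x) * (v x - v' x)).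

(* Elements of D'(T^d): the continuous linear forms on C^oo(T^d) with its
   Frechet topology; the values outside C^oo(T^d) are irrelevant. *)
Definition distribution_on_torus (R : realType) (d : nat)
    (T : ('rV[R]_d -> R) -> R) :=
  (forall (a : R) phi psi, Cinfty phi -> Cinfty psi ->
    T (fun x => a * phi x + psi x) = a * T phi + T psi) /\
  (exists (N : nat) (C : R), forall phi (B : R), Cinfty phi ->
    (forall (s : seq 'I_d) x, (size s <= N)%N -> `|partials s phi x| <= B) ->
    `|T phi| <= C * B).

Definition distribution_ge0 (R : realType) (d : nat)
    (T : ('rV[R]_d -> R) -> R) :=
  forall phi, Cinfty phi -> (forall x, 0 <= phi x) -> 0 <= T phi.

Definition regular_distribution (R : realType) (d : nat)
    (f : 'rV[R]_d -> R) (T : ('rV[R]_d -> R) -> R) :=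
  forall phi, Cinfty phi -> T phi = tint (fun x => f x * phi x).

(* Here m and u are distributions; the pairing of a smooth function with
   A (eta, v) is the integral of their product. *)
Definition weak_solution (R : realType) (d : nat) (E : set R)
    (h : ('rV[R]_d -> R) -> 'rV[R]_d -> R) (H : Hamiltonian R d)
    (m u : ('rV[R]_d -> R) -> R) :=
  [/\ distribution_on_torus m, distribution_on_torus u, distribution_ge0 m &
    forall eta v : 'rV[R]_d -> R, CinftyE E eta -> Cinfty v ->
    0 <= (tint (fun x => eta x * A1 h H eta v x) - m (A1 h H eta v))
       + (tint (fun x => v x * A2 h H eta v x) - u (A2 h H eta v))].

(* Main.v *)
(** Minty's method. Given finitely many test pairs [(eta_i, v_i)], some convex
    combination [(m, u)] of them satisfies
    [<(eta_i, v_i) - (m, u), A (m, u)> >= 0] for all [i]: this is a variational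
    inequality on a simplex, solved by monotonicity alone. By monotonicity again,
    [<(eta_i, v_i) - (m, u), A (eta_i, v_i)> >= 0], and these inequalities, affine
    in [(m, u)], are to be passed to the limit along a sequence of test pairs
    that is uniformly dense in the space of all tests. With the pairs [(s, 0)],
    [s = 1/2, 1, 2], among the tests, (H-growth) and (g-structure) bound
    [int m g1(x, m, h(m))], [int m], [int |Du|^gamma] and [int u].

    (g-compactness) gives a weak limit of the densities. No weak compactness
    theorem is used for [u]: the strictly convex energy [int sqrt(1 + z^2)] of
    [u] and its gradient, minimised over tails of convex hulls, forces
    near-minimisers to be Cauchy in [L^1], and convex combinations preserve the
    affine inequalities.

    That [A (eta, v)] is smooth rests on the Sobolev embedding of [W^{k,2}] into
    [C^j] for large [k], obtained by convolution with trigonometric kernels. *)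
Require Import Defs.
From HB Require Import structures.
From mathcomp Require Import all_boot all_order all_algebra.
From mathcomp Require Import all_classical all_reals all_analysis.
From mathcomp Require Import measurable_realfun ring lra zify.
Import Order.TTheory GRing.Theory Num.Theory numFieldNormedType.Exports.

Import Defs.

Set Implicit Arguments.
Unset Strict Implicit.
Unset Printing Implicit Defensive.

Local Open Scope classical_set_scope.
Local Open Scope ring_scope.

(** As [h] is nonlinear and nonlocal, [A] cannot be followed along weak limits. Minty's trick keeps
    [A] at fixed smooth pairs only, so that every inequality passed to the limit is affine in the
    unknowns; on the simplices it asks of [A] only continuity along segments, which (h-regularity)
    provides. Testing with [(s, 0)] gives (1 - s) int u - s int H - int m L >= 0, where L is the
    left-hand side of (H-growth)(a). The value s = 1 removes int u and leaves the energy estimate;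
    1/2 and 2, on either side of 1, then bound int u from below and from above. A test pair enters a
    limit inequality through two continuous functions, the components of [A (eta, v)], and one
    number. A countable dense family of tests therefore comes from the separability of C x C x R,
    and no topology on the tests is involved. Powers of cos^2 (pi t), normalised to mass 1, are
    smooth, periodic and nonnegative, and after subtraction of 1 they have a periodic primitive
    bounded by 1. Each integration by parts thus costs one weak derivative and no constant depending
    on the kernel. The mass is read off from the tests [(1, t)], t real: the inequality is affine in
    t. *)

Section mean_value.
Context {R : realType} {V : normedModType R}.
Implicit Types (f : V -> R) (x v : V).

(** Clearing the denominator of the difference quotient makes [t = 0] harmless: derivatives are then
    computed by estimates in a full neighbourhood of 0, without division. *)
Lemma is_deriveP f x v (l : R) : is_derive x v f l <->
  forall e, 0 < e -> \forall t \near (0 : R), `|f (x + t *: v) - f x - t * l| <= e * `|t|.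
Proof.
split.
  move=> [df <-] e e0.
  have /cvg_ex[/= l' fl] := df.
  have E : 'D_v f x = l' by exact: cvg_lim fl.
  rewrite E.
  have /cvgrPdist_le/(_ e e0) := fl.
  rewrite /= near_withinE => H.
  near=> t.
  have [->|t0] := eqVneq t 0.
    by rewrite scale0r addr0 mul0r !subrr normr0 mulr0.
  have /(_ t0) : t != 0 -> `|l' - t^-1 * (f (t *: v + x) - f x)| <= e by near: t.
  rewrite -ler_pdivrMr ?normr_gt0// -normf_div distrC [x + _]addrC.
  suff -> : (f (t *: v + x) - f x - t * l') / t = t^-1 * (f (t *: v + x) - f x) - l' by [].
  by field.
move=> H.
have fl : (fun h => h^-1 *: ((f \o shift x) (h *: v) - f x)) @ 0^' --> l.
  apply/cvgrPdist_le => e e0; rewrite near_withinE.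
  have := H e e0; apply: filterS => t Ht t0 /=.
  move: Ht; rewrite -ler_pdivrMr ?normr_gt0// -normf_div [x + _]addrC distrC.
  suff -> : (f (t *: v + x) - f x - t * l) / t = t^-1 *: (f (t *: v + x) - f x) - l.
    by rewrite distrC.
  by rewrite /GRing.scale /=; field.
split; first by apply/cvg_ex; exists l.
exact: cvg_lim fl.
Unshelve. all: by end_near. Qed.

End mean_value.

Section mean_value2.
Context {R : realType} {V : normedModType R}.
Implicit Types (f : V -> R) (x v : V).

Lemma is_derive_line f x v (s l : R) : is_derive (x + s *: v) v f l ->
  is_derive s 1 (fun t : R => f (x + t *: v)) l.
Proof.
move=> /is_deriveP H; apply/is_deriveP => e e0.
have := H e e0; apply: filterS => t.
by rewrite scalerDl addrA /GRing.scale /= mulr1.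
Qed.

Lemma mean_value f x v :
  (forall s : R, 0 <= s <= 1 -> derivable f (x + s *: v) v) ->
  exists2 s : R, 0 <= s <= 1 & f (x + v) - f x = 'D_v f (x + s *: v).
Proof.
move=> H.
have D (s : R) : 0 <= s <= 1 -> is_derive s 1 (fun t : R => f (x + t *: v)) ('D_v f (x + s *: v)).
  by move=> /H /derivableP /is_derive_line.
have [||s] := @MVT_segment R (fun t => f (x + t *: v)) (fun s => 'D_v f (x + s *: v)) 0 1 ler01.
- by move=> s; rewrite in_itv /= => /andP[/ltW s0 /ltW s1]; apply: D; rewrite s0.
- apply: derivable_within_continuous => s; rewrite in_itv /= => /D Ds.
  exact: ex_derive.
- by rewrite in_itv /= scale1r scale0r addr0 subr0 mulr1 => s01 ->; exists s.
Qed.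

Lemma deriveZv f x v (c : R) : derivable f x v ->
  is_derive x (c *: v) f (c * 'D_v f x).
Proof.
move=> /derivableP/is_deriveP H; apply/is_deriveP => e e0.
have c1 : 0 < `|c| + 1 by rewrite ltr_wpDl.
have e1 : 0 < e / (`|c| + 1) by rewrite divr_gt0.
have := H _ e1 => {}H.
have : \forall t \near (0:R), `|f (x + (t * c) *: v) - f x - (t * c) * 'D_v f x| <= e / (`|c| + 1) * `|t * c|.
  have : (fun t : R => t * c) @ 0 --> (0:R).
    by rewrite -[X in _ --> X](mul0r c); apply: cvgMl; exact: cvg_id.
  by move=> /(_ _ H).
apply: filterS => t; rewrite scalerA mulrA => /le_trans; apply.
rewrite normrM mulrCA [leRHS]mulrC ler_wpM2l// mulrAC ler_pdivrMr//.
by rewrite ler_wpM2l ?(ltW e0)// lerDl.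
Qed.

(** The mean value theorem in the direction [t *: v], followed by homogeneity of the derivative;
    this covers both signs of [t]. *)
Lemma mean_value_scale f x v (t : R) :
  (forall s : R, `|s| <= `|t| -> derivable f (x + s *: v) v) ->
  exists2 s : R, `|s| <= `|t| & f (x + t *: v) - f x = t * 'D_v f (x + s *: v).
Proof.
move=> H.
have N (s : R) : 0 <= s <= 1 -> `|s * t| <= `|t|.
  by move=> /andP[s0 s1]; rewrite normrM ger0_norm ?ler_piMl.
have D (s : R) : 0 <= s <= 1 ->
    is_derive (x + s *: (t *: v)) (t *: v) f (t * 'D_v f (x + s *: (t *: v))).
  by move=> s01; apply: deriveZv; rewrite scalerA; apply/H/N.
have [s s01 ->] : exists2 s : R, 0 <= s <= 1 & f (x + t *: v) - f x = 'D_(t *: v) f (x + s *: (t *: v)).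
  by apply: mean_value => s s01; have [] := D s s01.
exists (s * t); first exact: N.
by have [_ ->] := D s s01; rewrite scalerA.
Qed.

End mean_value2.

(** * Functions of class C^n *)

Section class_C_theory.
Context {R : realType} {V : normedModType R}.
Implicit Types (U : set V) (f g : V -> R) (x v : V).

Lemma class_C_continuous U n f x : class_C U n f -> U x -> {for x, continuous f}.
Proof. by case: n => [|n] [cf _] /cf. Qed.

Lemma class_CW U n f : class_C U n.+1 f -> class_C U n f.
Proof.
elim: n f => [|n IH] f [cf df]; split => // v; have [dfv Cfv] := df v.
by split => //; exact: IH.
Qed.

Lemma class_C_cst U n (c : R) : class_C U n (fun=> c).
Proof.
elim: n c => [|n IH] c; (split=> [x _|//]; first exact: cvg_cst).
move=> v; split=> [x _|]; first exact: derivable_cst.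
have -> : (fun x => 'D_v (fun=> c) x) = (fun=> 0) by apply/funext => x; exact: derive_cst.
exact: IH.
Qed.

Lemma class_CD n f g : class_C setT n f -> class_C setT n g ->
  class_C setT n (fun x => f x + g x).
Proof.
elim: n f g => [|n IH] f g [cf df] [cg dg];
  (split=> [x Ux|//]; first by apply: cvgD; [exact: cf|exact: cg]).
move=> v; have [dfv Cfv] := df v; have [dgv Cgv] := dg v.
split=> [x Ux|]; first by apply: derivableD; [exact: dfv|exact: dgv].
have -> : (fun x => 'D_v (fun y => f y + g y) x) = fun x => 'D_v f x + 'D_v g x.
  by apply/funext => x; apply: deriveD; [exact: dfv|exact: dgv].
exact: IH.
Qed.

Lemma class_CM n f g : class_C setT n f -> class_C setT n g ->
  class_C setT n (fun x => f x * g x).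
Proof.
elim: n f g => [|n IH] f g Cf Cg; (split=> [x Ux|//]; first
  by apply: cvgM; [exact: (class_C_continuous Cf)|exact: (class_C_continuous Cg)]).
move=> v; have [_ /(_ v)[dfv Cfv]] := Cf; have [_ /(_ v)[dgv Cgv]] := Cg.
split=> [x Ux|]; first by apply: derivableM; [exact: dfv|exact: dgv].
have -> : (fun x => 'D_v (fun y => f y * g y) x) =
    fun x => f x * 'D_v g x + g x * 'D_v f x.
  by apply/funext => x; apply: deriveM; [exact: dfv|exact: dgv].
by apply: class_CD; apply: IH => //; exact: class_CW.
Qed.

Lemma class_CZ n (c : R) f : class_C setT n f -> class_C setT n (fun x => c * f x).
Proof. by apply: class_CM; exact: class_C_cst. Qed.

Lemma class_C_sum (I : Type) (r : seq I) (F : I -> V -> R) n :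
  (forall i, class_C setT n (F i)) -> class_C setT n (fun x => \sum_(i <- r) F i x).
Proof.
move=> CF; elim: r => [|i r IH].
  have -> : (fun x => \sum_(i <- [::]) F i x) = fun=> 0 by apply/funext => x; rewrite big_nil.
  exact: class_C_cst.
have -> : (fun x => \sum_(j <- i :: r) F j x) = fun x => F i x + \sum_(j <- r) F j x.
  by apply/funext => x; rewrite big_cons.
exact: class_CD.
Qed.

Lemma class_C_prod (I : Type) (r : seq I) (F : I -> V -> R) n :
  (forall i, class_C setT n (F i)) -> class_C setT n (fun x => \prod_(i <- r) F i x).
Proof.
move=> CF; elim: r => [|i r IH].
  have -> : (fun x => \prod_(i <- [::]) F i x) = fun=> 1 by apply/funext => x; rewrite big_nil.
  exact: class_C_cst.
have -> : (fun x => \prod_(j <- i :: r) F j x) = fun x => F i x * \prod_(j <- r) F j x.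
  by apply/funext => x; rewrite big_cons.
exact: class_CM.
Qed.

End class_C_theory.

(** * The chain rule *)

Section chain_rule.
Context {R : realType} {V W : normedModType R}.
Implicit Types (F : V -> R) (l : seq ((W -> R) * V)).

(** [class_C] speaks of directional derivatives only, so the inner map is presented as a list of
    scalar coefficients and fixed directions. The directions are added one at a time: the mean value
    theorem handles the increment along the new one, and continuity of the derivative of [F] along
    it replaces Frechet differentiability. *)
Lemma derive_comp_sum (U : set V) F l (a : V) (x w : W) :
  open U -> (forall z ce, List.In ce l -> U z -> derivable F z ce.2) ->
  (forall z ce, List.In ce l -> U z -> {for z, continuous (fun y => 'D_(ce.2) F y)}) ->
  (forall ce, List.In ce l -> derivable ce.1 x w) ->
  U (a + \sum_(ce <- l) ce.1 x *: ce.2) ->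
  is_derive x w (fun y => F (a + \sum_(ce <- l) ce.1 y *: ce.2))
    (\sum_(ce <- l) 'D_w ce.1 x * 'D_(ce.2) F (a + \sum_(ce <- l) ce.1 x *: ce.2)).
Proof.
move=> oU; elim: l a => [|[c e] l IH] a dF cF dl Uz.
  rewrite big_nil; have -> : (fun y : W => F (a + \sum_(ce <- [::] : seq ((W -> R) * V)) ce.1 y *: ce.2)) = fun=> F a.
    by apply/funext => y; rewrite big_nil addr0.
  exact: is_derive_cst.
have dc : derivable c x w by apply: (dl (c, e)); left.
move: Uz; rewrite !big_cons /= addrA => Uz.
set z0 := _ + \sum_(ce <- l) ce.1 x *: ce.2 in Uz *.
have dl' ce : List.In ce l -> derivable ce.1 x w by move=> ?; apply: dl; right.
have dF' z ce : List.In ce l -> U z -> derivable F z ce.2 by move=> ?; apply: dF; right.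
have cF' z ce : List.In ce l -> U z -> {for z, continuous (fun y => 'D_(ce.2) F y)}.
  by move=> ?; apply: cF; right.
have {}IH := IH _ dF' cF' dl' Uz; rewrite -/z0 in IH.
have {}dF z : U z -> derivable F z e by apply: (dF z (c, e)); left.
have {}cF z : U z -> {for z, continuous (fun y => 'D_e F y)} by apply: (cF z (c, e)); left.
apply/is_deriveP => eps eps0.
pose y t := (a + c x *: e) + \sum_(ce <- l) ce.1 (x + t *: w) *: ce.2.
pose s t := c (x + t *: w) - c x.
have ct c' : derivable c' x w -> (fun t : R => c' (x + t *: w)) @ 0 --> (c' x : R).
  move=> /derivableP; rewrite -{1}[x]addr0 -(scale0r w) => /is_derive_line [/derivable1_diffP/differentiable_continuous H _].
  have {}H : c' (x + t *: w) @[t --> (0 : R)] --> c' (x + 0 *: w) := H.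
  by move: H; rewrite scale0r addr0.
have cs : s t @[t --> 0] --> (0 : R).
  suff : s t @[t --> (0 : R)] --> c x - c x by rewrite subrr.
  by apply: cvgB; [exact: ct|exact: cvg_cst].
have cy : y t @[t --> 0] --> z0.
  apply: cvgD; first exact: cvg_cst.
  elim: (l) dl' => [|[c' e'] l' IHl] dl''.
    rewrite big_nil; have -> : (fun t : R => \sum_(ce <- [::] : seq ((W -> R) * V)) ce.1 (x + t *: w) *: ce.2 : V) = fun=> 0.
      by apply/funext => t; rewrite big_nil.
    exact: cvg_cst.
  rewrite big_cons; have -> : (fun t : R => \sum_(ce <- (c', e') :: l') ce.1 (x + t *: w) *: ce.2 : V) =
      fun t => c' (x + t *: w) *: e' + \sum_(ce <- l') ce.1 (x + t *: w) *: ce.2.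
    by apply/funext => t; rewrite big_cons.
  apply: cvgD; last by apply: IHl => ce ?; apply: dl''; right.
  by apply: cvgZr_tmp; apply: ct; apply: (dl'' (c', e')); left.
have [r r0 Hr] : exists2 r, 0 < r & forall z, `|z - z0| < r ->
    U z /\ `|'D_e F z - 'D_e F z0| <= eps / 4 / (`|'D_w c x| + 1).
  have E : 0 < eps / 4 / (`|'D_w c x| + 1) by rewrite !divr_gt0// ltr_wpDl.
  have : \forall z \near z0, U z /\ `|'D_e F z - 'D_e F z0| <= eps / 4 / (`|'D_w c x| + 1).
    apply: filterI; first exact: (open_nbhs_nbhs (conj oU Uz)).
    have /cvgrPdist_le/(_ _ E) := cF z0 Uz.
    by apply: filterS => z; rewrite distrC.
  move=> /nbhs_ballP[r /= r0 H]; exists r => // z zr; apply: H.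
  by rewrite -ball_normE /= distrC.
have A : 0 < `|'D_w c x| + 1 by rewrite ltr_wpDl.
have B : 0 < `|'D_e F z0| + 1 by rewrite ltr_wpDl.
have H1 : \forall t \near (0 : R), `|s t - t * 'D_w c x| <= Num.min 1 (eps / 4 / (`|'D_e F z0| + 1)) * `|t|.
  have /derivableP/is_deriveP := dc.
  by apply; rewrite lt_min ltr01 /= !divr_gt0.
have H2 : \forall t \near (0 : R), `|y t - z0| + `|s t| * `|e| < r.
  have : `|y t - z0| + `|s t| * `|e| @[t --> 0] --> `|z0 - z0| + `|0 : R| * `|e|.
    apply: cvgD; first by apply: cvg_norm; apply: cvgB => //; exact: cvg_cst.
    by apply: cvgMl; apply: cvg_norm.
  by rewrite subrr !normr0 mul0r addr0 => /cvgr_lt; apply.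
have /is_deriveP/(_ (eps / 2)) H3 := IH.
have {}H3 := H3 (divr_gt0 eps0 (ltr0Sn _ _)).
move: H1 H2 H3; apply: filterS3 => t H1 H2 H3.
have -> : F (a + \sum_(ce <- (c, e) :: l) ce.1 (x + t *: w) *: ce.2) = F (y t + s t *: e).
  rewrite big_cons /y /s /= scalerBl; congr F.
  set E := c _ *: e; set S := \sum_(j <- l) _.
  by rewrite (addrAC a) (addrC E (- _)) (addrA (a + S + _)) addrK addrA addrAC.
have inr (s' : R) : `|s'| <= `|s t| -> `|y t + s' *: e - z0| < r.
  move=> s's; apply: le_lt_trans H2; rewrite addrAC (le_trans (ler_normD _ _))//.
  by rewrite lerD2l normrZ ler_wpM2r.
have [s' /inr/Hr[_ Hs'] FE] : exists2 s' : R, `|s'| <= `|s t| &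
    F (y t + s t *: e) - F (y t) = s t * 'D_e F (y t + s' *: e).
  by apply: mean_value_scale => s' /inr/Hr[Us' _]; exact: dF.
have -> : F (a + \sum_(ce <- (c, e) :: l) ce.1 x *: ce.2) = F z0.
  by rewrite big_cons addrA.
set S := \sum_(j <- l) 'D_w j.1 x * _ in H3 *.
set D := 'D_e F (y t + s' *: e) in Hs' FE.
(* The three errors come from freezing the derivative along [e] at [z0], from linearising [c], and
   from the induction hypothesis; they receive eps/4, eps/4 and eps/2. *)
have -> : F (y t + s t *: e) - F z0 - t * ('D_w c x * 'D_e F z0 + S) =
  s t * (D - 'D_e F z0) + (s t - t * 'D_w c x) * 'D_e F z0 + (F (y t) - F z0 - t * S).
  move: FE => /(canRL (subrK _)) ->; ring.
rewrite (le_trans (ler_normD _ _))// (_ : eps = eps / 2 + eps / 2); last by field.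
rewrite [leRHS]mulrDl lerD//.
rewrite (le_trans (ler_normD _ _))// (_ : eps / 2 = eps / 4 + eps / 4); last by field.
rewrite [leRHS]mulrDl lerD// normrM.
  have st : `|s t| <= (`|'D_w c x| + 1) * `|t|.
    rewrite -[s t](subrK (t * 'D_w c x)) (le_trans (ler_normD _ _))// mulrDl addrC.
    rewrite normrM [`|t| * _]mulrC lerD2l (le_trans H1)// ler_wpM2r// ge_min lexx//.
  rewrite (le_trans (ler_pM _ _ st Hs'))//.
  by rewrite mulrAC (mulrC (_ + 1)) divfK ?gt_eqF.
have H1' : `|s t - t * 'D_w c x| <= eps / 4 / (`|'D_e F z0| + 1) * `|t|.
  by rewrite (le_trans H1)// ler_wpM2r// ge_min lexx orbT.
rewrite (le_trans (ler_wpM2r _ H1'))//.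
rewrite mulrAC ler_wpM2r// mulrAC ler_pdivrMr// ler_pM2l ?divr_gt0//.
by rewrite lerDl.
Qed.

Lemma class_C_comp_sum (U : set V) F l (a : V) n : open U ->
  (forall k, class_C U k F) ->
  (forall ce, List.In ce l -> class_C setT n ce.1) ->
  (forall x, U (a + \sum_(ce <- l) ce.1 x *: ce.2)) ->
  class_C setT n (fun y => F (a + \sum_(ce <- l) ce.1 y *: ce.2)).
Proof.
move=> oU; elim: n F => [|n IH] F CF Cl Ul.
  split=> // x _; apply: continuous_comp; last exact: (class_C_continuous (CF 0%N)).
  apply: cvgD; first exact: cvg_cst.
  elim: (l) Cl => [|[c e] l' IHl] Cl.
    have -> : (fun y : W => \sum_(ce <- [::] : seq ((W -> R) * V)) ce.1 y *: ce.2) = fun=> 0.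
      by apply/funext => y; rewrite big_nil.
    by rewrite big_nil; exact: cvg_cst.
  have -> : (fun y : W => \sum_(ce <- (c, e) :: l') ce.1 y *: ce.2) =
      fun y => c y *: e + \sum_(ce <- l') ce.1 y *: ce.2.
    by apply/funext => y; rewrite big_cons.
  rewrite big_cons; apply: cvgD; last by apply: IHl => ce ?; apply: Cl; right.
  apply: cvgZr_tmp; have /class_C_continuous := Cl (c, e) (or_introl erefl).
  exact.
have DF x w := derive_comp_sum oU (fun z ce _ Uz => ((CF 1%N).2 ce.2).1 z Uz)
   (fun z ce _ Uz => ((CF 1%N).2 ce.2).2.1 z Uz)
   (fun ce li => ((Cl ce li).2 w).1 x Logic.I) (Ul x).
split=> [x _|w].
  exact: (class_C_continuous (IH F CF (fun ce li => class_CW (Cl ce li)) Ul)).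
split=> [x _|]; first by have [] := DF x w.
have -> : (fun x => 'D_w (fun y => F (a + \sum_(ce <- l) ce.1 y *: ce.2)) x) =
    fun x => \sum_(ce <- l) 'D_w ce.1 x * 'D_(ce.2) F (a + \sum_(ce <- l) ce.1 x *: ce.2).
  by apply/funext => x; have [] := DF x w.
(* Only the range of the outer sum shrinks in this induction; the point at which [F] is
   differentiated keeps the whole list [l]. *)
suff : forall l' : seq ((W -> R) * V), List.incl l' l -> class_C setT n (fun x =>
    \sum_(ce <- l') 'D_w ce.1 x * 'D_(ce.2) F (a + \sum_(ce <- l) ce.1 x *: ce.2)).
  by apply; exact: List.incl_refl.
elim=> [|[c e] l' IHl] ll'.
  have -> : (fun x : W => \sum_(ce <- [::] : seq ((W -> R) * V)) 'D_w ce.1 x * 'D_(ce.2) F (a + \sum_(ce <- l) ce.1 x *: ce.2)) = fun=> 0.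
    by apply/funext => y; rewrite big_nil.
  exact: class_C_cst.
have -> : (fun x : W => \sum_(ce <- (c, e) :: l') 'D_w ce.1 x * 'D_(ce.2) F (a + \sum_(ce <- l) ce.1 x *: ce.2)) =
    fun x => 'D_w c x * 'D_e F (a + \sum_(ce <- l) ce.1 x *: ce.2) +
     \sum_(ce <- l') 'D_w ce.1 x * 'D_(ce.2) F (a + \sum_(ce <- l) ce.1 x *: ce.2).
  by apply/funext => y; rewrite big_cons.
apply: class_CD; last by apply: IHl => ce ?; apply: ll'; right.
apply: class_CM; first exact: ((Cl (c, e) (ll' _ (or_introl erefl))).2 w).2.
apply: (IH (fun z => 'D_e F z)) => // [k|ce li]; first exact: ((CF k.+1).2 e).2.
by apply: class_CW; exact: Cl.
Qed.

End chain_rule.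

(** * Periodicity, the unit cube and measurability *)

Section row_vectors.
Context {R : realType}.

Lemma rV_norm_le d (x : 'rV[R]_d) (e : R) : 0 <= e ->
  (forall i, `|x 0 i| <= e) -> `|x| <= e.
Proof.
move=> e0 H; rewrite [`|x|]mx_normrE; apply: bigmax_le => // -[i j] _ /=.
by rewrite ord1.
Qed.

Lemma rV_coord_norm d (x : 'rV[R]_d) i : `|x 0 i| <= `|x|.
Proof. by rewrite [`|x|]mx_normrE; apply: (le_bigmax _ _ (ord0, i)). Qed.

Lemma rV_norm_lt d (x : 'rV[R]_d) (e : R) : 0 < e ->
  (forall i, `|x 0 i| < e) -> `|x| < e.
Proof.
move=> e0 H; rewrite [`|x|]mx_normrE; apply: bigmax_lt => // -[i j] _ /=.
by rewrite ord1.
Qed.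

Definition int_part d (x : 'rV[R]_d) : 'rV[int]_d := \row_i Num.floor (x 0 i).

Lemma frac_part_itv d (x : 'rV[R]_d) i :
  0 <= (x - map_mx intr (int_part x)) 0 i < 1.
Proof.
rewrite !mxE subr_ge0; have /andP[-> /=] := floor_itv (x 0 i).
by rewrite intrD ltrBlDl.
Qed.

Lemma periodic_frac_part d T (f : 'rV[R]_d -> T) x : periodic f ->
  f (x - map_mx intr (int_part x)) = f x.
Proof.
move=> pf; rewrite -[in RHS](subrK (map_mx intr (int_part x)) x).
by rewrite [RHS]pf.
Qed.

Definition unit_cube d : set 'rV[R]_d := [set x | forall i, `[0, 1]%classic (x 0 i)].

Lemma compact_unit_cube d : compact (@unit_cube d).
Proof.
apply: (@rV_compact R d (fun=> `[0, 1]%classic)) => i; exact: segment_compact.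
Qed.

Lemma frac_part_cube d (x : 'rV[R]_d) : unit_cube (x - map_mx intr (int_part x)).
Proof.
by move=> i /=; rewrite in_itv /=; have /andP[-> /ltW] := frac_part_itv x i.
Qed.

Lemma periodic_bounded d (f : 'rV[R]_d -> R) : continuous f -> periodic f ->
  exists2 B : R, 0 <= B & forall x, `|f x| <= B.
Proof.
move=> cf pf.
have [||c _ Hc] := @compact_EVT_max _ R (fun x => `|f x|) (@unit_cube d) _ (@compact_unit_cube d).
- by exists 0 => i /=; rewrite !mxE in_itv /= lexx ler01.
- apply: continuous_subspaceT => x.
  by apply: (@continuous_comp _ _ _ f (fun y : R => `|y|)); [exact: cf|exact: norm_continuous].
exists `|f c| => // x; rewrite -(periodic_frac_part x pf); apply: Hc.
by rewrite inE; exact: frac_part_cube.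
Qed.

Lemma countType_bigcup_measurable d (T : measurableType d) (I : countType)
    (P : set I) (F : I -> set T) :
  (forall k, P k -> measurable (F k)) -> measurable (\bigcup_(k in P) F k).
Proof.
move=> mF.
have -> : \bigcup_(k in P) F k = \bigcup_n \bigcup_(k in P `&` [set k | pickle k = n]) F k.
  apply/seteqP; split=> [t [k Pk Fk]|t [n _ [k [Pk _] Fk]]]; last by exists k.
  by exists (pickle k) => //; exists k.
apply: bigcup_measurable => n _.
have [[k [Pk kn]]|nP] := pselect (exists k, P k /\ pickle k = n).
  have -> : P `&` [set k | pickle k = n] = [set k].
    apply/seteqP; split=> [k' [/= _ k'n]|k' ->]; last by [].
    by apply: (pcan_inj pickleK); rewrite k'n kn.
  by rewrite bigcup_set1; exact: mF.
have -> : P `&` [set k | pickle k = n] = set0.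
  by apply/seteqP; split=> // k [/= Pk kn]; apply: nP; exists k.
by rewrite bigcup_set0; exact: measurable0.
Qed.

(** Continuity refers to matrices, measurability to tuples. The two meet through rounding: [f] is
    the pointwise limit of its values at grid points, and these take countably many values, each on
    a union of boxes that are measurable coordinate by coordinate. *)
Lemma measurable_continuous_row d (f : 'rV[R]_d -> R) : continuous f ->
  measurable_fun setT (f \o @row_of R d).
Proof.
move=> cf.
pose grid n (k : {ffun 'I_d -> int}) : 'rV[R]_d := \row_i ((k i)%:~R / n.+1%:R).
pose code n (t : d.-tuple (measurableTypeR R)) : {ffun 'I_d -> int} :=
  [ffun i => Num.floor (tnth t i * n.+1%:R)].
apply: (@measurable_fun_cvg _ _ _ _ (fun n t => f (grid n (code n t)))).
  move=> n _ Y mY; rewrite setTI.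
  have -> : (fun t => f (grid n (code n t))) @^-1` Y =
     \bigcup_(k in [set k | Y (f (grid n k))]) \bigcap_(i in [set: 'I_d])
       [set t : d.-tuple (measurableTypeR R) | Num.floor (tnth t i * n.+1%:R) = k i].
    apply/seteqP; split=> [t /= Yt|t [k /= Yk Hk]].
      by exists (code n t) => // i _; rewrite /= ffunE.
    suff -> : code n t = k by [].
    by apply/ffunP => i; rewrite ffunE; exact: Hk.
  apply: countType_bigcup_measurable => k _; apply: fin_bigcap_measurable => // i _.
  have -> : [set t : d.-tuple (measurableTypeR R) | Num.floor (tnth t i * n.+1%:R) = k i] =
      (fun t : d.-tuple (measurableTypeR R) => tnth t i * n.+1%:R) @^-1`
        `[(k i)%:~R, (k i + 1)%:~R[%classic.
    apply/seteqP; split=> t /=; rewrite in_itv /=.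
      by move=> <-; exact: floor_itv.
    by move=> /floor_def.
  rewrite -[X in measurable X]setTI.
  have : measurable_fun setT (fun t : d.-tuple (measurableTypeR R) => tnth t i * n.+1%:R).
    by apply: measurable_funM => //; exact: measurable_tnth.
  by apply => //; exact: measurable_itv.
move=> t _.
suff gt : (fun n => grid n (code n t)) @ \oo --> row_of t.
  exact: (cvg_comp _ _ gt (cf (row_of t))).
apply/cvgrPdist_lt => e e0; near=> n.
apply: rV_norm_lt => // i; rewrite !mxE ffunE.
have n0 : (0 : R) < n.+1%:R by rewrite ltr0n.
have /andP[H1] := floor_itv (tnth t i * n.+1%:R); rewrite intrD => H2.
rewrite ger0_norm; last by rewrite subr_ge0 ler_pdivrMr.
rewrite ltrBlDr -(ltr_pM2r n0) mulrDl divfK ?gt_eqF// (lt_le_trans H2)//.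
rewrite addrC lerD2r mulrC -ler_pdivrMr// div1r.
rewrite invf_ple ?posrE//; apply: ltW.
by near: n; exact: (near_infty_natSinv_lt (PosNum e0)).
Unshelve. all: by end_near. Qed.

End row_vectors.

(** * Integration over the torus *)

Section torus_integral.
Context {R : realType} {d : nat}.
Implicit Types f g : 'rV[R]_d -> R.

Definition tmeas f := measurable_fun setT (f \o @row_of R d).

Definition tintegrable f :=
  (torus_leb R d).-integrable setT (EFin \o (f \o @row_of R d)).

Definition cper f := continuous f /\ periodic f.

Lemma tintegrable_bounded f (B : R) : tmeas f -> (forall x, `|f x| <= B) ->
  tintegrable f.
Proof.
move=> mf fB; apply: measurable_bounded_integrable => //.
  by rewrite (le_lt_trans (probability_le1 _ _))// ltry.
by exists B; split; [exact: num_real|move=> x Bx t _; exact: le_trans (fB _) (ltW Bx)].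
Qed.

Lemma tintegrableD f g : tintegrable f -> tintegrable g ->
  tintegrable (fun x => f x + g x).
Proof. by move=> If Ig; exact: (integrableD measurableT If Ig). Qed.

Lemma tintegrableB f g : tintegrable f -> tintegrable g ->
  tintegrable (fun x => f x - g x).
Proof. by move=> If Ig; exact: (integrableB measurableT If Ig). Qed.

Lemma tintegrableZ (c : R) f : tintegrable f -> tintegrable (fun x => c * f x).
Proof. by move=> If; exact: (integrableZl measurableT c If). Qed.

Lemma tintegrable_norm f : tintegrable f -> tintegrable (fun x => `|f x|).
Proof. by move=> If; exact: (integrable_norm If). Qed.

Lemma tintegrableM f g (B : R) : tintegrable f -> tmeas g ->
  (forall x, `|g x| <= B) -> tintegrable (fun x => f x * g x).
Proof.
move=> If mg gB.
suff bg : [bounded (g \o @row_of R d) x | x in [set: d.-tuple (measurableTypeR R)]].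
  exact: (integrableMl measurableT If mg bg).
by exists B; split; [exact: num_real|move=> x Bx t _; exact: le_trans (gB _) (ltW Bx)].
Qed.

Lemma tintegrable_tmeas f : tintegrable f -> tmeas f.
Proof. by move=> /measurable_int/measurable_EFinP. Qed.

Lemma le_tintegrable f g : tmeas f -> (forall x, `|f x| <= `|g x|) ->
  tintegrable g -> tintegrable f.
Proof.
move=> mf fg; apply: le_integrable => //; first exact/measurable_EFinP.
by move=> t _ /=; rewrite lee_fin.
Qed.

Lemma tintD f g : tintegrable f -> tintegrable g ->
  tint (fun x => f x + g x) = tint f + tint g.
Proof. by move=> ? ?; rewrite /tint RintegralD. Qed.

Lemma tintB f g : tintegrable f -> tintegrable g ->
  tint (fun x => f x - g x) = tint f - tint g.
Proof. by move=> ? ?; rewrite /tint RintegralB. Qed.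

Lemma tintZ (c : R) f : tintegrable f -> tint (fun x => c * f x) = c * tint f.
Proof. by move=> ?; rewrite /tint RintegralZl. Qed.

Lemma tint_cst (c : R) : @tint R d (fun=> c) = c.
Proof.
rewrite /tint (@Rintegral_cst _ _ _ (torus_leb R d))//.
rewrite -[RHS]mulr1; congr (_ * _).
exact: (congr1 fine (probability_setT (torus_leb R d))).
Qed.

Lemma tint_ge0 f : (forall x, 0 <= f x) -> 0 <= tint f.
Proof. by move=> f0; apply: Rintegral_ge0 => t _. Qed.

Lemma le_tint f g : tintegrable f -> tintegrable g -> (forall x, f x <= g x) ->
  tint f <= tint g.
Proof. by move=> ? ? fg; apply: le_Rintegral => // t _; exact: fg. Qed.

Lemma le_norm_tint f : tintegrable f -> `|tint f| <= tint (fun x => `|f x|).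
Proof. by move=> ?; exact: le_normr_Rintegral. Qed.

Lemma eq_tint f g : f =1 g -> tint f = tint g.
Proof. by move=> /funext ->. Qed.

Lemma tint_le_bound f (B : R) : tintegrable f -> (forall x, `|f x| <= B) ->
  `|tint f| <= B.
Proof.
move=> If fB; apply: (le_trans (le_norm_tint If)).
rewrite -[leRHS]tint_cst; apply: le_tint => //; first exact: tintegrable_norm.
by apply: (@tintegrable_bounded _ `|B|) => //; exact: measurable_cst.
Qed.

Lemma cper_tmeas f : cper f -> tmeas f.
Proof. by case=> cf _; exact: measurable_continuous_row. Qed.

Lemma cper_bounded f : cper f -> exists2 B : R, 0 <= B & forall x, `|f x| <= B.
Proof. by case=> cf pf; exact: periodic_bounded. Qed.

Lemma cper_tintegrable f : cper f -> tintegrable f.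
Proof.
move=> cf; have [B _ fB] := cper_bounded cf.
by apply: tintegrable_bounded fB; exact: cper_tmeas.
Qed.

Lemma tintegrableM_cper f g : tintegrable f -> cper g ->
  tintegrable (fun x => f x * g x).
Proof.
move=> If cg; have [B _ gB] := cper_bounded cg.
by apply: tintegrableM gB => //; exact: cper_tmeas.
Qed.

Lemma cper_cst (c : R) : cper (fun=> c).
Proof. by split=> //; exact: cst_continuous. Qed.

Lemma cperD f g : cper f -> cper g -> cper (fun x => f x + g x).
Proof.
move=> [cf pf] [cg pg]; split=> [x|x k]; last by rewrite pf pg.
exact: (cvgD (cf x) (cg x)).
Qed.

Lemma cperM f g : cper f -> cper g -> cper (fun x => f x * g x).
Proof.
move=> [cf pf] [cg pg]; split=> [x|x k]; last by rewrite pf pg.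
exact: (cvgM (cf x) (cg x)).
Qed.

Lemma cper_comp (phi : R -> R) f : continuous phi -> cper f -> cper (fun x => phi (f x)).
Proof.
move=> cphi [cf pf]; split=> [x|x k]; last by rewrite pf.
exact: (cvg_comp _ _ (cf x) (cphi (f x))).
Qed.

Lemma cperN f : cper f -> cper (fun x => - f x).
Proof. by apply: (@cper_comp (fun y => - y)) => x; exact: opp_continuous. Qed.

Lemma cperB f g : cper f -> cper g -> cper (fun x => f x - g x).
Proof. by move=> cf /cperN; exact: cperD. Qed.

Lemma cperZ (c : R) f : cper f -> cper (fun x => c * f x).
Proof. exact: cperM (cper_cst c). Qed.

Lemma cper_norm f : cper f -> cper (fun x => `|f x|).
Proof. by apply: (@cper_comp (fun y => `|y|)) => x; exact: norm_continuous. Qed.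

Lemma cper_sum (I : Type) (r : seq I) (F : I -> 'rV[R]_d -> R) :
  (forall i, cper (F i)) -> cper (fun x => \sum_(i <- r) F i x).
Proof.
move=> cF; elim: r => [|i r IH].
  rewrite (_ : (fun x => _) = fun=> 0); first exact: cper_cst.
  by apply/funext => x; rewrite big_nil.
rewrite (_ : (fun x => _) = fun x => F i x + \sum_(j <- r) F j x); first exact: cperD.
by apply/funext => x; rewrite big_cons.
Qed.

Lemma tint_sum (I : Type) (r : seq I) (F : I -> 'rV[R]_d -> R) :
  (forall i, tintegrable (F i)) ->
  tint (fun x => \sum_(i <- r) F i x) = \sum_(i <- r) tint (F i) /\
  tintegrable (fun x => \sum_(i <- r) F i x).
Proof.
move=> cF; elim: r => [|i r [IH1 IH2]].
  rewrite (_ : (fun x => _) = fun=> 0); last by apply/funext => x; rewrite big_nil.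
  rewrite tint_cst big_nil; split => //.
  by apply: cper_tintegrable; exact: cper_cst.
rewrite (_ : (fun x => _) = fun x => F i x + \sum_(j <- r) F j x); last first.
  by apply/funext => x; rewrite big_cons.
by rewrite tintD// big_cons IH1; split => //; exact: tintegrableD.
Qed.

End torus_integral.

(** * Fubini's theorem in the first coordinate *)

Section first_coordinate.
Context {R : realType}.

Definition consrow (s : R) n (y : 'rV[R]_n) : 'rV[R]_n.+1 :=
  \row_i oapp (fun j => y 0 j) s (unlift ord0 i).

Lemma row_of_cons n (z : measurableTypeR R * n.-tuple (measurableTypeR R)) :
  row_of (cons_tuple z) = consrow z.1 (row_of z.2).
Proof.
apply/rowP => i; rewrite !mxE; case: unliftP => [j ->|->] /=.
  by rewrite mxE tnthS.
by rewrite tnth0.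
Qed.

Local Notation U := (uniform_prob (@ltr01 R)).

Section fubini.
Context (n : nat) (f : 'rV[R]_n.+1 -> R) (B : R).
Context (mf : tmeas f) (fB : forall x, `|f x| <= B).

Let F (z : measurableTypeR R * n.-tuple (measurableTypeR R)) := f (consrow z.1 (row_of z.2)).

Let mF : measurable_fun setT F.
Proof.
have -> : F = (f \o @row_of R n.+1) \o @cons_tuple R n.
  by apply/funext => z; rewrite /F /= row_of_cons.
by apply: measurableT_comp => //; exact: measurable_cons_tuple.
Qed.

Let IF : (U \x torus_leb R n)%E.-integrable setT (EFin \o F).
Proof.
apply: measurable_bounded_integrable => //.
  by rewrite (le_lt_trans (probability_le1 _ _))// ltry.
by exists B; split; [exact: num_real|move=> x Bx t _; exact: le_trans (fB _) (ltW Bx)].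
Qed.

Lemma tint_consE : tint f = fine (\int[U \x torus_leb R n]_z (F z)%:E)%E.
Proof.
rewrite /tint /Rintegral /=; congr fine.
rewrite integral_distribution; last 2 first.
- exact/measurable_EFinP.
- apply: eq_integrable IF => // z _ /=.
  by rewrite row_of_cons.
by apply: eq_integral => z _ /=; rewrite row_of_cons.
Qed.

Lemma tmeas_consrow s : tmeas (fun y => f (consrow s y)).
Proof. exact: (measurableT_comp mF (measurable_pair1 s)). Qed.

Lemma tint_cons : tint f = \int[U]_s tint (fun y => f (consrow s y)).
Proof.
rewrite tint_consE -(integral12_prod_meas1 IF) /Rintegral; congr fine.
apply: eq_integral => s _; rewrite /tint /Rintegral fineK//.
apply: integrable_fin_num => //.
exact: (tintegrable_bounded (@tmeas_consrow s) (fun y => fB _)).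
Qed.

Lemma tint_cons_swap : tint f = tint (fun y => \int[U]_s f (consrow s y)).
Proof.
rewrite tint_consE -(integral21_prod_meas1 IF) /tint /Rintegral; congr fine.
apply: eq_integral => t _; rewrite fineK//.
apply: integrable_fin_num => //.
apply: measurable_bounded_integrable => //.
- by rewrite (le_lt_trans (probability_le1 _ _))// ltry.
- exact: (measurableT_comp mF (measurable_pair2 t)).
- by exists B; split; [exact: num_real|move=> x Bx s _; exact: le_trans (fB _) (ltW Bx)].
Qed.

End fubini.

End first_coordinate.

(** * Integrals of derivatives over the torus *)

Section integration_by_parts_torus.
Context {R : realType}.
Local Notation U := (uniform_prob (@ltr01 R)).

Lemma Rintegral_uniform01 (f : measurableTypeR R -> R) (B : R) : measurable_fun setT f ->
  (forall s, `|f s| <= B) ->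
  \int[U]_s f s = \int[lebesgue_measure]_(s in `[0, 1]) f s.
Proof.
move=> mf fB.
have b f' : (forall s, `|f' s| <= B) -> [bounded f' x | x in setT].
  by move=> f'B; exists B; split; [exact: num_real|move=> x Bx t _; exact: le_trans (f'B _) (ltW Bx)].
have l01 : @lebesgue_measure R `[0, 1]%classic = 1%E.
  by rewrite lebesgue_measure_itv /= lte_fin ltr01 oppr0 adde0.
have l01y : (@lebesgue_measure R [set` `[0%R, 1%R]] < +oo)%E by rewrite l01 ltry.
have IU c : U.-integrable setT (EFin \o cst (c : R)).
  exact: (@finite_measure_integrable_cst _ _ _ U).
have IL c : (@lebesgue_measure R).-integrable `[0, 1]%classic (EFin \o cst (c : R)).
  apply: measurable_bounded_integrable => //.
  by exists `|c|; split => // x cx t _; exact: ltW.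
have IUf : U.-integrable setT (EFin \o f).
  apply: measurable_bounded_integrable => //; last exact: b.
  by rewrite (le_lt_trans (probability_le1 _ _))// ltry.
have ILf : (@lebesgue_measure R).-integrable `[0, 1]%classic (EFin \o f).
  apply: measurable_bounded_integrable => //; first exact: measurable_funTS.
  by exists B; split; [exact: num_real|move=> x Bx t _; exact: le_trans (fB _) (ltW Bx)].
(* [integral_uniform] concerns nonnegative functions: [B] is added on both sides and cancelled
   afterwards by linearity. *)
have : \int[U]_s (f s + B) = \int[lebesgue_measure]_(s in `[0, 1]) (f s + B).
  rewrite /Rintegral integral_uniform.
  - by rewrite subr0 invr1 mul1e.
  - by apply/measurable_EFinP; exact: measurable_funD.
  - by move=> s; rewrite lee_fin -lerBlDr sub0r; have := fB s; rewrite ler_norml => /andP[].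
have E1 : \int[U]_s (f s + B) = \int[U]_s f s + \int[U]_s (cst B s).
  by apply: RintegralD; [exact: measurableT|exact: IUf|exact: IU].
have E2 : \int[lebesgue_measure]_(s in `[0, 1]) (f s + B) =
    \int[lebesgue_measure]_(s in `[0, 1]) f s +
    \int[lebesgue_measure]_(s in `[0, 1]) (cst B s).
  by apply: RintegralD; [exact: measurable_itv|exact: ILf|exact: IL].
have UB : \int[U]_s (cst B s) = B.
  apply: etrans (Rintegral_cst U measurableT B) _.
  rewrite -[RHS]mulr1; congr (_ * _); exact: (congr1 fine (probability_setT U)).
have LB : \int[lebesgue_measure]_(s in `[0, 1]) (cst B s) = B.
  apply: etrans; first by apply: Rintegral_cst; exact: measurable_itv.
  rewrite -[RHS]mulr1; congr (_ * _); exact: (congr1 fine l01).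
by rewrite E1 E2 UB LB => /addIr.
Qed.

Lemma Rintegral_uniform_derive (F f : R -> R) : continuous f ->
  (forall s : R, is_derive s 1 F (f s)) -> (exists B, forall s, `|f s| <= B) ->
  \int[U]_s f s = F 1 - F 0.
Proof.
move=> cf dF [B fB].
rewrite (@Rintegral_uniform01 _ B)//; last first.
  exact: continuous_measurable_fun.
have cF : continuous F.
  by move=> s; have [/derivable1_diffP/differentiable_continuous] := dF s.
rewrite /Rintegral (@continuous_FTC2 _ f F)//.
- exact: continuous_subspaceT.
- split => [s _||]; first by have [] := dF s.
  + by apply: cvg_at_right_filter; exact: cF.
  + by apply: cvg_at_left_filter; exact: cF.
- by move=> s _; rewrite derive1E; have [] := dF s.
Qed.

Lemma consrow_shift0 (s t : R) n (y : 'rV[R]_n) :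
  consrow s y + t *: delta_mx 0 0 = consrow (s + t) y.
Proof.
apply/rowP => i; rewrite !mxE; case: unliftP => [j ->|->] /=.
  by rewrite mulr0 addr0.
by rewrite mulr1.
Qed.

Lemma consrow_shift_lift (s t : R) n (y : 'rV[R]_n) i :
  consrow s y + t *: delta_mx 0 (lift ord0 i) = consrow s (y + t *: delta_mx 0 i).
Proof.
apply/rowP => j; rewrite !mxE; case: unliftP => [k ->|->] /=.
  by rewrite !mxE (inj_eq lift_inj).
by rewrite mulr0 addr0.
Qed.

Lemma continuous_consrow n (s : R) : continuous (@consrow R s n).
Proof.
move=> y; suff : consrow s z @[z --> y] --> consrow s y by [].
apply: (@cvgrPdist_le _ _ _ _ (nbhs_filter y) _ _).2 => e e0; near=> z.
apply: rV_norm_le => [|i]; first exact: ltW.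
rewrite !mxE; case: unliftP => [j _|_] /=; last by rewrite subrr normr0 ltW.
have : `|y - z| <= e by near: z; apply: cvgr_dist_le.
by apply: le_trans; have := rV_coord_norm (y - z) j; rewrite !mxE.
Unshelve. all: by end_near. Qed.

(** If [i] is the first coordinate, integrate first in it, by the fundamental theorem of calculus;
    otherwise slice and use induction on [d]. Invariance of [F] is stated for the unit shift in
    direction [i] alone, a property that slices inherit. *)
Lemma tint_derive0 d (i : 'I_d) (F f : 'rV[R]_d -> R) (B : R) :
  continuous f -> (forall x, `|f x| <= B) ->
  (forall x, is_derive x (delta_mx 0 i) F (f x)) ->
  (forall x, F (x + delta_mx 0 i) = F x) -> tint f = 0.
Proof.
elim: d i F f => [|n IH] i F f cf fB dF pF; first by case: i dF pF.
have mf := measurable_continuous_row cf.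
case: (unliftP ord0 i) => [j|] ij; rewrite {i}ij in dF pF.
  have Z s : tint (fun y => f (consrow s y)) = 0.
    apply: (IH j (fun y => F (consrow s y))) => y.
    - by apply: (continuous_comp _ (cf _)); exact: continuous_consrow.
    - exact: fB.
    - have /is_deriveP H := dF (consrow s y); apply/is_deriveP => e /H.
      by apply: filterS => t; rewrite consrow_shift_lift.
    - by rewrite -[RHS]pF -[delta_mx 0 j]scale1r -consrow_shift_lift scale1r.
  rewrite (tint_cons mf fB).
  have -> : (fun s => tint (fun y => f (consrow s y))) = cst 0 by apply/funext.
  by rewrite (Rintegral_cst U)// mul0r.
rewrite (tint_cons_swap mf fB) (@eq_tint _ _ _ (fun=> 0)) ?tint_cst// => y.
apply: (@etrans _ _ (F (consrow 1 y) - F (consrow 0 y))); last first.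
  by rewrite -[1]add0r -consrow_shift0 scale1r pF; exact: subrr.
apply: (@Rintegral_uniform_derive (fun s => F (consrow s y))) => [|s|].
- have -> : (fun s : R => f (consrow s y)) = fun s => f (consrow 0 y + s *: delta_mx 0 0).
    by apply/funext => t; rewrite consrow_shift0 add0r.
  move=> s.
  apply: (@continuous_comp _ _ _ (fun s : R => consrow 0 y + s *: delta_mx 0 0) f); last exact: cf.
  by apply: cvgD; [exact: cvg_cst|apply: cvgZr_tmp; exact: cvg_id].
- have /is_deriveP H := dF (consrow s y); apply/is_deriveP => e /H.
  by apply: filterS => t; rewrite consrow_shift0 /GRing.scale /= mulr1.
- by exists B.
Qed.

End integration_by_parts_torus.

(** * Smooth periodic functions and integration by parts *)

Section smooth_periodic.
Context {R : realType} {d : nat}.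
Implicit Types (f g : 'rV[R]_d -> R) (i : 'I_d) (s : seq 'I_d).

Lemma CinftyP f : Cinfty f <-> periodic f /\ forall n, class_C setT n f.
Proof.
split=> [[pf [U [F [oU TU CF Ff]]]]|[pf Cf]]; last first.
  by split=> //; exists setT, f; split => //; exact: openT.
split=> // n.
have <- : F = f by apply/funext => x; exact: Ff.
by have <- : U = setT by rewrite -subTset.
Qed.

Lemma Cinfty_class_C f n : Cinfty f -> class_C setT n f.
Proof. by move=> /CinftyP[]. Qed.

Lemma Cinfty_cper f : Cinfty f -> cper f.
Proof.
move=> /CinftyP[pf /(_ 0%N)[cf _]]; split=> // x; exact: cf.
Qed.

Lemma Cinfty_derivable f x v : Cinfty f -> derivable f x v.
Proof. by move=> /CinftyP[_ /(_ 1%N)[_ /(_ v)[df _]]]; exact: df. Qed.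

Lemma Cinfty_partial_derive f i x : Cinfty f ->
  is_derive x (delta_mx 0 i) f (partial i f x).
Proof. by move=> Cf; apply: derivableP; exact: Cinfty_derivable. Qed.

Lemma Cinfty_partial i f : Cinfty f -> Cinfty (partial i f).
Proof.
move=> /CinftyP[pf Cf]; apply/CinftyP; split=> [x k|n]; last first.
  by have [_ /(_ (delta_mx 0 i))[_ ]] := Cf n.+1.
rewrite /partial; apply: derive_val; apply/is_deriveP => e e0.
have /derivableP/is_deriveP/(_ _ e0) : derivable f x (delta_mx 0 i).
  by have [_ /(_ (delta_mx 0 i))[df _]] := Cf 1%N; exact: df.
by apply: filterS => t; rewrite (addrAC x) !pf.
Qed.

Lemma Cinfty_partials s f : Cinfty f -> Cinfty (partials s f).
Proof. by move=> Cf; elim: s => [//|i s IH]; exact: Cinfty_partial. Qed.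

Lemma Cinfty_cst (c : R) : @Cinfty R d (fun=> c).
Proof. by apply/CinftyP; split=> // n; exact: class_C_cst. Qed.

Lemma CinftyD f g : Cinfty f -> Cinfty g -> Cinfty (fun x => f x + g x).
Proof.
move=> /CinftyP[pf Cf] /CinftyP[pg Cg]; apply/CinftyP; split=> [x k|n].
  by rewrite pf pg.
exact: class_CD.
Qed.

Lemma CinftyM f g : Cinfty f -> Cinfty g -> Cinfty (fun x => f x * g x).
Proof.
move=> /CinftyP[pf Cf] /CinftyP[pg Cg]; apply/CinftyP; split=> [x k|n].
  by rewrite pf pg.
exact: class_CM.
Qed.

Lemma CinftyZ (c : R) f : Cinfty f -> Cinfty (fun x => c * f x).
Proof. by apply: CinftyM; exact: Cinfty_cst. Qed.

Lemma CinftyN f : Cinfty f -> Cinfty (fun x => - f x).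
Proof.
move=> /(CinftyZ (-1)); rewrite (_ : (fun x => -1 * f x) = fun x => - f x)//.
by apply/funext => x; rewrite mulN1r.
Qed.

Lemma CinftyB f g : Cinfty f -> Cinfty g -> Cinfty (fun x => f x - g x).
Proof. by move=> Cf /CinftyN; exact: CinftyD. Qed.

Lemma Cinfty_sum (I : Type) (r : seq I) (F : I -> 'rV[R]_d -> R) :
  (forall j, Cinfty (F j)) -> Cinfty (fun x => \sum_(j <- r) F j x).
Proof.
move=> CF; apply/CinftyP; split=> [x k|n].
  by apply: eq_bigr => j _; have [] := CF j.
by apply: class_C_sum => j; exact: Cinfty_class_C.
Qed.

Lemma partialD i f g : Cinfty f -> Cinfty g ->
  partial i (fun x => f x + g x) = fun x => partial i f x + partial i g x.
Proof.
by move=> Cf Cg; apply/funext => x; apply: deriveD; exact: Cinfty_derivable.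
Qed.

Lemma partialM i f g : Cinfty f -> Cinfty g ->
  partial i (fun x => f x * g x) = fun x => f x * partial i g x + g x * partial i f x.
Proof.
by move=> Cf Cg; apply/funext => x; apply: deriveM; exact: Cinfty_derivable.
Qed.

Lemma partial_cst i (c : R) : @partial R d i (fun=> c) = fun=> 0.
Proof. by apply/funext => x; exact: derive_cst. Qed.

Lemma partialZ i (c : R) f : Cinfty f ->
  partial i (fun x => c * f x) = fun x => c * partial i f x.
Proof.
move=> Cf; rewrite partialM//; last exact: Cinfty_cst.
by apply/funext => x; rewrite partial_cst mulr0 addr0.
Qed.

Lemma partialsD s f g : Cinfty f -> Cinfty g ->
  partials s (fun x => f x + g x) = fun x => partials s f x + partials s g x.
Proof.
move=> Cf Cg; elim: s => [//|i s IH]; rewrite /partials /= -/(partials s _) IH.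
by rewrite partialD//; exact: Cinfty_partials.
Qed.

Lemma partialsZ s (c : R) f : Cinfty f ->
  partials s (fun x => c * f x) = fun x => c * partials s f x.
Proof.
move=> Cf; elim: s => [//|i s IH]; rewrite /partials /= -/(partials s _) IH.
by rewrite partialZ//; exact: Cinfty_partials.
Qed.

Lemma partialsB s f g : Cinfty f -> Cinfty g ->
  partials s (fun x => f x - g x) = fun x => partials s f x - partials s g x.
Proof.
move=> Cf Cg; have := partialsD s Cf (CinftyZ (-1) Cg); rewrite partialsZ//.
have -> : (fun x => f x + -1 * g x) = fun x => f x - g x.
  by apply/funext => x; rewrite mulN1r.
by move=> ->; apply/funext => x; rewrite mulN1r.
Qed.

Lemma periodic_delta T (f : 'rV[R]_d -> T) i x : periodic f -> f (x + delta_mx 0 i) = f x.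
Proof.
move=> pf; rewrite -[RHS](pf x (delta_mx 0 i)); congr (f (x + _)).
by apply/matrixP => a b; rewrite !mxE; case: (_ && _).
Qed.

Lemma tint_partial i f : Cinfty f -> tint (partial i f) = 0.
Proof.
move=> Cf; have [B _ fB] := cper_bounded (Cinfty_cper (Cinfty_partial i Cf)).
apply: (@tint_derive0 _ _ i f _ B) => //.
- by have [] := Cinfty_cper (Cinfty_partial i Cf).
- by move=> x; exact: Cinfty_partial_derive.
- by move=> x; apply: periodic_delta; case: Cf.
Qed.

Lemma Cinfty_tintegrable f : Cinfty f -> tintegrable f.
Proof. by move=> /Cinfty_cper/cper_tintegrable. Qed.

Lemma tint_parts i f g : Cinfty f -> Cinfty g ->
  tint (fun x => f x * partial i g x) = - tint (fun x => partial i f x * g x).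
Proof.
move=> Cf Cg; apply/eqP; rewrite -subr_eq0 opprK -tintD.
- rewrite -(tint_partial i (CinftyM Cf Cg)) partialM//.
  by apply/eqP; apply: eq_tint => x; rewrite [g x * _]mulrC.
- by apply: Cinfty_tintegrable; apply: CinftyM => //; exact: Cinfty_partial.
- by apply: Cinfty_tintegrable; apply: CinftyM => //; exact: Cinfty_partial.
Qed.

(** Derivatives are moved over one at a time, outermost first, which reverses their order; with
    [rev s] no commutation of derivatives has to be invoked. *)
Lemma tint_partials_parts s f g : Cinfty f -> Cinfty g ->
  tint (fun x => f x * partials s g x) =
  (-1) ^+ size s * tint (fun x => partials (rev s) f x * g x).
Proof.
elim: s f => [|i s IH] f Cf Cg; first by rewrite mul1r.
rewrite /partials /= -/(partials s g) tint_parts//; last exact: Cinfty_partials.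
rewrite IH//; last exact: Cinfty_partial.
by rewrite exprS mulN1r mulNr rev_cons -cats1 /partials foldr_cat.
Qed.

Lemma class_C_coord i n : class_C setT n (fun x : 'rV[R]_d => x 0 i).
Proof.
have D (x v : 'rV[R]_d) : is_derive x v (fun x : 'rV[R]_d => x 0 i) (v 0 i).
  apply/is_deriveP => e e0; near=> t.
  have -> : (x + t *: v) 0 i - x 0 i - t * v 0 i = 0 by rewrite !mxE; ring.
  by rewrite normr0 mulr_ge0// ltW.
case: n => [|n]; (split=> [x _|]; first exact: coord_continuous) => // v.
split=> [x _|]; first by have [] := D x v.
have -> : (fun x => 'D_v (fun x : 'rV[R]_d => x 0 i) x) = fun=> v 0 i.
  by apply/funext => x; have [] := D x v.
exact: class_C_cst.
Unshelve. all: by end_near. Qed.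

Lemma class_C_comp1 (a : R -> R) (f : 'rV[R]_d -> R) n :
  (forall k, class_C setT k a) -> class_C setT n f -> class_C setT n (fun x => a (f x)).
Proof.
move=> Ca Cf.
have -> : (fun x => a (f x)) = fun x => a (0 + \sum_(ce <- [:: (f, 1 : R)]) ce.1 x *: ce.2).
  by apply/funext => x; rewrite big_seq1 add0r /GRing.scale /= mulr1.
apply: (@class_C_comp_sum _ _ _ setT) => //; first exact: openT.
by move=> ce [<-|[]].
Qed.

End smooth_periodic.

Lemma continuous_near_le (R : realType) (V : normedModType R) (f : V -> R) (x : V) (e : R) :
  {for x, continuous f} -> 0 < e -> \forall z \near x, `|f x - f z| <= e.
Proof. by move=> /cvgrPdist_le cf e0; exact: cf. Qed.

(** * Symmetry of second derivatives; membership in L^p *)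

Section schwarz_and_Lp.
Context {R : realType} {d : nat}.
Implicit Types (f g : 'rV[R]_d -> R) (i j : 'I_d) (x : 'rV[R]_d) (s : seq 'I_d).

Lemma norm_delta i : `|delta_mx 0 i : 'rV[R]_d| <= 1.
Proof.
apply: rV_norm_le => // j; rewrite !mxE; case: (_ && _) => /=.
  by rewrite normr1.
by rewrite normr0.
Qed.

(** The second difference is symmetric in [i] and [j], whereas two applications of the mean value
    theorem express it by the mixed derivative in one chosen order. Comparing both orders as [h]
    shrinks proves Schwarz's theorem, [partialsC]. *)
Lemma second_difference f i j x (h : R) : Cinfty f ->
  exists2 z, `|z - x| <= 2 * `|h| &
  f (x + h *: delta_mx 0 i + h *: delta_mx 0 j) - f (x + h *: delta_mx 0 i) -
    f (x + h *: delta_mx 0 j) + f x = h ^+ 2 * partials [:: j; i] f z.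
Proof.
move=> Cf; set ei : 'rV[R]_d := delta_mx 0 i; set ej : 'rV[R]_d := delta_mx 0 j.
pose phi y := f (y + h *: ej) - f y.
have dphi y : is_derive y ei phi (partial i f (y + h *: ej) - partial i f y).
  apply: is_deriveB; last exact: Cinfty_partial_derive.
  have /is_deriveP H := Cinfty_partial_derive i (y + h *: ej) Cf.
  by apply/is_deriveP => e /H; apply: filterS => t; rewrite (addrAC y).
have [xi xih E1] : exists2 xi : R, `|xi| <= `|h| &
    phi (x + h *: ei) - phi x = h * 'D_ei phi (x + xi *: ei).
  by apply: mean_value_scale => xi _; have [] := dphi (x + xi *: ei).
have [eta etah E2] : exists2 eta : R, `|eta| <= `|h| &
    partial i f (x + xi *: ei + h *: ej) - partial i f (x + xi *: ei) =
    h * 'D_ej (partial i f) (x + xi *: ei + eta *: ej).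
  apply: mean_value_scale => eta _.
  by apply: Cinfty_derivable; exact: Cinfty_partial.
exists (x + xi *: ei + eta *: ej).
  rewrite -(addrA x) (addrC x) addrK (le_trans (ler_normD _ _))// mulr_natl mulr2n.
  by rewrite !normrZ lerD// -[leRHS]mulr1 ler_pM// norm_delta.
have [_ D] := dphi (x + xi *: ei).
rewrite expr2 -mulrA /= -/ej -E2 -D -E1 /phi addrAC; ring.
Qed.

Lemma partialsC f i j : Cinfty f -> partials [:: i; j] f = partials [:: j; i] f.
Proof.
move=> Cf; apply/funext => x.
have [c1 _] := Cinfty_cper (Cinfty_partials [:: i; j] Cf).
have [c2 _] := Cinfty_cper (Cinfty_partials [:: j; i] Cf).
have D1 h := second_difference i j x h Cf.
have D2 h := second_difference j i x h Cf.
move: (partials [:: i; j] f) (partials [:: j; i] f) c1 c2 D1 D2 => P Q c1 c2 D1 D2.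
apply/eqP; rewrite -subr_eq0 -normr_le0; apply/ler_addgt0Pr => e e0; rewrite add0r.
have e2 : 0 < e / 2 by rewrite divr_gt0.
have /nbhs_ballP[r /= r0 Hr] : \forall z \near x, `|P x - P z| <= e / 2 /\ `|Q x - Q z| <= e / 2.
  apply: filterI; first exact: (continuous_near_le (c1 x) e2).
  exact: (continuous_near_le (c2 x) e2).
pose h := r / 4.
have h0 : 0 < h by rewrite divr_gt0.
have near z : `|z - x| <= 2 * `|h| -> ball x r z.
  move=> zx; rewrite -ball_normE /= distrC (le_lt_trans zx)// gtr0_norm// /h.
  by rewrite mulrA ltr_pdivrMr// mulrC ltr_pM2l// ltr_nat.
have [z1 /near/Hr[_ H1] E1] := D1 h.
have [z2 /near/Hr[H2 _] E2] := D2 h.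
have E : Q z1 = P z2.
  apply: (@mulfI _ (h ^+ 2)); first by rewrite expf_neq0// gt_eqF.
  by rewrite -E1 -E2 (addrAC x); congr (_ + _); exact: addrAC.
rewrite (_ : P x - Q x = (P x - P z2) - (Q x - Q z1)); last by rewrite E; ring.
by rewrite (le_trans (ler_normB _ _))// [leRHS]splitr lerD.
Qed.

Lemma Lfun_tintegrable (p : R) f : 1 <= p ->
  (f \o @row_of R d) \in Lfun (torus_leb R d) p%:E <->
  tmeas f /\ tintegrable (fun x => `|f x| `^ p).
Proof.
move=> p1; split=> [Lf|[mf If]].
  split; last exact: Lfun_integrable p1 Lf.
  by move: Lf; rewrite inE => /andP[]; rewrite inE.
rewrite inE; apply/andP; split; rewrite inE//= /finite_norm unlock.
by apply: poweR_lty; exact: integrable_lty If.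
Qed.

Lemma cper_torusLp (p : R) f : 1 <= p -> cper f -> torusLp p%:E f.
Proof.
move=> p1 cf; split; first by case: cf.
apply/Lfun_tintegrable => //; split; first exact: cper_tmeas.
have [B B0 fB] := cper_bounded cf.
apply: (@tintegrable_bounded _ _ _ (B `^ p)).
  apply: (measurableT_comp (measurable_powR _)).
  by apply: measurableT_comp => //; exact: cper_tmeas.
move=> x; rewrite ger0_norm ?powR_ge0// ge0_ler_powR// ?nnegrE//.
exact: le_trans p1.
Qed.

Lemma torusLp_tintegrable (p : R) f : 1 <= p -> torusLp p%:E f -> tintegrable f.
Proof.
move=> p1 [_ Lf]; apply/Lfun1_integrable; move: Lf; apply: Lfun_subset => //.
by apply: fin_num_measure.
Qed.

Lemma Cinfty_wderiv (p : R) s f : 1 <= p -> Cinfty f ->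
  wderiv p%:E s f (partials (rev s) f).
Proof.
move=> p1 Cf; split; first by apply: cper_torusLp => //; exact/Cinfty_cper/Cinfty_partials.
by move=> phi Cphi; exact: tint_partials_parts.
Qed.

Lemma Cinfty_sobolev (p : R) k f : 1 <= p -> Cinfty f -> sobolev k p f.
Proof.
move=> p1 Cf; split; first exact/cper_torusLp/Cinfty_cper.
by move=> s _; exists (partials (rev s) f); exact: Cinfty_wderiv.
Qed.

End schwarz_and_Lp.

Lemma is_deriveW (R : realType) (V : normedModType R) (f g : V -> R) (x v : V) (l l' : R) :
  is_derive x v f l -> f = g -> l = l' -> is_derive x v g l'.
Proof. by move=> D <- <-. Qed.

(** * Trigonometric kernels and Sobolev embedding *)

Section trigonometric_kernel.
Context {R : realType}.
Implicit Types (t : R) (n : nat).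

(** The reciprocal of the mean of cos^(2n) (pi t) over a period (Wallis's product), so that [kern n]
    has mass 1. *)
Fixpoint kcoef n : R :=
  if n is m.+1 then kcoef m * ((m.*2.+2)%:R / (m.*2.+1)%:R) else 1.

Definition kern n t : R := kcoef n * cos (pi * t) ^+ n.*2.

(** The periodic primitive of [kern n - 1] that vanishes at 0, from the reduction formula for powers
    of the cosine. *)
Fixpoint kprim n t : R :=
  if n is m.+1 then
    kprim m t + kcoef n / ((m.*2.+2)%:R * pi) * (cos (pi * t) ^+ m.*2.+1 * sin (pi * t))
  else 0.

Lemma kcoef_gt0 n : 0 < kcoef n.
Proof. by elim: n => //= n IH; rewrite mulr_gt0// divr_gt0. Qed.

Lemma kern_ge0 n t : 0 <= kern n t.
Proof.
rewrite mulr_ge0 ?(ltW (kcoef_gt0 n))// -muln2 mulnC exprM exprn_ge0//.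
exact: sqr_ge0.
Qed.

Lemma is_derive_sin_pi t : is_derive t 1 (fun t => sin (pi * t)) (pi * cos (pi * t)).
Proof.
have D : is_derive t 1 (fun t : R => pi * t) pi.
  apply: (is_deriveW (is_deriveZ pi (is_derive_id t (1 : R)))) => //.
  by rewrite /GRing.scale /= mulr1.
have := @is_derive1_comp _ sin _ t _ _ (is_derive_sin (pi * t)) D.
by rewrite mulrC.
Qed.

Lemma is_derive_cos_pi t : is_derive t 1 (fun t => cos (pi * t)) (- (pi * sin (pi * t))).
Proof.
have D : is_derive t 1 (fun t : R => pi * t) pi.
  apply: (is_deriveW (is_deriveZ pi (is_derive_id t (1 : R)))) => //.
  by rewrite /GRing.scale /= mulr1.
have := @is_derive1_comp _ cos _ t _ _ (is_derive_cos (pi * t)) D.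
by rewrite mulNr mulrC.
Qed.

Lemma is_derive_kprim n t : is_derive t 1 (kprim n) (kern n t - 1).
Proof.
elim: n => [|n IH] /=.
  by rewrite /kern /= expr0 mulr1 subrr; exact: is_derive_cst.
have Ds := is_derive_sin_pi t; have Dc := is_derive_cos_pi t.
have DX := is_deriveX n.*2.+1 Dc.
have DM := is_deriveM DX Ds.
have DZ := is_deriveZ (kcoef n.+1 / ((n.*2.+2)%:R * pi)) DM.
apply: (is_deriveW (is_deriveD IH DZ)).
  by apply/funext => u; rewrite !fctE.
rewrite /kern doubleS /GRing.scale /= !fctE.
set c := cos _; set s := sin _.
have s2 : s ^+ 2 = 1 - c ^+ 2 by exact: sin2cos2.
have n1 : (n.*2.+1)%:R != 0 :> R by rewrite pnatr_eq0.
have n2 : (n.*2.+2)%:R != 0 :> R by rewrite pnatr_eq0.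
have p0 : pi != 0 :> R by rewrite gt_eqF// pi_gt0.
have En : (n.*2.+2)%:R = (n.*2.+1)%:R + 1 :> R by rewrite -natr1.
rewrite !exprS /=.
rewrite [X in _ + _ * X](_ : _ = pi * c ^+ n.*2 * (c ^+ 2 - (n.*2.+1)%:R * s ^+ 2)); last first.
  rewrite !mulrA expr2; ring.
rewrite s2; move: n1 n2 p0 En; move: (n.*2.+1)%:R (n.*2.+2)%:R (c ^+ n.*2) (kcoef n) (pi : R) => a b P K p a0 b0 p0 Eb.
rewrite Eb in b0; rewrite Eb; field.
by rewrite a0 p0 b0.
Qed.

Lemma cos_pi_shift t : cos (pi * (t + 1)) = - cos (pi * t) :> R.
Proof. by rewrite mulrDr mulr1 cosD cospi sinpi mulr0 subr0 mulrN1. Qed.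

Lemma sin_pi_shift t : sin (pi * (t + 1)) = - sin (pi * t) :> R.
Proof. by rewrite mulrDr mulr1 sinD cospi sinpi mulr0 addr0 mulrN1. Qed.

Lemma kern_shift n t : kern n (t + 1) = kern n t.
Proof. by rewrite /kern cos_pi_shift exprNn -signr_odd odd_double mul1r. Qed.

Lemma kprim_shift n t : kprim n (t + 1) = kprim n t.
Proof.
elim: n => //= n ->; rewrite cos_pi_shift sin_pi_shift exprNn.
by rewrite -signr_odd /= odd_double /= expr1 mulN1r mulrNN.
Qed.

Lemma shift_int T (a : R -> T) t (k : int) : (forall t, a (t + 1) = a t) ->
  a (t + k%:~R) = a t.
Proof.
move=> H.
have N (n : nat) u : a (u + n%:R) = a u.
  by elim: n u => [|n IH] u; rewrite ?addr0// -natr1 addrA H IH.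
case: k => n; first by rewrite -pmulrn N.
by rewrite NegzE mulrNz -[in RHS](subrK n.+1%:R t) N -pmulrn.
Qed.

Lemma kprim0 n : kprim n 0 = 0.
Proof. by elim: n => //= n ->; rewrite mulr0 sin0 mulr0 mulr0 addr0. Qed.

(** On [0, 1] the function [kprim n s + s] is a primitive of [kern n >= 0], so it increases from 0
    to 1. That the bound does not depend on [n] is what makes the Sobolev estimate uniform in the
    kernel. *)
Lemma kprim_le1 n t : `|kprim n t| <= 1.
Proof.
have -> : kprim n t = kprim n (t - (Num.floor t)%:~R).
  rewrite -{1}(subrK (Num.floor t)%:~R t).
  by apply: shift_int => s; exact: kprim_shift.
have /andP[] := floor_itv t; set u := t - _; rewrite intrD -subr_ge0 -/u => u0.
rewrite -ltrBlDl -/u => /ltW u1.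
pose G s := kprim n s + s.
have DG (s : R) : is_derive s 1 G (kern n s).
  by apply: (is_deriveW (is_deriveD (is_derive_kprim n s) (is_derive_id s (1 : R)))) => //; rewrite subrK.
have mono x y : 0 <= x -> x <= y -> y <= 1 -> G x <= G y.
  apply: ger0_derive1_ndecr => [s _|s _|].
  - by have [] := DG s.
  - by rewrite derive1E; have [_ ->] := DG s; exact: kern_ge0.
  - apply: continuous_subspaceT => s.
    by have [/derivable1_diffP/differentiable_continuous] := DG s.
have G0 : G 0 = 0 by rewrite /G kprim0 addr0.
have G1 : G 1 = 1 by rewrite /G -[X in kprim n X]add0r kprim_shift kprim0 add0r.
have := mono _ _ (lexx 0) u0 u1; have := mono _ _ u0 u1 (lexx 1).
rewrite G0 G1 /G ler_norml => H1 H2; apply/andP; split; lra.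
Qed.

(** Wallis's recursion: multiplication by sin^2 is expressed by two consecutive kernels, so its
    moment follows from their masses alone. *)
Lemma kern_sin2 n t :
  kern n t * sin (pi * t) ^+ 2 = kern n t - kern n.+1 t * ((n.*2.+1)%:R / (n.*2.+2)%:R).
Proof.
rewrite sin2cos2 /kern /= doubleS !exprS.
have n1 : (n.*2.+1)%:R != 0 :> R by rewrite pnatr_eq0.
have n2 : (n.*2.+2)%:R != 0 :> R by rewrite pnatr_eq0.
move: n1 n2; move: (n.*2.+1)%:R (n.*2.+2)%:R => a b a0 b0.
by field; rewrite a0 b0.
Qed.

Lemma class_C_trig_pi n : class_C setT n (fun t : R => cos (pi * t)) /\
  class_C setT n (fun t : R => sin (pi * t)).
Proof.
have Dc (t v : R) : is_derive t v (fun t => cos (pi * t)) ((- (v * pi)) * sin (pi * t)).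
  rewrite -{1}[v]mulr1.
  have [d1 D1] := is_derive_cos_pi t.
  have := deriveZv v d1; rewrite D1 /GRing.scale /=.
  by rewrite mulrN mulrA mulNr.
have Ds (t v : R) : is_derive t v (fun t => sin (pi * t)) ((v * pi) * cos (pi * t)).
  rewrite -{1}[v]mulr1.
  have [d1 D1] := is_derive_sin_pi t.
  by have := deriveZv v d1; rewrite D1 /GRing.scale /= mulrA.
have cc (f : R -> R) (df : R -> R) : (forall t, is_derive t 1 f (df t)) -> continuous f.
  by move=> D t; have [/derivable1_diffP/differentiable_continuous] := D t.
elim: n => [|n [IHc IHs]]; split; split => //.
- by move=> x _; apply: (cc _ _ (fun t => is_derive_cos_pi t)).
- by move=> x _; apply: (cc _ _ (fun t => is_derive_sin_pi t)).
- by move=> x _; apply: (cc _ _ (fun t => is_derive_cos_pi t)).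
- move=> v; split=> [x _|]; first by have [] := Dc x v.
  have -> : (fun x => 'D_v (fun t : R => cos (pi * t)) x) = fun t => (- (v * pi)) * sin (pi * t).
    by apply/funext => x; have [] := Dc x v.
  exact: class_CZ.
- by move=> x _; apply: (cc _ _ (fun t => is_derive_sin_pi t)).
- move=> v; split=> [x _|]; first by have [] := Ds x v.
  have -> : (fun x => 'D_v (fun t : R => sin (pi * t)) x) = fun t => (v * pi) * cos (pi * t).
    by apply/funext => x; have [] := Ds x v.
  exact: class_CZ.
Qed.

Lemma class_CX (V : normedModType R) (f : V -> R) m n :
  class_C setT n f -> class_C setT n (fun x => f x ^+ m).
Proof.
move=> Cf; elim: m => [|m IH].
  have -> : (fun x => f x ^+ 0) = fun=> 1 by apply/funext => x; rewrite expr0.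
  exact: class_C_cst.
have -> : (fun x => f x ^+ m.+1) = fun x => f x * f x ^+ m.
  by apply/funext => x; rewrite exprS.
exact: class_CM.
Qed.

Lemma class_C_kern m n : class_C setT n (kern m).
Proof. by apply: class_CZ; apply: class_CX; exact: (class_C_trig_pi n).1. Qed.

Lemma class_C_kprim m n : class_C setT n (kprim m).
Proof.
elim: m => [|m IH] /=; first exact: class_C_cst.
apply: class_CD => //; apply: class_CZ; apply: class_CM.
  by apply: class_CX; exact: (class_C_trig_pi n).1.
exact: (class_C_trig_pi n).2.
Qed.

End trigonometric_kernel.

Lemma continuous_reflect (R : realType) (V : normedModType R) (x : V) :
  continuous (fun y : V => x - y).
Proof. by move=> y; apply: cvgB; [exact: cvg_cst|exact: cvg_id]. Qed.

Section reflection.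
Context {R : realType} {d : nat}.
Implicit Types (g : 'rV[R]_d -> R) (x y z : 'rV[R]_d) (i : 'I_d).

Lemma is_derive_reflect g x y v (l : R) : is_derive (x - y) v g l ->
  is_derive y v (fun y => g (x - y)) (- l).
Proof.
move=> /is_deriveP H; apply/is_deriveP => e /H.
have N : (fun t : R => - t) @ 0 --> (0 : R).
  suff : (fun t : R => - t) @ 0 --> (- 0 : R) by rewrite oppr0.
  by apply: cvgN; exact: cvg_id.
move=> /N He.
have : \forall t \near (0 : R), `|g (x - y + (- t) *: v) - g (x - y) - (- t) * l| <= e * `|- t|.
  exact: He.
apply: filterS => t.
by rewrite normrN opprD addrA scaleNr mulNr mulrN opprK.
Qed.

Lemma class_C_reflect g x n : class_C setT n g -> class_C setT n (fun y => g (x - y)).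
Proof.
have cr g' : (forall z, setT z -> {for z, continuous g'}) ->
    forall y, setT y -> {for y, continuous (fun y => g' (x - y))}.
  move=> cg y _; apply: (@continuous_comp _ _ _ (fun y => x - y) g'); last exact: cg.
  exact: continuous_reflect.
elim: n g => [|n IH] g [cg dg]; (split; first exact: cr) => // v.
have [dv Cv] := dg v; split=> [y _|].
  by have /derivableP/is_derive_reflect[] := dv (x - y) Logic.I.
have -> : (fun y => 'D_v (fun y => g (x - y)) y) = fun y => - 1 * 'D_v g (x - y).
  apply/funext => y; have /derivableP/is_derive_reflect[_ ->] := dv (x - y) Logic.I.
  by rewrite mulN1r.
by apply: class_CZ; exact: (IH (fun z => 'D_v g z)).
Qed.

Lemma Cinfty_reflect g x : Cinfty g -> Cinfty (fun y => g (x - y)).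
Proof.
move=> /CinftyP[pg Cg]; apply/CinftyP; split=> [y k|n]; last exact: class_C_reflect.
rewrite opprD addrA (_ : - map_mx intr k = map_mx intr (- k)) ?pg//.
by apply/matrixP => a b; rewrite !mxE mulrNz.
Qed.

Lemma partial_reflect i g x : Cinfty g ->
  partial i (fun y => g (x - y)) = fun y => - partial i g (x - y).
Proof.
move=> Cg; apply/funext => y.
by have /is_derive_reflect[_] := Cinfty_partial_derive i (x - y) Cg.
Qed.

End reflection.

(** * Product kernels *)

Section product_kernel.
Context {R : realType} {d : nat}.
Implicit Types (x y z : 'rV[R]_d) (i : 'I_d) (a : 'I_d -> R -> R).

Definition Cinfty1 (b : R -> R) :=
  (forall n, class_C setT n b) /\ forall t, b (t + 1) = b t.

Lemma Cinfty1_kern n : Cinfty1 (kern n).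
Proof. by split=> [k|t]; [exact: class_C_kern|exact: kern_shift]. Qed.

Lemma Cinfty1_kprim n : Cinfty1 (kprim n).
Proof. by split=> [k|t]; [exact: class_C_kprim|exact: kprim_shift]. Qed.

Lemma Cinfty1_cst (c : R) : Cinfty1 (fun=> c).
Proof. by split=> // k; exact: class_C_cst. Qed.

Definition gk a z : R := \prod_i a i (z 0 i).

Lemma Cinfty_gk a : (forall i, Cinfty1 (a i)) -> Cinfty (gk a).
Proof.
move=> Ca; apply/CinftyP; split=> [z k|n].
  apply: eq_bigr => i _; rewrite !mxE; apply: shift_int; exact: (Ca i).2.
apply: class_C_prod => i; apply: class_C_comp1; first exact: (Ca i).1.
exact: class_C_coord.
Qed.

Definition upd a i (b : R -> R) : 'I_d -> R -> R := fun j => if j == i then b else a j.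

Lemma gk_upd a i b z : gk (upd a i b) z = b (z 0 i) * \prod_(j | j != i) a j (z 0 j).
Proof.
rewrite /gk (bigD1 i)//= /upd eqxx; congr (_ * _).
by apply: eq_bigr => j /negPf ->.
Qed.

Lemma gk_eq_upd a i : a = upd a i (a i).
Proof. by apply/funext => j; rewrite /upd; case: eqVneq => [->|]. Qed.

Lemma Cinfty1_upd a i b : (forall j, Cinfty1 (a j)) -> Cinfty1 b ->
  forall j, Cinfty1 (upd a i b j).
Proof. by move=> Ca Cb j; rewrite /upd; case: eqP. Qed.

Lemma partial_gk a i (b db : R -> R) : (forall t : R, is_derive t 1 b (db t)) ->
  partial i (gk (upd a i b)) = gk (upd a i db).
Proof.
move=> Db; apply/funext => z; apply: derive_val; apply/is_deriveP => e e0.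
set P : R := \prod_(j | j != i) a j (z 0 j).
have e1 : 0 < e / (`|P| + 1) by rewrite divr_gt0// ltr_wpDl.
have /is_deriveP/(_ _ e1) := Db (z 0 i); apply: filterS => t.
rewrite !gk_upd -/P.
have -> : \prod_(j | j != i) a j ((z + t *: delta_mx 0 i) 0 j) = P.
  by apply: eq_bigr => j /negPf ji; rewrite !mxE ji andbF mulr0 addr0.
rewrite !mxE !eqxx /GRing.scale /= => H.
rewrite mulrA -mulrBl -mulrBl normrM (le_trans (ler_wpM2r _ H))//.
rewrite mulrAC ler_wpM2r// mulrAC ler_pdivrMr ?ltr_wpDl//.
by rewrite ler_wpM2l ?(ltW e0)// lerDl.
Qed.

End product_kernel.

(** * Weak derivatives against product kernels *)

Section weak_family.
Context {R : realType} {d : nat}.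
Implicit Types (x y z : 'rV[R]_d) (i : 'I_d) (a : 'I_d -> R -> R) (t r : seq 'I_d).

(** A choice of weak derivatives up to order [N], integrable only. Even [w [::]] is tied to [f]
    solely through integrals against smooth functions. *)
Definition weak_family (N : nat) (f : 'rV[R]_d -> R) (w : seq 'I_d -> 'rV[R]_d -> R) :=
  forall t, (size t <= N)%N -> tintegrable (w t) /\
    forall phi, Cinfty phi ->
      tint (fun x => f x * partials t phi x) = (-1) ^+ size t * tint (fun x => w t x * phi x).

Lemma weak_family_step N f w t i phi : weak_family N f w -> (size t < N)%N ->
  Cinfty phi ->
  tint (fun x => w t x * partial i phi x) = - tint (fun x => w (rcons t i) x * phi x).
Proof.
move=> Hw tN Cphi.
have [_ H1] := Hw t (ltnW tN).
have [|_ H2] := Hw (rcons t i); first by rewrite size_rcons.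
have s0 : (-1) ^+ size t != 0 :> R by rewrite expf_neq0// oppr_eq0 oner_eq0.
apply: (mulfI s0); rewrite -H1; last exact: Cinfty_partial.
have := H2 _ Cphi; rewrite size_rcons exprS mulN1r mulNr mulrN => <-.
by apply: eq_tint => x; rewrite /partials foldr_rcons.
Qed.

(** The sum of the L^1 norms of the derivatives [w (t ++ r')] over all subsequences [r'] of [r]. *)
Fixpoint weak_bound (w : seq 'I_d -> 'rV[R]_d -> R) t r : R :=
  if r is i :: r' then weak_bound w t r' + weak_bound w (rcons t i) r'
  else tint (fun x => `|w t x|).

(** In direction [i] the factor [kern n] equals 1 plus the derivative of [kprim n]; the minus sign
    comes from the reflection [x - y]. *)
Lemma kern_split a i n x phi : (forall j, Cinfty1 (a j)) ->
  a i = kern n -> tintegrable phi ->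
  tint (fun y => phi y * gk a (x - y)) =
  tint (fun y => phi y * gk (upd a i (fun=> 1)) (x - y)) -
  tint (fun y => phi y * partial i (fun y => gk (upd a i (kprim n)) (x - y)) y).
Proof.
move=> Ca ai Iphi.
have C1 : Cinfty (gk (upd a i (fun=> 1))).
  by apply/Cinfty_gk/Cinfty1_upd => //; exact: Cinfty1_cst.
have CK : Cinfty (gk (upd a i (kprim n))).
  by apply/Cinfty_gk/Cinfty1_upd => //; exact: Cinfty1_kprim.
rewrite -tintB.
- apply: eq_tint => y; rewrite partial_reflect// (partial_gk _ _ (@is_derive_kprim R n)).
  rewrite {1}(gk_eq_upd a i) ai !gk_upd; ring.
- by apply: tintegrableM_cper => //; apply/Cinfty_cper/Cinfty_reflect.
- apply: tintegrableM_cper => //; apply/Cinfty_cper/Cinfty_partial.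
  exact: Cinfty_reflect.
Qed.

(** The list [r] holds the coordinates that still carry a kernel. [kern_split] removes one of them:
    the factor becomes either 1 or [kprim n], the latter at the price of one more derivative on [w].
    All resulting factors are bounded by 1, so the orders of the kernels disappear from the
    bound. *)
Lemma weak_family_gk_bound N f w r t a x : weak_family N f w -> uniq r ->
  (size t + size r <= N)%N -> (forall j, Cinfty1 (a j)) ->
  (forall j, j \in r -> exists n, a j = kern n) ->
  (forall j, j \notin r -> forall s, `|a j s| <= 1) ->
  `|tint (fun y => w t y * gk a (x - y))| <= weak_bound w t r.
Proof.
move=> Hw; elim: r t a => [|i r IH] t a /=.
  rewrite addn0 => _ tN Ca _ a1; have [Iw _] := Hw t tN.
  have g1 z : `|gk a z| <= 1.
    rewrite /gk; elim/big_ind: _ => [|u v u1 v1|j _]; last exact: a1.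
      by rewrite normr1.
    by rewrite normrM mulr_ile1.
  have Ig : tintegrable (fun y => w t y * gk a (x - y)).
    by apply: tintegrableM_cper => //; apply/Cinfty_cper/Cinfty_reflect/Cinfty_gk.
  rewrite (le_trans (le_norm_tint Ig))//; apply: le_tint; try exact: tintegrable_norm.
  by move=> y; rewrite normrM ler_piMr.
rewrite addnS => /andP[ir ur] tN Ca ak a1.
have [n ai] := ak i (mem_head _ _).
have [Iw _] := Hw t (leq_trans (leq_addr _ _) (ltnW tN)).
have tN' : (size t < N)%N by rewrite (leq_trans _ tN)// ltnS leq_addr.
rewrite (kern_split _ Ca ai)// (weak_family_step _ Hw)//; last first.
  by apply/Cinfty_reflect/Cinfty_gk/Cinfty1_upd => //; exact: Cinfty1_kprim.
rewrite opprK (le_trans (ler_normD _ _))//; apply: lerD; apply: IH => //.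
- exact: ltnW.
- by apply: Cinfty1_upd => //; exact: Cinfty1_cst.
- move=> j jr; rewrite /upd; case: eqP => [ji|_]; first by rewrite -ji jr in ir.
  by apply: ak; rewrite inE jr orbT.
- move=> j jr s; rewrite /upd; case: eqVneq => [_|ji]; first by rewrite normr1.
  by apply: a1; rewrite inE negb_or ji.
- by rewrite size_rcons addSn.
- by apply: Cinfty1_upd => //; exact: Cinfty1_kprim.
- move=> j jr; rewrite /upd; case: eqP => [ji|_]; first by rewrite -ji jr in ir.
  by apply: ak; rewrite inE jr orbT.
- move=> j jr s; rewrite /upd; case: eqVneq => [_|ji]; first exact: kprim_le1.
  by apply: a1; rewrite inE negb_or ji.
Qed.

Lemma tint_gk r a x : uniq r -> (forall j, Cinfty1 (a j)) ->
  (forall j, j \in r -> exists n, a j = kern n) ->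
  (forall j, j \notin r -> a j = fun=> 1) ->
  tint (fun y => gk a (x - y)) = 1.
Proof.
elim: r a => [|i r IH] a /= ur Ca ak a1.
  rewrite (@eq_tint _ _ _ (fun=> 1)) ?tint_cst// => y.
  by rewrite /gk big1// => j _; rewrite a1.
have [n ai] := ak i (mem_head _ _); have /andP[ir ur'] := ur.
have := kern_split x Ca ai (cper_tintegrable (cper_cst 1)).
rewrite (@eq_tint _ _ _ (fun y => gk a (x - y))); last by move=> y; rewrite mul1r.
rewrite (@eq_tint _ _ (fun y => 1 * _) (fun y => gk (upd a i (fun=> 1)) (x - y))); last first.
  by move=> y; rewrite mul1r.
rewrite (@eq_tint _ _ (fun y => 1 * _) (partial i (fun y => gk (upd a i (kprim n)) (x - y)))); last first.
  by move=> y; rewrite mul1r.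
rewrite tint_partial; last first.
  by apply/Cinfty_reflect/Cinfty_gk/Cinfty1_upd => //; exact: Cinfty1_kprim.
rewrite subr0 => ->; apply: IH => //.
- by apply: Cinfty1_upd => //; exact: Cinfty1_cst.
- move=> j jr; rewrite /upd; case: eqP => [ji|_]; first by rewrite -ji jr in ir.
  by apply: ak; rewrite inE jr orbT.
- move=> j jr; rewrite /upd; case: eqVneq => // ji.
  by apply: a1; rewrite inE negb_or ji.
Qed.

(** The order may vary with the coordinate because the computation of the sin^2 moment raises a
    single one of them. *)
Lemma tint_gk_kern (nu : 'I_d -> nat) x : tint (fun y => gk (fun i => kern (nu i)) (x - y)) = 1.
Proof.
apply: (@tint_gk (enum 'I_d)) => [|j|j _|j].
- exact: enum_uniq.
- exact: Cinfty1_kern.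
- by exists (nu j).
- by rewrite mem_enum.
Qed.

End weak_family.

(** * The product kernels as an approximate identity *)

Section approximate_identity.
Context {R : realType} {d : nat}.
Implicit Types (f : 'rV[R]_d -> R) (x y z : 'rV[R]_d) (i : 'I_d).

Lemma sin_pi_gt0 (u : R) : 0 < u -> u <= 1 / 2 -> 0 < sin (pi * u).
Proof.
move=> u0 u2; apply: sin_gt0_pi; rewrite mulr_gt0 ?pi_gt0//=.
by rewrite -[ltRHS]mulr1 ltr_pM2l ?pi_gt0//; lra.
Qed.

Lemma sin2_pi_mono (u v : R) : 0 < u -> u <= `|v| -> `|v| <= 1 / 2 ->
  sin (pi * u) ^+ 2 <= sin (pi * v) ^+ 2.
Proof.
move=> u0 uv v2.
have -> : sin (pi * v) ^+ 2 = sin (pi * `|v|) ^+ 2.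
  by case: (ger0P v) => // _; rewrite mulrN sinN sqrrN.
have v0 := lt_le_trans u0 uv.
have p0 := @pi_gt0 R.
have itv w : 0 < w -> w <= 1 / 2 -> pi * w \in `[- (pi / 2), pi / 2 : R].
  move=> w0 w2; rewrite in_itv /=; apply/andP; split.
    by apply: (@le_trans _ _ 0); rewrite ?oppr_le0 ?mulr_ge0 ?ltW// divr_ge0// ltW.
  by rewrite ler_pM2l//; lra.
apply: lerXn2r.
- by rewrite nnegrE ltW// sin_pi_gt0//; exact: le_trans v2.
- by rewrite nnegrE ltW// sin_pi_gt0.
move: uv; rewrite le_eqVlt => /predU1P[<-//|uv].
apply/ltW; rewrite ltr_sin ?itv//; last exact: le_trans (ltW uv) v2.
by rewrite ltr_pM2l.
Qed.

(* This inequality reduces the convergence f * K_n -> f to the single moment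
   \int sin^2 (pi t) k_n t dt = 1 / (2 n + 2), as in Korovkin's theorem. *)
Lemma modulus_sin2 f x (e : R) : cper f -> 0 < e -> exists2 C : R, 0 <= C &
  forall y, `|f y - f x| <= e + C * \sum_i sin (pi * (x - y) 0 i) ^+ 2.
Proof.
move=> cf e0; have [B B0 fB] := cper_bounded cf; have [cf1 pf] := cf.
have /nbhs_ballP[r /= r0 Hr] := continuous_near_le (cf1 x) e0.
pose u := Num.min (r / 2) (1 / 2).
have u0 : 0 < u by rewrite lt_min !divr_gt0.
have u2 : u <= 1 / 2 by rewrite ge_min lexx orbT.
have ur : u < r by rewrite gt_min; apply/orP; left; lra.
have s0 : 0 < sin (pi * u) ^+ 2 by rewrite exprn_gt0// sin_pi_gt0.
have C0 : 0 <= 2 * B / sin (pi * u) ^+ 2 by rewrite divr_ge0 ?(ltW s0)// mulr_ge0.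
exists (2 * B / sin (pi * u) ^+ 2) => //.
have S0 y : 0 <= \sum_i sin (pi * (x - y) 0 i) ^+ 2 by apply: sumr_ge0 => i _; exact: sqr_ge0.
(* Subtracting [k] moves [y] to the translate whose coordinates are within 1/2 of those of [x];
   there sin^2 (pi v) increases with |v|. *)
move=> y; pose k : 'rV[int]_d := \row_i Num.floor (y 0 i - x 0 i + 1 / 2).
pose y' := y - map_mx intr k.
have fy : f y' = f y by rewrite -[in RHS](subrK (map_mx intr k) y) pf.
have y'2 i : `|(x - y') 0 i| <= 1 / 2.
  rewrite !mxE; have /andP[] := floor_itv (y 0 i - x 0 i + 1 / 2).
  rewrite intrD; set n := (Num.floor _)%:~R => H1 H2.
  by rewrite ler_norml; apply/andP; split; lra.
have sE i : sin (pi * (x - y') 0 i) ^+ 2 = sin (pi * (x - y) 0 i) ^+ 2.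
  rewrite !mxE.
  pose b (t : R) := sin (pi * t) ^+ 2.
  have -> : x 0 i - (y 0 i - (Num.floor (y 0 i - x 0 i + 1 / 2))%:~R) =
    (x 0 i - y 0 i) + (Num.floor (y 0 i - x 0 i + 1 / 2))%:~R by ring.
  rewrite -/(b _) -/(b (_ - _)); apply: shift_int => t.
  by rewrite /b sin_pi_shift sqrrN.
have [near|] := pselect (forall i, `|(x - y') 0 i| < u).
  rewrite -fy distrC (@le_trans _ _ e)//; last first.
    by rewrite lerDl mulr_ge0.
  apply: Hr; rewrite -ball_normE /=; apply: le_lt_trans ur.
  by apply: rV_norm_le => [|i]; [exact: ltW|exact/ltW/near].
move=> /existsNP[i /negP]; rewrite -leNgt => ui.
rewrite (@le_trans _ _ (2 * B))//.
  by rewrite (le_trans (ler_normB _ _))// mulr_natl mulr2n lerD.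
rewrite (@le_trans _ _ (2 * B / sin (pi * u) ^+ 2 * sin (pi * (x - y) 0 i) ^+ 2))//.
  rewrite mulrAC ler_pdivlMr// ler_wpM2l ?mulr_ge0//.
  by rewrite -sE; exact: sin2_pi_mono.
rewrite (ler_wpDl (ltW e0))// ler_wpM2l//.
by rewrite (bigD1 i)//= lerDl; apply: sumr_ge0 => j _; exact: sqr_ge0.
Qed.

Lemma gk_kern_ge0 n z : 0 <= gk (fun i : 'I_d => @kern R n) z.
Proof. by apply: prodr_ge0 => i _; exact: kern_ge0. Qed.

Lemma Cinfty_gk_kern n : Cinfty (gk (fun i : 'I_d => @kern R n)).
Proof. by apply: Cinfty_gk => i; exact: Cinfty1_kern. Qed.

(** By [kern_sin2] in coordinate [i], the moment is a difference of two masses, both equal to 1: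
    that of the kernel of order [n] and a multiple of that with order [n.+1] in coordinate [i]. *)
Lemma tint_sin2_gk n i x :
  tint (fun y => sin (pi * (x - y) 0 i) ^+ 2 * gk (fun i => kern n) (x - y)) =
  (n.*2.+2)%:R^-1.
Proof.
pose nu j := if j == i then n.+1 else n.
have Cnu : Cinfty (fun y => gk (fun j => @kern R (nu j)) (x - y)).
  by apply/Cinfty_reflect/Cinfty_gk => j; exact: Cinfty1_kern.
have Cn : Cinfty (fun y => gk (fun j => @kern R n) (x - y)).
  exact/Cinfty_reflect/Cinfty_gk_kern.
have -> : (n.*2.+2)%:R^-1 = 1 - ((n.*2.+1)%:R / (n.*2.+2)%:R) * 1 :> R.
  have n2 : (n.*2.+2)%:R != 0 :> R by rewrite pnatr_eq0.
  have : (n.*2.+2)%:R = (n.*2.+1)%:R + 1 :> R by rewrite -natr1.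
  move: n2; move: (n.*2.+2)%:R (n.*2.+1)%:R => b a b0 E.
  by rewrite mulr1 -[X in X - _](divff b0) -mulrBl E addrAC subrr add0r div1r.
rewrite -[X in X - _](tint_gk_kern (fun=> n) x) -[X in _ * X](tint_gk_kern nu x).
rewrite -tintZ; last exact: Cinfty_tintegrable.
rewrite -tintB; [|exact: Cinfty_tintegrable|]; last by apply: Cinfty_tintegrable; exact: CinftyZ.
apply: eq_tint => y.
have -> : (fun j => @kern R (nu j)) = upd (fun=> kern n) i (kern n.+1).
  by apply/funext => j; rewrite /upd /nu; case: eqP.
rewrite {1 2}(gk_eq_upd (fun=> kern n) i) !gk_upd.
rewrite mulrA [sin _ ^+ 2 * _]mulrC kern_sin2 mulrBl; congr (_ - _).
by rewrite mulrA [kern n.+1 _ * _]mulrC.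
Qed.

Lemma gk_kern_approx f x : cper f ->
  tint (fun y => f y * gk (fun i => kern n) (x - y)) @[n --> \oo] --> f x.
Proof.
move=> cf; apply/cvgrPdist_le => e e0.
have e2 : 0 < e / 2 by rewrite divr_gt0.
have [C C0 HC] := modulus_sin2 x cf e2.
have Ck n := Cinfty_cper (Cinfty_reflect x (Cinfty_gk_kern n)).
have H n : `|f x - tint (fun y => f y * gk (fun i => kern n) (x - y))| <=
    e / 2 + C * d%:R * (n.*2.+2)%:R^-1.
  have Iabs := cperM (cper_norm (cperB cf (cper_cst (f x)))) (Ck n).
  have -> : f x - tint (fun y => f y * gk (fun i => kern n) (x - y)) =
      - tint (fun y => (f y - f x) * gk (fun i => kern n) (x - y)).
    rewrite -[in LHS](mulr1 (f x)) -(tint_gk_kern (fun=> n) x) -tintZ; last exact: cper_tintegrable.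
    rewrite -tintB; try (apply: cper_tintegrable).
    - rewrite -[RHS]mulN1r -tintZ; last by apply/cper_tintegrable/cperM => //; exact/cperB/cper_cst.
      by apply: eq_tint => y; ring.
    - by apply: cperM => //; exact: cper_cst.
    - exact: cperM.
  rewrite normrN.
  have Il : cper (fun y => (f y - f x) * gk (fun i => kern n) (x - y)).
    by apply: cperM => //; exact/cperB/cper_cst.
  apply: (le_trans (le_norm_tint (cper_tintegrable Il))).
  have Cs i : cper (fun y => sin (pi * (x - y) 0 i) ^+ 2 * gk (fun i => kern n) (x - y)).
    apply: cperM => //; split=> [y|y k].
      apply: (@continuous_comp _ _ _ (fun y => (x - y) 0 i) (fun s : R => sin (pi * s) ^+ 2)).
        apply: (@continuous_comp _ _ _ (fun y => x - y) (fun y : 'rV[R]_d => y 0 i)).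
          exact: continuous_reflect.
        exact: coord_continuous.
      exact: (class_C_continuous (class_CX 2 (@class_C_trig_pi R 0).2)).
    pose b (t : R) := sin (pi * t) ^+ 2.
    rewrite !mxE -/(b _) -/(b (x 0 i - y 0 i)) opprD addrA -mulrNz.
    by apply: shift_int => t; rewrite /b sin_pi_shift sqrrN.
  have [Es Is] := tint_sum (index_enum 'I_d) (fun i => cper_tintegrable (Cs i)).
  have Ie : tintegrable (fun y => e / 2 * gk (fun i => kern n) (x - y)).
    exact/cper_tintegrable/cperZ.
  have -> : e / 2 + C * d%:R * (n.*2.+2)%:R^-1 =
      tint (fun y => e / 2 * gk (fun i => kern n) (x - y) + C *
      \sum_i sin (pi * (x - y) 0 i) ^+ 2 * gk (fun i => kern n) (x - y)).
    rewrite tintD//; last exact: tintegrableZ.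
    rewrite !tintZ//; last exact: cper_tintegrable.
    rewrite tint_gk_kern mulr1 Es; congr (_ + _).
    under eq_bigr do rewrite tint_sin2_gk.
    by rewrite sumr_const card_ord -mulrA [d%:R * _]mulr_natl.
  apply: le_tint.
  - by apply: tintegrable_norm; exact: cper_tintegrable.
  - by apply: tintegrableD => //; exact: tintegrableZ.
  - move=> y; rewrite normrM (ger0_norm (gk_kern_ge0 _ _)) -mulr_suml mulrA -mulrDl.
    by rewrite ler_wpM2r// gk_kern_ge0.
have C1 : 0 < C * d%:R + 1 by rewrite ltr_wpDl// mulr_ge0.
have E : 0 < e / 2 / (C * d%:R + 1) by rewrite divr_gt0.
have := near_infty_natSinv_lt (PosNum E); apply: filterS => n /= Hn.
rewrite (le_trans (H n))// [leRHS]splitr lerD2l.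
have n2 : (n.*2.+2)%:R^-1 <= n.+1%:R^-1 :> R.
  by rewrite lef_pV2 ?posrE// ler_nat ltnS -addnn -addnS leq_addr.
rewrite (le_trans (ler_wpM2l _ n2)) ?mulr_ge0//.
rewrite (le_trans (ler_wpM2l _ (ltW Hn))) ?mulr_ge0//.
by rewrite mulrCA ger_pMr// ler_pdivrMr// mul1r lerDl.
Qed.

End approximate_identity.

Lemma mean_value_is_derive (R : realType) (V : normedModType R) (f f1 : V -> R)
    (x v : V) (t : R) :
  (forall x, is_derive x v f (f1 x)) ->
  exists2 s : R, `|s| <= `|t| & f (x + t *: v) - f x = t * f1 (x + s *: v).
Proof.
move=> D; have [|s st ->] := @mean_value_scale R V f x v t.
  by move=> s _; have [] := D (x + s *: v).
by exists s => //; have [_ ->] := D (x + s *: v).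
Qed.

(** * Families of iterated derivatives and their limits *)

Section towers.
Context {R : realType} {d : nat}.
Implicit Types (x y z : 'rV[R]_d) (i : 'I_d) (s t : seq 'I_d).

Lemma cvgn_le (u : nat -> R) (l c : R) : u n @[n --> \oo] --> l ->
  (forall n, u n <= c) -> l <= c.
Proof.
move=> ul uc; rewrite -(cvg_lim _ ul)//; apply: limr_le; first by apply/cvg_ex; exists l.
exact: nearW.
Qed.

Lemma taylor2 (f f1 f2 : 'rV[R]_d -> R) i (B : R) :
  (forall x, is_derive x (delta_mx 0 i) f (f1 x)) ->
  (forall x, is_derive x (delta_mx 0 i) f1 (f2 x)) ->
  (forall x, `|f2 x| <= B) ->
  forall x (h : R), `|f (x + h *: delta_mx 0 i) - f x - h * f1 x| <= h ^+ 2 * B.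
Proof.
move=> D1 D2 f2B x h.
have [s sh ->] := mean_value_is_derive x h D1.
have [u us E] := mean_value_is_derive x s D2.
rewrite -mulrBr E !normrM -[h ^+ 2]ger0_norm ?sqr_ge0// normrX expr2 -mulrA.
by rewrite ler_wpM2l// ler_pM.
Qed.

(* A family of functions indexed by sequences of coordinates, in which
   [F (rcons s i)] is the i-th partial derivative of [F s], uniformly. *)
Definition tower (F : seq 'I_d -> 'rV[R]_d -> R) (B : seq 'I_d -> R) :=
  (forall s x, `|F s x| <= B s) /\
  forall s i x (h : R), `|F s (x + h *: delta_mx 0 i) - F s x - h * F (rcons s i) x|
    <= h ^+ 2 * B (rcons (rcons s i) i).

Lemma tower_derive F B s i x : tower F B ->
  is_derive x (delta_mx 0 i) (F s) (F (rcons s i) x).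
Proof.
move=> [FB TF]; apply/is_deriveP => e e0.
set c := B (rcons (rcons s i) i).
have c0 : 0 <= c by rewrite (le_trans _ (FB _ x)).
have ec : 0 < e / (c + 1) by rewrite divr_gt0// ltr_wpDl.
have : \forall h \near (0 : R), `|h| <= e / (c + 1).
  have := @continuous_near_le R R (fun h => h) 0 _ (fun A => id) ec.
  by apply: filterS => h; rewrite sub0r normrN.
apply: filterS => h he; apply: (le_trans (TF s i x h)); rewrite -/c.
rewrite -[h ^+ 2]ger0_norm ?sqr_ge0// normrX expr2 -mulrA mulrC ler_wpM2r//.
rewrite (le_trans (ler_wpM2r c0 he))// -mulrA ger_pMr// mulrC ler_pdivrMr ?mul1r ?ltr_wpDl//.
by rewrite lerDl.
Qed.

Lemma tower_lipschitz F B s r (c : 'I_d -> R) x : tower F B ->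
  `|F s (x + \sum_(i <- r) c i *: delta_mx 0 i) - F s x| <=
  \sum_(i <- r) `|c i| * B (rcons s i).
Proof.
move=> TF; have [FB _] := TF; elim: r x => [|i r IH] x.
  by rewrite !big_nil addr0 subrr normr0.
rewrite !big_cons addrA; set y := x + c i *: _.
rewrite (le_trans (ler_distD (F s y) _ _))// [leRHS]addrC; apply: lerD; first exact: IH.
have [u _ ->] := mean_value_is_derive x (c i) (fun x => tower_derive s i x TF).
by rewrite normrM ler_wpM2l.
Qed.

Lemma tower_continuous F B s : tower F B -> continuous (F s).
Proof.
move=> TF x; have [FB _] := TF.
set K := \sum_i B (rcons s i).
have K0 : 0 <= K by apply: sumr_ge0 => i _; rewrite (le_trans _ (FB _ x)).
suff H (e : R) : 0 < e -> \forall y \near x, `|F s x - F s y| <= e.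
  by apply: (@cvgrPdist_le _ _ _ _ (nbhs_filter x) _ _).2.
move=> e0; have eK : 0 < e / (K + 1) by rewrite divr_gt0// ltr_wpDl.
apply/nbhs_ballP; exists (e / (K + 1)) => //= y; rewrite -ball_normE /= distrC => yx.
rewrite distrC.
have -> : y = x + \sum_i (y - x) 0 i *: delta_mx 0 i by rewrite -row_sum_delta addrC subrK.
rewrite (le_trans (tower_lipschitz _ _ _ _ TF))//.
rewrite (@le_trans _ _ (\sum_i (e / (K + 1)) * B (rcons s i)))//.
  apply: ler_sum => i _; rewrite ler_wpM2r//; first by rewrite (le_trans _ (FB _ x)).
  exact: le_trans (rV_coord_norm _ _) (ltW yx).
rewrite -mulr_sumr -/K mulrAC ler_pdivrMr ?ltr_wpDl// ler_wpM2l ?(ltW e0)//.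
by rewrite lerDl.
Qed.

Lemma tower_class_C F B n s : tower F B -> class_C setT n (F s).
Proof.
move=> TF; elim: n s => [|n IH] s; (split=> [x _|//]; first exact: tower_continuous TF _).
move=> v.
have D x : is_derive x v (F s) (\sum_i v 0 i * F (rcons s i) x).
  (* A tower provides derivatives along coordinate directions only, so the line through [x] in
     direction [v] is decomposed along these and the chain rule is applied to it. *)
  pose l := [seq ((fun t : R => t * v 0 i), delta_mx 0 i : 'rV[R]_d) | i <- enum 'I_d].
  have lE ce : List.In ce l -> exists i, ce = ((fun t : R => t * v 0 i), delta_mx 0 i : 'rV[R]_d).
    by rewrite /l; elim: (enum _) => //= i r IHr [<-|/IHr//]; exists i.
  have vE (t : R) : t *: v = \sum_(ce <- l) ce.1 t *: ce.2.
    rewrite big_map big_enum /= {1}[v]row_sum_delta scaler_sumr.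
    by apply: eq_bigr => i _; rewrite scalerA.
  have Dt (i : 'I_d) : is_derive (0 : R) (1 : R) (fun t : R => t * v 0 i) (v 0 i).
    apply: (is_deriveW (is_deriveZ (v 0 i) (is_derive_id (0 : R) (1 : R)))).
      by apply/funext => t; rewrite /GRing.scale /= mulrC.
    by rewrite /GRing.scale /= mulr1.
  have := @derive_comp_sum R _ R setT (F s) l x 0 1 openT _ _ _ Logic.I.
  case.
  - by move=> z ce /lE[i ->] _; have [] := tower_derive s i z TF.
  - move=> z ce /lE[i ->] _ /=.
    have -> : (fun y => 'D_(delta_mx 0 i) (F s) y) = F (rcons s i).
      by apply/funext => y; have [] := tower_derive s i y TF.
    exact: tower_continuous TF _.
  - by move=> ce /lE[i ->]; have [] := Dt i.
  rewrite -vE scale0r addr0 => dl Dl.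
  have {}Dl : is_derive (0 : R) (1 : R) (fun t : R => F s (x + t *: v)) (\sum_i v 0 i * F (rcons s i) x).
    have E : (fun y : R => F s (x + \sum_(ce <- l) ce.1 y *: ce.2)) = fun t : R => F s (x + t *: v).
      by apply/funext => t; rewrite vE.
    rewrite -E; split=> //; rewrite Dl big_map big_enum /=.
    apply: eq_bigr => i _; have [_ ->] := Dt i.
    by have [_ ->] := tower_derive s i x TF.
  apply/is_deriveP => e /((is_deriveP _ _ _ _).1 Dl); apply: filterS => t.
  by rewrite add0r scale0r addr0 /GRing.scale /= mulr1.
split=> [x _|]; first by have [] := D x.
have -> : (fun x => 'D_v (F s) x) = fun x => \sum_i v 0 i * F (rcons s i) x.
  by apply/funext => x; have [] := D x.
by apply: class_C_sum => i; exact: class_CZ.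
Qed.

(** The inequalities defining a tower survive pointwise limits. Convergence of the derivatives
    themselves follows by induction on the list: a difference quotient of step [h] converges as [n]
    grows, and it differs from the derivative by at most [h] times a bound on the second derivative,
    uniformly in [n]. *)
Lemma tower_limit (Fn : nat -> seq 'I_d -> 'rV[R]_d -> R) B (f : 'rV[R]_d -> R) :
  (forall n, tower (Fn n) B) -> (forall x, Fn n [::] x @[n --> \oo] --> f x) ->
  exists2 F, tower F B & F [::] = f.
Proof.
move=> TF Ff.
have cvgF s x : cvg (Fn n s x @[n --> \oo]).
  elim/last_ind: s x => [|s i IH] x; first by apply/cvg_ex; exists (f x).
  apply/cauchy_cvgP; apply: cauchy_exP => e e0.
  set c := B (rcons (rcons s i) i).
  have c0 : 0 <= c by have [/(_ (rcons (rcons s i) i) x) + _] := TF 0%N; apply: le_trans.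
  pose h := e / (4 * (c + 1)).
  have h0 : 0 < h by rewrite divr_gt0// mulr_gt0// ltr_wpDl.
  pose a n := (Fn n s (x + h *: delta_mx 0 i) - Fn n s x) / h.
  have /cvg_ex[la Hla] : cvg (a n @[n --> \oo]).
    apply: is_cvgM; last exact: is_cvg_cst.
    by apply: is_cvgB; exact: IH.
  exists la.
  have e4 : 0 < e / 4 by rewrite divr_gt0.
  have /cvgrPdist_le/(_ _ e4) := Hla; apply: filterS => n Hn.
  rewrite /= -ball_normE /=.
  have H1 : `|a n - Fn n (rcons s i) x| <= e / 4.
    have [_ /(_ s i x h)] := TF n; rewrite -/c => H.
    have -> : a n - Fn n (rcons s i) x =
        (Fn n s (x + h *: delta_mx 0 i) - Fn n s x - h * Fn n (rcons s i) x) / h.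
      by rewrite /a [RHS]mulrBl (mulrC h) mulfK// gt_eqF.
    rewrite normrM [`|h^-1|]gtr0_norm ?invr_gt0// ler_pdivrMr// (le_trans H)//.
    rewrite expr2 -mulrA mulrC ler_pM2r//.
    have -> : e / 4 = h * (c + 1) by rewrite /h invfM mulrA divfK// gt_eqF// ltr_wpDl.
    by rewrite ler_pM2l// lerDl.
  rewrite -(subrK (a n) la) -addrA (le_lt_trans (ler_normD _ _))//.
  by rewrite (le_lt_trans (lerD Hn H1))//; lra.
exists (fun s x => lim (Fn n s x @[n --> \oo])); last first.
  by apply/funext => x; exact: cvg_lim.
split=> [s x|s i x h].
  apply: (@cvgn_le (fun n => `|Fn n s x|)); first by apply: cvg_norm; exact: cvgF.
  by move=> n; have [] := TF n.
apply: (@cvgn_le (fun n => `|Fn n s (x + h *: delta_mx 0 i) - Fn n s x - h * Fn n (rcons s i) x|)).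
  apply: cvg_norm; apply: cvgB; first by apply: cvgB; exact: cvgF.
  by apply: cvgMr; exact: cvgF.
by move=> n; have [_ ] := TF n.
Qed.

End towers.

(** * Sobolev embedding and smoothness *)

Section sobolev_regularity.
Context {R : realType} {d : nat}.
Implicit Types (f g q : 'rV[R]_d -> R) (x y z : 'rV[R]_d) (i : 'I_d) (s t : seq 'I_d).

Lemma convolution_tintegrable q g x : tintegrable q -> Cinfty g ->
  tintegrable (fun y => q y * g (x - y)).
Proof. by move=> Iq Cg; apply: tintegrableM_cper => //; exact/Cinfty_cper/Cinfty_reflect. Qed.

Lemma is_derive_convolution q g i x : tintegrable q -> Cinfty g ->
  is_derive x (delta_mx 0 i) (fun x => tint (fun y => q y * g (x - y)))
    (tint (fun y => q y * partial i g (x - y))).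
Proof.
move=> Iq Cg; apply/is_deriveP => e e0.
have Cgi := Cinfty_partial i Cg; have Cgii := Cinfty_partial i Cgi.
have [B B0 gB] := cper_bounded (Cinfty_cper Cgii).
pose K := tint (fun y => `|q y|) * B.
have K0 : 0 <= K by rewrite mulr_ge0// tint_ge0.
have eK : 0 < e / (K + 1) by rewrite divr_gt0// ltr_wpDl.
have : \forall h \near (0 : R), `|h| <= e / (K + 1).
  have := @continuous_near_le R R (fun h => h) 0 _ (fun A => id) eK.
  by apply: filterS => h; rewrite sub0r normrN.
apply: filterS => h he.
have I1 := convolution_tintegrable (x + h *: delta_mx 0 i) Iq Cg.
have I2 := convolution_tintegrable x Iq Cg.
have I3 := convolution_tintegrable x Iq Cgi.
rewrite -tintZ// -tintB// -tintB//; [|exact: tintegrableB|exact: tintegrableZ].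
have I4 : tintegrable (fun y => q y * g (x + h *: delta_mx 0 i - y) - q y * g (x - y)
    - h * (q y * partial i g (x - y))).
  by apply: tintegrableB; [exact: tintegrableB|exact: tintegrableZ].
apply: (le_trans (le_norm_tint I4)).
apply: (@le_trans _ _ (tint (fun y => (h ^+ 2 * B) * `|q y|))).
  apply: le_tint; [exact: tintegrable_norm|by apply: tintegrableZ; exact: tintegrable_norm|].
  move=> y.
  have -> : q y * g (x + h *: delta_mx 0 i - y) - q y * g (x - y) - h * (q y * partial i g (x - y)) =
     q y * (g (x - y + h *: delta_mx 0 i) - g (x - y) - h * partial i g (x - y)).
    by rewrite (addrAC x); ring.
  rewrite normrM mulrC ler_wpM2r//.
  exact: (taylor2 (fun z => Cinfty_partial_derive i z Cg)
    (fun z => Cinfty_partial_derive i z Cgi) gB).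
rewrite tintZ; last exact: tintegrable_norm.
rewrite -mulrA [B * _]mulrC -/K -[h ^+ 2]ger0_norm ?sqr_ge0// normrX expr2 -mulrA mulrC ler_wpM2r//.
rewrite (le_trans (ler_wpM2r K0 he))// -mulrA ger_pMr// mulrC ler_pdivrMr ?mul1r ?ltr_wpDl//.
by rewrite lerDl.
Qed.

Lemma weak_family_cvg N f w x : cper f -> weak_family N f w ->
  tint (fun y => w [::] y * gk (fun i => kern n) (x - y)) @[n --> \oo] --> f x.
Proof.
move=> cf Hw; have [_ H0] := Hw [::] (leq0n N).
have := @gk_kern_approx _ _ f x cf.
suff -> : (fun n => tint (fun y => f y * gk (fun i => kern n) (x - y))) =
  fun n => tint (fun y => w [::] y * gk (fun i => kern n) (x - y)) by [].
apply/funext => n; have := H0 _ (Cinfty_reflect x (Cinfty_gk_kern n)).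
by rewrite mul1r.
Qed.

(** W^{d,1} embeds into C: the convolutions of [w [::]] with the kernels converge to [f] pointwise,
    and [weak_family_gk_bound] bounds them independently of [n]. *)
Lemma sobolev_embedding N f w x : (d <= N)%N -> cper f -> weak_family N f w ->
  `|f x| <= weak_bound w [::] (enum 'I_d).
Proof.
move=> dN cf Hw.
apply: (@cvgn_le _ (fun n => `|tint (fun y => w [::] y * gk (fun i => kern n) (x - y))|)).
  apply: cvg_norm; exact: (weak_family_cvg cf Hw).
move=> n; apply: (weak_family_gk_bound _ Hw).
- exact: enum_uniq.
- by rewrite size_enum_ord.
- by move=> j; exact: Cinfty1_kern.
- by move=> j _; exists n.
- by move=> j; rewrite mem_enum.
Qed.

(** The convolutions of all weak derivatives form one tower for each [n], with bounds independent of
    [n]; the limit tower starts with [f]. *)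
Lemma sobolev_Cinfty f w : cper f -> (forall N, weak_family N f w) -> Cinfty f.
Proof.
move=> cf Hw.
pose Fn n s x := tint (fun y => w s y * gk (fun i : 'I_d => kern n) (x - y)).
pose B s := weak_bound w s (enum 'I_d).
have Iw s : tintegrable (w s) by have [] := Hw (size s) s (leqnn _).
have FB n s x : `|Fn n s x| <= B s.
  apply: (weak_family_gk_bound _ (Hw (size s + d)%N)).
  - exact: enum_uniq.
  - by rewrite size_enum_ord.
  - by move=> j; exact: Cinfty1_kern.
  - by move=> j _; exists n.
  - by move=> j; rewrite mem_enum.
have FD n s i x : is_derive x (delta_mx 0 i) (Fn n s) (Fn n (rcons s i) x).
  apply: (is_deriveW (is_derive_convolution i x (Iw s) (Cinfty_gk_kern n))) => //.
  have := weak_family_step i (Hw (size s).+1) (ltnSn _) (Cinfty_reflect x (Cinfty_gk_kern n)).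
  rewrite partial_reflect; last exact: Cinfty_gk_kern.
  move=> /(congr1 -%R); rewrite opprK /Fn => <-.
  rewrite -mulN1r -tintZ.
    by apply: eq_tint => y; rewrite mulrN mulN1r opprK.
  apply: tintegrableM_cper => //; apply/cperN/Cinfty_cper.
  exact/Cinfty_reflect/Cinfty_partial/Cinfty_gk_kern.
have [F TF Ff] : exists2 F, tower F B & F [::] = f.
  apply: (@tower_limit _ _ Fn) => [n|x]; last exact: (weak_family_cvg cf (Hw 0%N)).
  split; first exact: FB.
  move=> s i x h; exact: (taylor2 (fun z => FD n s i z) (fun z => FD n (rcons s i) i z) (FB n _)).
apply/CinftyP; split=> [|n]; first by case: cf.
by rewrite -Ff; exact: tower_class_C TF.
Qed.

End sobolev_regularity.

Lemma Rintegral_cvg (R : realType) dT (T : measurableType dT) (mu : {measure set T -> \bar R})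
    (f_ : nat -> T -> R) (f g : T -> R) :
  mu.-integrable setT (EFin \o g) -> (forall n, measurable_fun setT (f_ n)) ->
  (forall n t, `|f_ n t| <= g t) -> (forall t, f_ n t @[n --> \oo] --> f t) ->
  mu.-integrable setT (EFin \o f) /\
  (\int[mu]_t f_ n t)%R @[n --> \oo] --> (\int[mu]_t f t)%R.
Proof.
move=> Ig mf fg ff.
have mf' : measurable_fun setT f by apply: (measurable_fun_cvg mf) => t _; exact: ff.
have [|||||If _ C] := @dominated_convergence _ _ _ mu setT measurableT
    (fun n t => (f_ n t)%:E) (fun t => (f t)%:E) (EFin \o g).
- by move=> n; exact/measurable_EFinP.
- exact/measurable_EFinP.
- apply: aeW => t _; apply: cvg_EFin; last exact: ff.
  exact: nearW.
- exact: Ig.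
- by apply: aeW => t n _; rewrite lee_fin.
split=> //; apply: fine_cvg; rewrite fineK; first exact: C.
exact: integrable_fin_num If.
Qed.

(** * The fundamental lemma of the calculus of variations *)

Section fundamental_lemma.
Context {R : realType} {d : nat}.
Implicit Types (f g q psi : 'rV[R]_d -> R) (x y z : 'rV[R]_d) (i : 'I_d).

Lemma Cinfty_convolution q g : tintegrable q -> Cinfty g ->
  Cinfty (fun x => tint (fun y => q y * g (x - y))).
Proof.
move=> Iq Cg.
pose F s x := tint (fun y => q y * partials (rev s) g (x - y)).
have Cs s := Cinfty_partials (rev s) Cg.
have /choice[B HB] s : exists B : R, forall x, `|F s x| <= B.
  have [b b0 gb] := cper_bounded (Cinfty_cper (Cs s)).
  exists (b * tint (fun y => `|q y|)) => x.
  have I1 := convolution_tintegrable x Iq (Cs s).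
  rewrite (le_trans (le_norm_tint I1))// -tintZ; last exact: tintegrable_norm.
  apply: le_tint; first exact: tintegrable_norm.
    by apply: tintegrableZ; exact: tintegrable_norm.
  by move=> y; rewrite normrM mulrC ler_wpM2r.
have FD s i x : is_derive x (delta_mx 0 i) (F s) (F (rcons s i) x).
  apply: (is_deriveW (is_derive_convolution i x Iq (Cs s))) => //.
  by rewrite /F rev_rcons.
have TF : tower F B.
  split=> [//|s i x h].
  exact: (taylor2 (fun z => FD s i z) (fun z => FD (rcons s i) i z) (HB _)).
apply/CinftyP; split=> [x k|n]; last exact: (tower_class_C n [::] TF).
by apply: eq_tint => y; rewrite addrAC; have [-> _] := Cg.
Qed.

Lemma tint_cvg (f_ : nat -> 'rV[R]_d -> R) f g : tintegrable g -> (forall n, tmeas (f_ n)) ->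
  (forall n x, `|f_ n x| <= g x) -> (forall x, f_ n x @[n --> \oo] --> f x) ->
  tint (f_ n) @[n --> \oo] --> tint f.
Proof.
move=> Ig mf fg ff.
by have [] := @Rintegral_cvg _ _ _ (torus_leb R d) (fun n => f_ n \o @row_of R d)
  (f \o @row_of R d) (g \o @row_of R d) Ig mf (fun n t => fg n (row_of t)) (fun t => ff (row_of t)).
Qed.

(** The smooth convolutions of [psi] with the kernels converge to it pointwise and stay below its
    bound, so dominated convergence applies. *)
Lemma tint_test_continuous q psi : tintegrable q ->
  (forall phi, Cinfty phi -> tint (fun x => q x * phi x) = 0) ->
  cper psi -> tint (fun x => q x * psi x) = 0.
Proof.
move=> Iq Hq cpsi; have [B B0 psiB] := cper_bounded cpsi.
pose psin n x := tint (fun y => psi y * gk (fun i => kern n) (x - y)).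
have Cn n : Cinfty (psin n).
  exact: Cinfty_convolution (cper_tintegrable cpsi) (Cinfty_gk_kern n).
have : tint (fun x => q x * psin n x) @[n --> \oo] --> tint (fun x => q x * psi x).
  apply: (@tint_cvg _ _ (fun x => B * `|q x|)).
  - by apply: tintegrableZ; exact: tintegrable_norm.
  - move=> n; apply: tintegrable_tmeas; apply: tintegrableM_cper => //.
    exact: Cinfty_cper.
  - move=> n x; rewrite normrM mulrC ler_wpM2r//.
    have Ck := Cinfty_cper (Cinfty_reflect x (@Cinfty_gk_kern R d n)).
    rewrite (le_trans (le_norm_tint (cper_tintegrable (cperM cpsi Ck))))//.
    rewrite -[leRHS]mulr1 -(tint_gk_kern (fun=> n) x) -tintZ; last exact: cper_tintegrable.
    apply: le_tint.
    + by apply: tintegrable_norm; exact: (cper_tintegrable (cperM cpsi Ck)).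
    + by apply: tintegrableZ; exact: cper_tintegrable.
    + by move=> y; rewrite normrM (ger0_norm (gk_kern_ge0 _ _)) ler_wpM2r// gk_kern_ge0.
  - by move=> x; apply: cvgMr; exact: gk_kern_approx.
have -> : (fun n => tint (fun x => q x * psin n x)) = fun=> 0.
  by apply/funext => n; exact: Hq.
by move=> /(cvg_unique _ (cvg_cst 0))/esym; apply.
Qed.

End fundamental_lemma.

Section fundamental_lemma_ae.
Context {R : realType} {d : nat}.
Local Notation T := (d.-tuple (measurableTypeR R)).
Local Notation mu := (torus_leb R d).

(* Sets whose indicator is a bounded pointwise limit of continuous periodic
   functions: a pi-system that generates all periodic Borel sets. *)
Definition cper_limit_sets : set (set T) := [set A | exists psi : nat -> 'rV[R]_d -> R,
  [/\ forall k, cper (psi k), forall k x, `|psi k x| <= 1 &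
      forall t, psi k (row_of t) @[k --> \oo] --> (\1_A t : R)]].

Lemma cper_limit_setI : setI_closed cper_limit_sets.
Proof.
move=> A B [a [ca a1 aA]] [b [cb b1 bB]].
exists (fun k x => a k x * b k x); split=> [k|k x|t].
- exact: cperM.
- by rewrite normrM mulr_ile1.
- by rewrite indicI; apply: cvgM.
Qed.

Lemma cper_limit_set_measurable A : cper_limit_sets A -> measurable A.
Proof.
move=> [a [ca _ aA]]; apply/(measurable_indicP R).
apply: (@measurable_fun_cvg _ _ _ _ (fun k => a k \o @row_of R d)) => [k|t _].
  exact: cper_tmeas.
exact: aA.
Qed.

Lemma cper_limit_set_pos (phi : 'rV[R]_d -> R) : cper phi ->
  cper_limit_sets [set t : T | 0 < phi (row_of t)].
Proof.
move=> cphi; exists (fun k x => Num.min 1 (k%:R * Num.max 0 (phi x))).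
have m0 y : 0 <= Num.max 0 y :> R by rewrite le_max lexx.
split=> [k|k x|t].
- rewrite (_ : (fun x => _) = fun x => (1 + k%:R * ((0 + phi x + `|0 - phi x|) / 2)
      - `|1 - k%:R * ((0 + phi x + `|0 - phi x|) / 2)|) / 2); last first.
    by apply/funext => x; rewrite minr_absE maxr_absE.
  have c0 := cperZ k%:R (cperM (cperD (cperD (cper_cst 0) cphi)
    (cper_norm (cperB (cper_cst 0) cphi))) (cper_cst 2^-1)).
  apply: cperM; last exact: cper_cst.
  apply: cperB; first exact: cperD (cper_cst 1) c0.
  exact/cper_norm/cperB/c0/cper_cst.
- have H : 0 <= Num.min 1 (k%:R * Num.max 0 (phi x)) by rewrite le_min ler01 mulr_ge0.
  by rewrite ger0_norm// ge_min lexx.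
- rewrite indicE; have [pos|npos] := ltP 0 (phi (row_of t)); last first.
    rewrite memNset /=; last by apply/negP; rewrite -leNgt.
    rewrite (_ : (fun k => _) = fun=> 0); first exact: cvg_cst.
    apply/funext => k; rewrite mulr0; apply/min_idPr; exact: ler01.
  rewrite mem_set//=; apply: cvg_near_cst.
  near=> k; apply/min_idPl.
  rewrite mulrC -ler_pdivrMl// mulr1; near: k.
  exact: nbhs_infty_ger.
Unshelve. all: by end_near. Qed.

Lemma cosDpi (u : R) : cos (u + pi) = - cos u.
Proof. by rewrite cosD cospi sinpi mulr0 subr0 mulrN1. Qed.

(** On the circle, the open arc from a to 1 is the ball of radius (1 - a)/2 around its midpoint (a +
    1)/2, and the cosine decreases with the distance to the midpoint. Hence the arc is the
    positivity set of a continuous periodic function. *)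
Lemma frac_gt_cos (u a : R) : 0 <= a < 1 ->
  (a < u - (Num.floor u)%:~R) =
  (0 < cos (2 * pi * (u - (a + 1) / 2)) - cos (pi * (1 - a))).
Proof.
move=> /andP[a0 a1]; have /andP[] := floor_itv u.
have p0 := @pi_gt0 R.
pose b (v : R) := cos (2 * pi * (v - (a + 1) / 2)).
have -> : cos (2 * pi * (u - (a + 1) / 2)) = b (u - (Num.floor u)%:~R).
  rewrite -[LHS]/(b u) -[in LHS](subrK (Num.floor u)%:~R u).
  apply: shift_int => v; rewrite /b.
  rewrite (_ : 2 * pi * (v + 1 - (a + 1) / 2) = 2 * pi * (v - (a + 1) / 2) + pi + pi); last by ring.
  by rewrite cosDpi cosDpi opprK.
rewrite intrD; set n : R := (Num.floor u)%:~R; move: (u - n) (subrK n u) => f <-.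
rewrite lerDr => f0; rewrite addrC ltrD2l -[1%:~R]/(1 : R) => f1.
rewrite subr_gt0 /b; set v := f - _.
have inpi (w : R) : 0 <= w -> w <= 1 -> pi * w \in `[0, pi].
    by move=> w0 w1; rewrite in_itv /= mulr_ge0 ?(ltW p0)//= ger_pMr.
  have cosv (w : R) : 0 <= w -> w <= 1 / 2 -> (cos (pi * (1 - a)) < cos (2 * pi * w)) = (w < (1 - a) / 2).
  move=> w0 w2; rewrite [2 * pi]mulrC -mulrA ltr_cos; [|apply: inpi; lra|apply: inpi; lra].
  by rewrite ltr_pM2l//; apply/idP/idP => ?; lra.
have cE : cos (2 * pi * v) = cos (2 * pi * `|v|).
  by case: (ger0P v) => // _; rewrite mulrN cosN.
rewrite cE; have [v2|v2] := leP `|v| (1 / 2).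
  rewrite cosv//; rewrite ltr_norml /v; apply/idP/andP => [H|[H1 H2]]; first split; lra.
have -> : cos (2 * pi * `|v|) = cos (2 * pi * (1 - `|v|)).
  rewrite (_ : 2 * pi * (1 - `|v|) = - (2 * pi * `|v|) + pi + pi); last by ring.
  by rewrite cosDpi cosDpi opprK cosN.
have vE : `|v| = - v.
  by apply: ltr0_norm; move: v2; rewrite /v; case: (ger0P (f - _)) => //; lra.
rewrite cosv; [|rewrite vE /v; lra|rewrite vE; lra].
by rewrite vE /v; apply/idP/idP => ?; rewrite vE /v in v2; lra.
Qed.

End fundamental_lemma_ae.

Section fundamental_lemma.
Context {R : realType} {d : nat}.
Local Notation T := (d.-tuple (measurableTypeR R)).
Local Notation mu := (torus_leb R d).
Local Notation G := (@cper_limit_sets R d).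
Local Notation T' := (g_sigma_algebraType G).

Lemma g_cper_limit_measurable (A : set T) : <<s G >> A -> measurable A.
Proof.
apply: smallest_sub; first exact: sigma_algebra_measurable.
by move=> B; exact: cper_limit_set_measurable.
Qed.

Lemma tintegrable_indic (q : 'rV[R]_d -> R) (A : set T) : tintegrable q -> measurable A ->
  mu.-integrable setT (EFin \o (fun t => q (row_of t) * \1_A t)).
Proof.
move=> Iq mA; apply: (le_integrable measurableT _ _ Iq).
  apply/measurable_EFinP/measurable_funM; first exact: (tintegrable_tmeas Iq).
  exact: measurable_indic.
move=> t _ /=; rewrite lee_fin normrM ler_piMr// indicE.
by case: (_ \in _); rewrite ?normr1 ?normr0.
Qed.

Lemma cvg_indic_bigcup (F : nat -> set T) t : trivIset setT F ->
  \sum_(k < n) (\1_(F k) t : R) @[n --> \oo] --> (\1_(\bigcup_k F k) t : R).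
Proof.
move=> tF; have [[k Fk]|nF] := pselect (exists k, F k t); last first.
  rewrite indicE memNset; last by case=> k _ Fk; apply: nF; exists k.
  rewrite (_ : (fun n => _) = fun=> 0); first exact: cvg_cst.
  apply/funext => n /=; rewrite big1// => i _; rewrite indicE memNset//.
  by move=> Fi; apply: nF; exists (val i).
rewrite indicE mem_set; last by exists k.
apply: cvg_near_cst; near=> n.
have kn : (k < n)%N by near: n; exact: nbhs_infty_gt.
rewrite (bigD1 (Ordinal kn))//= big1 ?addr0; first by rewrite indicE mem_set.
move=> i /negP ik; rewrite indicE memNset// => Fi; apply: ik; apply/eqP/val_inj => /=.
by apply: (tF i k) => //; exists t.
Unshelve. all: by end_near. Qed.

(** Dynkin's theorem: the sets over which [q] integrates to 0 form a lambda-system, and by dominated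
    convergence it contains the pi-system [cper_limit_sets]. *)
Lemma int_g_cper_limit (q : 'rV[R]_d -> R) : tintegrable q ->
  (forall psi, cper psi -> tint (fun x => q x * psi x) = 0) ->
  forall A : set T, <<s G >> A -> \int[mu]_t (q (row_of t) * \1_A t) = 0.
Proof.
move=> Iq Hq.
pose P := [set A : set T' | (\int[mu]_(t in (setT : set T)) (q (row_of t) * \1_A t) = 0)%R].
have Inq : mu.-integrable setT (EFin \o (fun t : T => `|q (row_of t)|)).
  exact: (tintegrable_norm Iq).
have IM A : <<s G >> A -> mu.-integrable setT (EFin \o (fun t => q (row_of t) * \1_A t)).
  by move=> /g_cper_limit_measurable; exact: tintegrable_indic.
have ind01 (A : set T) t : `|(\1_A t : R)| <= 1.
  by rewrite indicE; case: (_ \in _); rewrite ?normr1 ?normr0.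
have mq := tintegrable_tmeas Iq.
apply: (@dynkin_induction _ T' G P) => //.
- exact: cper_limit_setI.
- rewrite /P /= -(Hq (fun=> 1)); last exact: cper_cst.
  by rewrite /tint; apply: eq_Rintegral => t _; rewrite indicE mem_set.
- move=> A GA; have [a [ca a1 aA]] := GA; rewrite /P /=.
  have qA t : q (row_of t) * a n (row_of t) @[n --> \oo] --> q (row_of t) * \1_A t.
    by apply: cvgMr; exact: aA.
  have qb n t : `|q (row_of t) * a n (row_of t)| <= `|q (row_of t)|.
    by rewrite normrM ler_piMr.
  have [_] := @Rintegral_cvg _ _ _ mu (fun n t => q (row_of t) * a n (row_of t))
    (fun t => q (row_of t) * \1_A t) _ Inq
    (fun n => measurable_funM mq (cper_tmeas (ca n))) qb qA.
  rewrite (_ : (fun n => _) = fun=> 0); last by apply/funext => n; exact: Hq.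
  by move=> /(cvg_unique _ (cvg_cst _)) /= <-.
- move=> A mA; rewrite /P /= => A0.
  have -> : (\int[mu]_t (q (row_of t) * \1_(~` A) t) =
     \int[mu]_t (q (row_of t) - q (row_of t) * \1_A t))%R.
    apply: eq_Rintegral => t _; rewrite !indicE in_setC.
    by case: (_ \in _); rewrite /= ?mulr0 ?mulr1 ?subrr ?subr0.
  rewrite RintegralB//; last exact: IM.
  rewrite A0 subr0 -(Hq (fun=> 1)); last exact: cper_cst.
  by rewrite /tint; apply: eq_Rintegral => t _; rewrite mulr1.
- move=> F mF tF F0; rewrite /P /=.
  pose f n t := q (row_of t) * \sum_(k < n) (\1_(F k) t : R).
  have fE n t : f n t = \sum_(k < n) q (row_of t) * \1_(F k) t by rewrite /f mulr_sumr.
  have mf n : measurable_fun setT (f n).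
    have mk (k : 'I_n) : measurable_fun (setT : set T) (fun t : T => \1_(F k : set T) t : R).
      by apply: measurable_indic; apply: g_cper_limit_measurable; exact: mF.
    by apply: measurable_funM => //; apply: (measurable_sum _ mk).
  have f0 n : (\int[mu]_t f n t = 0)%R.
    elim: n => [|n IH].
      rewrite (_ : f 0%N = fun=> 0); last by apply/funext => t; rewrite /f big_ord0 mulr0.
      by rewrite Rintegral_cst//= mul0r.
    have In : mu.-integrable setT (EFin \o f n).
      have -> : EFin \o f n = fun t => (\sum_(k < n) (q (row_of t) * \1_(F k) t)%:E)%E.
        by apply/funext => t; rewrite /= fE sumEFin.
      have IF k : mu.-integrable setT (fun t => (q (row_of t) * \1_(F k : set T) t)%:E).
        by apply: (IM (F k)); exact: mF.
      by apply: integrable_sum => // k _; exact: IF.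
    have -> : (\int[mu]_t f n.+1 t = \int[mu]_t (f n t + q (row_of t) * \1_(F n) t))%R.
      by apply: eq_Rintegral => t _; rewrite /f big_ord_recr /= mulrDr.
    by rewrite RintegralD//; [rewrite IH add0r; exact: F0|apply: IM; exact: mF].
  have nd (t : T) : {homo (fun n => \sum_(k < n) (\1_(F k) t : R)) : n m / (n <= m)%N >-> n <= m}.
    apply: homo_leq => [//|x y z|n]; first exact: le_trans.
    by rewrite big_ord_recr /= lerDl indicE.
  have fF t : f n t @[n --> \oo] --> q (row_of t) * \1_(\bigcup_k F k) t.
    by apply: cvgMr; exact: cvg_indic_bigcup.
  have fb n t : `|f n t| <= `|q (row_of t)|.
    rewrite /f normrM ler_piMr// ger0_norm; last by apply: sumr_ge0 => k _; rewrite indicE.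
    have C := @cvg_indic_bigcup F t tF.
    apply: (le_trans (nondecreasing_cvgn_le (nd t) _ n)); first by apply/cvg_ex; eexists; exact: C.
    rewrite (cvg_lim _ C)//; exact: le_trans (ler_norm _) (ind01 _ _).
  have [_] := @Rintegral_cvg _ _ _ mu f
    (fun t => q (row_of t) * \1_(\bigcup_k F k) t) _ Inq mf fb fF.
  rewrite (_ : (fun n => _) = fun=> 0); last by apply/funext => n; exact: f0.
  by move=> /(cvg_unique _ (cvg_cst _)) /= <-.
Qed.

End fundamental_lemma.

Section fundamental_lemma_periodic.
Context {R : realType} {d : nat}.
Local Notation T := (d.-tuple (measurableTypeR R)).
Local Notation mu := (torus_leb R d).
Local Notation G := (@cper_limit_sets R d).
Local Notation T' := (g_sigma_algebraType G).

(** The generated sigma-algebra does not separate points that are congruent modulo Z^d, but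
    reduction to the fundamental domain is measurable for it. A periodic Borel function factors
    through this reduction, which gives [g_cper_limit_periodic]. *)
Lemma measurable_frac_part : measurable_fun (setT : set T')
  (fun t : T' => [tuple tnth (t : T) i - (Num.floor (tnth (t : T) i))%:~R | i < d] : T).
Proof.
apply/measurable_fun_tnthP => i.
apply: (measurability (@RGenOInfty.G R)); first exact: (RGenOInfty.measurableE R).
move=> _ [_ [a ->] <-]; rewrite setTI.
rewrite (_ : _ @^-1` _ = [set t : T' | a < tnth (t : T) i - (Num.floor (tnth (t : T) i))%:~R]); last first.
  by apply/seteqP; split=> t /=; rewrite tnth_mktuple in_itv /= andbT.
have fr (u : R) : 0 <= u - (Num.floor u)%:~R < 1.
  have /andP[f0 f1] := floor_itv u.
  by rewrite subr_ge0 f0 ltrBlDr addrC -[1]/(1%:~R) -intrD.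
have [a0|a0] := ltP a 0.
  rewrite (_ : [set t : T' | _] = setT); first exact: measurableT.
  by apply/seteqP; split=> t //= _; have /andP[h _] := fr (tnth (t : T) i); exact: lt_le_trans h.
have [a1|a1] := leP 1 a.
  rewrite (_ : [set t : T' | _] = set0); first exact: measurable0.
  apply/seteqP; split=> t //= h; have /andP[_ h1] := fr (tnth (t : T) i).
  by have := lt_trans h h1; rewrite ltNge a1.
apply: sub_sigma_algebra.
pose phi (x : 'rV[R]_d) := cos (2 * pi * (x 0 i - (a + 1) / 2)) - cos (pi * (1 - a)).
rewrite (_ : [set t : T' | _] = [set t : T | 0 < phi (row_of t)]); last first.
  by apply/seteqP; split=> t /=; rewrite /phi mxE -frac_gt_cos// a0 a1.
apply: cper_limit_set_pos; split.
  move=> x; apply: (@continuousB _ _ _ (fun x : 'rV[R]_d => cos (2 * pi * (x 0 i - (a + 1) / 2)))).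
    apply: (@continuous_comp _ _ _ (fun x : 'rV[R]_d => 2 * pi * (x 0 i - (a + 1) / 2)) cos); last exact: continuous_cos.
    apply: (@continuous_comp _ _ _ (fun x : 'rV[R]_d => x 0 i) (fun y : R => 2 * pi * (y - (a + 1) / 2))).
      exact: coord_continuous.
    by apply: cvgMr; apply: cvgB; [exact: cvg_id|exact: cvg_cst].
  exact: cst_continuous.
move=> x k; rewrite /phi !mxE; congr (_ - _).
pose b (v : R) := cos (2 * pi * (v - (a + 1) / 2)).
rewrite -[LHS]/(b (x 0 i + (k 0 i)%:~R)) -[RHS]/(b (x 0 i)); apply: shift_int => v; rewrite /b.
rewrite (_ : 2 * pi * (v + 1 - (a + 1) / 2) = 2 * pi * (v - (a + 1) / 2) + pi + pi); last by ring.
by rewrite !cosDpi opprK.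
Qed.

Lemma g_cper_limit_periodic (q : 'rV[R]_d -> R) (Y : set R) : periodic q -> tmeas q ->
  measurable Y -> <<s G >> [set t : T | Y (q (row_of t))].
Proof.
move=> pq mq mY.
have mS : measurable [set t : T | Y (q (row_of t))].
  by rewrite -[X in measurable X]setTI; exact: mq.
have := measurable_frac_part measurableT mS; rewrite setTI.
rewrite (_ : _ @^-1` _ = [set t : T | Y (q (row_of t))])//.
apply/seteqP; split=> t /=; rewrite -(periodic_frac_part (row_of t) pq);
  rewrite (_ : _ - _ = row_of [tuple tnth (t : T) i - (Num.floor (tnth (t : T) i))%:~R | i < d])//;
  by apply/rowP => i; rewrite !mxE tnth_mktuple.
Qed.

Lemma tint_norm_eq0 (q : 'rV[R]_d -> R) : periodic q -> tintegrable q ->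
  (forall psi, cper psi -> tint (fun x => q x * psi x) = 0) ->
  tint (fun x => `|q x|) = 0.
Proof.
move=> pq Iq Hq; have mq := tintegrable_tmeas Iq.
have H Y (mY : measurable Y) := int_g_cper_limit Iq Hq (g_cper_limit_periodic pq mq mY).
pose P := [set t : T | 0 < q (row_of t)].
have P0 : \int[mu]_t (q (row_of t) * \1_P t) = 0.
  have -> : P = [set t : T | `]0, +oo[%classic (q (row_of t))].
    by apply/seteqP; split=> t /=; rewrite in_itv /= andbT.
  exact: H.
have mP : measurable P.
  apply: g_cper_limit_measurable.
  have -> : P = [set t : T | `]0, +oo[%classic (q (row_of t))].
    by apply/seteqP; split=> t /=; rewrite in_itv /= andbT.
  exact: g_cper_limit_periodic.
(* |q| is twice the positive part of [q] minus [q], and both have integral 0. *)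
have -> : tint (fun x => `|q x|) = \int[mu]_t (q (row_of t) * \1_P t + q (row_of t) * \1_P t - q (row_of t)).
  apply: eq_Rintegral => t _; rewrite indicE.
  have [q0|q0] := ltP 0 (q (row_of t)).
    by rewrite mem_set// mulr1 gtr0_norm//; ring.
  rewrite memNset /P /=; last by apply/negP; rewrite -leNgt.
  by rewrite ler0_norm// mulr0; ring.
have IP := tintegrable_indic Iq mP.
have IPP : mu.-integrable setT (EFin \o (fun t => q (row_of t) * \1_P t + q (row_of t) * \1_P t)).
  exact: (integrableD measurableT IP IP).
rewrite (RintegralB measurableT IPP Iq) (RintegralD measurableT IP IP) P0.
have -> : \int[mu]_t q (row_of t) = tint (fun x => q x * 1).
  by apply: eq_Rintegral => t _; rewrite mulr1.
by rewrite Hq ?addr0 ?subr0//; exact: cper_cst.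
Qed.

End fundamental_lemma_periodic.

(** * Weak derivatives and Sobolev norms *)

Section weak_derivative_norms.
Context {R : realType} {d : nat}.
Implicit Types f w q : 'rV[R]_d -> R.

Lemma ae_torusS (P Q : 'rV[R]_d -> Prop) : (forall x, P x -> Q x) ->
  ae_torus P -> ae_torus Q.
Proof.
move=> PQ; apply: (@filterS _ (almost_everywhere (torus_leb R d))) => t; exact: PQ.
Qed.

Lemma ae_torusI (P Q : 'rV[R]_d -> Prop) : ae_torus P -> ae_torus Q ->
  ae_torus (fun x => P x /\ Q x).
Proof. exact: (@filterI _ (almost_everywhere (torus_leb R d))). Qed.

Lemma tint0_ae q : tintegrable q -> tint (fun x => `|q x|) = 0 -> ae_torus (fun x => q x = 0).
Proof.
move=> Iq H.
have mq : measurable_fun setT (fun t => (q (row_of t))%:E).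
  by apply/measurable_EFinP; exact: tintegrable_tmeas.
have := (ae_eq_integral_abs (torus_leb R d) measurableT mq).1.
have -> : (\int[torus_leb R d]_t `|(q (row_of t))%:E| = 0)%E.
  have fn : (\int[torus_leb R d]_t `|(q (row_of t))%:E|)%E \is a fin_num.
    exact: (integrable_fin_num measurableT (tintegrable_norm Iq)).
  by rewrite -(fineK fn); congr (_%:E); exact: H.
move=> /(_ erefl); apply: filterS => t /= /(_ I) [].
by [].
Qed.

Lemma eq_ae_tint f g : tmeas f -> tmeas g -> ae_torus (fun x => f x = g x) -> tint f = tint g.
Proof.
move=> mf mg fg; congr fine; apply: ae_eq_integral => //; [exact/measurable_EFinP|exact/measurable_EFinP|].
by apply: (@filterS _ (almost_everywhere (torus_leb R d)) _ _ _ _ fg) => t /= -> _.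
Qed.

Lemma torusLpD p f g : 1 <= p -> torusLp p%:E f -> torusLp p%:E g ->
  torusLp p%:E (fun x => f x + g x).
Proof.
move=> p1 [pf Lf] [pg Lg]; split=> [x k|]; first by rewrite pf pg.
have P1 : (1 <= p%:E)%E by rewrite lee_fin.
exact: (@rpredD _ (Lfun (torus_leb R d) p%:E)).
Qed.

Lemma torusLpZ (a : R) p f : 1 <= p -> torusLp p%:E f -> torusLp p%:E (fun x => a * f x).
Proof.
move=> p1 [pf Lf]; split=> [x k|]; first by rewrite pf.
rewrite (_ : _ \o _ = a \o* (f \o @row_of R d)); last by apply/funext => t /=; rewrite mulrC.
exact: Lfun_scale.
Qed.

Lemma wderiv_lincomb (a b : R) p s f g w v : 1 <= p -> tintegrable f -> tintegrable g ->
  wderiv p%:E s f w -> wderiv p%:E s g v ->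
  wderiv p%:E s (fun x => a * f x + b * g x) (fun x => a * w x + b * v x).
Proof.
move=> p1 If Ig [Lw Hw] [Lv Hv]; split.
  by apply: torusLpD => //; exact: torusLpZ.
move=> phi Cphi.
have IM q phi' : tintegrable q -> Cinfty phi' -> tintegrable (fun x => q x * phi' x).
  by move=> Iq C; apply: tintegrableM_cper => //; exact: Cinfty_cper.
have T q r phi' : tintegrable q -> tintegrable r -> Cinfty phi' ->
    tint (fun x => (a * q x + b * r x) * phi' x) =
    a * tint (fun x => q x * phi' x) + b * tint (fun x => r x * phi' x).
  move=> Iq Ir C; rewrite -!tintZ; [|exact: IM|exact: IM].
  rewrite -tintD; [|exact/tintegrableZ/IM|exact/tintegrableZ/IM].
  by congr tint; apply/funext => x; ring.
rewrite T//; last exact: Cinfty_partials.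
have Iw := torusLp_tintegrable p1 Lw; have Iv := torusLp_tintegrable p1 Lv.
by rewrite T// Hw// Hv//; ring.
Qed.

Lemma sobolev_lincomb (a b : R) k p f g : 1 <= p -> sobolev k p f -> sobolev k p g ->
  sobolev k p (fun x => a * f x + b * g x).
Proof.
move=> p1 [Lf Df] [Lg Dg]; split; first by apply: torusLpD => //; exact: torusLpZ.
move=> s sk; have [w Dw] := Df s sk; have [v Dv] := Dg s sk.
by eexists; apply: wderiv_lincomb Dw Dv => //; exact: torusLp_tintegrable Lf || exact: torusLp_tintegrable Lg.
Qed.

Lemma wderiv_unique p s f w w' : 1 <= p -> wderiv p%:E s f w -> wderiv p%:E s f w' ->
  ae_torus (fun x => w x = w' x).
Proof.
move=> p1 [Lw Hw] [Lw' Hw'].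
have Iw := torusLp_tintegrable p1 Lw; have Iw' := torusLp_tintegrable p1 Lw'.
have Iq := tintegrableB Iw Iw'.
have : tint (fun x => `|w x - w' x|) = 0.
  apply: tint_norm_eq0 => // [x k|psi]; first by rewrite (Lw.1 x k) (Lw'.1 x k).
  apply: tint_test_continuous => // phi Cphi.
  have IM q : tintegrable q -> tintegrable (fun x => q x * phi x).
    by move=> Iq'; apply: tintegrableM_cper => //; exact: Cinfty_cper.
  rewrite (_ : (fun x => _) = fun x => w x * phi x - w' x * phi x); last first.
    by apply/funext => x; ring.
  rewrite tintB; [|exact: IM|exact: IM].
  have := Hw _ Cphi; rewrite Hw'// => /(congr1 (fun z => (-1) ^+ size s * z)).
  by rewrite !mulrA -expr2 -exprM mulnC exprM sqrrN expr1n expr1n !mul1r => ->; rewrite subrr.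
move=> /(tint0_ae Iq); apply: ae_torusS => x /eqP.
by rewrite subr_eq0 => /eqP.
Qed.

Lemma wder2P k s f : sobolev k 2 f -> (size s <= k)%N -> wderiv 2%:E s f (wder2 s f).
Proof.
by move=> [_ Df] /Df[w Dw]; rewrite /wder2; apply: (@xgetPex _ (fun=> 0) [set w | wderiv 2%:E s f w]); exists w.
Qed.

Lemma torusL2_sqr w : torusLp 2%:E w -> tintegrable (fun x => w x ^+ 2).
Proof. by move=> [_ /Lfun2_integrable_sqr]. Qed.

Lemma tint_norm_le_sqrt w : torusLp 2%:E w ->
  tint (fun x => `|w x|) <= Num.sqrt (tint (fun x => w x ^+ 2)).
Proof.
move=> Lw; have Iw : tintegrable w by apply: torusLp_tintegrable Lw; lra.
have I1 := tintegrable_norm Iw; have I2 := torusL2_sqr Lw.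
set a := tint (fun x => `|w x|).
have a0 : 0 <= a by apply: tint_ge0 => x; exact: normr_ge0.
rewrite -(ger0_norm a0) -sqrtr_sqr ler_sqrt; last first.
  by apply: tint_ge0 => x; exact: sqr_ge0.
(* The variance of |w|, whose mean is [a], is nonnegative. *)
have : 0 <= tint (fun x => w x ^+ 2 - (2 * a) * `|w x| + a ^+ 2).
  apply: tint_ge0 => x; rewrite -(real_normK (num_real (w x))).
  by rewrite (_ : _ + _ = (`|w x| - a) ^+ 2) ?sqr_ge0//; ring.
have Ia : tintegrable (fun _ : 'rV[R]_d => a ^+ 2) := cper_tintegrable (cper_cst _).
rewrite tintD//; last by apply: tintegrableB => //; exact: tintegrableZ.
rewrite tintB//; last exact: tintegrableZ.
rewrite tintZ// tint_cst -/a => H.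
by move: H; rewrite (_ : _ + _ = tint (fun x => w x ^+ 2) - a ^+ 2) ?subr_ge0//; ring.
Qed.

Lemma wder2_sqr_le k s f : sobolev k 2 f -> (size s <= k)%N ->
  Num.sqrt (tint (fun x => wder2 s f x ^+ 2)) <= sobolev_norm k f.
Proof.
move=> Sf sk; rewrite ler_sqrt; last first.
  by apply: sumr_ge0 => j _; apply: sumr_ge0 => u _; apply: tint_ge0 => x; exact: sqr_ge0.
have sk' : (size s < k.+1)%N by [].
rewrite (bigD1 (Ordinal sk'))//= (bigD1 (in_tuple s))//= -addrA lerDl addr_ge0//.
  by apply: sumr_ge0 => u _; apply: tint_ge0 => x; exact: sqr_ge0.
by apply: sumr_ge0 => j _; apply: sumr_ge0 => u _; apply: tint_ge0 => x; exact: sqr_ge0.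
Qed.

(** A list [r] has 2 ^ size r subsequences. *)
Lemma weak_bound_le (N : nat) (B : R) (w : seq 'I_d -> 'rV[R]_d -> R) r t :
  (forall s, (size s <= N)%N -> tint (fun x => `|w s x|) <= B) ->
  (size t + size r <= N)%N -> weak_bound w t r <= 2 ^+ size r * B.
Proof.
move=> H; elim: r t => [|i r IH] t /=.
  by rewrite addn0 expr0 mul1r; exact: H.
move=> tN; rewrite exprS -mulrA mulr_natl mulr2n; apply: lerD; apply: IH.
  by apply: leq_trans tN; rewrite leq_add2l.
by rewrite size_rcons addSnnS.
Qed.

(** [wder2] is an arbitrary choice of weak derivative. For smooth functions uniqueness almost
    everywhere identifies it with the classical one, whose homogeneity is evident. *)
Lemma sobolev_normZ_Cinfty k (a : R) f : 0 <= a -> Cinfty f ->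
  sobolev_norm k (fun x => a * f x) = a * sobolev_norm k f.
Proof.
move=> a0 Cf.
have E f' : Cinfty f' -> forall s, tint (fun x => wder2 s f' x ^+ 2) =
    tint (fun x => partials (rev s) f' x ^+ 2).
  move=> Cf' s.
  have P12 : 1 <= 2 :> R by lra.
  have Sf' : sobolev (size s) 2 f' by exact: Cinfty_sobolev.
  have D1 := wder2P Sf' (leqnn _); have D2 := Cinfty_wderiv s P12 Cf'.
  have m2 g : wderiv 2%:E s f' g -> tmeas (fun x => g x ^+ 2).
    by move=> [Lg _]; apply: tintegrable_tmeas; exact: torusL2_sqr.
  apply: eq_ae_tint; [exact: m2 D1|exact: m2 D2|].
  by apply: (ae_torusS _ (wderiv_unique P12 D1 D2)) => x ->.

rewrite /sobolev_norm -[in RHS](ger0_norm a0) -sqrtr_sqr -sqrtrM ?sqr_ge0//; congr Num.sqrt.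
rewrite mulr_sumr; apply: eq_bigr => j _; rewrite mulr_sumr; apply: eq_bigr => s _.
rewrite (E _ (CinftyZ a Cf)) (E _ Cf) -tintZ.
  by congr tint; apply/funext => x; rewrite partialsZ//; ring.
apply: cper_tintegrable; rewrite (_ : (fun x => _) = fun x => partials (rev s) f x * partials (rev s) f x).
  by apply: cperM; apply: Cinfty_cper; exact: Cinfty_partials.
by apply/funext => x; rewrite expr2.
Qed.

End weak_derivative_norms.

(** * Smoothness of h(m) and continuity of h along segments *)

Section operator_regularity.
Context {R : realType} {d : nat}.
Implicit Types m f : 'rV[R]_d -> R.

Lemma sobolev_weak_family k f : sobolev k 2 f -> weak_family k f (fun s => wder2 s f).
Proof.
move=> Sf s sk; have [Lw Hw] := wder2P Sf sk; split=> //.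
by apply: torusLp_tintegrable Lw; lra.
Qed.

Lemma sobolev_cone_Cinfty k m : Cinfty m -> (forall x, 0 <= m x) -> sobolev_cone k m.
Proof.
move=> Cm m0; split; first by apply: Cinfty_sobolev => //; lra.
by apply: aeW => t; exact: m0.
Qed.

Lemma Cinfty_Mac m : Cinfty m -> (forall x, 0 <= m x) -> Mac m.
Proof.
move=> Cm m0; split; first by apply: cper_torusLp => //; exact: Cinfty_cper.
by apply: aeW => t; exact: m0.
Qed.

Lemma h_regularity_Cinfty (h : ('rV[R]_d -> R) -> 'rV[R]_d -> R) m :
  operator_Mac_C h -> h_regularity h ->
  Cinfty m -> (forall x, 0 <= m x) -> Cinfty (h m).
Proof.
move=> [hC _] hR Cm m0.
have ch : cper (h m) by have [? ?] := hC _ (Cinfty_Mac Cm m0).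
apply: (@sobolev_Cinfty _ _ _ (fun s => wder2 s (h m)) ch) => N.
(* An order that dominates [N] and is admissible in (h-regularity). *)
have kN : d%:R / 2 + 1 < (N + d + 2)%:R :> R.
  have : 0 <= (d%:R : R) by []; have : 0 <= (N%:R : R) by [].
  by rewrite !natrD; lra.
have [Hs _] := hR _ kN.
move=> s sN; apply: sobolev_weak_family (Hs _ (sobolev_cone_Cinfty _ Cm m0)) _ _.
by rewrite (leq_trans sN)// -addnA leq_addr.
Qed.

(** Frechet differentiability at [m0], used with tolerance 1, splits [h m' - h m0] into a remainder
    and a linear part whose Sobolev norms are at most [t * K] and [C * (t * K)]. The embedding turns
    this into a bound in the sup norm that is linear in [t]. *)
Lemma operator_segment_continuous (h : ('rV[R]_d -> R) -> 'rV[R]_d -> R) m0 m1 (e : R) :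
  operator_Mac_C h -> h_regularity h -> Cinfty m0 -> Cinfty m1 ->
  (forall x, 0 <= m0 x) -> (forall x, 0 <= m1 x) -> 0 < e ->
  exists2 delta : R, 0 < delta & forall t : R, 0 <= t -> t <= 1 -> t <= delta ->
    forall x, `|h (fun y => m0 y + t * (m1 y - m0 y)) x - h m0 x| <= e.
Proof.
move=> hO hR C0 C1 m00 m10 e0; have P12 : 1 <= 2 :> R by lra.
have [hC _] := hO.
pose k := (d + 2)%N; have dk : d%:R / 2 + 1 < k%:R :> R.
  by have : 0 <= (d%:R : R) by []; rewrite /k natrD; lra.
have [hS /(_ _ (sobolev_cone_Cinfty k C0 m00))[L [LS _ [C HC] HF]]] := hR _ dk.
have [delta delta0 Hd] := HF 1 ltr01.
pose f x := m1 x - m0 x; have Cf : Cinfty f by exact: CinftyB.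
pose K := sobolev_norm k f.
have K0 : 0 <= K by exact: sqrtr_ge0.
(* 2 ^ d counts the terms of [weak_bound] over the d coordinates; the increments 1 keep [D]
   positive. *)
pose D := 2 ^+ d * ((1 + `|C|) * (K + 1)).
have C00 : 0 <= `|C| by []; have K1 : 0 < K + 1 by lra.
have D0 : 0 < D by rewrite /D mulr_gt0 ?exprn_gt0 ?mulr_gt0//; lra.
exists (Num.min (delta / (K + 2)) (e / D)) => [|t t0 t1].
  by rewrite lt_min !divr_gt0//; lra.
rewrite le_min => /andP[td te] x.
set m' := fun y => _.
have Ctf : Cinfty (fun y => t * f y) by exact: CinftyZ.
have Cm' : Cinfty m' by exact: CinftyD.
have m'0 y : 0 <= m' y.
  rewrite (_ : m' y = (1 - t) * m0 y + t * m1 y); last by rewrite /m'; ring.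
  by rewrite addr_ge0// mulr_ge0//; lra.
have m'E : (fun y => m' y - m0 y) = (fun y => t * f y).
  by apply/funext => y; rewrite /m' /f; ring.
have S' := sobolev_cone_Cinfty k Cm' m'0.
have NE : sobolev_norm k (fun y => t * f y) = t * K by rewrite sobolev_normZ_Cinfty.
have : sobolev_norm k (fun x => m' x - m0 x) < delta.
  rewrite m'E NE; have [->|tn0] := eqVneq t 0; first by rewrite mul0r.
  have tp : 0 < t by rewrite lt_def tn0.
  have K2 : 0 < K + 2 by rewrite ltr_wpDl.
  have : t * (K + 2) <= delta by rewrite -ler_pdivlMr.
  by apply: lt_le_trans; rewrite ltr_pM2l// ltrDl.
have := Hd m' S'; rewrite m'E NE mul1r => /[apply].
set r := fun x => _ => Hr.
have Sf : sobolev k 2 (fun y => t * f y) by exact: Cinfty_sobolev.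
have SL := LS _ Sf; have HL := HC _ Sf; rewrite NE in HL.
set Lf := L _ in r Hr SL HL.
have Sr : sobolev k 2 r.
  have := sobolev_lincomb 1 (-1) P12 (sobolev_lincomb 1 (-1) P12 (hS _ S')
    (hS _ (sobolev_cone_Cinfty k C0 m00))) SL.
  by congr sobolev; apply/funext => y; rewrite /r; ring.
pose w s x := wder2 s r x + wder2 s Lf x.
have W : weak_family k (fun x => h m' x - h m0 x) w.
  move=> s sk.
  have I1 := torusLp_tintegrable P12 Sr.1; have I2 := torusLp_tintegrable P12 SL.1.
  have := wderiv_lincomb 1 1 P12 I1 I2 (wder2P Sr sk) (wder2P SL sk).
  have -> : (fun x => 1 * r x + 1 * Lf x) = (fun x => h m' x - h m0 x).
    by apply/funext => y; rewrite /r; ring.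
  have -> : (fun x => 1 * wder2 s r x + 1 * wder2 s Lf x) = w s.
    by apply/funext => y; rewrite /w; ring.
  by move=> [Lw Hw]; split=> //; exact: torusLp_tintegrable Lw.
have ch : cper (fun x => h m' x - h m0 x).
  have [? ?] := hC _ (Cinfty_Mac Cm' m'0); have [? ?] := hC _ (Cinfty_Mac C0 m00).
  exact: cperB.
have dk' : (d <= k)%N by exact: leq_addr.
apply: (le_trans (sobolev_embedding x dk' ch W)).
have sB s : (size s <= k)%N -> tint (fun x => `|w s x|) <= t * K + C * (t * K).
  move=> sk.
  have L1 := (wder2P Sr sk).1; have L2 := (wder2P SL sk).1.
  have I1 := tintegrable_norm (torusLp_tintegrable P12 L1).
  have I2 := tintegrable_norm (torusLp_tintegrable P12 L2).
  apply: (@le_trans _ _ (tint (fun x => `|wder2 s r x| + `|wder2 s Lf x|))).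
    apply: le_tint; [|exact: tintegrableD|by move=> y; exact: ler_normD].
    exact/tintegrable_norm/(torusLp_tintegrable P12)/torusLpD.
  rewrite tintD//; apply: lerD.
    exact: le_trans (tint_norm_le_sqrt L1) (le_trans (wder2_sqr_le Sr sk) Hr).
  exact: le_trans (tint_norm_le_sqrt L2) (le_trans (wder2_sqr_le SL sk) HL).
have dk2 : (size ([::] : seq 'I_d) + size (enum 'I_d) <= k)%N by rewrite size_enum_ord.
apply: (le_trans (weak_bound_le sB dk2)); rewrite size_enum_ord.
apply: (@le_trans _ _ (t * D)); last by rewrite -ler_pdivlMr.
rewrite /D [leRHS]mulrCA ler_pM2l ?exprn_gt0//.
rewrite (_ : _ + _ = t * ((1 + C) * K)); last by ring.
rewrite ler_wpM2l//; apply: (@le_trans _ _ ((1 + `|C|) * K)).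
  by rewrite ler_wpM2r// lerD2l ler_norm.
by rewrite ler_wpM2l ?addr_ge0// lerDl.
Qed.

End operator_regularity.

(** * Variational inequalities on simplices *)

Section simplex_variational_inequality.
Context {R : realType}.

Definition simplex N : set 'rV[R]_N :=
  [set l | (forall i, 0 <= l 0 i) /\ \sum_i l 0 i = 1].

Lemma continuous_coord_sum N (F : 'I_N -> R -> R) :
  (forall i, continuous (F i)) -> continuous (fun l : 'rV[R]_N => \sum_i F i (l 0 i)).
Proof.
move=> cF; rewrite (_ : (fun l => _) = \sum_i (fun l : 'rV[R]_N => F i (l 0 i))); last first.
  by apply/funext => l; rewrite fct_sumE.
apply: (big_ind (fun f : 'rV[R]_N -> R => continuous f)) => [x|f g cf cg x|i _ x].
- exact: (@cst_continuous _ _ (0 : R)).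
- by apply: (@continuousD _ _ _ f g); [exact: cf|exact: cg].
- by apply: (@continuous_comp _ _ _ (fun l : 'rV[R]_N => l 0 i) (F i)); [exact: coord_continuous|exact: cF].
Qed.

Lemma closed_le_fun N (f : 'rV[R]_N -> R) (a : R) : continuous f -> closed [set l | a <= f l].
Proof.
move=> cf; rewrite (_ : [set l | _] = f @^-1` [set y | a <= y])//.
by apply: preimage_closed; [move=> x _; exact: cf|exact: closed_ge].
Qed.

Lemma compact_simplex N : compact (@simplex N).
Proof.
apply: (subclosed_compact _ (@compact_unit_cube R N)); last first.
  move=> l [l0 l1] i /=; rewrite in_itv /= l0 /= -l1 (bigD1 i)//= lerDl.
  by apply: sumr_ge0 => j _.
have cid : continuous (fun y : R => y) by move=> y; exact: cvg_id.
have cN : continuous (fun y : R => - y) by move=> y; apply: cvgN; exact: cvg_id.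
rewrite (_ : @simplex N = \bigcap_(i in [set: 'I_N]) [set l | 0 <= l 0 i] `&`
   ([set l | 1 <= \sum_i l 0 i] `&` [set l | -1 <= \sum_i - l 0 i])).
  apply: closedI; first by apply: closed_bigI => i _; apply: closed_le_fun; exact: coord_continuous.
  apply: closedI; apply: closed_le_fun.
    exact: (continuous_coord_sum (fun _ => cid)).
  exact: (continuous_coord_sum (fun _ => cN)).
apply/seteqP; split=> [l [l0 l1]|l [l0 [/= l1 l2]]].
  by split; [move=> i _; exact: l0|rewrite /= sumrN l1].
split; first by move=> i; exact: (l0 i I).
by apply/eqP; rewrite eq_le l1 andbT; move: l2; rewrite sumrN lerN2.
Qed.

Lemma simplex_delta N (i : 'I_N) : simplex (delta_mx 0 i).
Proof.
split=> [j|]; first by rewrite mxE.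
rewrite (bigD1 i)//= mxE !eqxx big1 ?addr0// => j ji.
by rewrite mxE eqxx (negPf ji).
Qed.

Lemma simplex_convex N (l m : 'rV[R]_N) (t : R) : simplex l -> simplex m -> 0 <= t -> t <= 1 ->
  simplex (l + t *: (m - l)).
Proof.
move=> [l0 l1] [m0 m1] t0 t1; split=> [i|].
  rewrite !mxE (_ : _ + _ = (1 - t) * l 0 i + t * m 0 i); last by ring.
  by rewrite addr_ge0// mulr_ge0// subr_ge0.
under eq_bigr do rewrite !mxE.
by rewrite big_split /= l1 -mulr_sumr sumrB m1 l1 subrr mulr0 addr0.
Qed.

Lemma simplex_comb p N (w : 'rV[R]_p) (mu : 'I_p -> 'rV[R]_N) :
  simplex w -> (forall j, simplex (mu j)) -> simplex (\sum_j w 0 j *: mu j).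
Proof.
move=> [w0 w1] Hmu; split=> [i|].
  rewrite summxE; apply: sumr_ge0 => j _; rewrite mxE mulr_ge0//; exact: (Hmu j).1.
under eq_bigr do rewrite summxE.
rewrite exchange_big -[RHS]w1; apply: eq_bigr => j _.
by under eq_bigr do rewrite mxE; rewrite -mulr_sumr (Hmu j).2 mulr1.
Qed.

(* Minimise the sum of the squared negative parts of B w. If it is positive at
   the minimiser w, then it decreases when moving towards the normalised vector
   of negative parts, since n^T B n >= 0 for every n. *)
Lemma monotone_matrix_simplex p (B : 'I_p.+1 -> 'I_p.+1 -> R) :
  (forall k j, 0 <= B k j + B j k) ->
  exists2 w : 'rV[R]_p.+1, simplex w & forall k, 0 <= \sum_j B k j * w 0 j.
Proof.
move=> HB.
pose bw (w : 'rV[R]_p.+1) k := \sum_j B k j * w 0 j.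
pose np (a : R) : R := Num.max 0 (- a).
have np0 a : 0 <= np a by rewrite le_max lexx.
have cnp : continuous np.
  move=> a; rewrite /np.
  rewrite (_ : (fun b => _) = (fun b : R => 2^-1 * (`|b| - b))); last first.
    apply/funext => b; case: (ger0P b) => b0.
      by rewrite subrr mulr0 max_l// oppr_le0.
    by rewrite max_r ?oppr_ge0 1?ltW//; field.
  apply: cvgMr; apply: (@continuousB _ _ _ (fun b : R => `|b|) id); [exact: norm_continuous|exact: cvg_id].
pose phi w : R := \sum_k np (bw w k) ^+ 2.
have cphi : continuous phi.
  rewrite (_ : phi = \sum_k (fun w => np (bw w k) ^+ 2)); last by apply/funext => w; rewrite fct_sumE.
  apply: (big_ind (fun f : 'rV[R]_p.+1 -> R => continuous f)) => [x|f g cf cg x|k _ x].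
  - exact: (@cst_continuous _ _ (0 : R)).
  - by apply: (@continuousD _ _ _ f g); [exact: cf|exact: cg].
  - apply: (@continuous_comp _ _ _ (fun w => bw w k) (fun a => np a ^+ 2)).
      by apply: (@continuous_coord_sum _ (fun j y => B k j * y)) => j y; apply: cvgMr; exact: cvg_id.
    by apply: (@continuous_comp _ _ _ np (fun a : R => a ^+ 2)); [exact: cnp|exact: exprn_continuous].
have S0 : @simplex p.+1 !=set0 by exists (delta_mx 0 ord0); exact: simplex_delta.
have [w] := compact_EVT_min S0 (@compact_simplex p.+1) (continuous_subspaceT cphi).
rewrite inE => Sw Hmin; exists w => // k0.
pose n k := np (bw w k).
have [n00|] := eqVneq (\sum_k n k) 0.
  have nk k : n k = 0.
    by apply: (psumr_eq0P (P := predT) (F := n) _ n00) => // i _; exact: np0.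
  have : - bw w k0 <= n k0 by rewrite le_max lexx orbT.
  by rewrite nk oppr_le0.
move=> sn0; exfalso; set s := \sum_k n k in sn0.
have s0 : 0 < s by rewrite lt_def sn0 /=; apply: sumr_ge0 => k _; exact: np0.
pose v : 'rV[R]_p.+1 := \row_k (n k / s).
have Sv : simplex v.
  split=> [i|]; first by rewrite mxE divr_ge0 ?(ltW s0)//; exact: np0.
  by under eq_bigr do rewrite mxE; rewrite -mulr_suml divff.
pose b k := bw v k - bw w k.
have bwD k t : bw (w + t *: (v - w)) k = bw w k + t * b k.
  rewrite /b /bw -sumrB mulr_sumr -big_split /=; apply: eq_bigr => j _.
  by rewrite !mxE; ring.
have nB : 0 <= \sum_k \sum_j n k * B k j * n j.
  rewrite -(@pmulr_rge0 _ 2)// mulr2n mulrDl mul1r {2}exchange_big -big_split /=.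
  apply: sumr_ge0 => k _; rewrite -big_split; apply: sumr_ge0 => j _ /=.
  have -> : n k * B k j * n j + n j * B j k * n k = n k * n j * (B k j + B j k) by ring.
  by rewrite mulr_ge0 ?HB// mulr_ge0//; exact: np0.
have nbw k : n k * bw w k = - n k ^+ 2.
  rewrite /n /np; case: (leP 0 (- bw w k)) => _; ring.
pose Q := \sum_k n k ^+ 2.
have Q0 : 0 < Q.
  rewrite lt_def sumr_ge0 ?andbT; last by move=> k _; exact: sqr_ge0.
  apply: contra sn0 => /eqP H; apply/eqP/big1 => k _.
  have := psumr_eq0P (fun i _ => sqr_ge0 (n i)) H (i := k) isT.
  by move/eqP; rewrite sqrf_eq0 => /eqP.
(* Towards [v = n / s], the derivative of the functional at [w] is at most -2Q: the contribution of
   [v] is a positive multiple of n^T B n, that of [w] is exactly Q. *)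
have nb : Q <= \sum_k n k * b k.
  rewrite /b; under eq_bigr do rewrite mulrBr nbw opprK.
  rewrite big_split /= lerDr.
  rewrite (_ : \sum_i _ = s^-1 * \sum_k \sum_j n k * B k j * n j); last first.
    rewrite mulr_sumr; apply: eq_bigr => k _; rewrite /bw !mulr_sumr; apply: eq_bigr => j _.
    by rewrite mxE; ring.
  by rewrite mulr_ge0// invr_ge0 ltW.
pose C := \sum_k b k ^+ 2.
have C0 : 0 <= C by apply: sumr_ge0 => k _; exact: sqr_ge0.
have step t : 0 <= t -> t <= 1 -> 2 * t * Q <= t ^+ 2 * C.
  move=> t0 t1.
  have /Hmin : (w + t *: (v - w)) \in @simplex p.+1 by rewrite inE; exact: simplex_convex.
  have : phi (w + t *: (v - w)) <= \sum_k (n k - t * b k) ^+ 2.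
    apply: ler_sum => k _; rewrite bwD -[leRHS]real_normK ?num_real//.
    rewrite lerXn2r ?nnegrE//.
    rewrite {1}/np ge_max normr_ge0 /= (le_trans _ (ler_norm _))// opprD lerD2r.
    by rewrite /n /np le_max lexx orbT.
  move=> /[swap] /le_trans /[apply].
  have -> : \sum_k (n k - t * b k) ^+ 2 = Q - 2 * t * (\sum_k n k * b k) + t ^+ 2 * C.
    rewrite /Q /C !mulr_sumr -sumrB -big_split /=; apply: eq_bigr => k _; ring.
  rewrite -[phi w]/Q -addrA lerDl => H.
  apply: (@le_trans _ _ (2 * t * \sum_k n k * b k)); first by rewrite ler_wpM2l// mulr_ge0.
  by rewrite -subr_ge0 addrC.
(* With this step t C <= Q, whereas minimality of [w] gives 2 Q <= t C. *)
pose t := Q / (Q + C).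
have QC : 0 < Q + C by rewrite ltr_wpDr.
have t0 : 0 < t by rewrite divr_gt0.
have t1 : t <= 1 by rewrite ler_pdivrMr// mul1r lerDl.
have := step t (ltW t0) t1.
rewrite (_ : t ^+ 2 * C = t * (t * C)); last by ring.
rewrite (_ : 2 * t * Q = t * (2 * Q)); last by ring.
rewrite ler_pM2l// => H.
have : t * C <= Q.
  rewrite /t mulrAC ler_pdivrMr// mulrDr lerDr.
  exact: sqr_ge0.
lra.
Qed.

End simplex_variational_inequality.

Section simplex_minty.
Context {R : realType} {N : nat}.
(** Minty's lemma. Evaluating [c] at the test point [mu] instead of the unknown makes each condition
    a closed half-space in the unknown, without any regularity of [c]. By compactness finitely many
    test points suffice, and for these [monotone_matrix_simplex] yields weights. Continuity along
    segments then brings [c] back to the solution. *)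
Lemma simplex_variational_inequality (c : 'rV[R]_N.+1 -> 'I_N.+1 -> R) :
  (forall mu nu, simplex mu -> simplex nu ->
    0 <= \sum_i (mu 0 i - nu 0 i) * (c mu i - c nu i)) ->
  (forall mu nu, simplex mu -> simplex nu -> forall i (e : R), 0 < e ->
    exists2 delta : R, 0 < delta & forall t : R, 0 <= t -> t <= 1 -> t <= delta ->
      `|c (mu + t *: (nu - mu)) i - c mu i| <= e) ->
  exists2 l, simplex l & forall i, \sum_j l 0 j * c l j <= c l i.
Proof.
move=> cmono chemi.
pose G (mu l : 'rV[R]_N.+1) := \sum_i (mu 0 i - l 0 i) * c mu i.
have [l [Hl]] : exists l, simplex l /\ forall mu, simplex mu -> 0 <= G mu l.
  have := @compact_simplex R N.+1; rewrite compact_In0 => FIP.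
  have [|D' HD'|l Hl] := FIP ('rV[R]_N.+1 : choiceType) (@simplex R N.+1)
      (fun mu => @simplex R N.+1 `&` [set l | 0 <= G mu l]).
  - exists (fun mu => [set l | 0 <= G mu l]) => // mu _; apply: closed_le_fun.
    apply: (@continuous_coord_sum _ _ (fun i y => (mu 0 i - y) * c mu i)) => i y.
    by apply: cvgMl; apply: cvgB; [exact: cvg_cst|exact: cvg_id].
  - have HD (mu : 'rV[R]_N.+1) : mu \in finmap.enum_fset D' -> simplex mu.
      by move=> Dmu; exact: (set_mem (HD' mu Dmu)).
    case E : (finmap.enum_fset D') => [|mu0 s].
      by exists 0 => mu Dmu; exfalso; have : mu \in finmap.enum_fset D' := Dmu; rewrite E.
    pose m (j : 'I_(size s).+1) := nth 0 (mu0 :: s) j.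
    have mD j : simplex (m j).
      by apply: HD; rewrite E mem_nth.
    (* The unknown is sought as a convex combination of the test points themselves; since [G] is
       affine in its second argument, this leaves a matrix inequality in the weights. *)
    have [k j|w Sw Hw] := @monotone_matrix_simplex R (size s) (fun k j => G (m k) (m j)).
      rewrite /G -big_split /=; apply: le_trans (cmono _ _ (mD k) (mD j)) _.
      by rewrite le_eqVlt; apply/orP; left; apply/eqP; apply: eq_bigr => i _; ring.
    exists (\sum_j w 0 j *: m j) => mu Dmu; have : mu \in finmap.enum_fset D' := Dmu; rewrite E => /(nthP 0)[k ks <-].
    split; first exact: simplex_comb.
    have := Hw (Ordinal ks); rewrite -[nth _ _ _]/(m (Ordinal ks)); move: (Ordinal ks) => k0 /=.
    congr (_ <= _); rewrite /G.
    under eq_bigr do rewrite mulr_suml.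
    rewrite exchange_big; apply: eq_bigr => i _ /=; rewrite summxE.
    under eq_bigr do rewrite mulrAC.
    rewrite -mulr_suml; congr (_ * _).
    under eq_bigr do rewrite mulrBl mulrC.
    rewrite sumrB -mulr_suml (Sw.2) mul1r; congr (_ - _).
    by apply: eq_bigr => j _; rewrite mxE mulrC.
  exists l; split; first exact: (Hl _ (simplex_delta ord0)).1.
  by move=> mu Smu; exact: (Hl _ Smu).2.
move=> Gl; exists l => // i; apply/ler_addgt0Pr => e e0.
pose nu : 'rV[R]_N.+1 := delta_mx 0 i.
have Snu : simplex nu by exact: simplex_delta.
pose e' := e / 2.
have e'0 : 0 < e' / N.+1%:R by rewrite !divr_gt0.
have /choice [dl Hdl] j : exists delta : R, 0 < delta /\ forall t : R, 0 <= t -> t <= 1 -> t <= delta ->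
      `|c (l + t *: (nu - l)) j - c l j| <= e' / N.+1%:R.
  by have [delta ? ?] := chemi l nu Hl Snu j _ e'0; exists delta.
(* One step towards the vertex [nu] that is short enough for all components; the factor [t] of the
   variational inequality at the new point cancels. *)
pose t := \big[Num.min/1]_j dl j.
have t1 : t <= 1 by rewrite /t; exact: bigmin_le_id.
have t0 : 0 < t by rewrite /t; apply: lt_bigmin => // j _; exact: (Hdl j).1.
have td j : t <= dl j by rewrite /t; exact: bigmin_le_cond.
have Hj j : `|c (l + t *: (nu - l)) j - c l j| <= e' / N.+1%:R.
  by apply: (Hdl j).2 => //; exact: ltW.
have St := simplex_convex Hl Snu (ltW t0) t1.
set mu := l + _ in Hj St.
have : 0 <= \sum_j (nu 0 j - l 0 j) * c mu j.
  have := Gl _ St; have -> : G mu l = t * \sum_j (nu 0 j - l 0 j) * c mu j.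
    rewrite /G mulr_sumr; apply: eq_bigr => j _.
    have -> : mu 0 j = l 0 j + t * (nu 0 j - l 0 j) by rewrite /mu !mxE.
    by ring.
  by rewrite pmulr_rge0.
have -> : \sum_j (nu 0 j - l 0 j) * c mu j =
   \sum_j (nu 0 j - l 0 j) * (c mu j - c l j) + (c l i - \sum_j l 0 j * c l j).
  have -> : c l i = \sum_j nu 0 j * c l j.
    rewrite (bigD1 i)//= mxE !eqxx mul1r big1 ?addr0// => j ji.
    by rewrite mxE eqxx (negPf ji) mul0r.
  by rewrite -sumrB -big_split /=; apply: eq_bigr => j _; ring.
have : \sum_j (nu 0 j - l 0 j) * (c mu j - c l j) <= e'.
  apply: (@le_trans _ _ (\sum_(j < N.+1) e' / N.+1%:R)); last first.
    by rewrite sumr_const card_ord -[leLHS]mulr_natr divfK.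
  apply: ler_sum => j _; apply: le_trans (ler_norm _) _; rewrite normrM.
  rewrite -[leRHS]mul1r; apply: ler_pM => //.
  have S01 (v : 'rV[R]_N.+1) : simplex v -> v 0 j <= 1.
    by case=> v0 <-; rewrite (bigD1 j)//= lerDl sumr_ge0.
  have := Snu.1 j; have := S01 _ Snu; have := Hl.1 j; have := S01 _ Hl.
  move: (nu 0 j) (l 0 j) => a b' *.
  by rewrite ler_norml; lra.
have : e' <= e by rewrite /e' ler_pdivrMr//; lra.
move: (\sum_j _) (\sum_j _) (c l i) => a b z; lra.
Qed.

End simplex_minty.

(** * Composition with jets *)

Section jets.
Context {R : realType} {d : nat}.
Local Notation Z := ('rV[R]_d * 'rV[R]_d * 'M[R]_d * R * R)%type.
Implicit Types (eta th v : 'rV[R]_d -> R).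

Definition jet eta th v (x : 'rV[R]_d) : Z := (x, grad v x, hess v x, eta x, th x).

(** The jet in the form required by [class_C_comp_sum], as scalar coefficients with fixed
    directions; the base point [x] contributes its coordinates. *)
Definition jet_decomp eta th v : seq (('rV[R]_d -> R) * Z) :=
  [seq ((fun x : 'rV[R]_d => x 0 i), (delta_mx 0 i, 0, 0, 0, 0) : Z) | i <- index_enum 'I_d] ++
  [seq (partial i v, (0, delta_mx 0 i, 0, 0, 0) : Z) | i <- index_enum 'I_d] ++
  [seq (partials [:: ij.1; ij.2] v, (0, 0, delta_mx ij.1 ij.2, 0, 0) : Z)
     | ij <- index_enum ('I_d * 'I_d)%type] ++
  [:: (eta, (0, 0, 0, 1, 0) : Z); (th, (0, 0, 0, 0, 1) : Z)].

Lemma jet_decompE eta th v x : jet eta th v x = 0 + \sum_(ce <- jet_decomp eta th v) ce.1 x *: ce.2.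
Proof.
rewrite add0r /jet_decomp !big_cat !big_map /= !big_cons big_nil addr0 /=.
have E1 (I : finType) (c : I -> R) (e : I -> 'rV[R]_d) :
    \sum_i c i *: ((e i, 0, 0, 0, 0) : Z) = (\sum_i c i *: e i, 0, 0, 0, 0).
  elim/big_ind2 : _ => // [a b a' b' -> ->|i _]; congr (_, _, _, _, _); rewrite /= ?addr0 ?scaler0//.
have E2 (I : finType) (c : I -> R) (e : I -> 'rV[R]_d) :
    \sum_i c i *: ((0, e i, 0, 0, 0) : Z) = (0, \sum_i c i *: e i, 0, 0, 0).
  elim/big_ind2 : _ => // [a b a' b' -> ->|i _]; congr (_, _, _, _, _); rewrite /= ?addr0 ?scaler0//.
have E3 (I : finType) (c : I -> R) (e : I -> 'M[R]_d) :
    \sum_i c i *: ((0, 0, e i, 0, 0) : Z) = (0, 0, \sum_i c i *: e i, 0, 0).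
  elim/big_ind2 : _ => // [a b a' b' -> ->|i _]; congr (_, _, _, _, _); rewrite /= ?addr0 ?scaler0//.
rewrite E1 E2 E3 /jet.
congr (_, _, _, _, _); rewrite /= ?scaler0 ?addr0 ?add0r.
- exact: row_sum_delta.
- rewrite [LHS]row_sum_delta; apply: eq_bigr => i _; by rewrite mxE.
- rewrite [LHS]matrix_sum_delta pair_big /=; apply: eq_bigr => -[i j] _ /=; by rewrite mxE.
- by rewrite /GRing.scale /= mulr1.
- by rewrite /GRing.scale /= mulr1.
Qed.

Lemma jet_decomp_Cinfty eta th v n : Cinfty eta -> Cinfty th -> Cinfty v ->
  forall ce, List.In ce (jet_decomp eta th v) -> class_C setT n ce.1.
Proof.
move=> Ce Ct Cv.
have inmap (I : Type) (F : I -> ('rV[R]_d -> R) * Z) (s : seq I) ce :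
    (forall i, class_C setT n (F i).1) -> List.In ce (map F s) -> class_C setT n ce.1.
  by move=> H; elim: s => //= i s IH [<-|]//.
move=> ce /(List.in_app_or _ _ _)[|/(List.in_app_or _ _ _)[|/(List.in_app_or _ _ _)[]]].
- by apply: inmap => i /=; exact: class_C_coord.
- by apply: inmap => i /=; apply: Cinfty_class_C; exact: Cinfty_partial.
- by apply: inmap => i /=; apply: Cinfty_class_C; do 2 apply: Cinfty_partial.
- by case=> [<-|[<-|[]]]; apply: Cinfty_class_C.
Qed.

Lemma Cinfty_comp_jet (U : set Z) (F : Z -> R) eta th v : open U ->
  (forall n, class_C U n F) -> Cinfty eta -> Cinfty th -> Cinfty v ->
  (forall x, U (jet eta th v x)) -> periodic (fun x => F (jet eta th v x)) ->
  Cinfty (fun x => F (jet eta th v x)).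
Proof.
move=> oU CF Ce Ct Cv Uj pF; apply/CinftyP; split=> // n.
rewrite (_ : (fun x => _) = fun x => F (0 + \sum_(ce <- jet_decomp eta th v) ce.1 x *: ce.2)); last first.
  by apply/funext => x; rewrite jet_decompE.
apply: (class_C_comp_sum oU CF).
  exact: jet_decomp_Cinfty.
by move=> x; rewrite -jet_decompE.
Qed.

Lemma continuous_jet eta th v : Cinfty eta -> Cinfty th -> Cinfty v ->
  continuous (jet eta th v).
Proof.
move=> Ce Ct Cv.
rewrite (_ : jet eta th v = fun x => 0 + \sum_(ce <- jet_decomp eta th v) ce.1 x *: ce.2); last first.
  by apply/funext => x; rewrite jet_decompE.
have : forall ce, List.In ce (jet_decomp eta th v) -> continuous ce.1.
  move=> ce /(jet_decomp_Cinfty 0 Ce Ct Cv) C x; exact: class_C_continuous C I.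
elim: jet_decomp => [|[c e] l IH] Hl x.
  rewrite (_ : (fun _ => _) = fun=> 0); first exact: (@cst_continuous _ _ (0 : Z)).
  by apply/funext => y; rewrite big_nil addr0.
rewrite (_ : (fun _ => _) = (fun y => c y *: e) \+ (fun y => 0 + \sum_(ce <- l) ce.1 y *: ce.2)).
  apply: (@continuousD _ _ _ (fun y => c y *: e)); last by apply: IH => ce Hce; apply: Hl; right.
  have cc : continuous c := Hl (c, e) (or_introl erefl).
  by exact: (cvgZr_tmp (cc x)).
by apply/funext => y; rewrite big_cons add0r /= add0r.
Qed.

End jets.

(** * Uniform continuity along segments *)

Section uniform_segments.
Context {R : realType} {d : nat}.
Implicit Types (f g : R -> 'rV[R]_d -> R) (psi : 'rV[R]_d -> R).

(** Continuity, uniform in [x], is stated at the starting point of the segment: this is where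
    Minty's lemma evaluates it, and every point of a simplex can serve as a start. *)
Definition segment_continuous f :=
  (forall t : R, 0 <= t <= 1 -> cper (f t)) /\
  forall e : R, 0 < e -> exists2 delta : R, 0 < delta &
    forall t : R, 0 <= t <= 1 -> t <= delta -> forall x, `|f t x - f 0 x| <= e.

Lemma segment_continuous_cst psi : cper psi -> segment_continuous (fun=> psi).
Proof.
move=> cpsi; split=> // e e0; exists 1 => // t _ _ x.
by rewrite subrr normr0 ltW.
Qed.

Lemma segment_continuousD f g : segment_continuous f -> segment_continuous g ->
  segment_continuous (fun t x => f t x + g t x).
Proof.
move=> [cf uf] [cg ug]; split=> [t t01|e e0]; first by apply: cperD; [exact: cf|exact: cg].
have e2 : 0 < e / 2 by rewrite divr_gt0.
have [a a0 Ha] := uf _ e2; have [b b0 Hb] := ug _ e2.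
exists (Num.min a b) => [|t t01]; first by rewrite lt_min a0.
rewrite le_min => /andP[ta tb] x.
have -> : f t x + g t x - (f 0 x + g 0 x) = (f t x - f 0 x) + (g t x - g 0 x) by ring.
rewrite [e]splitr (le_trans (ler_normD _ _))// lerD//; [exact: Ha|exact: Hb].
Qed.

Lemma segment_continuousM f g : segment_continuous f -> segment_continuous g ->
  segment_continuous (fun t x => f t x * g t x).
Proof.
move=> [cf uf] [cg ug]; split=> [t t01|e e0]; first by apply: cperM; [exact: cf|exact: cg].
have z01 : 0 <= (0 : R) <= 1 by rewrite lexx ler01.
have [A A0 HA] := cper_bounded (cf 0 z01); have [B B0 HB] := cper_bounded (cg 0 z01).
have e1 : 0 < Num.min 1 (e / (A + B + 1)).
  by rewrite lt_min ltr01 divr_gt0// ltr_wpDl// addr_ge0.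
have [a a0 Ha] := uf _ e1; have [b b0 Hb] := ug _ e1.
exists (Num.min a b) => [|t t01]; first by rewrite lt_min a0.
rewrite le_min => /andP[ta tb] x.
have Hf := Ha t t01 ta x; have Hg := Hb t t01 tb x.
move: e1 Hf Hg; set e' := Num.min _ _ => e1 Hf Hg.
have e'1 : e' <= 1 by rewrite ge_min lexx.
have e'e : e' * (A + B + 1) <= e.
  by rewrite -ler_pdivlMr ?ge_min ?lexx ?orbT// ltr_wpDl// addr_ge0.
apply: le_trans e'e.
have -> : f t x * g t x - f 0 x * g 0 x =
  (f t x - f 0 x) * (g t x - g 0 x) + f 0 x * (g t x - g 0 x) + (f t x - f 0 x) * g 0 x by ring.
rewrite (le_trans (ler_normD _ _))// (_ : e' * _ = e' * (1 + A) + e' * B); last by ring.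
apply: lerD; last by rewrite normrM; apply: ler_pM.
rewrite (le_trans (ler_normD _ _))// [leRHS]mulrDr lerD//.
  by rewrite normrM; apply: ler_pM => //; exact: le_trans Hg _.
by rewrite normrM mulrC; apply: ler_pM.
Qed.

Lemma segment_continuous_sum (I : Type) (r : seq I) (F : I -> R -> 'rV[R]_d -> R) :
  (forall i, segment_continuous (F i)) ->
  segment_continuous (fun t x => \sum_(i <- r) F i t x).
Proof.
move=> H; elim: r => [|i r IH].
  rewrite (_ : (fun t => _) = fun=> fun=> 0).
    by apply: segment_continuous_cst; exact: cper_cst.
  by apply/funext => t; apply/funext => x; rewrite big_nil.
rewrite (_ : (fun t => _) = fun t x => F i t x + \sum_(i <- r) F i t x).
  by apply: segment_continuousD.
by apply/funext => t; apply/funext => x; rewrite big_cons.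
Qed.

Lemma segment_continuous_line psi psi' : cper psi -> cper psi' ->
  segment_continuous (fun t x => psi x + t * (psi' x - psi x)).
Proof.
move=> c0 c1; apply: segment_continuousD; first exact: segment_continuous_cst.
have c := cperB c1 c0; apply: segment_continuousM; last exact: segment_continuous_cst.
split=> [t _|e e0]; first exact: cper_cst.
by exists e => // t /andP[t0 _] te x; rewrite subr0 ger0_norm.
Qed.

Lemma segment_continuous_tint f : segment_continuous f -> forall e : R, 0 < e ->
  exists2 delta : R, 0 < delta & forall t : R, 0 <= t <= 1 -> t <= delta ->
    `|tint (f t) - tint (f 0)| <= e.
Proof.
move=> [cf uf] e e0; have [a a0 Ha] := uf _ e0; exists a => // t t01 ta.
have z01 : 0 <= (0 : R) <= 1 by rewrite lexx ler01.
have I1 := cper_tintegrable (cf _ t01); have I0 := cper_tintegrable (cf _ z01).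
rewrite -tintB//; apply: tint_le_bound; first exact: tintegrableB.
by move=> x; exact: Ha.
Qed.

(** Uniform continuity of [F] near the compact image of [J]. The point [z] ranges over the whole
    space because perturbed jets leave that image. *)
Lemma uniform_comp_compact (X : topologicalType) (V : normedModType R) (K : set X)
    (J : X -> V) (F : V -> R) (e : R) : compact K ->
  continuous J -> (forall x, {for J x, continuous F}) -> 0 < e ->
  exists2 delta : R, 0 < delta & forall x, K x -> forall z, `|J x - z| <= delta ->
    `|F z - F (J x)| <= e.
Proof.
move=> /compact_near_coveringP cK cJ cF e0.
have e2 : 0 < e / 2 by rewrite divr_gt0.
pose P (delta : R) (x : X) := forall z, `|J x - z| <= delta -> `|F z - F (J x)| <= e.
suff /(cK R (0^'+) P _) HK : forall x, K x -> \forall x \near x & delta \near 0^'+, P delta x.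
  have [delta [d0 Hd]] := filter_ex (filterI (nbhs_right_gt (0 : R)) HK).
  by exists delta.
move=> x Kx; have /cvgrPdist_le/(_ _ e2) := cF x.
move=> /nbhs_ballP[r /= r0 Hr].
have r2 : 0 < r / 2 by rewrite divr_gt0.
have /cvgrPdist_lt/(_ _ r2) nJ := cJ x.
near=> x' delta => z /= Hz.
have J1 : `|J x - J x'| < r / 2 by near: x'; exact: nJ.
have d1 : delta <= r / 2 by near: delta; exact: nbhs_right_le.
have B1 : `|F (J x) - F (J x')| <= e / 2.
  by apply: Hr; rewrite -ball_normE /=; apply: lt_le_trans J1 _; rewrite [leRHS]splitr lerDl (ltW r2).
have B2 : `|F (J x) - F z| <= e / 2.
  apply: Hr; rewrite -ball_normE /= -(subrKA (J x')).
  rewrite [ltRHS]splitr (le_lt_trans (ler_normD _ _))// ltr_leD//.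
  exact: le_trans Hz d1.
have -> : F z - F (J x') = (F (J x) - F (J x')) - (F (J x) - F z) by ring.
by rewrite (le_trans (ler_normB _ _))// [leRHS]splitr lerD.
Unshelve. all: by end_near. Qed.

End uniform_segments.

(** * The operator A on smooth pairs *)

Section hamiltonian_composition.
Context {R : realType} {d : nat}.
Local Notation Z := ('rV[R]_d * 'rV[R]_d * 'M[R]_d * R * R)%type.

Lemma eq_derive_line (V W : normedModType R) (f : V -> R) (g : W -> R) a v b w :
  (forall s : R, f (s *: v + a) = g (s *: w + b)) -> 'D_v f a = 'D_w g b.
Proof.
move=> H; rewrite /derive.
suff -> : (fun s : R => s^-1 *: ((f \o shift a) (s *: v) - f a)) =
          (fun s : R => s^-1 *: ((g \o shift b) (s *: w) - g b)) by [].
apply/funext => s; have := H 0; rewrite !scale0r !add0r => ->.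
by rewrite /= /shift H.
Qed.

Lemma jet_norm_le (eta th v eta' th' v' : 'rV[R]_d -> R) (x : 'rV[R]_d) (e : R) : 0 <= e ->
  (forall i, `|partial i v x - partial i v' x| <= e) ->
  (forall i j, `|partials [:: i; j] v x - partials [:: i; j] v' x| <= e) ->
  `|eta x - eta' x| <= e -> `|th x - th' x| <= e ->
  `|jet eta th v x - jet eta' th' v' x| <= e.
Proof.
move=> e0 H1 H2 H3 H4; rewrite !prod_normE !ge_max /= subrr normr0 e0 H3 H4 !andbT /=.
apply/andP; split; first by apply: rV_norm_le => // i; rewrite !mxE.
rewrite [X in X <= _]mx_normrE; apply: bigmax_le => // -[i j] _ /=.
by rewrite !mxE; exact: H2.
Qed.

Context (E : set R) (hE : E = [set m | 0 < m] \/ E = [set m | 0 <= m]).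

Lemma E_ge0 m : E m -> 0 <= m.
Proof. by case: hE => -> //= /ltW. Qed.

Lemma E_gt0 m : 0 < m -> E m.
Proof. by case: hE => -> //= /ltW. Qed.

Lemma E_convex a b (t : R) : E a -> E b -> 0 <= t <= 1 -> E (a + t * (b - a)).
Proof.
have -> : a + t * (b - a) = (1 - t) * a + t * b by ring.
move=> + + /andP[t0 t1]; case: hE => -> /= a0 b0; last by rewrite addr_ge0// mulr_ge0// subr_ge0.
have [->|t1'] := eqVneq t 1; first by rewrite subrr mul0r mul1r add0r.
by rewrite ltr_wpDr ?mulr_ge0 ?(ltW b0)// mulr_gt0// subr_gt0 lt_def eq_sym t1'.
Qed.

Implicit Types (G : Hamiltonian R d) (eta v : 'rV[R]_d -> R).

(** The direction of differentiation fixes the coordinate [m], so the line stays in the set where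
    the extension [F] agrees with [G], also for [m] on the boundary of [E]. *)
Lemma H_smoothness_DpH G i : H_smoothness E G -> H_smoothness E (DpH G i).
Proof.
move=> [pG [U [F [oU SU CF FG]]]]; split.
  move=> p M m th Em x k; rewrite /DpH; apply: eq_derive_line => s.
  by rewrite (pG _ _ _ _ Em x k).
exists U, (fun z => 'D_((0, delta_mx 0 i, 0, 0, 0) : Z) F z); split=> //.
  by move=> n; have [_ /(_ ((0, delta_mx 0 i, 0, 0, 0) : Z))[]] := CF n.+1.
move=> [[[[x p] M] m] th] /= Em; apply: eq_derive_line => s.
rewrite (_ : _ + _ = ((x, s *: delta_mx 0 i + p, M, m, th) : Z)).
  by rewrite FG.
by congr (_, _, _, _, _); rewrite /= scaler0 add0r.
Qed.

Lemma H_smoothness_DMH G i j : H_smoothness E G -> H_smoothness E (DMH G i j).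
Proof.
move=> [pG [U [F [oU SU CF FG]]]]; split.
  move=> p M m th Em x k; rewrite /DMH; apply: eq_derive_line => s.
  by rewrite (pG _ _ _ _ Em x k).
exists U, (fun z => 'D_((0, 0, delta_mx i j, 0, 0) : Z) F z); split=> //.
  by move=> n; have [_ /(_ ((0, 0, delta_mx i j, 0, 0) : Z))[]] := CF n.+1.
move=> [[[[x p] M] m] th] /= Em; apply: eq_derive_line => s.
rewrite (_ : _ + _ = ((x, p, s *: delta_mx i j + M, m, th) : Z)).
  by rewrite FG.
by congr (_, _, _, _, _); rewrite /= scaler0 add0r.
Qed.

Context (h : ('rV[R]_d -> R) -> 'rV[R]_d -> R) (h_op : operator_Mac_C h) (h_reg : h_regularity h).

Definition along G (eta v : 'rV[R]_d -> R) (x : 'rV[R]_d) : R :=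
  G x (grad v x) (hess v x) (eta x) (h eta x).

Lemma grad_periodic (v : 'rV[R]_d -> R) : Cinfty v -> periodic (grad v).
Proof.
move=> Cv x k; apply/rowP => i; rewrite !mxE.
by have [] := Cinfty_partial i Cv.
Qed.

Lemma hess_periodic (v : 'rV[R]_d -> R) : Cinfty v -> periodic (hess v).
Proof.
move=> Cv x k; apply/matrixP => i j; rewrite [LHS]mxE [RHS]mxE.
by have [] := Cinfty_partials [:: i; j] Cv.
Qed.

Lemma Cinfty_operator eta : CinftyE E eta -> Cinfty (h eta).
Proof. by move=> [Ce Ee]; apply: h_regularity_Cinfty => // x; apply: E_ge0; exact: Ee. Qed.

Lemma Cinfty_along G eta v : H_smoothness E G -> CinftyE E eta -> Cinfty v ->
  Cinfty (along G eta v).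
Proof.
move=> [pG [U [F [oU SU CF FG]]]] CE Cv; have [Ce Ee] := CE.
have Ch := Cinfty_operator CE.
rewrite (_ : along G eta v = fun x => F (jet eta (h eta) v x)); last first.
  by apply/funext => x; rewrite FG//=; exact: Ee.
apply: (Cinfty_comp_jet oU CF) => //; first by move=> x; apply: SU; exact: Ee.
move=> x k; rewrite !FG; [|exact: Ee|exact: Ee] => /=.
rewrite (grad_periodic Cv) (hess_periodic Cv) Ce.1 Ch.1.
exact: (pG _ _ _ _ (Ee x)).
Qed.

Lemma CinftyE_segment eta eta' (t : R) : CinftyE E eta -> CinftyE E eta' -> 0 <= t <= 1 ->
  CinftyE E (fun x => eta x + t * (eta' x - eta x)).
Proof.
move=> [Ce Ee] [Ce' Ee'] t01; split; last by move=> x; apply: E_convex; [exact: Ee|exact: Ee'|].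
by apply: CinftyD => //; apply: CinftyZ; exact: CinftyB.
Qed.

Lemma Cinfty_segment v v' (t : R) : Cinfty v -> Cinfty v' ->
  Cinfty (fun x : 'rV[R]_d => v x + t * (v' x - v x)).
Proof. by move=> Cv Cv'; apply: CinftyD => //; apply: CinftyZ; exact: CinftyB. Qed.

Lemma partials_segment s v v' (t : R) : Cinfty v -> Cinfty v' ->
  partials s (fun x : 'rV[R]_d => v x + t * (v' x - v x)) =
  fun x => partials s v x + t * (partials s v' x - partials s v x).
Proof.
move=> Cv Cv'.
rewrite (_ : (fun x => _) = fun x => (1 - t) * v x - (- t) * v' x); last first.
  by apply/funext => x; ring.
have C1 := CinftyZ (1 - t) Cv; have C2 := CinftyZ (- t) Cv'.
by apply/funext => x; rewrite partialsB// !partialsZ//; ring.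
Qed.

Lemma segment_continuous_along G eta v eta' v' : H_smoothness E G ->
  CinftyE E eta -> Cinfty v -> CinftyE E eta' -> Cinfty v' ->
  segment_continuous (fun t : R => along G (fun x => eta x + t * (eta' x - eta x))
    (fun x => v x + t * (v' x - v x))).
Proof.
move=> SG CE Cv CE' Cv'.
pose et (t : R) x := eta x + t * (eta' x - eta x).
pose vt (t : R) x := v x + t * (v' x - v x).
have Cet (t : R) : 0 <= t <= 1 -> CinftyE E (et t) by exact: CinftyE_segment.
have Cvt t : Cinfty (vt t) by exact: Cinfty_segment.
split=> [t t01|e e0]; first exact: (Cinfty_cper (Cinfty_along SG (Cet t t01) (Cvt t))).
have pvt s (t : R) x : partials s (vt t) x = partials s v x + t * (partials s v' x - partials s v x).
  by rewrite (partials_segment s t Cv Cv').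
have Ch := Cinfty_operator CE.
have [pG [U [F [oU SU CF FG]]]] := SG; have [Ce Ee] := CE; have [Ce' Ee'] := CE'.
have jU x : U (jet eta (h eta) v x) by apply: SU; exact: Ee.
have [dl dl0 Hdl] := uniform_comp_compact (@compact_unit_cube R d)
  (continuous_jet Ce Ch Cv) (fun x => class_C_continuous (CF 0%N) (jU x)) e0.
have line (f g : 'rV[R]_d -> R) : Cinfty f -> Cinfty g ->
    exists2 delta : R, 0 < delta & forall t : R, 0 <= t <= 1 -> t <= delta ->
      forall x, `|f x - (f x + t * (g x - f x))| <= dl.
  move=> Cf Cg; have [_ /(_ _ dl0)[a a0 Ha]] :=
    segment_continuous_line (Cinfty_cper Cf) (Cinfty_cper Cg).
  by exists a => // t t01 ta x; have := Ha t t01 ta x; rewrite mul0r addr0 distrC.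
have [a1 a10 H1] := line _ _ Ce Ce'.
have [a2 a20 H2] := operator_segment_continuous h_op h_reg Ce Ce'
  (fun x => E_ge0 (Ee x)) (fun x => E_ge0 (Ee' x)) dl0.
have /choice[b3 H3] i : exists delta : R, 0 < delta /\ forall t : R, 0 <= t <= 1 -> t <= delta ->
    forall x, `|partial i v x - partial i (vt t) x| <= dl.
  have [a a0 Ha] := line _ _ (Cinfty_partial i Cv) (Cinfty_partial i Cv').
  exists a; split=> // t t01 ta x; have -> : partial i (vt t) x = _ := pvt [:: i] t x.
  exact: Ha.
have /choice[b4 H4] (ij : 'I_d * 'I_d) : exists delta : R, 0 < delta /\ forall t : R, 0 <= t <= 1 -> t <= delta ->
    forall x, `|partials [:: ij.1; ij.2] v x - partials [:: ij.1; ij.2] (vt t) x| <= dl.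
  have [a a0 Ha] := line _ _ (Cinfty_partials [:: ij.1; ij.2] Cv) (Cinfty_partials [:: ij.1; ij.2] Cv').
  exists a; split=> // t t01 ta x; rewrite pvt.
  exact: Ha.
pose a := Num.min (Num.min a1 a2) (Num.min (\big[Num.min/1]_i b3 i) (\big[Num.min/1]_ij b4 ij)).
exists a.
  rewrite !lt_min a10 a20 /=; apply/andP; split; apply: lt_bigmin => // i _.
    exact: (H3 i).1.
  exact: (H4 i).1.
move=> t t01; rewrite !le_min => /andP[/andP[ta1 ta2] /andP[ta3 ta4]] x0.
have z01 : 0 <= (0 : R) <= 1 by rewrite lexx ler01.
have et0 : et 0 = eta by apply/funext => x; rewrite /et mul0r addr0.
have vt0 : vt 0 = v by apply/funext => x; rewrite /vt mul0r addr0.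
rewrite -/(et t) -/(vt t) -/(et 0) -/(vt 0) et0 vt0.
(* Periodicity moves the point into the unit cube, where [Hdl] provides a single radius. *)
have pe (s : R) (s01 : 0 <= s <= 1) : periodic (along G (et s) (vt s)).
  by have [] := Cinfty_along SG (Cet s s01) (Cvt s).
rewrite -(periodic_frac_part x0 (pe t t01)).
have := periodic_frac_part x0 (pe 0 z01); rewrite et0 vt0 => <-.
set x := x0 - _; have Kx : unit_cube x by exact: frac_part_cube.
have -> : along G (et t) (vt t) x = F (jet (et t) (h (et t)) (vt t) x).
  by rewrite FG//; exact: (Cet t t01).2.
have -> : along G eta v x = F (jet eta (h eta) v x) by rewrite FG//; exact: Ee.
apply: Hdl => //; apply: jet_norm_le; first exact: ltW.
- move=> i; apply: (H3 i).2 => //; apply: le_trans ta3 _; exact: bigmin_le_cond.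
- move=> i j; apply: (H4 (i, j)).2 => //; apply: le_trans ta4 _; exact: bigmin_le_cond.
- exact: H1.
- by rewrite distrC; have /andP[t0 t1] := t01; exact: H2.
Qed.

End hamiltonian_composition.

(** * The pairing with A and Galerkin solutions *)

Section galerkin.
Context {R : realType} {d : nat}.
Context (E : set R) (hE : E = [set m | 0 < m] \/ E = [set m | 0 <= m]).
Context (h : ('rV[R]_d -> R) -> 'rV[R]_d -> R) (h_op : operator_Mac_C h) (h_reg : h_regularity h).
Context (H : Hamiltonian R d) (H_smooth : H_smoothness E H).
Implicit Types eta v phi psi : 'rV[R]_d -> R.
Local Notation Dp i := (along h (DpH H i)).
Local Notation DM i j := (along h (DMH H i j)).

Lemma Cinfty_A1 eta v : CinftyE E eta -> Cinfty v -> Cinfty (A1 h H eta v).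
Proof.
move=> CE Cv; have C := Cinfty_along hE h_op h_reg H_smooth CE Cv.
by apply: CinftyB => //; exact: CinftyN.
Qed.

Lemma Cinfty_flux1 i eta v : CinftyE E eta -> Cinfty v ->
  Cinfty (fun x => eta x * Dp i eta v x).
Proof.
move=> CE Cv; apply: CinftyM; first exact: CE.1.
exact: (Cinfty_along hE h_op h_reg (H_smoothness_DpH i H_smooth) CE Cv).
Qed.

Lemma Cinfty_flux2 i j eta v : CinftyE E eta -> Cinfty v ->
  Cinfty (fun x => eta x * DM i j eta v x).
Proof.
move=> CE Cv; apply: CinftyM; first exact: CE.1.
exact: (Cinfty_along hE h_op h_reg (H_smoothness_DMH i j H_smooth) CE Cv).
Qed.

Lemma Cinfty_A2 eta v : CinftyE E eta -> Cinfty v -> Cinfty (A2 h H eta v).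
Proof.
move=> CE Cv.
have C1 : Cinfty (fun x => \sum_i partial i (fun y => eta y * Dp i eta v y) x).
  by apply: Cinfty_sum => i; apply: Cinfty_partial; exact: Cinfty_flux1.
have C2 : Cinfty (fun x => \sum_i \sum_j partials [:: i; j] (fun y => eta y * DM i j eta v y) x).
  by do 2 (apply: Cinfty_sum => ?); apply: Cinfty_partials; exact: Cinfty_flux2.
exact: CinftyB (CinftyD (CinftyB CE.1 C1) C2) (Cinfty_cst 1).
Qed.

(** The tested pair is kept separate from the argument of [A]: in the limit it will be a pair of
    merely integrable functions. *)
Definition pairing phi psi eta v : R :=
  tint (fun x => phi x * A1 h H eta v x) + tint (fun x => psi x * A2 h H eta v x).

(** The second component after all derivatives have moved to [psi]. No derivative of a composition
    with [H] remains, so continuity along segments reduces to that of values of [DpH] and [DMH]. *)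
Definition weak_A2 psi eta v x : R :=
  psi x * eta x + \sum_i partial i psi x * (eta x * Dp i eta v x)
  + \sum_i \sum_j partials [:: j; i] psi x * (eta x * DM i j eta v x) - psi x.

Lemma tint_weak_A2 psi eta v : Cinfty psi -> CinftyE E eta -> Cinfty v ->
  tint (fun x => psi x * A2 h H eta v x) = tint (weak_A2 psi eta v).
Proof.
move=> Cpsi CE Cv; have [Ce _] := CE.
have C1 i := Cinfty_flux1 i CE Cv; have C2 i j := Cinfty_flux2 i j CE Cv.
have I1 i : Cinfty (fun x => psi x * partial i (fun y => eta y * Dp i eta v y) x).
  exact: (CinftyM Cpsi (Cinfty_partial i (C1 i))).
have I2 i j : Cinfty (fun x => psi x * partials [:: i; j] (fun y => eta y * DM i j eta v y) x).
  exact: (CinftyM Cpsi (Cinfty_partials [:: i; j] (C2 i j))).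
have J1 i : Cinfty (fun x => partial i psi x * (eta x * Dp i eta v x)).
  exact: (CinftyM (Cinfty_partial i Cpsi) (C1 i)).
have J2 i j : Cinfty (fun x => partials [:: j; i] psi x * (eta x * DM i j eta v x)).
  exact: (CinftyM (Cinfty_partials [:: j; i] Cpsi) (C2 i j)).
have K0 : Cinfty (fun x => psi x * eta x) := CinftyM Cpsi Ce.
have KI1 := Cinfty_sum (index_enum 'I_d) I1; have KJ1 := Cinfty_sum (index_enum 'I_d) J1.
have KI2 := Cinfty_sum (index_enum 'I_d) (fun i => Cinfty_sum (index_enum 'I_d) (I2 i)).
have KJ2 := Cinfty_sum (index_enum 'I_d) (fun i => Cinfty_sum (index_enum 'I_d) (J2 i)).
have T (a b c e : 'rV[R]_d -> R) : Cinfty a -> Cinfty b -> Cinfty c -> Cinfty e ->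
    tint (fun x => a x + b x + c x - e x) = tint a + tint b + tint c - tint e.
  move=> /Cinfty_tintegrable Ia /Cinfty_tintegrable Ib /Cinfty_tintegrable Ic /Cinfty_tintegrable Ie.
  rewrite tintB ?tintD//; by do ?apply: tintegrableD.
rewrite /weak_A2 (T _ _ _ _ K0 KJ1 KJ2 Cpsi).
rewrite (_ : (fun x => _) = fun x => psi x * eta x
   + - (\sum_i psi x * partial i (fun y => eta y * Dp i eta v y) x)
   + \sum_i \sum_j psi x * partials [:: i; j] (fun y => eta y * DM i j eta v y) x - psi x); last first.
  apply/funext => x; rewrite /A2 mulrBr mulr1 mulrDr mulrBr -mulr_sumr; congr (_ - _ + _ - _).
  by rewrite mulr_sumr; apply: eq_bigr => i _; rewrite mulr_sumr.
rewrite (T _ _ _ _ K0 (CinftyN KI1) KI2 Cpsi).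
congr (_ + _ + _ - _).
- rewrite (_ : (fun x => - _) = fun x => -1 * (\sum_i psi x * partial i (fun y => eta y * Dp i eta v y) x)); last first.
    by apply/funext => x; rewrite mulN1r.
  rewrite (tintZ _ (Cinfty_tintegrable KI1)).
  rewrite (tint_sum _ (fun i => Cinfty_tintegrable (I1 i))).1 (tint_sum _ (fun i => Cinfty_tintegrable (J1 i))).1.
  by rewrite mulN1r -sumrN; apply: eq_bigr => i _; rewrite (tint_parts i Cpsi (C1 i)) opprK.
- rewrite (tint_sum _ (fun i => Cinfty_tintegrable (Cinfty_sum _ (I2 i)))).1.
  rewrite (tint_sum _ (fun i => Cinfty_tintegrable (Cinfty_sum _ (J2 i)))).1.
  apply: eq_bigr => i _.
  rewrite (tint_sum _ (fun j => Cinfty_tintegrable (I2 i j))).1 (tint_sum _ (fun j => Cinfty_tintegrable (J2 i j))).1.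
  apply: eq_bigr => j _.
  by rewrite (tint_partials_parts [:: i; j] Cpsi (C2 i j)) [size _]/= sqrrN expr1n mul1r.
Qed.

Lemma segment_continuous_pairing phi psi eta v eta' v' : Cinfty phi -> Cinfty psi ->
  CinftyE E eta -> Cinfty v -> CinftyE E eta' -> Cinfty v' ->
  forall e : R, 0 < e -> exists2 delta : R, 0 < delta &
    forall t : R, 0 <= t <= 1 -> t <= delta ->
      `|pairing phi psi (fun x => eta x + t * (eta' x - eta x)) (fun x => v x + t * (v' x - v x))
        - pairing phi psi eta v| <= e.
Proof.
move=> Cphi Cpsi CE Cv CE' Cv' e e0.
pose et (t : R) x := eta x + t * (eta' x - eta x).
pose vt (t : R) x := v x + t * (v' x - v x).
have Cet (t : R) : 0 <= t <= 1 -> CinftyE E (et t) by exact: CinftyE_segment.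
have Cvt (t : R) : Cinfty (vt t) by exact: Cinfty_segment.
have sC f : Cinfty f -> segment_continuous (fun=> f).
  by move=> Cf; apply: segment_continuous_cst; exact: Cinfty_cper.
have se : segment_continuous et.
  by apply: segment_continuous_line; apply: Cinfty_cper; [exact: CE.1|exact: CE'.1].
have sG G : H_smoothness E G -> segment_continuous (fun t => along h G (et t) (vt t)).
  by move=> SG; exact: (segment_continuous_along hE h_op h_reg SG CE Cv CE' Cv').
have sN f : segment_continuous f -> segment_continuous (fun (t : R) x => -1 * f t x).
  by move=> sf; apply: segment_continuousM => //; apply: segment_continuous_cst; exact: cper_cst.
have S1 : segment_continuous (fun (t : R) x => phi x * (-1 * vt t x + -1 * along h H (et t) (vt t) x)).
  apply: segment_continuousM; first exact: sC.
  apply: segment_continuousD; apply: sN; last exact: sG.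
  by apply: segment_continuous_line; exact: Cinfty_cper.
have S2 : segment_continuous (fun t x => psi x * et t x + \sum_i partial i psi x * (et t x * Dp i (et t) (vt t) x)
  + \sum_i \sum_j partials [:: j; i] psi x * (et t x * DM i j (et t) (vt t) x) + -1 * psi x).
  apply: segment_continuousD; last by apply: sN; exact: sC.
  apply: segment_continuousD; first apply: segment_continuousD.
  - by apply: segment_continuousM => //; exact: sC.
  - apply: segment_continuous_sum => i; apply: segment_continuousM; first by apply: sC; exact: Cinfty_partial.
    by apply: segment_continuousM => //; apply: sG; exact: H_smoothness_DpH.
  - apply: segment_continuous_sum => i; apply: segment_continuous_sum => j.
    apply: segment_continuousM; first by apply: sC; exact: Cinfty_partials.
    by apply: segment_continuousM => //; apply: sG; exact: H_smoothness_DMH.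
have e2 : 0 < e / 2 by rewrite divr_gt0.
have [a a0 Ha] := segment_continuous_tint S1 e2; have [b b0 Hb] := segment_continuous_tint S2 e2.
exists (Num.min a b) => [|t t01]; first by rewrite lt_min a0.
rewrite le_min => /andP[ta tb].
have et0 : et 0 = eta by apply/funext => x; rewrite /et mul0r addr0.
have vt0 : vt 0 = v by apply/funext => x; rewrite /vt mul0r addr0.
have P (s : R) : 0 <= s <= 1 -> pairing phi psi (et s) (vt s) =
    tint (fun x => phi x * (-1 * vt s x + -1 * along h H (et s) (vt s) x)) +
    tint (fun x => psi x * et s x + \sum_i partial i psi x * (et s x * Dp i (et s) (vt s) x)
  + \sum_i \sum_j partials [:: j; i] psi x * (et s x * DM i j (et s) (vt s) x) + -1 * psi x).
  move=> s01; rewrite /pairing tint_weak_A2//; last exact: Cet.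
  congr (_ + _); apply: eq_tint => x; first by rewrite /A1 !mulN1r.
  by rewrite /weak_A2 mulN1r.
have z01 : 0 <= (0 : R) <= 1 by rewrite lexx ler01.
have -> : pairing phi psi eta v = pairing phi psi (et 0) (vt 0) by rewrite et0 vt0.
rewrite -[X in X - _]/(pairing phi psi (et t) (vt t)) (P _ t01) (P _ z01).
rewrite (_ : forall p q r s : R, p + q - (r + s) = (p - r) + (q - s)); last by move=> *; ring.
by rewrite [leRHS]splitr (le_trans (ler_normD _ _))// lerD//; [exact: Ha|exact: Hb].
Qed.

Lemma pairingB phi psi phi' psi' eta v : Cinfty phi -> Cinfty psi -> Cinfty phi' -> Cinfty psi' ->
  CinftyE E eta -> Cinfty v ->
  pairing (fun x => phi x - phi' x) (fun x => psi x - psi' x) eta v =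
  pairing phi psi eta v - pairing phi' psi' eta v.
Proof.
move=> C1 C2 C3 C4 CE Cv; have CA1 := Cinfty_A1 CE Cv; have CA2 := Cinfty_A2 CE Cv.
have T (f f' k : 'rV[R]_d -> R) : Cinfty f -> Cinfty f' -> Cinfty k ->
    tint (fun x => (f x - f' x) * k x) = tint (fun x => f x * k x) - tint (fun x => f' x * k x).
  move=> Cf Cf' Ck; rewrite -tintB; [|by apply: Cinfty_tintegrable; exact: CinftyM..].
  by apply: eq_tint => x; rewrite mulrBl.
by rewrite /pairing (T _ _ _ C1 C3 CA1) (T _ _ _ C2 C4 CA2) [in RHS]opprD [RHS]addrACA.
Qed.

Context (A_mono : A_monotone E h H).

Lemma pairing_monotone eta v eta' v' : CinftyE E eta -> Cinfty v -> CinftyE E eta' -> Cinfty v' ->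
  pairing (fun x => eta x - eta' x) (fun x => v x - v' x) eta' v' <=
  pairing (fun x => eta x - eta' x) (fun x => v x - v' x) eta v.
Proof.
move=> CE Cv CE' Cv'; rewrite -subr_ge0; have := A_mono CE Cv CE' Cv'; congr (_ <= _).
have [Ce _] := CE; have [Ce' _] := CE'.
have T (f k k' : 'rV[R]_d -> R) : Cinfty f -> Cinfty k -> Cinfty k' ->
    tint (fun x => (k x - k' x) * f x) = tint (fun x => f x * k x) - tint (fun x => f x * k' x).
  move=> Cf Ck Ck'; rewrite -tintB; [|by apply: Cinfty_tintegrable; exact: CinftyM..].
  by apply: eq_tint => x; rewrite mulrC mulrBr.
rewrite (T _ _ _ (CinftyB Ce Ce') (Cinfty_A1 CE Cv) (Cinfty_A1 CE' Cv')).
rewrite (T _ _ _ (CinftyB Cv Cv') (Cinfty_A2 CE Cv) (Cinfty_A2 CE' Cv')).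
by rewrite /pairing [in RHS]opprD [RHS]addrACA.
Qed.

Definition comb N (l : 'rV[R]_N) (f : 'I_N -> 'rV[R]_d -> R) x := \sum_i l 0 i * f i x.

Lemma Cinfty_comb N (l : 'rV[R]_N) f : (forall i, Cinfty (f i)) -> Cinfty (comb l f).
Proof. by move=> Cf; apply: Cinfty_sum => i; exact: CinftyZ. Qed.

Lemma E_comb N (l : 'rV[R]_N) (a : 'I_N -> R) : simplex l -> (forall i, E (a i)) ->
  E (\sum_i l 0 i * a i).
Proof.
move=> [l0 l1] Ea; case: hE => EE; rewrite EE /=; last first.
  by apply: sumr_ge0 => i _; rewrite mulr_ge0//; apply: (E_ge0 hE).
have [i li] : exists i, 0 < l 0 i.
  apply/not_existsP => H0; suff : \sum_i l 0 i = 0 by rewrite l1 => /eqP; rewrite oner_eq0.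
  apply: big1 => i _; apply/eqP; rewrite eq_le l0 andbT leNgt; apply/negP; exact: H0.
have a0 j : 0 < a j by have := Ea j; rewrite EE.
rewrite (bigD1 i)//= ltr_wpDr ?mulr_gt0//.
by apply: sumr_ge0 => j _; rewrite mulr_ge0// ltW.
Qed.

Lemma CinftyE_comb N (l : 'rV[R]_N) f : simplex l -> (forall i, CinftyE E (f i)) ->
  CinftyE E (comb l f).
Proof.
move=> Sl Cf; split; first by apply: Cinfty_comb => i; exact: (Cf i).1.
by move=> x; apply: E_comb => // i; exact: (Cf i).2.
Qed.

Lemma comb_segment N (l m : 'rV[R]_N) f (t : R) :
  comb (l + t *: (m - l)) f = fun x => comb l f x + t * (comb m f x - comb l f x).
Proof.
apply/funext => x; rewrite /comb -sumrB mulr_sumr -big_split /=.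
by apply: eq_bigr => i _; rewrite !mxE; ring.
Qed.

Lemma pairing_comb N (l : 'rV[R]_N) f g eta v : (forall i, Cinfty (f i)) -> (forall i, Cinfty (g i)) ->
  CinftyE E eta -> Cinfty v ->
  pairing (comb l f) (comb l g) eta v = \sum_i l 0 i * pairing (f i) (g i) eta v.
Proof.
move=> Cf Cg CE Cv; have CA1 := Cinfty_A1 CE Cv; have CA2 := Cinfty_A2 CE Cv.
have T (k : 'I_N -> 'rV[R]_d -> R) q : (forall i, Cinfty (k i)) -> Cinfty q ->
    tint (fun x => comb l k x * q x) = \sum_i l 0 i * tint (fun x => k i x * q x).
  move=> Ck Cq; rewrite (_ : (fun x => _) = fun x => \sum_i l 0 i * (k i x * q x)); last first.
    by apply/funext => x; rewrite mulr_suml; apply: eq_bigr => i _; rewrite mulrA.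
  have Ckq i : tintegrable (fun x => k i x * q x) by apply: Cinfty_tintegrable; exact: CinftyM.
  rewrite (tint_sum _ (fun i => tintegrableZ (l 0 i) (Ckq i))).1.
  by apply: eq_bigr => i _; rewrite tintZ.
rewrite /pairing (T _ _ Cf CA1) (T _ _ Cg CA2) -big_split /=.
by apply: eq_bigr => i _; rewrite mulrDr.
Qed.

(** Apply Minty's lemma to [c l i], the pairing of the i-th test with [A] at the combination with
    weights [l]. As [comb] is linear in the weights, monotonicity of [A] is exactly that of [c]. *)
Lemma galerkin_solution N (eta v : 'I_N.+1 -> 'rV[R]_d -> R) :
  (forall i, CinftyE E (eta i)) -> (forall i, Cinfty (v i)) ->
  exists2 l, simplex l & forall i,
    0 <= pairing (fun x => eta i x - comb l eta x) (fun x => v i x - comb l v x)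
           (comb l eta) (comb l v).
Proof.
move=> CE Cv.
have Ce i : Cinfty (eta i) by exact: (CE i).1.
pose c l i := pairing (eta i) (v i) (comb l eta) (comb l v).
have cE l i : c l i = pairing (eta i) (v i) (comb l eta) (comb l v) by [].
clearbody c.
have Cl l : simplex l -> CinftyE E (comb l eta) by move=> Sl; exact: CinftyE_comb.
have Cvl l : Cinfty (comb l v) by exact: Cinfty_comb.
have [mu nu Smu Snu|mu nu Smu Snu i e e0|l Sl Hl] := @simplex_variational_inequality R N c.
- have B l : simplex l -> \sum_i (mu 0 i - nu 0 i) * c l i =
     pairing (fun x => comb mu eta x - comb nu eta x) (fun x => comb mu v x - comb nu v x) (comb l eta) (comb l v).
    move=> Sl; rewrite pairingB//; [|exact: (Cl _ Smu).1|exact: (Cl _ Snu).1|exact: Cl].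
    rewrite !pairing_comb//; [|exact: Cl..].
    by rewrite -sumrB; apply: eq_bigr => i _; rewrite cE mulrBl.
  under eq_bigr do rewrite mulrBr.
  rewrite sumrB (B _ Smu) (B _ Snu) subr_ge0.
  exact: (pairing_monotone (Cl _ Smu) (Cvl mu) (Cl _ Snu) (Cvl nu)).
- have [dl dl0 Hdl] := segment_continuous_pairing (Ce i) (Cv i) (Cl _ Smu) (Cvl mu) (Cl _ Snu) (Cvl nu) e0.
  exists dl => // t t0 t1 td; rewrite !cE !comb_segment; apply: Hdl => //; exact/andP.
- exists l => // i; rewrite pairingB//; [|exact: (Cl _ Sl).1|exact: Cl].
  rewrite subr_ge0 pairing_comb//; last exact: Cl.
  have := Hl i; rewrite cE; congr (_ <= _).
  by apply: eq_bigr => j _; rewrite cE.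
Qed.

End galerkin.

(** * Poincare inequality *)

Section poincare.
Context {R : realType}.
Local Notation U := (uniform_prob (@ltr01 R)).

Lemma tint_cons_le n (f g : 'rV[R]_n.+1 -> R) (A B : R) :
  tmeas f -> (forall x, `|f x| <= A) -> tmeas g -> (forall x, `|g x| <= B) ->
  (forall s : R, tint (fun y => f (consrow s y)) <= tint (fun y => g (consrow s y))) ->
  tint f <= tint g.
Proof.
move=> mf fA mg gB H; rewrite (tint_cons mf fA) (tint_cons mg gB).
have I (k : 'rV[R]_n.+1 -> R) (C : R) : tmeas k -> (forall x, `|k x| <= C) ->
    U.-integrable setT (EFin \o (fun s => tint (fun y => k (consrow s y)))).
  move=> mk kC.
  pose K (z : measurableTypeR R * n.-tuple (measurableTypeR R)) := k (consrow z.1 (row_of z.2)).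
  have mK : measurable_fun setT K.
    have -> : K = (k \o @row_of R n.+1) \o @cons_tuple R n.
      by apply/funext => z; rewrite /K /= row_of_cons.
    by apply: measurableT_comp => //; exact: measurable_cons_tuple.
  have IK : (U \x torus_leb R n)%E.-integrable setT (EFin \o K).
    apply: measurable_bounded_integrable => //.
      by rewrite (le_lt_trans (probability_le1 _ _))// ltry.
    by exists C; split; [exact: num_real|move=> x Cx t _; exact: le_trans (kC _) (ltW Cx)].
  have := integrable_fubini_F IK; congr (integrable _ _ _); apply/funext => s.
  rewrite /fubini_F /= /tint /Rintegral fineK//.
  apply: integrable_fin_num => //.
  exact: (tintegrable_bounded (tmeas_consrow mk s) (fun y => kC _)).
by apply: le_Rintegral => //; [exact: I mf fA|exact: I mg gB].
Qed.

Lemma cper_powR d (f : 'rV[R]_d -> R) (p : R) : 0 <= p -> cper f ->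
  tmeas (fun x => `|f x| `^ p) /\ exists2 B : R, 0 <= B & forall x, `| `|f x| `^ p | <= B.
Proof.
move=> p0 cf; split.
  apply: (@measurableT_comp _ _ _ _ _ _ (fun a : R => a `^ p)); first exact: measurable_powR.
  by have := cper_tmeas (cper_norm cf).
have [B B0 fB] := cper_bounded cf; exists (B `^ p) => [|x]; first exact: powR_ge0.
by rewrite ger0_norm ?powR_ge0// ge0_ler_powR// nnegrE.
Qed.

Lemma powR_cper_tintegrable d (f : 'rV[R]_d -> R) (p : R) : 0 <= p -> cper f ->
  tintegrable (fun x => `|f x| `^ p).
Proof.
by move=> p0 cf; have [mf [B _ fB]] := cper_powR p0 cf; exact: tintegrable_bounded mf fB.
Qed.

Lemma le_powRD (a b p : R) : 0 <= a -> 0 <= b -> 0 <= p ->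
  (a + b) `^ p <= 2 `^ p * (a `^ p + b `^ p).
Proof.
move=> a0 b0 p0; wlog ab : a b a0 b0 / a <= b => [W|].
  have [ab|/ltW ba] := leP a b; first exact: W.
  by rewrite addrC [a `^ p + _]addrC; exact: W.
apply: (@le_trans _ _ ((2 * b) `^ p)).
  by apply: ge0_ler_powR; rewrite ?nnegrE// ?addr_ge0 ?mulr_ge0//; lra.
by rewrite powRM// ler_wpM2l ?powR_ge0// lerDr powR_ge0.
Qed.

(** Jensen's inequality for the p-th power, by integrating Young's inequality for the product of |f
    x| and A^(p-1), with A the mean of |f|. *)
Lemma powR_tint_le d (f : 'rV[R]_d -> R) (p : R) : 1 <= p -> cper f ->
  (tint (fun x => `|f x|)) `^ p <= tint (fun x => `|f x| `^ p).
Proof.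
move=> p1 cf; set A := tint _.
have A0 : 0 <= A by apply: tint_ge0 => x; exact: normr_ge0.
have I0 := tintegrable_norm (cper_tintegrable cf).
have p0 : 0 < p by apply: lt_le_trans p1.
have Ip := powR_cper_tintegrable (ltW p0) cf.
have [->|pn1] := eqVneq p 1.
  rewrite powRr1//; apply: le_tint => //; last by move=> x; rewrite powRr1.
  by apply: powR_cper_tintegrable.
have p1' : 1 < p by rewrite lt_def pn1.
pose q := p / (p - 1).
have pq : p^-1 + q^-1 = 1 by rewrite /q invf_div; field; rewrite gt_eqF ?subr_gt0// gt_eqF.
have q0 : 0 < q by rewrite divr_gt0// subr_gt0.
have AA : A * A `^ (p - 1) = A `^ p.
  have [->|A1] := eqVneq A 0; first by rewrite mul0r powR0// gt_eqF.
  by rewrite -{1}(powRr1 A0) -powRD ?A1 ?implybT//; congr (_ `^ _); ring.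
have Aq : (A `^ (p - 1)) `^ q = A `^ p.
  by rewrite -powRrM /q mulrC divfK// gt_eqF// subr_gt0.
have : A * A `^ (p - 1) <= (tint (fun x => `|f x| `^ p)) / p + A `^ p / q.
  have -> : A * A `^ (p - 1) = tint (fun x => A `^ (p - 1) * `|f x|) by rewrite tintZ// mulrC.
  have Ic (c : R) : @tintegrable R d (fun=> c) := cper_tintegrable (cper_cst c).
  have -> : tint (fun x => `|f x| `^ p) / p + A `^ p / q =
      tint (fun x => p^-1 * (`|f x| `^ p) + A `^ p / q).
    by rewrite tintD// ?tintZ// ?tint_cst 1?mulrC//; exact: tintegrableZ.
  apply: le_tint; first exact: tintegrableZ.
    by apply: tintegrableD => //; exact: tintegrableZ.
  by move=> x; rewrite mulrC [p^-1 * _]mulrC -Aq; apply: conjugate_powR => //; exact: powR_ge0.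
rewrite AA -lerBlDr.
have -> : A `^ p - A `^ p / q = A `^ p / p.
  by rewrite -{1}[A `^ p]mulr1 -pq mulrDr addrK.
by rewrite ler_pM2r// invr_gt0.
Qed.

Lemma oscillation_le (p p' : R -> R) (B : R) (s t : R) : continuous p' ->
  (forall a, `|p' a| <= B) -> (forall a : R, is_derive a 1 p (p' a)) ->
  0 <= s -> s <= t -> t <= 1 -> `|p t - p s| <= \int[U]_a `|p' a|.
Proof.
move=> cp' p'B Dp s0 st t1.
have [->|sn] := eqVneq s t; first by rewrite subrr normr0; apply: Rintegral_ge0.
have {}st : s < t by rewrite lt_def eq_sym sn.
have mp' : measurable_fun setT p' by exact: continuous_measurable_fun.
have mn : measurable_fun setT (fun a => `|p' a|) by exact: measurableT_comp.
rewrite (@Rintegral_uniform01 _ _ B)//; last by move=> a; rewrite normr_id.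
have cp : continuous p.
  by move=> a; have [/derivable1_diffP/differentiable_continuous] := Dp a.
have FE : \int[lebesgue_measure]_(a in `[s, t]) p' a = p t - p s.
  rewrite /Rintegral (@continuous_FTC2 _ p' p)//.
  - exact: continuous_subspaceT.
  - split => [a _||]; first by have [] := Dp a.
    + by apply: cvg_at_right_filter; exact: cp.
    + by apply: cvg_at_left_filter; exact: cp.
  - by move=> a _; rewrite derive1E; have [] := Dp a.
have I u v : u < v -> (@lebesgue_measure R).-integrable `[u, v]%classic (EFin \o p').
  move=> uv.
  have luv : (@lebesgue_measure R [set` `[u, v]] < +oo)%E.
    by rewrite lebesgue_measure_itv /= lte_fin uv -EFinB ltry.
  apply: measurable_bounded_integrable => //.
  - exact: measurable_funTS.
  - by exists B; split; [exact: num_real|move=> x Bx y _; exact: le_trans (p'B _) (ltW Bx)].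
rewrite -FE; apply: (le_trans (le_normr_Rintegral _ (I _ _ st))) => //.
apply: fine_le.
- by apply: integrable_fin_num => //; exact: (integrable_norm (I _ _ st)).
- by apply: integrable_fin_num => //; exact: (integrable_norm (I _ _ ltr01)).
apply: ge0_subset_integral => //.
- apply/measurable_EFinP; exact: measurable_funTS.
- by move=> a /=; rewrite !in_itv /= => /andP[sa ta]; rewrite (le_trans s0 sa) (le_trans ta t1).
Qed.

End poincare.

Section poincare_induction.
Context {R : realType}.
Local Notation U := (uniform_prob (@ltr01 R)).

Lemma consrow_affine n (s : R) (y : 'rV[R]_n) :
  consrow s y = consrow s 0 + \sum_(ce <- [seq ((fun y : 'rV[R]_n => y 0 i), delta_mx 0 (lift ord0 i) : 'rV[R]_n.+1) | i <- index_enum 'I_n]) ce.1 y *: ce.2.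
Proof.
rewrite big_map /=; apply/rowP => j; rewrite !mxE summxE.
case: unliftP => [k ->|->] /=.
  rewrite mxE add0r (bigD1 k)//= !mxE !eqxx mulr1 big1 ?addr0// => i ik.
  by rewrite !mxE (inj_eq lift_inj) [k == i]eq_sym (negPf ik) andbF mulr0.
by rewrite big1 ?addr0// => i _; rewrite !mxE eqxx /= mulr0.
Qed.

Lemma Cinfty_slice n (f : 'rV[R]_n.+1 -> R) (s : R) : Cinfty f -> Cinfty (fun y => f (consrow s y)).
Proof.
move=> Cf; apply/CinftyP; split=> [y k|m].
  pose k' : 'rV[int]_n.+1 := \row_i oapp (fun j => k 0 j) 0 (unlift ord0 i).
  rewrite -[RHS](Cf.1 _ k'); congr f; apply/rowP => j; rewrite !mxE.
  by case: (unlift ord0 j) => [i|] /=; rewrite ?mxE ?addr0.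
rewrite (_ : (fun y => _) = fun y => f (consrow s 0 + \sum_(ce <- [seq ((fun y : 'rV[R]_n => y 0 i), delta_mx 0 (lift ord0 i) : 'rV[R]_n.+1) | i <- index_enum 'I_n]) ce.1 y *: ce.2)); last first.
  by apply/funext => y; rewrite -consrow_affine.
apply: (class_C_comp_sum openT) => // [l|ce]; first exact: Cinfty_class_C.
elim: (index_enum _) => //= i l IH [<-|]//.
exact: class_C_coord.
Qed.

Lemma partial_slice n (f : 'rV[R]_n.+1 -> R) (s : R) i y :
  partial i (fun y => f (consrow s y)) y = partial (lift ord0 i) f (consrow s y).
Proof.
apply: eq_derive_line => t.
by rewrite addrC -consrow_shift_lift addrC.
Qed.

Lemma continuous_consrow0 n (y : 'rV[R]_n) : continuous (fun s : R => consrow s y).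
Proof.
have -> : (fun s : R => consrow s y) = fun s => consrow 0 y + s *: delta_mx 0 0.
  by apply/funext => t; rewrite consrow_shift0 add0r.
by move=> s; apply: cvgD; [exact: cvg_cst|apply: cvgZr_tmp; exact: cvg_id].
Qed.

Lemma slice_oscillation n (f : 'rV[R]_n.+1 -> R) (s t : R) (y : 'rV[R]_n) : Cinfty f ->
  `|f (consrow t y) - f (consrow s y)| <= \int[U]_a `|partial ord0 f (consrow a y)|.
Proof.
move=> Cf.
have cp0 := Cinfty_cper (Cinfty_partial ord0 Cf).
have [B _ fB] := cper_bounded cp0.
have per (a : R) : f (consrow a y) = f (consrow (a - (Num.floor a)%:~R) y).
  pose k' : 'rV[int]_n.+1 := \row_i oapp (fun j : 'I_n => 0) (Num.floor a) (unlift ord0 i).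
  rewrite -[RHS](Cf.1 _ k'); congr f; apply/rowP => j; rewrite !mxE.
  by case: (unlift ord0 j) => [i|] /=; rewrite ?addr0 ?subrK.
have fr (u : R) : 0 <= u - (Num.floor u)%:~R <= 1.
  have /andP[f0 f1] := floor_itv u.
  by rewrite subr_ge0 f0 lerBlDr addrC -[1]/(1%:~R) -intrD ltW.
have D (a : R) : is_derive a 1 (fun a : R => f (consrow a y)) (partial ord0 f (consrow a y)).
  have /is_deriveP H := Cinfty_partial_derive ord0 (consrow a y) Cf; apply/is_deriveP => e /H.
  by apply: filterS => u; rewrite consrow_shift0 /GRing.scale /= mulr1.
have cd : continuous (fun a : R => partial ord0 f (consrow a y)).
  move=> a; apply: (@continuous_comp _ _ _ (fun a : R => consrow a y) (partial ord0 f)).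
    exact: continuous_consrow0.
  exact: cp0.1.
rewrite (per t) (per s).
have := fr t; have := fr s; move: (t - _) (s - _) => {}t {}s /andP[s0 s1] /andP[t0 t1].
have [st|ts] := leP s t; first exact: (oscillation_le cd (fun a => fB _) D).
by rewrite distrC; exact: (oscillation_le cd (fun a => fB _) D t0 (ltW ts) s1).
Qed.

Lemma tintegrable_cons_swap n (f : 'rV[R]_n.+1 -> R) (B : R) : tmeas f -> (forall x, `|f x| <= B) ->
  tintegrable (fun y => \int[U]_s f (consrow s y)).
Proof.
move=> mf fB.
pose F (z : measurableTypeR R * n.-tuple (measurableTypeR R)) := f (consrow z.1 (row_of z.2)).
have mF : measurable_fun setT F.
  have -> : F = (f \o @row_of R n.+1) \o @cons_tuple R n.
    by apply/funext => z; rewrite /F /= row_of_cons.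
  by apply: measurableT_comp => //; exact: measurable_cons_tuple.
pose F' (z : n.-tuple (measurableTypeR R) * measurableTypeR R) := f (consrow z.2 (row_of z.1)).
have mF' : measurable_fun setT F'.
  have -> : F' = F \o (fun z => (z.2, z.1)) by [].
  apply: (measurableT_comp mF).
  by apply: measurable_fun_pair; [exact: measurable_snd|exact: measurable_fst].
have IF : (torus_leb R n \x U)%E.-integrable setT (EFin \o F').
  apply: measurable_bounded_integrable => //.
    by rewrite (le_lt_trans (probability_le1 _ _))// ltry.
  by exists B; split; [exact: num_real|move=> x Bx t _; exact: le_trans (fB _) (ltW Bx)].
have := integrable_fubini_F IF; congr (integrable _ _ _); apply/funext => t.
rewrite /fubini_F /= /Rintegral fineK//.
apply: integrable_fin_num => //.
apply: measurable_bounded_integrable => //.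
- by rewrite (le_lt_trans (probability_le1 _ _))// ltry.
- exact: (measurableT_comp mF (measurable_pair2 t)).
- by exists B; split; [exact: num_real|move=> x Bx s _; exact: le_trans (fB _) (ltW Bx)].
Qed.

(** The means over any two slices differ by at most the L^1 norm of the first partial derivative,
    and the total mean is an average of slice means. *)
Lemma slice_mean_le n (f : 'rV[R]_n.+1 -> R) (s : R) : Cinfty f ->
  `|tint (fun y => f (consrow s y))| <= `|tint f| + tint (fun x => `|partial ord0 f x|).
Proof.
move=> Cf; set D := tint (fun x => `|_|).
have cp0 := cper_norm (Cinfty_cper (Cinfty_partial ord0 Cf)).
have cf := Cinfty_cper Cf; have [A _ fA] := cper_bounded cf.
have [B _ fB] := cper_bounded cp0.
have DE : D = tint (fun y => \int[U]_a `|partial ord0 f (consrow a y)|).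
  by rewrite /D (tint_cons_swap (cper_tmeas cp0) fB).
have I0 (a : R) : tintegrable (fun y => f (consrow a y)) := Cinfty_tintegrable (Cinfty_slice a Cf).
have osc (a b : R) : `|tint (fun y => f (consrow a y)) - tint (fun y => f (consrow b y))| <= D.
  rewrite -tintB// (le_trans (le_norm_tint (tintegrableB (I0 a) (I0 b))))//.
  rewrite DE; apply: le_tint.
  - exact: tintegrable_norm (tintegrableB (I0 a) (I0 b)).
  - exact: tintegrable_cons_swap (cper_tmeas cp0) fB.
  - by move=> y; exact: slice_oscillation.
have cst_le (c : R) : cper (fun _ : 'rV[R]_n.+1 => c) by exact: cper_cst.
set w := tint (fun y => f (consrow s y)).
have H1 : tint f <= w + D.
  rewrite -(@tint_cst R n.+1 (w + D)).
  apply: (tint_cons_le (cper_tmeas cf) fA (cper_tmeas (cst_le _)) (fun=> lexx _)) => a.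
  by rewrite tint_cst -lerBlDl; apply: le_trans (ler_norm _) (osc _ _).
have H2 : w - D <= tint f.
  rewrite -(@tint_cst R n.+1 (w - D)).
  apply: (tint_cons_le (cper_tmeas (cst_le _)) (fun=> lexx _) (cper_tmeas cf) fA) => a.
  by rewrite tint_cst lerBlDl -lerBlDr; apply: le_trans (ler_norm _) (osc _ _).
have a1 := ler_norm (tint f); have a2 := ler_norm (- tint f); rewrite normrN in a2.
by rewrite ler_norml; apply/andP; split; lra.
Qed.

(** Induction on the dimension: the inequality on slices leaves their means, which [slice_mean_le]
    compares with the total mean. Splitting the p-th power of that sum costs 2^p in each
    dimension. *)
Lemma poincare n (p : R) : 1 <= p -> exists2 K : R, 0 <= K & forall f : 'rV[R]_n -> R, Cinfty f ->
  tint (fun x => `|f x| `^ p) <=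
  K * (`|tint f| `^ p + \sum_i tint (fun x => `|partial i f x| `^ p)).
Proof.
move=> p1; have p0 : 0 <= p by apply: le_trans p1.
have ineq (K t a D S : R) : 0 <= K -> 1 <= t -> 0 <= S ->
    K * (t * (a + D)) + K * S <= K * t * (a + (D + S)).
  move=> K0 t1 S0; rewrite -subr_ge0.
  have -> : K * t * (a + (D + S)) - (K * (t * (a + D)) + K * S) = K * ((t - 1) * S) by ring.
  by rewrite !mulr_ge0// subr_ge0.
elim: n => [|n [K K0 IH]].
  exists 1 => // f Cf; rewrite mul1r big_ord0 addr0.
  have fE x : f x = f 0 by congr f; apply/rowP => -[].
  have -> : tint f = f 0 by rewrite -[RHS](@tint_cst R 0); apply: eq_tint => x; exact: fE.
  by rewrite -[leRHS](@tint_cst R 0) (@eq_tint _ _ _ (fun=> `|f 0| `^ p))// => x; rewrite fE.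
exists (K * 2 `^ p) => [|f Cf]; first by rewrite mulr_ge0 ?powR_ge0.
have cf := Cinfty_cper Cf; have cp i := Cinfty_cper (Cinfty_partial i Cf).
have [mf [A _ fA]] := cper_powR p0 cf.
pose a := `|tint f| `^ p; pose D i := tint (fun x => `|partial i f x| `^ p).
have D0 i : 0 <= D i by apply: tint_ge0 => x; exact: powR_ge0.
pose G x := K * (2 `^ p * (a + D ord0)) + K * (\sum_(i < n) `|partial (lift ord0 i) f x| `^ p).
have IG i : tintegrable (fun x => `|partial i f x| `^ p) by exact: powR_cper_tintegrable.
have IGs : tintegrable G.
  apply: tintegrableD; first exact: cper_tintegrable (cper_cst _).
  by apply: tintegrableZ; exact: (tint_sum _ (fun i : 'I_n => IG (lift ord0 i))).2.
have [C GC] : exists C : R, forall x, `|G x| <= C.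
  have /choice[b Hb] (i : 'I_n) : exists b : R, forall x, `| `|partial (lift ord0 i) f x| `^ p | <= b.
    by have [_ [b _ Hb]] := cper_powR p0 (cp (lift ord0 i)); exists b.
  exists (`|K * (2 `^ p * (a + D ord0))| + K * \sum_(i < n) b i) => x.
  rewrite (le_trans (ler_normD _ _))// lerD2l normrM ger0_norm// ler_wpM2l//.
  by rewrite (le_trans (ler_norm_sum _ _ _))// ler_sum.
apply: (@le_trans _ _ (tint G)); last first.
  rewrite tintD; [|exact: cper_tintegrable (cper_cst _)|].
    rewrite tint_cst tintZ ?(tint_sum _ (fun i : 'I_n => IG (lift ord0 i))).1; last first.
      exact: (tint_sum _ (fun i : 'I_n => IG (lift ord0 i))).2.
    rewrite big_ord_recl -/a; apply: ineq => //; first by rewrite -[leLHS](powRr0 2) ler_powR//; lra.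
    by apply: sumr_ge0 => i _; exact: D0.
  by apply: tintegrableZ; exact: (tint_sum _ (fun i : 'I_n => IG (lift ord0 i))).2.
apply: (tint_cons_le mf fA (tintegrable_tmeas IGs) GC) => s.
have Cs := Cinfty_slice s Cf.
apply: (le_trans (IH _ Cs)).
have ISl (i : 'I_n) : tintegrable (fun y => `|partial (lift ord0 i) f (consrow s y)| `^ p).
  have := powR_cper_tintegrable p0 (Cinfty_cper (Cinfty_slice s (Cinfty_partial (lift ord0 i) Cf))).
  by [].
rewrite /G tintD; [|exact: cper_tintegrable (cper_cst _)|].
  rewrite tint_cst tintZ; last exact: (tint_sum _ ISl).2.
  rewrite (tint_sum _ ISl).1 mulrDr; apply: lerD.
    apply: (ler_wpM2l K0).
    apply: (@le_trans _ _ ((`|tint f| + tint (fun x => `|partial ord0 f x|)) `^ p)).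
      apply: ge0_ler_powR; rewrite ?nnegrE//; last exact: slice_mean_le.
      by rewrite addr_ge0// tint_ge0.
    apply: le_trans (le_powRD _ _ _) _ => //; first by apply: tint_ge0.
    by rewrite ler_wpM2l ?powR_ge0// lerD2l; exact: powR_tint_le.
  apply: (ler_wpM2l K0); apply: ler_sum => i _.
  by rewrite le_eqVlt; apply/orP; left; apply/eqP; apply: eq_tint => y; rewrite partial_slice.
by apply: tintegrableZ; exact: (tint_sum _ ISl).2.
Qed.

End poincare_induction.

(** * Integrals of functions that are measurable up to a null set *)

Section lower_integral.
Import HBNNSimple.
Context {dT} {T : measurableType dT} {R : realType} (mu : {measure set T -> \bar R}).
Local Open Scope ereal_scope.

(* The integral of a nonnegative function is a supremum over simple functions,
   hence monotone even on nonmeasurable functions. *)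
Lemma ge0_integral_mono (f g : T -> \bar R) : (forall x, 0 <= f x) ->
  (forall x, f x <= g x) -> \int[mu]_x f x <= \int[mu]_x g x.
Proof.
move=> f0 fg; have g0 x : 0 <= g x := le_trans (f0 x) (fg x).
rewrite !ge0_integralTE//; apply: ereal_sup_le => _ [k kf <-].
exists k => // x; exact: le_trans (kf x) (fg x).
Qed.

(** Measurability is asked of [g] alone, since the assumptions on [g1] and [g2] integrate
    compositions that agree with measurable functions only almost everywhere. *)
Lemma ge0_integral_ae (f g : T -> \bar R) : (forall x, 0 <= f x) -> (forall x, 0 <= g x) ->
  measurable_fun setT g -> {ae mu, forall x, f x = g x} ->
  \int[mu]_x f x = \int[mu]_x g x.
Proof.
move=> f0 g0 mg fg; apply/eqP; rewrite eq_le; apply/andP; split.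
  rewrite [leLHS]ge0_integralTE//; apply: ge_ereal_sup => _ [k kf <-].
  rewrite -integralT_nnsfun; apply: ae_ge0_le_integral => //.
  - by move=> x _; rewrite lee_fin; exact: fun_ge0.
  - by apply/measurable_EFinP.
  - by apply: filterS fg => x <- _; exact: kf.
(* Setting [g] to 0 on a measurable null set containing the exceptional points keeps its integral
   and places it below [f] everywhere, where plain monotonicity applies. *)
have [N [mN N0 HN]] := fg.
have gN x : (g \_ (~` N)) x = if x \in N then 0 else g x.
  by rewrite patchE in_setC; case: (x \in N).
apply: (@le_trans _ _ (\int[mu]_x (g \_ (~` N)) x)); last first.
  apply: ge0_integral_mono => x; rewrite gN; first by case: ifP.
  case: ifPn => // xN; have [->//|fgx] := eqVneq (f x) (g x).
  by exfalso; move/negP: xN; apply; rewrite inE; apply: HN => /= E; rewrite E eqxx in fgx.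
rewrite le_eqVlt; apply/orP; left; apply/eqP; apply: ae_eq_integral => //.
  apply/(measurable_restrictT _ _).1; first exact: measurableC.
  exact: measurable_funTS.
exists N; split => // x /= H; have [xN|xN] := boolP (x \in N); first by rewrite inE in xN.
by exfalso; apply: H => _; rewrite gN (negPf xN).
Qed.

Lemma integral_ae (f g : T -> \bar R) : measurable_fun setT g -> {ae mu, forall x, f x = g x} ->
  \int[mu]_x f x = \int[mu]_x g x.
Proof.
move=> mg fg; rewrite [LHS]integralE [RHS]integralE; congr (_ - _); apply: ge0_integral_ae => //.
- exact: measurable_funepos.
- by apply: filterS fg => x; rewrite !funeposE => ->.
- exact: measurable_funeneg.
- by apply: filterS fg => x; rewrite !funenegE => ->.
Qed.

End lower_integral.

Section torus_ereal_integral.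
Context {R : realType} {d : nat}.
Implicit Types f g : 'rV[R]_d -> R.

Lemma eint_tint f : tintegrable f -> eint (EFin \o f) = (tint f)%:E.
Proof. by move=> If; rewrite /tint /Rintegral fineK//; exact: integrable_fin_num. Qed.

Lemma eint_ae f g : tintegrable g -> ae_torus (fun x => f x = g x) ->
  eint (EFin \o f) = (tint g)%:E.
Proof.
move=> Ig fg; rewrite -eint_tint//; apply: integral_ae.
  by apply/measurable_EFinP; exact: tintegrable_tmeas.
by apply: (@filterS _ (almost_everywhere (torus_leb R d)) _ _ _ _ fg) => t /= ->.
Qed.

Lemma eint_mono (f g : 'rV[R]_d -> \bar R) : (forall x, 0 <= f x)%E ->
  (forall x, f x <= g x)%E -> (eint f <= eint g)%E.
Proof. by move=> f0 fg; apply: ge0_integral_mono => t; [exact: f0|exact: fg]. Qed.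

Lemma tintegrable_ge0 f (C : R) : tmeas f -> ae_torus (fun x => 0 <= f x) ->
  (eint (EFin \o f) <= C%:E)%E -> tintegrable f.
Proof.
move=> mf f0 fC; apply/integrableP; split; first exact/measurable_EFinP.
apply: le_lt_trans (ltry C); apply: le_trans fC.
rewrite le_eqVlt; apply/orP; left; apply/eqP; apply: integral_ae; first exact/measurable_EFinP.
apply: (@filterS _ (almost_everywhere (torus_leb R d)) _ _ _ _ f0) => t /= h.
by rewrite ger0_norm.
Qed.

Lemma le_ae_tint f g : tintegrable f -> tintegrable g -> ae_torus (fun x => f x <= g x) ->
  tint f <= tint g.
Proof.
move=> If Ig fg; rewrite -subr_ge0 -tintB//.
have Id := tintegrableB Ig If.
have -> : tint (fun x => g x - f x) = tint (fun x => `|g x - f x|).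
  apply: eq_ae_tint; [exact: tintegrable_tmeas|exact: (tintegrable_tmeas (tintegrable_norm Id))|].
  by apply: ae_torusS fg => x h; rewrite ger0_norm// subr_ge0.
by apply: tint_ge0 => x.
Qed.

End torus_ereal_integral.

Lemma continuous_comp_within (R : realType) (X Y : topologicalType) (S : set X) (F : X -> R)
    (z : Y -> X) : {within S, continuous F} -> continuous z -> (forall x, S (z x)) ->
  continuous (fun x => F (z x)).
Proof.
move=> /subspace_continuousP cF cz Sz x; apply: cvg_trans (cF _ (Sz x)).
move=> A FA.
exact: (@filterS _ (nbhs x) _ (fun y => S (z y) -> A (F (z y))) (fun y => A (F (z y)))
  (fun y k => k (Sz y)) (cz x _ FA)).
Qed.
(** * A priori bounds *)

Section energy_inequalities.
Context {R : realType}.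

(** The arithmetic of the a priori estimate. U, I, X stand for the integrals of u, H, m; T0 for that
    of m times the Lagrangian; Q and P for those of |Du|^gamma m^(1-tau) and |Du|^gamma m^(-tau); Y,
    Y1 for those of m g, m g1; G1, G2 for those of g1, g2. The case s = 1 gives I + T0 <= 0;
    inserting the lower bounds for I and T0, the choice of [delta] absorbs half of C2 Y1. Then U >=
    I + 2 T0 and U <= - 2 I - T0 are the cases 1/2 and 2. *)
Lemma energy_bounds (C1 C2 C3 c r delta Cd : R) :
  0 < C1 -> 0 < C2 -> 0 < C3 -> 0 < c -> 0 <= r -> 0 <= Cd ->
  delta * (C1 + C3 * (1 + c)) = C2 / 2 -> 0 < delta ->
  exists K : R, forall U I T0 Q P X Y Y1 G1 G2 : R,
    (forall s : R, s = 1 / 2 \/ s = 1 \/ s = 2 -> 0 <= (1 - s) * U - s * I - T0) ->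
    C1^-1 * Q + C2 * Y - C1 * X <= T0 ->
    - C3 * (G1 + G2) + C1^-1 * P - C1 <= I ->
    Y1 <= Y -> G2 <= c * (1 + X) -> G1 <= delta * Y1 + Cd -> X <= delta * Y1 + Cd ->
    0 <= X -> 0 <= Q -> 0 <= P -> - r <= Y1 ->
    [/\ Y1 <= K, X <= K, Q + P <= K & `|U| <= K].
Proof.
move=> C10 C20 C30 c0 r0 Cd0 dB d0.
pose B := C1 + C3 * (1 + c).
pose K0 := B * Cd + C3 * c + C1.
have B0 : 0 < B by rewrite addr_gt0// mulr_gt0// addr_gt0.
have K00 : 0 < K0 by rewrite addr_gt0// ltr_wpDl ?mulr_gt0// mulr_ge0// ltW.
pose Kx := delta * (2 * K0 / C2) + Cd.
have Kx0 : 0 <= Kx by rewrite addr_ge0// mulr_ge0 ?(ltW d0)// divr_ge0 ?mulr_ge0 ?(ltW K00)// ltW.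
pose Kg := Kx + c * (1 + Kx).
pose Kq := C1 * (K0 + C2 * r / 2).
pose Ku := 2 * (C3 * Kg + C1) + 2 * (C2 * r + C1 * Kx).
have Kg0 : 0 <= Kg by rewrite addr_ge0// mulr_ge0 ?(ltW c0)// addr_ge0.
have Kq0 : 0 <= Kq by rewrite mulr_ge0 ?(ltW C10)// addr_ge0 ?(ltW K00)// mulr_ge0// mulr_ge0 ?(ltW C20).
have Ku0 : 0 <= Ku.
  by rewrite addr_ge0// mulr_ge0// addr_ge0// ?mulr_ge0 ?(ltW C30) ?(ltW C10) ?(ltW C20).
have Ky0 : 0 <= 2 * K0 / C2 by rewrite divr_ge0 ?mulr_ge0 ?(ltW K00)// ltW.
exists (2 * K0 / C2 + Kx + Kq + Ku) => U I T0 Q P X Y Y1 G1 G2 HU HT HI HY HG2 HG1 HX X0 Q0 P0 HY1.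
have h12 := HU _ (or_introl erefl); have h1 := HU _ (or_intror (or_introl erefl)).
have h2 := HU _ (or_intror (or_intror erefl)).
have a0 : 0 < C1^-1 by rewrite invr_gt0.
have e1 : C2 * Y1 <= C2 * Y by rewrite ler_pM2l.
have e2 : C1 * X <= C1 * (delta * Y1 + Cd) by rewrite ler_pM2l.
have e3 : C3 * (G1 + G2) <= C3 * ((delta * Y1 + Cd) + c * (1 + (delta * Y1 + Cd))).
  rewrite ler_pM2l// lerD// (le_trans HG2)// ler_pM2l// lerD2l//.
have e4 : C1 * (delta * Y1 + Cd) + C3 * ((delta * Y1 + Cd) + c * (1 + (delta * Y1 + Cd))) =
   (C2 / 2) * Y1 + B * Cd + C3 * c.
  by rewrite -dB /B; ring.
have e3_ : C1 * X + C3 * (G1 + G2) <= C2 / 2 * Y1 + B * Cd + C3 * c.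
  by rewrite -e4; exact: lerD.
have aQ : 0 <= C1^-1 * Q by rewrite mulr_ge0// ltW.
have aP : 0 <= C1^-1 * P by rewrite mulr_ge0// ltW.
have key : C1^-1 * Q + C1^-1 * P + C2 / 2 * Y1 <= K0.
  have {}h1 : I + T0 <= 0 by move: h1; clear => h1; lra.
  clear -h1 HT HI e1 e3_.
  rewrite /K0; lra.
have y1 : Y1 <= 2 * K0 / C2.
  by rewrite ler_pdivlMr//; clear -key aQ aP; lra.
have x1 : X <= Kx by rewrite (le_trans HX)// lerD2r ler_pM2l.
have w1 : delta * Y1 + Cd <= Kx by rewrite lerD2r ler_pM2l.
have qp : Q + P <= Kq.
  rewrite /Kq -ler_pdivrMl// mulrDr.
  have : C2 * (- r) <= C2 * Y1 by rewrite ler_pM2l.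
  by clear -key => ?; lra.
have g3 : C3 * (G1 + G2) <= C3 * Kg.
  rewrite ler_pM2l// lerD//; first exact: le_trans HG1 w1.
  by rewrite (le_trans HG2)// ler_pM2l// lerD2l.
have t1 : - (C2 * r + C1 * Kx) <= T0.
  have : C2 * (- r) <= C2 * Y1 by rewrite ler_pM2l.
  have : C1 * X <= C1 * Kx by rewrite ler_pM2l.
  by clear -HT aQ e1 => ? ?; lra.
have i1 : - (C3 * Kg + C1) <= I by clear -HI g3 aP; lra.
split; [clear -y1 Kx0 Kq0 Ku0; lra|clear -x1 Ky0 Kq0 Ku0; lra|clear -qp Ky0 Kx0 Ku0; lra|].
have z1 : 0 <= C2 * r + C1 * Kx by rewrite addr_ge0// mulr_ge0 ?(ltW C20) ?(ltW C10).
have z2 : 0 <= C3 * Kg + C1 by rewrite addr_ge0 ?(ltW C10)// mulr_ge0 ?(ltW C30).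
have U1 : U <= Ku by rewrite /Ku; clear -h2 t1 i1 z1; lra.
have U2 : - Ku <= U by rewrite /Ku; clear -h12 t1 i1 z2; lra.
rewrite ler_norml; clear -U1 U2 Ky0 Kx0 Kq0.
by apply/andP; split; lra.
Qed.

End energy_inequalities.

Lemma continuous_pairing (X Y Z : topologicalType) (f : X -> Y) (g : X -> Z) :
  continuous f -> continuous g -> continuous (fun x => (f x, g x)).
Proof. by move=> cf cg x; apply: cvg_pair; [exact: cf|exact: cg]. Qed.

Section apriori.
Context {R : realType} {d : nat}.
Context (E : set R) (hE : E = [set m | 0 < m] \/ E = [set m | 0 <= m]).
Context (h : ('rV[R]_d -> R) -> 'rV[R]_d -> R) (h_op : operator_Mac_C h) (h_reg : h_regularity h).
Context (H : Hamiltonian R d) (H_smooth : H_smoothness E H).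
Context (g g1 g2 : 'rV[R]_d -> R -> R -> R) (gamma tau : R).
Context (g_cont : g_continuous E g) (g_struct : g_structure E h g g1 g2).
Context (H_grow : H_growth E h H g gamma tau).
Implicit Types m u : 'rV[R]_d -> R.

Lemma CinftyE_MacE m : CinftyE E m -> MacE E m.
Proof.
move=> [Cm Em]; split; last by apply: aeW => t; exact: Em.
by apply: Cinfty_Mac => // x; exact: (E_ge0 hE (Em x)).
Qed.

Lemma cper_comp_g m : CinftyE E m -> cper (comp_g h g m).
Proof.
move=> CE; have [Cm Em] := CE; have [pg cg] := g_cont.
have [cm pm] := Cinfty_cper Cm.
have [ch ph] := Cinfty_cper (Cinfty_operator hE h_op h_reg CE).
split; last by move=> x k; rewrite /comp_g pm ph; exact: (pg _ _ (Em x)).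
apply: (@continuous_comp_within _ _ _ [set z : 'rV[R]_d * R * R | E z.1.2]
  (fun z => g z.1.1 z.1.2 z.2) (fun x => (x, m x, h m x))) => //.
apply: continuous_pairing; last exact: ch.
by apply: continuous_pairing; [move=> x; exact: cvg_id|exact: cm].
Qed.

(** Along [m], the summand [g2] is replaced by a measurable representative [f2] and [g1] by
    [g - f2], where [g] is continuous; all integrals in (g-structure) become real ones. *)
Lemma comp_g_decomposition m : CinftyE E m -> exists f2 : 'rV[R]_d -> R,
  [/\ tintegrable f2, ae_torus (fun x => 0 <= f2 x),
    eint (EFin \o comp_g h g2 m) = (tint f2)%:E,
    eint (EFin \o comp_g h g1 m) = (tint (fun x => comp_g h g m x - f2 x))%:E &
    eint (fun x => (m x * comp_g h g1 m x)%:E) =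
      (tint (fun x => m x * (comp_g h g m x - f2 x)))%:E].
Proof.
move=> CE; have ME := CinftyE_MacE CE; have [Cm Em] := CE.
have [gE _ g2P [[c c0 Hc] _ _]] := g_struct.
have [[f2 [mf2 f2E]] g20] := g2P _ ME.
have f20 : ae_torus (fun x => 0 <= f2 x).
  by apply: ae_torusS (ae_torusI f2E g20) => x [<-].
have If2 : tintegrable f2.
  apply: (@tintegrable_ge0 _ _ _ (c * (1 + tint m))) => //.
  have -> : eint (EFin \o f2) = eint (EFin \o comp_g h g2 m).
    apply/esym; apply: integral_ae; first exact/measurable_EFinP.
    by apply: (@filterS _ (almost_everywhere (torus_leb R d)) _ _ _ _ f2E) => t /= ->.
  by have := Hc _ ME; rewrite (eint_tint (Cinfty_tintegrable Cm)).
have cg := cper_comp_g CE.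
have g1E : ae_torus (fun x => comp_g h g1 m x = comp_g h g m x - f2 x).
  by apply: ae_torusS f2E => x <-; rewrite /comp_g gE ?addrK.
have Id := tintegrableB (cper_tintegrable cg) If2.
exists f2; split=> //; [exact: eint_ae|exact: eint_ae|].
apply: eint_ae; last by apply: ae_torusS g1E => x ->.
rewrite (_ : (fun x => _) = fun x => (comp_g h g m x - f2 x) * m x).
  by apply: tintegrableM_cper => //; exact: Cinfty_cper.
by apply/funext => x; rewrite mulrC.
Qed.

(** The left-hand side of the pointwise growth condition along the pair; see [lagrangianE]. *)
Definition lagrangian m u x : R := - along h H m u x
  + \sum_i along h (DpH H i) m u x * partial i u x
  + \sum_i \sum_j along h (DMH H i j) m u x * partials [:: j; i] u x.

Lemma Cinfty_lagrangian m u : CinftyE E m -> Cinfty u -> Cinfty (lagrangian m u).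
Proof.
move=> CE Cu.
have A G : H_smoothness E G -> Cinfty (along h G m u) by move=> SG; exact: (Cinfty_along hE h_op h_reg SG CE Cu).
have C1 := Cinfty_sum (index_enum 'I_d) (fun i => CinftyM (A _ (H_smoothness_DpH i H_smooth)) (Cinfty_partial i Cu)).
have C2 := Cinfty_sum (index_enum 'I_d) (fun i => Cinfty_sum (index_enum 'I_d)
  (fun j => CinftyM (A _ (H_smoothness_DMH i j H_smooth)) (Cinfty_partials [:: j; i] Cu))).
exact: (CinftyD (CinftyD (CinftyN (A _ H_smooth)) C1) C2).
Qed.

(** The constant test contributes no derivatives. Those of [u] enter multiplied by [m] and combine
    with the term in [H] into [m] times the Lagrangian. *)
Lemma pairing_cst (s : R) m u : CinftyE E m -> Cinfty u ->
  pairing h H (fun x => s - m x) (fun x => 0 - u x) m u =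
  (1 - s) * tint u - s * tint (along h H m u) - tint (fun x => m x * lagrangian m u x).
Proof.
move=> CE Cu; have [Cm _] := CE.
have CA1 := Cinfty_A1 hE h_op h_reg H_smooth CE Cu.
have Cphi : Cinfty (fun x => s - m x) := CinftyB (Cinfty_cst s) Cm.
have Cpsi : Cinfty (fun x => 0 - u x) := CinftyB (Cinfty_cst 0) Cu.
have CA2 := Cinfty_A2 hE h_op h_reg H_smooth CE Cu.
have CH := Cinfty_along hE h_op h_reg H_smooth CE Cu.
have CL := CinftyM Cm (Cinfty_lagrangian CE Cu).
have pN (q : seq 'I_d) x : partials q (fun x => 0 - u x) x = - partials q u x.
  rewrite (_ : (fun x => 0 - u x) = fun x => -1 * u x); last by apply/funext => y; ring.
  by rewrite (partialsZ _ _ Cu) mulN1r.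
rewrite /pairing (tint_weak_A2 hE h_op h_reg H_smooth Cpsi CE Cu).
have WE x : weak_A2 h H (fun x => 0 - u x) m u x =
    (1 - s) * u x - s * along h H m u x - m x * lagrangian m u x - (s - m x) * A1 h H m u x.
  rewrite /weak_A2 /lagrangian /A1 -/(along h H m u x).
  have -> : \sum_i partial i (fun x0 => 0 - u x0) x * (m x * along h (DpH H i) m u x) =
     - (m x * \sum_i along h (DpH H i) m u x * partial i u x).
    rewrite mulr_sumr -sumrN; apply: eq_bigr => i _.
    by rewrite [partial i _ x](pN [:: i] x) /=; ring.
  have -> : \sum_i \sum_j partials [:: j; i] (fun x0 => 0 - u x0) x * (m x * along h (DMH H i j) m u x) =
     - (m x * \sum_i \sum_j along h (DMH H i j) m u x * partials [:: j; i] u x).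
    rewrite mulr_sumr -sumrN; apply: eq_bigr => i _.
    rewrite mulr_sumr -sumrN; apply: eq_bigr => j _.
    by rewrite (pN [:: j; i] x); ring.
  move: (\sum_i _) (\sum_i _) (along h H m u x) (m x) (u x) => a b e k l; ring.
rewrite (eq_tint WE).
have I1 := Cinfty_tintegrable (CinftyM Cphi CA1).
have I2 := Cinfty_tintegrable (CinftyB (CinftyB (CinftyZ (1 - s) Cu) (CinftyZ s CH)) CL).
rewrite (tintB I2 I1) addrC subrK.
have J1 := Cinfty_tintegrable (CinftyZ (1 - s) Cu); have J2 := Cinfty_tintegrable (CinftyZ s CH).
have J3 := Cinfty_tintegrable CL.
by rewrite (tintB (tintegrableB J1 J2) J3) (tintB J1 J2) !tintZ//; exact: Cinfty_tintegrable.
Qed.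

Lemma cper_enorm_grad u : Cinfty u -> cper (fun x => enorm (grad u x)).
Proof.
move=> Cu; apply: (@cper_comp _ _ Num.sqrt); first exact: sqrt_continuous.
apply: cper_sum => i.
rewrite (_ : (fun x => _) = fun x => partial i u x * partial i u x).
  by apply: cperM; apply: Cinfty_cper; exact: Cinfty_partial.
by apply/funext => x; rewrite mxE expr2.
Qed.

End apriori.

Section apriori_bounds.
Context {R : realType} {d : nat}.
Context (E : set R) (hE : E = [set m | 0 < m] \/ E = [set m | 0 <= m]).
Context (h : ('rV[R]_d -> R) -> 'rV[R]_d -> R) (h_op : operator_Mac_C h) (h_reg : h_regularity h).
Context (H : Hamiltonian R d) (H_smooth : H_smoothness E H).
Context (g g1 g2 : 'rV[R]_d -> R -> R -> R) (gamma tau : R).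
Context (g_cont : g_continuous E g) (g_struct : g_structure E h g g1 g2).
Context (H_grow : H_growth E h H g gamma tau).
Implicit Types m u : 'rV[R]_d -> R.

Lemma lagrangianE m u x : lagrangian h H m u x =
  - H x (grad u x) (hess u x) (m x) (h m x)
  + \sum_i DpH H i x (grad u x) (hess u x) (m x) (h m x) * grad u x 0 i
  + \tr ((\matrix_(i, j) DMH H i j x (grad u x) (hess u x) (m x) (h m x)) *m hess u x).
Proof.
rewrite /lagrangian; congr (_ + _ + _).
  by apply: eq_bigr => i _; rewrite [grad u x 0 i]mxE.
rewrite /mxtrace; apply: eq_bigr => i _; rewrite [RHS]mxE; apply: eq_bigr => j _.
by rewrite [(\matrix_(_, _) _) i j]mxE [hess u x j i]mxE.
Qed.

(** Multiplication by [m] turns [npow] into m^(1-tau), which is finite also where [m] vanishes;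
    there both sides are 0. *)
Lemma lagrangian_lower (C1 C2 : R) m u x : 0 <= tau < 1 ->
  H_growth_pointwise E H g gamma tau C1 C2 -> CinftyE E m ->
  C1^-1 * (m x `^ (1 - tau) * enorm (grad u x) `^ gamma) + C2 * (m x * comp_g h g m x) - C1 * m x
    <= m x * lagrangian h H m u x.
Proof.
move=> /andP[t0 t1] HP CE; have [Cm Em] := CE.
have [m0|mn0] := eqVneq (m x) 0.
  by rewrite m0 powR0 ?subr_eq0 ?gt_eqF// !mul0r !mulr0 addr0 subr0.
have mp : 0 < m x by rewrite lt_def mn0 (E_ge0 hE (Em x)).
have := HP x (grad u x) (hess u x) (m x) (h m x) (Em x).
rewrite -lagrangianE /npow (negPf mn0) /= -!EFinM -EFinD lee_fin => HL.
have {HL} := ler_wpM2l (ltW mp) HL.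
have -> : m x `^ (1 - tau) = m x * m x `^ (- tau).
  by rewrite powRD ?mn0 ?implybT// powRr1// ltW.
apply: le_trans; rewrite le_eqVlt; apply/orP; left; apply/eqP; rewrite /comp_g; ring.
Qed.

(** Since a^(1-tau) + a^(-tau) >= 1, the two weighted gradient integrals together control the
    unweighted one. The maximum with 0 makes the left side nonnegative, so that [eint_mono]
    applies. *)
Lemma npow_lower (D a : R) : 0 <= D -> 0 <= a -> 0 <= tau < 1 ->
  ((Num.max 0 (D - a `^ (1 - tau) * D))%:E <= D%:E * npow a tau)%E.
Proof.
move=> D0 a0 /andP[t0 t1]; rewrite /npow; case: ifPn => [/andP[/eqP -> tp]|].
  rewrite powR0 ?subr_eq0 ?gt_eqF// mul0r subr0.
  have [->|Dn0] := eqVneq D 0; first by rewrite maxxx mul0e.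
  by rewrite gt0_muley ?leey// lte_fin lt_def Dn0.
move=> Hat; rewrite -EFinM lee_fin ge_max mulr_ge0 ?powR_ge0//=.
have -> : D - a `^ (1 - tau) * D = D * (1 - a `^ (1 - tau)) by ring.
rewrite ler_wpM2l// lerBlDl.
have [a1|a1] := leP 1 a.
  rewrite -[leLHS]addr0; apply: lerD; last exact: powR_ge0.
  by rewrite -[leLHS](powRr0 a) ler_powR// subr_ge0 ltW.
rewrite -[leLHS]add0r; apply: lerD; first exact: powR_ge0.
have [aE0|an0] := eqVneq a 0.
  move: Hat; rewrite aE0 eqxx /= -leNgt => tn.
  have -> : tau = 0 by apply/eqP; rewrite eq_le tn.
  by rewrite oppr0 powRr0.
have ap : 0 < a by rewrite lt_def an0.
rewrite powRN -[leLHS]invr1 lef_pV2 ?posrE ?powR_gt0//.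
rewrite [leRHS](_ : 1 = 1 `^ tau); last by rewrite powR1.
apply: ge0_ler_powR => //; rewrite ?nnegrE//.
exact: ltW.
Qed.

Lemma apriori_bounds : exists K : R, forall m u, CinftyE E m -> Cinfty u ->
  (forall s : R, s = 1 / 2 \/ s = 1 \/ s = 2 ->
    0 <= pairing h H (fun x => s - m x) (fun x => 0 - u x) m u) ->
  [/\ (eint (fun x => (m x * comp_g h g1 m x)%:E) <= K%:E)%E, tint m <= K,
      tint (fun x => enorm (grad u x) `^ gamma) <= K & `|tint u| <= K].
Proof.
have [gam1 t01 [C1 [C2 [C3 [C4 [[C10 C20 C30 C40] HP HI]]]]]] := H_grow.
have [_ _ _ [[c c0 Hc] Hd [r r0 Hr]]] := g_struct.
have B0 : 0 < C1 + C3 * (1 + c) by rewrite addr_gt0// mulr_gt0// addr_gt0.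
pose delta := C2 / 2 / (C1 + C3 * (1 + c)).
have d0 : 0 < delta by rewrite !divr_gt0.
have dB : delta * (C1 + C3 * (1 + c)) = C2 / 2 by rewrite /delta divfK ?gt_eqF.
have [Cd Cd0 HCd] := Hd _ d0.
have [K HK] := energy_bounds C10 C20 C30 c0 r0 (ltW Cd0) dB d0.
exists K => m u CE Cu Hs.
have ME := CinftyE_MacE hE CE; have [Cm Em] := CE.
have m0 x : 0 <= m x := E_ge0 hE (Em x).
have [f2 [If2 f20 g2E g1E mg1E]] := comp_g_decomposition hE h_op h_reg g_cont g_struct CE.
have cg := cper_comp_g hE h_op h_reg g_cont CE; have cm := Cinfty_cper Cm.
have cD := cper_enorm_grad Cu.
have gam0 : 0 <= gamma by apply: le_trans (ltW gam1).
pose D x := enorm (grad u x) `^ gamma.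
have DE : D = fun x => `|enorm (grad u x)| `^ gamma.
  by apply/funext => x; rewrite ger0_norm// sqrtr_ge0.
have D0 x : 0 <= D x by exact: powR_ge0.
have ID : tintegrable D by rewrite DE; exact: powR_cper_tintegrable.
pose mt x := m x `^ (1 - tau).
have t1 : 0 <= 1 - tau by rewrite subr_ge0 ltW//; case/andP: t01.
have mtE : mt = fun x => `|m x| `^ (1 - tau) by apply/funext => x; rewrite ger0_norm.
have [mmt [A A0 mtA]] : tmeas mt /\ exists2 A : R, 0 <= A & forall x, `|mt x| <= A.
  by rewrite mtE; exact: cper_powR.
have IQ : tintegrable (fun x => mt x * D x).
  rewrite (_ : (fun x => _) = fun x => D x * mt x); last by apply/funext => x; rewrite mulrC.
  exact: (tintegrableM ID mmt mtA).
have Ig := cper_tintegrable cg; have Im := cper_tintegrable cm.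
have IH := Cinfty_tintegrable (Cinfty_along hE h_op h_reg H_smooth CE Cu).
have Img : tintegrable (fun x => m x * comp_g h g m x) by apply: cper_tintegrable; exact: cperM.
have ImL := Cinfty_tintegrable (CinftyM Cm (Cinfty_lagrangian hE h_op h_reg H_smooth CE Cu)).
set Pe := eint (fun x => ((enorm (grad u x) `^ gamma)%:E * npow (m x) tau)%E).
have np0 (x : 'rV[R]_d) : (0 <= npow (m x) tau)%E.
  by rewrite /npow; case: ifP => _; rewrite ?leey// lee_fin powR_ge0.
have Pe0 : (0 <= Pe)%E by apply: integral_ge0 => t _; rewrite mule_ge0// lee_fin powR_ge0.
have Sob : sobolev 1 gamma u by apply: Cinfty_sobolev => //; exact: ltW.
have gE : eint (EFin \o comp_g h g m) = (tint (comp_g h g m))%:E := eint_tint Ig.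
have HE : eint (fun x => (H x (grad u x) (hess u x) (m x) (h m x))%:E) = (tint (along h H m u))%:E.
  exact: (eint_tint IH).
have p1 i : wderiv gamma%:E [:: i] u (fun x => grad u x 0 i).
  have := Cinfty_wderiv [:: i] (ltW gam1) Cu; congr wderiv.
  by apply/funext => x; rewrite mxE.
have p2 i j : wderiv 1%:E [:: i; j] u (fun x => hess u x i j).
  have := Cinfty_wderiv [:: i; j] (lexx 1) Cu; congr wderiv.
  by apply/funext => x; rewrite mxE [rev _]/= (partialsC j i Cu).
have p3 : has_int (EFin \o comp_g h g m).
  left; apply: (@le_lt_trans _ _ (eint (EFin \o (fun x => `|comp_g h g m x|)))).
    apply: eint_mono => x; first exact: funepos_ge0.
    by rewrite funeposE /= -EFin_max lee_fin ge_max ler_norm normr_ge0.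
  by rewrite eint_tint ?ltry//; exact: tintegrable_norm.
have p4 : ~ (eint (EFin \o comp_g h g m) = +oo%E /\ Pe = +oo%E) by rewrite gE => -[].
have [HIl _] := HI m u (grad u) (hess u) ME Sob p1 p2 p3 p4.
move: HIl; rewrite -/Pe gE HE => HIl.
(* The integrals of [H] and of [g] are finite, so the lower growth bound excludes the value +oo. *)
have [P PE] : exists P : R, Pe = P%:E.
  move: (Pe) Pe0 HIl => [P _ _|_|//]; first by exists P.
  by rewrite gt0_muley ?lte_fin ?invr_gt0//= leNgt ltry.
rewrite PE in HIl Pe0; have P0 : 0 <= P by rewrite -lee_fin.
have {}HIl : - C3 * tint (comp_g h g m) + C1^-1 * P - C1 <= tint (along h H m u).
  by rewrite -lee_fin; exact: HIl.
have HT : C1^-1 * tint (fun x => mt x * D x) + C2 * tint (fun x => m x * comp_g h g m x) - C1 * tint m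
    <= tint (fun x => m x * lagrangian h H m u x).
  rewrite -!tintZ// -tintD; [|exact: tintegrableZ|exact: tintegrableZ].
  have I3 := tintegrableD (tintegrableZ C1^-1 IQ) (tintegrableZ C2 Img).
  rewrite -(tintB I3 (tintegrableZ C1 Im)).
  apply: le_tint => //; first exact: (tintegrableB I3 (tintegrableZ C1 Im)).
  by move=> x; exact: lagrangian_lower.
have Y1 : tint (fun x => m x * (comp_g h g m x - f2 x)) <= tint (fun x => m x * comp_g h g m x).
  apply: le_ae_tint => //.
    rewrite (_ : (fun x => _) = fun x => (comp_g h g m x - f2 x) * m x).
      by apply: tintegrableM_cper => //; exact: tintegrableB.
    by apply/funext => x; rewrite mulrC.
  by apply: ae_torusS f20 => x f0; rewrite ler_wpM2l// gerBl.
have XE : eint (EFin \o m) = (tint m)%:E := eint_tint Im.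
have G2 : tint f2 <= c * (1 + tint m).
  by have := Hc _ ME; rewrite g2E XE.
have := HCd _ ME; rewrite g1E XE mg1E -EFinM -EFinD ge_max !lee_fin => /andP[G1 X1].
have := Hr _ ME; rewrite mg1E lee_fin => Yr.
have X0 : 0 <= tint m by exact: tint_ge0.
have Q0 : 0 <= tint (fun x => mt x * D x) by apply: tint_ge0 => x; rewrite mulr_ge0 ?powR_ge0.
have gsum : tint (comp_g h g m) = tint (fun x => comp_g h g m x - f2 x) + tint f2.
  by rewrite tintB// subrK.
rewrite gsum in HIl.
have HU (s : R) : s = 1 / 2 \/ s = 1 \/ s = 2 ->
    0 <= (1 - s) * tint u - s * tint (along h H m u) - tint (fun x => m x * lagrangian h H m u x).
  by move=> /Hs; rewrite (pairing_cst hE h_op h_reg H_smooth s CE Cu).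
have [k1 k2 k3 k4] := HK _ _ _ _ _ _ _ _ _ _
  HU
  HT HIl Y1 G2 G1 X1 X0 Q0 P0 Yr.
split=> //.
apply: le_trans k3.
pose k x := D x - mt x * D x.
have Ik : tintegrable k := tintegrableB ID IQ.
have Imk : tintegrable (fun x => Num.max 0 (k x)).
  rewrite (_ : (fun x => _) = fun x => 2^-1 * (k x + `|k x|)).
    by apply/tintegrableZ/tintegrableD => //; exact: tintegrable_norm.
  apply/funext => x; case: (ger0P (k x)) => k0; first by field.
  by rewrite subrr mulr0.
have -> : tint D = tint (fun x => mt x * D x) + tint k by rewrite /k tintB// addrC subrK.
rewrite lerD2l -lee_fin -PE.
apply: (@le_trans _ _ (tint (fun x => Num.max 0 (k x)))%:E).
  by rewrite lee_fin; apply: le_tint => // x; rewrite le_max lexx orbT.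
rewrite -(eint_tint Imk); apply: eint_mono => x; first by rewrite lee_fin le_max lexx.
exact: npow_lower.
Qed.

End apriori_bounds.

(** * Separability and completeness *)

Section separability.
Context {R : realType} {d : nat}.
Implicit Types F : 'rV[R]_d -> R.

(** The cube is closed: the index N + 1 occurs exactly at coordinate 1, hence N + 2 values. *)
Definition grid_cell N (x : 'rV[R]_d) : {ffun 'I_d -> 'I_N.+2} :=
  [ffun i => inord (absz (Num.floor (x 0 i * N.+1%:R)))].

(* A countable family of functions on the unit cube: step functions on cubic
   grids, with integer values. *)
Definition grid_step (c : nat * seq int) (x : 'rV[R]_d) : R :=
  (nth 0 c.2 (index (grid_cell c.1 x) (enum {ffun 'I_d -> 'I_c.1.+2})))%:~R.

(** Of the tolerance, one half pays for the oscillation of [F] on a cell, the other for rounding its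
    value to a multiple of 1/(n+1). *)
Definition grid_approx n (c : nat * seq int) F :=
  forall x, unit_cube x -> `|F x - grid_step c x / n.+1%:R| <= 2 / n.+1%:R.

Lemma grid_approx_exists n F : continuous F -> exists c, grid_approx n c F.
Proof.
move=> cF; have n0 : 0 < n.+1%:R :> R by rewrite ltr0n.
have i0 : 0 < 1 / n.+1%:R :> R by rewrite divr_gt0.
have cid : continuous (fun x : 'rV[R]_d => x) by move=> x; exact: cvg_id.
have [dl dl0 Hdl] := uniform_comp_compact (@compact_unit_cube R d) cid (fun x => cF x) i0.
have [N] : exists N : nat, 1 / N.+1%:R <= dl.
  near \oo => N; exists N; rewrite div1r; apply: ltW; near: N.
  exact: (near_infty_natSinv_lt (PosNum dl0)).
have N0 : 0 < N.+1%:R :> R by rewrite ltr0n.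
move=> Ndl.
pose grid (k : {ffun 'I_d -> 'I_N.+2}) : 'rV[R]_d := \row_i ((k i : nat)%:R / N.+1%:R).
exists (N, [seq Num.floor (F (grid k) * n.+1%:R) | k <- enum {ffun 'I_d -> 'I_N.+2}]) => x Kx.
set k := grid_cell N x.
have -> : grid_step (N, [seq Num.floor (F (grid k) * n.+1%:R) | k <- enum {ffun 'I_d -> 'I_N.+2}]) x =
    (Num.floor (F (grid k) * n.+1%:R))%:~R.
  by rewrite /grid_step /= (nth_map k) ?index_mem ?mem_enum// nth_index ?mem_enum.
have xk : `|x - grid k| <= dl.
  apply: le_trans Ndl; apply: rV_norm_le => [|i]; first by rewrite divr_ge0// ltW.
  rewrite !mxE /k /grid_cell ffunE.
  have /= := Kx i; rewrite in_itv /= => /andP[x0 x1].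
  have y0 : 0 <= x 0 i * N.+1%:R by rewrite mulr_ge0// ltW.
  have f0 : 0 <= Num.floor (x 0 i * N.+1%:R) by rewrite floor_ge0.
  have fE : (absz (Num.floor (x 0 i * N.+1%:R)))%:R = (Num.floor (x 0 i * N.+1%:R))%:~R :> R.
    by rewrite -[in RHS](gez0_abs f0).
  have /andP[F1 F2] := floor_itv (x 0 i * N.+1%:R).
  rewrite inordK; last first.
    rewrite ltnS -(ler_nat R) fE (le_trans F1)// -[leRHS]mul1r ler_wpM2r//.
  rewrite fE -{1}[x 0 i](mulfK (lt0r_neq0 N0)) -mulrBl normrM [`|_^-1|]gtr0_norm ?invr_gt0//.
  rewrite ler_pM2r ?invr_gt0// ger0_norm ?subr_ge0//.
  by rewrite lerBlDl ltW//; rewrite intrD in F2.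
have H1 := Hdl x Kx _ xk.
have /andP[G1 G2] := floor_itv (F (grid k) * n.+1%:R).
have -> : F x - (Num.floor (F (grid k) * n.+1%:R))%:~R / n.+1%:R =
   - (F (grid k) - F x) + (F (grid k) - (Num.floor (F (grid k) * n.+1%:R))%:~R / n.+1%:R) by ring.
rewrite (le_trans (ler_normD _ _))// normrN (_ : 2 / n.+1%:R = 1 / n.+1%:R + 1 / n.+1%:R); last by rewrite -mulrDl.
apply: lerD => //.
rewrite -{1}[F (grid k)](mulfK (lt0r_neq0 n0)) -mulrBl normrM [`|_^-1|]gtr0_norm ?invr_gt0//.
rewrite ler_pM2r ?invr_gt0// ger0_norm ?subr_ge0//.
by rewrite lerBlDl ltW//; rewrite intrD in G2.
Unshelve. all: by end_near. Qed.

(** A subset of a separable metric space is separable: for each of the countably many codes choose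
    an element of [T] having that code, if there is one. Elements with a common code of precision
    [n] differ by at most 4/(n+1) in all three quantities. *)
Lemma countable_uniform_dense (T : Type) (t0 : T) (F1 F2 : T -> 'rV[R]_d -> R) (a : T -> R) :
  (forall t, cper (F1 t)) -> (forall t, cper (F2 t)) ->
  exists ts : nat -> T, forall t (e : R), 0 < e -> exists n,
    [/\ forall x, `|F1 t x - F1 (ts n) x| <= e, forall x, `|F2 t x - F2 (ts n) x| <= e &
        `|a t - a (ts n)| <= e].
Proof.
move=> c1 c2.
pose P (i : nat * (nat * seq int) * (nat * seq int) * int) t :=
  [/\ grid_approx i.1.1.1 i.1.1.2 (F1 t), grid_approx i.1.1.1 i.1.2 (F2 t) &
     `|a t - i.2%:~R / i.1.1.1.+1%:R| <= 2 / i.1.1.1.+1%:R].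
have /choice[s Hs] i : exists t, (exists t', P i t') -> P i t.
  by have [[t Pt]|nP] := pselect (exists t', P i t'); [exists t|exists t0 => /nP].
exists (fun n => oapp s t0 (unpickle n)) => t e e0.
have [n nE] : exists n : nat, 1 / n.+1%:R <= e / 4.
  have e4 : 0 < e / 4 by rewrite divr_gt0.
  near \oo => n; exists n; rewrite div1r; apply: ltW; near: n.
  exact: (near_infty_natSinv_lt (PosNum e4)).
have n0 : 0 < n.+1%:R :> R by rewrite ltr0n.
have [k1 H1] := grid_approx_exists n (c1 t).1; have [k2 H2] := grid_approx_exists n (c2 t).1.
have Ha : `|a t - (Num.floor (a t * n.+1%:R))%:~R / n.+1%:R| <= 2 / n.+1%:R.
  have /andP[G1 G2] := floor_itv (a t * n.+1%:R).
  rewrite -{1}[a t](mulfK (lt0r_neq0 n0)) -mulrBl normrM [`|_^-1|]gtr0_norm ?invr_gt0//.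
  rewrite ler_pM2r ?invr_gt0// ger0_norm ?subr_ge0// lerBlDl.
  by rewrite intrD in G2; apply: (le_trans (ltW G2)); rewrite lerD2l ler1n.
pose i := (n, k1, k2, Num.floor (a t * n.+1%:R)).
have [K1 K2 K3] := Hs i (ex_intro _ t (And3 H1 H2 Ha)).
exists (pickle i); rewrite pickleK /=.
have ne : 2 / n.+1%:R + 2 / n.+1%:R <= e.
  by rewrite (_ : 2 / _ + _ = 4 * (1 / n.+1%:R)); [rewrite mulrC -ler_pdivlMr|ring].
have tri (p q r : R) : `|p - r| <= 2 / n.+1%:R -> `|q - r| <= 2 / n.+1%:R -> `|p - q| <= e.
  move=> pr qr; apply: le_trans ne; rewrite (_ : p - q = (p - r) - (q - r)); last by ring.
  by rewrite (le_trans (ler_normB _ _))// lerD.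
have per (G G' : 'rV[R]_d -> R) c : cper G -> cper G' -> grid_approx n c G -> grid_approx n c G' ->
    forall x, `|G x - G' x| <= e.
  move=> [_ pG] [_ pG'] HG HG' x.
  rewrite -(periodic_frac_part x pG) -(periodic_frac_part x pG').
  by apply: tri; [exact: (HG _ (frac_part_cube x))|exact: (HG' _ (frac_part_cube x))].
by split; [exact: per H1 K1|exact: per H2 K2|exact: tri Ha K3].
Unshelve. all: by end_near. Qed.

End separability.

(** * Fatou's lemma and completeness of L^1 *)

Section L1_completeness.
Context {R : realType} {d : nat}.
Implicit Types f h : 'rV[R]_d -> R.

Lemma tint_fatou (F : nat -> 'rV[R]_d -> R) h (C : R) :
  (forall k, tintegrable (F k)) -> (forall k x, 0 <= F k x) -> tmeas h ->
  ae_torus (fun x => F k x @[k --> \oo] --> h x) -> (forall k, tint (F k) <= C) ->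
  tintegrable h /\ tint h <= C.
Proof.
move=> IF F0 mh Fh FC.
have mF k : measurable_fun setT (fun t => (F k (row_of t))%:E).
  by apply/measurable_EFinP; exact: tintegrable_tmeas.
have h0 : ae_torus (fun x => 0 <= h x).
  apply: ae_torusS Fh => x Fx; rewrite -(cvg_lim _ Fx)//.
  by apply: limr_ge; [apply/cvg_ex; exists (h x)|near=> k].
have hE : ae_torus (fun x => (h x)%:E = limn_einf (fun k => (F k x)%:E)).
  apply: ae_torusS Fh => x Fx.
  have /cvg_limn_einf_sup[-> _] // : (F k x)%:E @[k --> \oo] --> (h x)%:E.
  by apply: cvg_EFin => //; exact: nearW.
have le1 : (eint (EFin \o h) <= C%:E)%E.
  rewrite /eint (_ : \int[_]_t _ = \int[torus_leb R d]_t (limn_einf (fun k => (F k (row_of t))%:E)))%E; last first.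
    apply/esym; apply: integral_ae; first exact/measurable_EFinP.
    by apply: (@filterS _ (almost_everywhere (torus_leb R d)) _ _ _ _ hE) => t /= ->.
  apply: le_trans.
    apply: (@fatou _ _ _ (torus_leb R d) setT measurableT (fun k t => (F k (row_of t))%:E)) => //.
    by move=> k t _; rewrite lee_fin.
  rewrite limn_einf_lim; apply: lime_le; first exact: is_cvg_einfs.
  near=> n; apply: (@le_trans _ _ (\int[torus_leb R d]_t (F n (row_of t))%:E)%E).
    by apply: ereal_inf_lbound; exists n => /=.
  by have := eint_tint (IF n); rewrite /eint /= => ->; rewrite lee_fin.
have Ih := tintegrable_ge0 mh h0 le1.
by split=> //; rewrite -lee_fin -eint_tint.
Unshelve. all: by end_near. Qed.

Lemma cvg_powR_norm (u : nat -> R) (l p : R) : 1 <= p -> u @ \oo --> l ->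
  `|u k| `^ p @[k --> \oo] --> `|l| `^ p.
Proof.
move=> p1 ul; have nl : `|u k| @[k --> \oo] --> `|l| by exact: cvg_norm.
have p0 : 0 < p by apply: lt_le_trans p1.
have [l0|ln0] := eqVneq l 0.
  rewrite l0 normr0 powR0 ?gt_eqF// in nl *.
  apply: (@squeeze_cvgr _ _ _ _ (fun=> 0) (fun k => `|u k|)); [|exact: cvg_cst|exact: nl].
  near=> k; rewrite powR_ge0 /=.
  have : `|u k| <= 1 by near: k; apply: (cvgr_le _ nl); exact: ltr01.
  move=> u1; have [->|un0] := eqVneq `|u k| 0; first by rewrite powR0 ?gt_eqF.
  rewrite -[leRHS]powRr1//; apply: ger_powR => //.
  by rewrite u1 lt_def un0 normr_ge0.
have lp : 0 < `|l| by rewrite normr_gt0.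
have E : \forall k \near \oo, expR (p * ln `|u k|) = `|u k| `^ p.
  near=> k; rewrite /powR ifF//; apply/negbTE; rewrite gt_eqF//.
  by near: k; apply: (cvgr_gt _ nl).
have -> : `|l| `^ p = expR (p * ln `|l|) by rewrite /powR gt_eqF.
apply: (cvg_trans _ (_ : expR (p * ln `|u k|) @[k --> \oo] --> expR (p * ln `|l|))).
  by apply: near_eq_cvg; exact: E.
apply: (@cvg_comp _ _ _ (fun k => p * ln `|u k|) expR); last exact: continuous_expR.
apply: cvgMr; apply: (@cvg_comp _ _ _ (fun k => `|u k|) (@ln R)); first exact: nl.
exact: continuous_ln.
Unshelve. all: by end_near. Qed.

(** Riesz and Fischer's argument along a fast subsequence. Taking an upper limit as the limit
    function defines it everywhere, which preserves periodicity and measurability. Bounds in L^p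
    pass to it by Fatou's lemma. *)
Lemma L1_complete (f_ : nat -> 'rV[R]_d -> R) :
  (forall n, cper (f_ n)) ->
  (forall e : R, 0 < e -> exists N, forall n p, (N <= n)%N -> (N <= p)%N ->
    tint (fun x => `|f_ n x - f_ p x|) <= e) ->
  exists f, [/\ periodic f, tintegrable f,
    (forall e : R, 0 < e -> exists N, forall n, (N <= n)%N -> tint (fun x => `|f_ n x - f x|) <= e) &
    (forall p K : R, 1 <= p -> (forall n, tint (fun x => `|f_ n x| `^ p) <= K) -> torusLp p%:E f)].
Proof.
move=> cf Hc.
have h0 k : 0 < (2^-1 : R) ^+ k by rewrite exprn_gt0// invr_gt0.
have /choice[N HN] k := Hc _ (h0 k).
(* The maximum makes all later indices admissible for the k-th tolerance; adding [k] makes the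
   indices tend to infinity. *)
pose nk k := (k + \max_(i < k.+1) N i)%N.
have nkN k j : (k <= j)%N -> (N k <= nk j)%N.
  by move=> kj; apply: leq_trans (leq_addl _ _); apply: (@leq_bigmax _ (fun i : 'I_j.+1 => N i) (Ordinal (kj : (k < j.+1)%N))).
pose F k := f_ (nk k).
pose D k x : R := `|F k.+1 x - F k x|.
have cD k : cper (D k) by exact: (cper_norm (cperB (cf _) (cf _))).
have ID k := cper_tintegrable (cD k).
have tD k : tint (D k) <= 2^-1 ^+ k by apply: HN; apply: nkN.
have D0 k x : 0 <= D k x by exact: normr_ge0.
pose S (t : d.-tuple (measurableTypeR R)) := (\sum_(k <oo) (D k (row_of t))%:E)%E.
have mD k : measurable_fun setT (fun t => (D k (row_of t))%:E).
  by apply/measurable_EFinP; exact: cper_tmeas.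
have S0 t : (0 <= S t)%E by apply: nneseries_ge0 => k _ _; rewrite lee_fin.
have IS : (torus_leb R d).-integrable setT S.
  apply/integrableP; split.
    by apply: ge0_emeasurable_sum => // k t _; rewrite lee_fin.
  under eq_integral do rewrite gee0_abs//.
  rewrite integral_nneseries//; last by move=> k t _; rewrite lee_fin.
  apply: (@le_lt_trans _ _ ((2 : R)%:E)%E); last exact: ltry.
  rewrite -[leRHS](_ : (\sum_(k <oo) ((2^-1 : R) ^+ k)%:E)%E = _).
    apply: lee_nneseries; first by move=> k *; apply: integral_ge0 => t _; rewrite lee_fin.
    by move=> k *; have := eint_tint (ID k); rewrite /eint /= => ->; rewrite lee_fin.
  have half : `|2^-1 : R| < 1 by rewrite ger0_norm ?invr_ge0// invf_lt1// ltr1n.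
  have gs : series (geometric (1 : R) 2^-1) @ \oo --> (1 * (1 - 2^-1)^-1 : R).
    exact: cvg_geometric_series.
  have gsE : (fun n => \sum_(0 <= k < n) ((2^-1 : R) ^+ k)%:E)%E = EFin \o series (geometric 1 2^-1).
    apply/funext => n /=; rewrite /series /= sumEFin; congr (_%:E).
    by apply: eq_bigr => k _; rewrite /geometric /= mul1r.
  rewrite gsE; apply/cvg_lim => //.
  have -> : (2 : R)%:E = (1 * (1 - 2^-1)^-1 : R)%:E by congr (_%:E); field.
  by apply: cvg_EFin; [exact: nearW|exact: gs].
have aeS : {ae torus_leb R d, forall t, S t \is a fin_num}.
  have := integrable_ae measurableT IS.
  by apply: filterS => t; apply.
pose fL (x : 'rV[R]_d) : R := fine (limn_esup (fun k => (F k x)%:E)).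
have aeF : ae_torus (fun x => F k x @[k --> \oo] --> fL x).
  apply: (@filterS _ (almost_everywhere (torus_leb R d)) _ _ _ _ aeS) => t St.
  set x := row_of t.
  have cF : cvgn (F^~ x).
    have FE n : F n x = F 0%N x + \sum_(0 <= k < n) (F k.+1 x - F k x).
      by rewrite telescope_sumr// addrC subrK.
    have : cvgn (series (fun k => F k.+1 x - F k x)).
      apply: normed_cvg; apply: nondecreasing_is_cvgn.
        by apply: nondecreasing_series => k _ _; exact: normr_ge0.
      exists (fine (S t)) => _ [n _ <-].
      rewrite -lee_fin fineK// /series /= -sumEFin.
      by rewrite /S; apply: nneseries_lim_ge => k *; rewrite lee_fin.
    move=> /cvg_ex[l Hl]; apply/cvg_ex; exists (F 0%N x + l).
    rewrite (_ : F^~ x = fun n => F 0%N x + series (fun k => F k.+1 x - F k x) n).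
      by apply: cvgD; [exact: cvg_cst|exact: Hl].
    by apply/funext => n; rewrite FE.
  have [l Hl] := (cvg_ex _).1 cF.
  have El : (F k x)%:E @[k --> \oo] --> l%:E by apply: cvg_EFin => //; exact: nearW.
  by have [_ lE] := cvg_limn_einf_sup El; rewrite /fL lE.
have mfL : tmeas fL.
  have : measurable_fun setT (fun t => limn_esup (fun k => (F k (row_of t))%:E)).
    by apply: measurable_fun_limn_esup => k; apply/measurable_EFinP; exact: cper_tmeas (cf _).
  by move=> m; exact: (measurableT_comp (@fine_measurable R setT measurableT) m).
have pfL : periodic fL.
  move=> x k; rewrite /fL; congr (fine (limn_esup _)); apply/funext => j.
  by rewrite /F (cf _).2.
have dist e : 0 < e -> exists M, forall n, (M <= n)%N ->
    tintegrable (fun x => `|f_ n x - fL x|) /\ tint (fun x => `|f_ n x - fL x|) <= e.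
  move=> e0; have [M HM] := Hc _ e0; exists M => n Mn.
  have [K HK] : exists K, forall k, (M <= nk (k + K)%N)%N.
    by exists M => k; rewrite /nk -addnA addnCA leq_addr.
  apply: (@tint_fatou (fun k x => `|f_ n x - F (k + K)%N x|)) => //.
  - by move=> k; exact: (cper_tintegrable (cper_norm (cperB (cf _) (cf _)))).
  - apply: (@measurableT_comp _ _ _ _ _ _ (fun y : R => `|y|)) => //.
    by apply: measurable_funB => //; exact: cper_tmeas (cf n).
  - apply: ae_torusS aeF => x Fx; apply: cvg_norm; apply: cvgB; first exact: cvg_cst.
    by have := Fx; rewrite -(cvg_shiftn K).
  - by move=> k; exact: HM.
exists fL; split=> //.
- have [M HM] := dist 1 ltr01; have [Id _] := HM M (leqnn _).
  apply: (@le_tintegrable _ _ _ (fun x => `|f_ M x - fL x| + `|f_ M x|)) => //.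
    move=> x; rewrite [leRHS]ger0_norm ?addr_ge0// -{1}(subKr (f_ M x) (fL x)).
    by rewrite [leRHS]addrC ler_normB.
  by apply: tintegrableD => //; apply: tintegrable_norm; exact: cper_tintegrable.
- by move=> e /dist[M HM]; exists M => n /HM[].
- move=> p K p1 HK; split=> //; apply/Lfun_tintegrable => //; split=> //.
  apply: (@tint_fatou (fun k x => `|F k x| `^ p) _ K _ _ _ _ _).1.
  + by move=> k; apply: powR_cper_tintegrable; [exact: le_trans p1|exact: cf].
  + by move=> k x; exact: powR_ge0.
  + apply: (@measurableT_comp _ _ _ _ _ _ (fun a : R => a `^ p)); first exact: measurable_powR.
    exact: measurableT_comp.
  + by apply: ae_torusS aeF => x; exact: cvg_powR_norm.
  + by move=> k; exact: HK.
Qed.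

End L1_completeness.

(** * Strong limits of convex combinations *)

Section strict_convexity.
Context {R : realType}.
Implicit Types a b : R.

Definition sqrt1 a : R := Num.sqrt (1 + a ^+ 2).

(** The convexity defect of [sqrt1] at the midpoint. By [defect_lower] it controls (a - b)^2, but
    only with a weight that grows with a and b. *)
Definition defect a b : R := (sqrt1 a + sqrt1 b) / 2 - sqrt1 ((a + b) / 2).

Lemma sqrt1_sqr a : sqrt1 a ^+ 2 = 1 + a ^+ 2.
Proof. by rewrite sqr_sqrtr// addr_ge0// sqr_ge0. Qed.

Lemma sqrt1_ge1 a : 1 <= sqrt1 a.
Proof. by rewrite -[leLHS]sqrtr1 ler_sqrt ?lerDl ?sqr_ge0// addr_ge0// sqr_ge0. Qed.

Lemma norm_le_sqrt1 a : `|a| <= sqrt1 a.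
Proof. by rewrite -sqrtr_sqr ler_sqrt ?lerDr// addr_ge0// sqr_ge0. Qed.

Lemma sqrt1_le a : sqrt1 a <= 1 + `|a|.
Proof.
have s0 : 0 <= sqrt1 a by exact: sqrtr_ge0.
have n0 := normr_ge0 a.
rewrite -(@ler_pXn2r _ 2%N) ?nnegrE ?addr_ge0// sqrt1_sqr -(real_normK (num_real a)).
have -> : (1 + `|a|) ^+ 2 = 1 + `|a| ^+ 2 + 2 * `|a| by ring.
by rewrite lerDl mulr_ge0.
Qed.

(* With A = sqrt1 a, B = sqrt1 b and M = sqrt1 ((a + b) / 2),
   ((A + B) / 2)^2 - M^2 = (AB - 1 - ab) / 2 and
   (AB)^2 - (1 + ab)^2 = (a - b)^2. *)
Lemma defect_lower a b :
  (a - b) ^+ 2 <= 4 * (sqrt1 a * sqrt1 b * (sqrt1 a + sqrt1 b)) * defect a b /\ 0 <= defect a b.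
Proof.
rewrite /defect; set A := sqrt1 a; set B := sqrt1 b; set M := sqrt1 _.
have A1 : 1 <= A := sqrt1_ge1 a; have B1 : 1 <= B := sqrt1_ge1 b; have M1 : 1 <= M := sqrt1_ge1 _.
have A2 : A ^+ 2 = 1 + a ^+ 2 := sqrt1_sqr a; have B2 : B ^+ 2 = 1 + b ^+ 2 := sqrt1_sqr b.
have M2 : M ^+ 2 = 1 + ((a + b) / 2) ^+ 2 := sqrt1_sqr _.
clearbody A B M.
have AB1 : 1 <= A * B by rewrite -[leLHS]mulr1 ler_pM.
have E1 : (A * B - (1 + a * b)) * (A * B + (1 + a * b)) = (a - b) ^+ 2.
  have -> : (A * B - (1 + a * b)) * (A * B + (1 + a * b)) = A ^+ 2 * B ^+ 2 - (1 + a * b) ^+ 2 by ring.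
  by rewrite A2 B2; ring.
have E2 : ((A + B) / 2 - M) * ((A + B) / 2 + M) = (A * B - (1 + a * b)) / 2.
  have -> : ((A + B) / 2 - M) * ((A + B) / 2 + M) = (A ^+ 2 + B ^+ 2 + 2 * A * B) / 4 - M ^+ 2 by field.
  by rewrite A2 B2 M2; field.
have abAB : `|1 + a * b| <= A * B.
  have AB0 : 0 <= A * B by apply: le_trans AB1.
  rewrite -(@ler_pXn2r _ 2%N) ?nnegrE//.
  rewrite real_normK ?num_real// exprMn A2 B2 -subr_ge0.
  have -> : (1 + a ^+ 2) * (1 + b ^+ 2) - (1 + a * b) ^+ 2 = (a - b) ^+ 2 by ring.
  exact: sqr_ge0.
move: abAB; rewrite ler_norml => /andP[ab1 ab2].
have P0 : 0 <= A * B - (1 + a * b) by rewrite subr_ge0.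
have S0 : 0 < (A + B) / 2 + M by clear -A1 B1 M1; lra.
have D0 : 0 <= (A + B) / 2 - M by rewrite -(pmulr_lge0 _ S0) E2 divr_ge0.
split=> //.
have H1 : (a - b) ^+ 2 <= (A * B - (1 + a * b)) * (2 * (A * B)).
  by rewrite -E1 ler_wpM2l//; clear -ab2; lra.
apply: (le_trans H1).
have -> : A * B - (1 + a * b) = 2 * (((A + B) / 2 - M) * ((A + B) / 2 + M)) by rewrite E2; field.
have H2 : (A + B) / 2 + M <= A + B by clear -D0; lra.
set Dd := (A + B) / 2 - M in D0 *; set Ss := (A + B) / 2 + M in H2 *.
have -> : 2 * (Dd * Ss) * (2 * (A * B)) = 4 * (A * B * Dd) * Ss by ring.
have -> : 4 * (A * B * (A + B)) * Dd = 4 * (A * B * Dd) * (A + B) by ring.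
rewrite ler_wpM2l// mulr_ge0// mulr_ge0//; exact: le_trans AB1.
Qed.

(** Where the two values of [sqrt1] sum to at most [M], (a - b)^2 is at most 4 M^3 times the defect,
    and the inequality 4 x y <= (x + y)^2 with x = lam defect, y = M^3 / lam separates the factors.
    Beyond [M] the superlinear p-th power takes over. *)
Lemma norm_sub_le_defect (L M p lam : R) a b : 0 < L -> 0 < M -> 0 < lam ->
  (forall x : R, M < x -> x * L <= x `^ p) ->
  `|a - b| <= lam * defect a b + M ^+ 3 / lam + (sqrt1 a + sqrt1 b) `^ p / L.
Proof.
move=> L0 M0 l0 HM; have [H D0] := defect_lower a b.
have A1 := sqrt1_ge1 a; have B1 := sqrt1_ge1 b.
have ML : 0 <= M ^+ 3 / lam by rewrite divr_ge0 ?exprn_ge0// ltW.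
have [AB|AB] := leP (sqrt1 a + sqrt1 b) M; last first.
  have n1 : `|a - b| <= sqrt1 a + sqrt1 b.
    by rewrite (le_trans (ler_normB _ _))// lerD// norm_le_sqrt1.
  have n2 : sqrt1 a + sqrt1 b <= (sqrt1 a + sqrt1 b) `^ p / L by rewrite ler_pdivlMr//; exact: HM.
  have n3 : 0 <= lam * defect a b by rewrite mulr_ge0// ltW.
  by rewrite (le_trans n1)// (le_trans n2)// lerDr addr_ge0.
have p0 : 0 <= (sqrt1 a + sqrt1 b) `^ p / L by rewrite divr_ge0 ?powR_ge0// ltW.
apply: le_trans (_ : lam * defect a b + M ^+ 3 / lam <= _); last by rewrite lerDl.
set A := sqrt1 a in H A1 AB; set B := sqrt1 b in H B1 AB.
have A0 : 0 <= A by apply: le_trans A1.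
have B0 : 0 <= B by apply: le_trans B1.
have AM : A <= M by clear -AB B0; lra.
have BM : B <= M by clear -AB A0; lra.
have H3 : (a - b) ^+ 2 <= 4 * M ^+ 3 * defect a b.
  apply: (le_trans H); rewrite ler_wpM2r// ler_pM2l//.
  by rewrite (_ : M ^+ 3 = M * M * M); [rewrite !ler_pM ?mulr_ge0 ?addr_ge0|ring].
set x := lam * defect a b; set y := M ^+ 3 / lam.
have x0 : 0 <= x by rewrite mulr_ge0// ltW.
have xy : 4 * M ^+ 3 * defect a b = 4 * (x * y).
  by rewrite /x /y; field; rewrite gt_eqF.
rewrite -(@ler_pXn2r _ 2%N) ?nnegrE ?addr_ge0// real_normK ?num_real//.
apply: (le_trans H3); rewrite xy -subr_ge0.
by rewrite (_ : (x + y) ^+ 2 - 4 * (x * y) = (x - y) ^+ 2) ?sqr_ge0//; ring.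
Qed.

Lemma powR_superlinear (L p : R) : 0 < L -> 1 < p ->
  exists2 M : R, 0 < M & forall x : R, M < x -> x * L <= x `^ p.
Proof.
move=> L0 p1; have q0 : 0 < p - 1 by rewrite subr_gt0.
exists (L `^ (p - 1)^-1) => [|x Mx]; first by rewrite powR_gt0.
have x0 : 0 < x by apply: le_lt_trans Mx; exact: powR_ge0.
have -> : x `^ p = x * x `^ (p - 1).
  rewrite {1}(_ : p = 1 + (p - 1)); last by ring.
  by rewrite (@powRD _ x 1 (p - 1)) ?(lt0r_neq0 x0) ?implybT// (powRr1 (ltW x0)).
rewrite ler_pM2l//.
have -> : L = (L `^ (p - 1)^-1) `^ (p - 1) by rewrite -powRrM mulVf ?gt_eqF// powRr1// ltW.
by apply: ge0_ler_powR; rewrite ?nnegrE ?powR_ge0// ltW.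
Qed.

Lemma powR_midpoint a b (p : R) : 1 <= p ->
  `|(a + b) / 2| `^ p <= (`|a| `^ p + `|b| `^ p) / 2.
Proof.
move=> p1; have p0 : 0 < p by apply: lt_le_trans p1.
apply: (@le_trans _ _ (((`|a| + `|b|) / 2) `^ p)).
  apply: ge0_ler_powR; rewrite ?nnegrE ?divr_ge0 ?addr_ge0 ?(ltW p0)//.
  by rewrite normrM [`|2^-1|]ger0_norm// ler_pM2r// ler_normD.
have [->|pn1] := eqVneq p 1; first by rewrite !powRr1// divr_ge0// addr_ge0.
move: (normr_ge0 a) (normr_ge0 b); move: `|a| `|b| => {}a {}b a0 b0.
set c := (a + b) / 2; have c0 : 0 <= c by rewrite divr_ge0// addr_ge0.
have p1' : 1 < p by rewrite lt_def pn1.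
pose q := p / (p - 1).
have pq : p^-1 + q^-1 = 1 by rewrite /q invf_div; field; rewrite gt_eqF ?subr_gt0// gt_eqF.
have q0 : 0 < q by rewrite divr_gt0// subr_gt0.
have cc : c * c `^ (p - 1) = c `^ p.
  have [->|cn0] := eqVneq c 0; first by rewrite mul0r powR0// gt_eqF.
  by rewrite -{1}(powRr1 c0) -powRD ?cn0 ?implybT//; congr (_ `^ _); ring.
have cq : (c `^ (p - 1)) `^ q = c `^ p.
  by rewrite -powRrM /q mulrC divfK// gt_eqF// subr_gt0.
have Y x : 0 <= x -> x * c `^ (p - 1) <= x `^ p / p + c `^ p / q.
  by move=> x0; rewrite -cq; apply: conjugate_powR => //; exact: powR_ge0.
have Ya := Y _ a0; have Yb := Y _ b0.
have cE : c `^ p / q = c `^ p - c `^ p / p.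
  by rewrite -{2}[c `^ p]mulr1 -pq mulrDr addrAC subrr add0r.
have ab : a * c `^ (p - 1) + b * c `^ (p - 1) = 2 * c `^ p.
  by rewrite -cc /c; field.
have : c `^ p / p <= ((a `^ p + b `^ p) / 2) / p.
  rewrite !mulrDl; clear -Ya Yb cE ab; lra.
by rewrite ler_pM2r// invr_gt0.
Qed.

End strict_convexity.

Section linear_arithmetic.
Context {R : realType}.

Lemma half_sum_le (a b K : R) : a <= K -> b <= K -> 2^-1 * (a + b) <= K.
Proof. lra. Qed.

Lemma add1_le_add2 (a b : R) : 0 <= b -> (1 < a -> a <= b) -> 1 + a <= 2 + b.
Proof. by move=> b0 H; have [|/H] := leP a 1; lra. Qed.

Lemma midpoint_gap_le (s eta a m x y : R) : s - eta < a -> a <= m -> x <= s + eta ->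
  y <= s + eta -> (x + y) / 2 - m <= 2 * eta.
Proof. lra. Qed.

Lemma third_sum_le (a b e : R) : a <= e / 3 -> b <= e / 3 -> a + e / 3 + b <= e.
Proof. lra. Qed.

End linear_arithmetic.

(** * Near-minimisers of a strictly convex energy over midpoint hulls *)

Section midpoint_hulls.
Context {R : realType} {d : nat}.
Implicit Types f g : 'rV[R]_d -> R.

Definition jet1 (i : option 'I_d) f : 'rV[R]_d -> R := if i is Some j then partial j f else f.

(** Strict convexity is exploited at midpoints only. Closure under midpoints suffices for it and
    turns the preservation of affine inequalities into a structural induction. *)
Inductive midpoint_hull (P : ('rV[R]_d -> R) -> Prop) : ('rV[R]_d -> R) -> Prop :=
| midpoint_hull_base f : P f -> midpoint_hull P f
| midpoint_hull_mid f g : midpoint_hull P f -> midpoint_hull P g ->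
    midpoint_hull P (fun x => (f x + g x) / 2).

Lemma midpoint_hullS (P Q : ('rV[R]_d -> R) -> Prop) f : (forall f, P f -> Q f) ->
  midpoint_hull P f -> midpoint_hull Q f.
Proof.
move=> PQ; elim=> [k /PQ Qk|k l _ Hk _ Hl]; first exact: midpoint_hull_base.
exact: midpoint_hull_mid.
Qed.

Lemma Cinfty_mid f g : Cinfty f -> Cinfty g -> Cinfty (fun x => (f x + g x) / 2).
Proof.
move=> Cf Cg; have := CinftyM (CinftyD Cf Cg) (Cinfty_cst 2^-1).
by [].
Qed.

Lemma jet1_mid i f g x : Cinfty f -> Cinfty g ->
  jet1 i (fun x => (f x + g x) / 2) x = (jet1 i f x + jet1 i g x) / 2.
Proof.
move=> Cf Cg; case: i => [j|] //=.
have -> : (fun x => (f x + g x) / 2) = fun x => 2^-1 * f x - (- 2^-1) * g x.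
  by apply/funext => y; ring.
rewrite -[LHS]/(partials [:: j] (fun x => 2^-1 * f x - - 2^-1 * g x) x).
rewrite (partialsB [:: j] (CinftyZ 2^-1 Cf) (CinftyZ (- 2^-1) Cg)).
by rewrite (partialsZ [:: j] _ Cf) (partialsZ [:: j] _ Cg) /=; ring.
Qed.

Lemma Cinfty_jet1 i f : Cinfty f -> Cinfty (jet1 i f).
Proof. by case: i => [j|] //= Cf; exact: Cinfty_partial. Qed.

Lemma cper_sqrt1 f : cper f -> cper (fun x => sqrt1 (f x)).
Proof.
move=> cf; apply: (@cper_comp _ _ Num.sqrt (fun x => 1 + f x ^+ 2)); first exact: sqrt_continuous.
apply: cperD; first exact: cper_cst.
rewrite (_ : (fun x => _) = fun x => f x * f x); first exact: cperM.
by apply/funext => x; rewrite expr2.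
Qed.

Context (u_ : nat -> 'rV[R]_d -> R) (p K : R).
Context (p1 : 1 < p) (Cu : forall j, Cinfty (u_ j)).
Context (uK : forall j i, tint (fun x => `|jet1 i (u_ j) x| `^ p) <= K).

Definition tail_hull n := midpoint_hull (fun f => exists2 j, (n <= j)%N & f = u_ j).

Definition energy f : R := \sum_i tint (fun x => sqrt1 (jet1 i f x)).

Let p0 : 0 <= p. Proof. by apply: ltW; apply: lt_trans p1. Qed.

Lemma tail_hull_Cinfty n f : tail_hull n f -> Cinfty f.
Proof. by elim=> [_ [j _ ->]|k l _ Ck _ Cl]; [exact: Cu|exact: Cinfty_mid]. Qed.

Let Ip i f : Cinfty f -> tintegrable (fun x => `|jet1 i f x| `^ p).
Proof. by move=> Cf; apply: powR_cper_tintegrable => //; exact/Cinfty_cper/Cinfty_jet1. Qed.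

Lemma tail_hull_bound n f i : tail_hull n f -> tint (fun x => `|jet1 i f x| `^ p) <= K.
Proof.
elim=> [_ [j _ ->]|k l Hk IHk Hl IHl]; first exact: uK.
have Ck := tail_hull_Cinfty Hk; have Cl := tail_hull_Cinfty Hl.
have Ik := Ip i Ck; have Il := Ip i Cl.
apply: (@le_trans _ _ (tint (fun x => 2^-1 * (`|jet1 i k x| `^ p + `|jet1 i l x| `^ p)))).
  apply: le_tint; [exact: Ip (Cinfty_mid Ck Cl)|by apply: tintegrableZ; exact: tintegrableD|].
  move=> x; rewrite (jet1_mid i x Ck Cl) [leRHS]mulrC; exact: powR_midpoint (ltW p1).
rewrite tintZ ?tintD//; last exact: tintegrableD.
exact: half_sum_le.
Qed.

Lemma energy_ge0 f : 0 <= energy f.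
Proof. by apply: sumr_ge0 => i _; apply: tint_ge0 => x; exact: sqrtr_ge0. Qed.

Lemma tail_hull_energy n f : tail_hull n f -> energy f <= \sum_(i : option 'I_d) (2 + K).
Proof.
move=> Hf; have Cf := tail_hull_Cinfty Hf; apply: ler_sum => i _.
have c2 := cper_tintegrable (cper_cst 2 : cper (fun _ : 'rV[R]_d => 2)).
apply: (@le_trans _ _ (tint (fun x => 2 + `|jet1 i f x| `^ p))); last first.
  by rewrite tintD ?tint_cst ?lerD2l ?(tail_hull_bound _ Hf)//; exact: Ip.
apply: le_tint; first exact/cper_tintegrable/cper_sqrt1/Cinfty_cper/Cinfty_jet1.
  by apply: tintegrableD => //; exact: Ip.
move=> x; apply: (le_trans (sqrt1_le _)); apply: add1_le_add2; first exact: powR_ge0.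
by move=> a1; rewrite -[leLHS](powRr1 (normr_ge0 _)); apply: ler_powR; exact: ltW.
Qed.

Lemma energy_defect f g : Cinfty f -> Cinfty g ->
  \sum_i tint (fun x => defect (jet1 i f x) (jet1 i g x)) =
  (energy f + energy g) / 2 - energy (fun x => (f x + g x) / 2).
Proof.
move=> Cf Cg; rewrite /energy -big_split mulr_suml -sumrB; apply: eq_bigr => i _ /=.
have S k : Cinfty k -> tintegrable (fun x => sqrt1 (jet1 i k x)).
  by move=> Ck; exact/cper_tintegrable/cper_sqrt1/Cinfty_cper/Cinfty_jet1.
have Sf := S _ Cf; have Sg := S _ Cg; have Sm := S _ (Cinfty_mid Cf Cg).
rewrite -tintD// mulrC -tintZ; last exact: tintegrableD.
rewrite -tintB//; last by apply: tintegrableZ; exact: tintegrableD.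
by apply: eq_tint => x; rewrite /defect (jet1_mid i x Cf Cg) mulrC.
Qed.

Lemma tail_hull_cauchy_bound : exists K2 : R, forall n f g i, tail_hull n f -> tail_hull n g ->
  tintegrable (fun x => (sqrt1 (jet1 i f x) + sqrt1 (jet1 i g x)) `^ p) /\
  tint (fun x => (sqrt1 (jet1 i f x) + sqrt1 (jet1 i g x)) `^ p) <= K2.
Proof.
exists (2 `^ p * (2 `^ p * (1 + K) + 2 `^ p * (1 + K))) => n f g i Hf Hg.
have Cf := tail_hull_Cinfty Hf; have Cg := tail_hull_Cinfty Hg.
have s0 (a : R) : 0 <= sqrt1 a by exact: sqrtr_ge0.
have cs k : Cinfty k -> cper (fun x => sqrt1 (jet1 i k x)).
  by move=> Ck; exact/cper_sqrt1/Cinfty_cper/Cinfty_jet1.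
have I0 : tintegrable (fun x => (sqrt1 (jet1 i f x) + sqrt1 (jet1 i g x)) `^ p).
  have := powR_cper_tintegrable p0 (cperD (cs _ Cf) (cs _ Cg)).
  by congr tintegrable; apply/funext => x; rewrite ger0_norm// addr_ge0.
split=> //.
have c1 := cper_tintegrable (cper_cst 1 : cper (fun _ : 'rV[R]_d => 1)).
have I1 k : Cinfty k -> tintegrable (fun x => 2 `^ p * (1 + `|jet1 i k x| `^ p)).
  by move=> Ck; apply: tintegrableZ; apply: tintegrableD => //; exact: Ip.
have Jf := I1 _ Cf; have Jg := I1 _ Cg.
apply: (@le_trans _ _ (tint (fun x => 2 `^ p * (2 `^ p * (1 + `|jet1 i f x| `^ p) + 2 `^ p * (1 + `|jet1 i g x| `^ p))))).
  apply: le_tint => //; first by apply: tintegrableZ; exact: tintegrableD.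
  have b (a : R) : sqrt1 a `^ p <= 2 `^ p * (1 + `|a| `^ p).
    apply: (@le_trans _ _ ((1 + `|a|) `^ p)).
      by apply: ge0_ler_powR; rewrite ?nnegrE ?addr_ge0//; exact: sqrt1_le.
    by apply: le_trans (le_powRD _ _ _) _ => //; rewrite powR1.
  move=> x; apply: le_trans (le_powRD _ _ _) _ => //.
  by rewrite ler_wpM2l ?powR_ge0// lerD.
rewrite tintZ; last exact: tintegrableD.
rewrite ler_wpM2l ?powR_ge0// tintD//.
have If := Ip i Cf; have Ig := Ip i Cg.
have t k : Cinfty k -> tail_hull n k -> tint (fun x => 2 `^ p * (1 + `|jet1 i k x| `^ p)) <= 2 `^ p * (1 + K).
  move=> Ck Hk; rewrite tintZ; last by apply: tintegrableD => //; exact: Ip.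
  by rewrite ler_wpM2l ?powR_ge0// tintD ?tint_cst ?lerD2l ?(tail_hull_bound _ Hk)//; exact: Ip.
by apply: lerD; exact: t.
Qed.

(** The infima [a n] of the energy over the tail hulls increase to a finite limit s. For large n and
    q, the midpoint of [z n] and [z q] lies in a hull whose infimum is close to s, while both
    energies are hardly above s. The defects are thus small in mean, for the functions and for each
    partial derivative. *)
Lemma hull_limit : exists z : nat -> 'rV[R]_d -> R, exists w : option 'I_d -> 'rV[R]_d -> R,
  [/\ forall n, tail_hull n (z n), forall i, torusLp p%:E (w i) &
      forall i (e : R), 0 < e -> exists N, forall n, (N <= n)%N ->
        tint (fun x => `|jet1 i (z n) x - w i x|) <= e].
Proof.
pose A n := [set energy f | f in tail_hull n].
have A0 n : A n !=set0.
  by exists (energy (u_ n)); exists (u_ n) => //; apply: midpoint_hull_base; exists n.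
have Alb n : has_lbound (A n) by exists 0 => _ [f _ <-]; exact: energy_ge0.
pose a n := inf (A n).
have a_le n f : tail_hull n f -> a n <= energy f by move=> Hf; apply: (ge_inf (Alb n)); exists f.
have hullS m n f : (m <= n)%N -> tail_hull n f -> tail_hull m f.
  by move=> mn; apply: midpoint_hullS => k [j nj ->]; exists j => //; exact: leq_trans nj.
have a_nd m n : (m <= n)%N -> a m <= a n.
  move=> mn; apply: lb_le_inf; first exact: A0.
  by move=> _ [f Hf <-]; apply: a_le; exact: hullS Hf.
have a_ub : has_ubound (range a).
  exists (\sum_(i : option 'I_d) (2 + K)) => _ [n _ <-].
  have [y [f Hf _]] := A0 n.
  exact: le_trans (a_le _ _ Hf) (tail_hull_energy Hf).
pose s := sup (range a).
have a_s n : a n <= s by apply: ub_le_sup => //; exists n.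
have /choice[z Hz] n : exists f, tail_hull n f /\ energy f < a n + n.+1%:R^-1.
  have n0 : 0 < n.+1%:R^-1 :> R by rewrite invr_gt0.
  by have [y [f Hf fy] fa] := inf_adherent n0 (conj (A0 n) (Alb n)); exists f; rewrite fy.
have Cz n : Cinfty (z n) := tail_hull_Cinfty (Hz n).1.
have [K2 HK2] := tail_hull_cauchy_bound.
have cauchy i (e : R) : 0 < e -> exists N, forall n q, (N <= n)%N -> (N <= q)%N ->
    tint (fun x => `|jet1 i (z n) x - jet1 i (z q) x|) <= e.
  move=> e0; have e3 : 0 < e / 3 by rewrite divr_gt0.
  have K20 : 0 < `|K2| + 1 by rewrite ltr_wpDl.
  (* [L], [lam] and [eta] are chosen in this order so that the power term, M^3 / lam and the defect
     term of [norm_sub_le_defect] each contribute at most e/3. *)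
  pose L := (`|K2| + 1) / (e / 3); have L0 : 0 < L by rewrite divr_gt0.
  have [M M0 HM] := powR_superlinear L0 p1.
  pose lam := M ^+ 3 / (e / 3); have lam0 : 0 < lam by rewrite divr_gt0// exprn_gt0.
  pose eta := e / 3 / lam / 2; have eta0 : 0 < eta by rewrite divr_gt0// divr_gt0.
  have [y [N1 _ yE]] := sup_adherent eta0 (conj (ex_intro _ (a 0%N) (ex_intro2 _ _ 0%N I erefl)) a_ub).
  rewrite -yE => HN1.
  have [N2 HN2] : exists N, forall n, (N <= n)%N -> n.+1%:R^-1 <= eta :> R.
    have := near_infty_natSinv_lt (PosNum eta0); case=> N _ H; exists N => n Nn; apply: ltW; exact: (H n Nn).
  exists (maxn N1 N2) => n q; rewrite !geq_max => /andP[n1 n2] /andP[q1 q2].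
  have Hn := hullS _ _ _ n1 (Hz n).1; have Hq := hullS _ _ _ q1 (Hz q).1.
  have En : energy (z n) <= s + eta.
    by apply: le_trans (ltW (Hz n).2) _; apply: lerD; [exact: a_s|exact: HN2].
  have Eq : energy (z q) <= s + eta.
    by apply: le_trans (ltW (Hz q).2) _; apply: lerD; [exact: a_s|exact: HN2].
  have Em := a_le _ _ (midpoint_hull_mid Hn Hq).
  have SD : \sum_i tint (fun x => defect (jet1 i (z n) x) (jet1 i (z q) x)) <= 2 * eta.
    by rewrite (energy_defect (Cz n) (Cz q)); exact: midpoint_gap_le HN1 Em En Eq.
  have def0 j : 0 <= tint (fun x => defect (jet1 j (z n) x) (jet1 j (z q) x)).
    by apply: tint_ge0 => x; exact: (defect_lower _ _).2.
  have Di : tint (fun x => defect (jet1 i (z n) x) (jet1 i (z q) x)) <= 2 * eta.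
    by apply: le_trans SD; rewrite (bigD1 i)//= lerDl sumr_ge0.
  have [I3 B3] := HK2 _ _ _ i Hn Hq.
  have cj k : cper (jet1 i (z k)) by exact/Cinfty_cper/Cinfty_jet1.
  have Id : tintegrable (fun x => defect (jet1 i (z n) x) (jet1 i (z q) x)).
    apply: cper_tintegrable; apply: cperB.
      by apply: cperM; [apply: cperD; exact: cper_sqrt1|exact: cper_cst].
    by apply: cper_sqrt1; apply: cperM; [exact: cperD|exact: cper_cst].
  have Ic := cper_tintegrable (cper_cst (M ^+ 3 / lam) : cper (fun _ : 'rV[R]_d => M ^+ 3 / lam)).
  have I1 := tintegrableD (tintegrableZ lam Id) Ic.
  have I2 := tintegrableZ L^-1 I3.
  apply: (@le_trans _ _ (tint (fun x => lam * defect (jet1 i (z n) x) (jet1 i (z q) x) + M ^+ 3 / lam +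
     L^-1 * (sqrt1 (jet1 i (z n) x) + sqrt1 (jet1 i (z q) x)) `^ p))).
    apply: le_tint; [exact: (cper_tintegrable (cper_norm (cperB (cj n) (cj q))))|exact: tintegrableD|].
    by move=> x; rewrite [L^-1 * _]mulrC; exact: norm_sub_le_defect.
  rewrite (tintD I1 I2) (tintD (tintegrableZ lam Id) Ic) (tintZ _ Id) (tintZ _ I3) tint_cst.
  have T1 : lam * tint (fun x => defect (jet1 i (z n) x) (jet1 i (z q) x)) <= e / 3.
    apply: (@le_trans _ _ (lam * (2 * eta))); first by rewrite ler_pM2l.
    by rewrite /eta le_eqVlt; apply/orP; left; apply/eqP; field; rewrite gt_eqF.
  have T2 : M ^+ 3 / lam = e / 3 by rewrite /lam; field; rewrite !gt_eqF ?exprn_gt0.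
  have T3 : L^-1 * tint (fun x => (sqrt1 (jet1 i (z n) x) + sqrt1 (jet1 i (z q) x)) `^ p) <= e / 3.
    rewrite ler_pdivrMl// (le_trans B3)// /L divfK ?gt_eqF//.
    by rewrite (le_trans (ler_norm _))// lerDl.
  by rewrite T2; exact: third_sum_le.
have /choice[w Hw] i := L1_complete (fun n => Cinfty_cper (Cinfty_jet1 i (Cz n))) (cauchy i).
exists z, w; split=> [n|i|i e e0]; first exact: (Hz n).1.
- have [_ _ _ H] := Hw i; apply: (H _ K (ltW p1)) => n.
  exact: tail_hull_bound (Hz n).1.
- by have [_ _ H _] := Hw i; exact: H.
Qed.

End midpoint_hulls.

(** * Limits of integrals against test functions *)

Section limit_helpers.
Context {R : realType} {d : nat}.
Implicit Types f phi : 'rV[R]_d -> R.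

Lemma bounded_torusLoo f (B : R) : periodic f -> tmeas f -> (forall x, `|f x| <= B) -> torusLp +oo%E f.
Proof.
move=> pf mf fB; split=> //.
rewrite inE; apply/andP; split; first by rewrite inE.
rewrite inE /finite_norm /= unlock /Lnorm.
have P0 : (0 < torus_leb R d [set: d.-tuple (measurableTypeR R)])%E.
  by rewrite probability_setT lte_fin.
rewrite P0.
apply: (@le_lt_trans _ _ B%:E); last exact: ltry.
by apply/ess_sup_inf.ess_supP; apply: aeW => t /=; rewrite lee_fin.
Qed.

Lemma tint_le_mul f phi (B : R) : tintegrable f -> cper phi -> (forall x, `|phi x| <= B) ->
  `|tint (fun x => f x * phi x)| <= B * tint (fun x => `|f x|).
Proof.
move=> If cphi phiB; have I1 := tintegrableM_cper If cphi.
rewrite (le_trans (le_norm_tint I1))// -tintZ; last exact: tintegrable_norm.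
apply: le_tint; [exact: tintegrable_norm|by apply: tintegrableZ; exact: tintegrable_norm|].
by move=> x; rewrite normrM mulrC ler_wpM2r.
Qed.

Lemma tint_mulBl f g phi : tintegrable f -> tintegrable g -> cper phi ->
  tint (fun x => f x * phi x) - tint (fun x => g x * phi x) = tint (fun x => (f x - g x) * phi x).
Proof.
move=> If Ig cphi; rewrite -tintB; [|exact: tintegrableM_cper|exact: tintegrableM_cper].
by apply: eq_tint => x; rewrite mulrBl.
Qed.

Lemma tint_test_limit (f_ : nat -> 'rV[R]_d -> R) f phi : (forall n, tintegrable (f_ n)) ->
  tintegrable f -> cper phi ->
  (forall e : R, 0 < e -> exists N, forall n, (N <= n)%N -> tint (fun x => `|f_ n x - f x|) <= e) ->
  forall e : R, 0 < e -> exists N, forall n, (N <= n)%N ->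
    `|tint (fun x => f_ n x * phi x) - tint (fun x => f x * phi x)| <= e.
Proof.
move=> If_ If cphi H e e0; have [B B0 phiB] := cper_bounded cphi.
have B1 : 0 < B + 1 by rewrite ltr_wpDl.
have [N HN] := H _ (divr_gt0 e0 B1); exists N => n /HN Hn.
rewrite tint_mulBl// (le_trans (tint_le_mul (tintegrableB (If_ n) If) cphi phiB))//.
apply: (@le_trans _ _ ((B + 1) * (e / (B + 1)))).
  by apply: ler_pM => //; [apply: tint_ge0 => x|rewrite lerDl].
by rewrite mulrC divfK ?gt_eqF.
Qed.

Lemma distribution_of_tint f : tintegrable f ->
  distribution_on_torus (fun phi => tint (fun x => f x * phi x)).
Proof.
move=> If; split=> [a phi psi Cphi Cpsi|].
  have I1 := tintegrableM_cper If (Cinfty_cper Cphi); have I2 := tintegrableM_cper If (Cinfty_cper Cpsi).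
  rewrite -tintZ// -tintD//; last exact: tintegrableZ.
  by apply: eq_tint => x; ring.
exists 0%N, (tint (fun x => `|f x|)) => phi B Cphi HB.
rewrite mulrC; apply: tint_le_mul => //; first exact: Cinfty_cper.
by move=> x; exact: (HB [::]).
Qed.

Lemma weak_limit_ge0 (m_ : nat -> 'rV[R]_d -> R) m : (forall j, Cinfty (m_ j)) ->
  (forall j x, 0 <= m_ j x) -> torusLp 1%:E m ->
  (forall psi, torusLp +oo%E psi -> tint (fun x => m_ j x * psi x) @[j --> \oo] --> tint (fun x => m x * psi x)) ->
  ae_torus (fun x => 0 <= m x).
Proof.
move=> Cm m0 Lm W; have Im := torusLp_tintegrable (lexx 1) Lm.
have mA : measurable [set t : d.-tuple (measurableTypeR R) | m (row_of t) < 0].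
  have := tintegrable_tmeas Im measurableT (measurable_itv `]-oo, 0[ ).
  rewrite setTI; congr measurable; apply/seteqP; split=> t /=; rewrite in_itv //=.
(* The indicator of the set where the limit is negative is a bounded measurable test, admissible
   because the convergence is weak in L^1. *)
pose psi x : R := (m x < 0)%R%:R.
have psi01 x : `|psi x| <= 1.
  by rewrite /psi; case: (_ < _); rewrite ?normr1 ?normr0.
have mpsi : tmeas psi.
  rewrite /tmeas (_ : psi \o _ = \1_[set t : d.-tuple (measurableTypeR R) | m (row_of t) < 0]).
    exact: measurable_indic.
  apply/funext => t; rewrite /psi /= indicE; congr (nat_of_bool _)%:R.
  by apply/idP/idP; rewrite inE.
have ppsi : periodic psi by move=> x k; rewrite /psi Lm.1.
have C := W _ (bounded_torusLoo ppsi mpsi psi01).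
have I1 : tintegrable (fun x => m x * psi x) by exact: (tintegrableM Im mpsi psi01).
have ge : 0 <= tint (fun x => m x * psi x).
  rewrite -(cvg_lim _ C)//; apply: limr_ge; first by apply/cvg_ex; eexists; exact: C.
  by near=> j; apply: tint_ge0 => x; rewrite mulr_ge0 ?m0// /psi ler0n.
have mp x : m x * psi x <= 0.
  by rewrite /psi; case: ltP => [mx|_]; rewrite ?mulr0// mulr1 ltW.
have z : tint (fun x => `|m x * psi x|) = 0.
  have -> : tint (fun x => `|m x * psi x|) = tint (fun x => -1 * (m x * psi x)).
    by apply: eq_tint => x; rewrite ler0_norm// mulN1r.
  apply/eqP; rewrite eq_le tint_ge0 ?andbT; last by move=> x; rewrite mulN1r oppr_ge0.
  by rewrite tintZ// mulN1r oppr_le0.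
apply: ae_torusS (tint0_ae I1 z) => x H; rewrite leNgt; apply/negP => mx.
by move: H; rewrite /psi mx mulr1 => mx0; rewrite mx0 ltxx in mx.
Unshelve. all: by end_near. Qed.

Lemma linear_ge0_coef (a b : R) : (forall t : R, 0 <= a + t * b) -> b = 0.
Proof.
move=> H; apply/eqP; apply/negPn/negP => b0.
have := H (- (a + 1) / b); rewrite divfK// => h; lra.
Qed.

End limit_helpers.

Section linear_arithmetic_limits.
Context {R : realType}.
Implicit Types a b c e : R.

Lemma norm_oppD_le (p q r : R) : `|- (p + r)| <= `|- q - p| + `|q - r|.
Proof. by rewrite (_ : - (p + r) = (- q - p) + (q - r)) ?ler_normD//; ring. Qed.

Lemma test_base_le a b c d e : b - c <= e -> 0 <= a - (c + d) -> d <= a - b + e.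
Proof. lra. Qed.

Lemma test_limit_ge a b c d e : - (e / 2) <= c - d -> c <= a - b + e / 2 -> 0 <= a - (b + d) + e.
Proof. lra. Qed.

End linear_arithmetic_limits.

(** * Passage to the limit *)

Section existence.
Context {R : realType} {d : nat}.
Context (E : set R) (hE : E = [set m | 0 < m] \/ E = [set m | 0 <= m]).
Context (H : Hamiltonian R d) (h : ('rV[R]_d -> R) -> 'rV[R]_d -> R).
Context (g g1 g2 : 'rV[R]_d -> R -> R -> R) (gamma tau : R).
Context (h_op : operator_Mac_C h) (g_cont : g_continuous E g).
Context (h_reg : h_regularity h) (g_struct : g_structure E h g g1 g2).
Context (g_comp : g_compactness E h g1) (H_grow : H_growth E h H g gamma tau).
Context (H_smooth : H_smoothness E H) (A_mono : A_monotone E h H).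

Definition test_pair := {y : ('rV[R]_d -> R) * ('rV[R]_d -> R) | CinftyE E y.1 /\ Cinfty y.2}.
Implicit Types y : test_pair.
Local Notation eta y := (sval y).1.
Local Notation vv y := (sval y).2.
Local Notation A1y y := (A1 h H (eta y) (vv y)).
Local Notation A2y y := (A2 h H (eta y) (vv y)).
Local Notation PA phi psi y := (pairing h H phi psi (eta y) (vv y)).

Lemma cst_test_pair (s : R) : 0 < s ->
  CinftyE E (fun _ : 'rV[R]_d => s) /\ Cinfty (fun _ : 'rV[R]_d => 0 : R).
Proof.
by move=> s0; split; [split; [exact: Cinfty_cst|move=> _; exact: (E_gt0 hE)]|exact: Cinfty_cst].
Qed.

Definition base_pair (s : R) (s0 : 0 < s) : test_pair := exist _ (fun=> s, fun=> 0) (cst_test_pair s0).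

Let half0 : 0 < 1 / 2 :> R. Proof. by rewrite divr_gt0. Qed.
Let two0 : 0 < 2 :> R. Proof. by []. Qed.

Let cA1 y : cper (A1y y).
Proof. exact: (Cinfty_cper (Cinfty_A1 hE h_op h_reg H_smooth (svalP y).1 (svalP y).2)). Qed.

Let cA2 y : cper (A2y y).
Proof. exact: (Cinfty_cper (Cinfty_A2 hE h_op h_reg H_smooth (svalP y).1 (svalP y).2)). Qed.

Let gam1 : 1 < gamma. Proof. by have [] := H_grow. Qed.

Lemma galerkin_sequence (ts : nat -> test_pair) : exists m_ u_ : nat -> 'rV[R]_d -> R, exists K : R,
  [/\ forall j, CinftyE E (m_ j) /\ Cinfty (u_ j),
      forall j, (eint (fun x => (m_ j x * comp_g h g1 (m_ j) x)%:E) <= K%:E)%E,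
      forall j i, tint (fun x => `|jet1 i (u_ j) x| `^ gamma) <= K &
      forall j n, (n <= j)%N ->
        0 <= PA (eta (ts n)) (vv (ts n)) (ts n) - PA (m_ j) (u_ j) (ts n)].
Proof.
(* The constants 1/2, 1, 2 come first, so every Galerkin problem contains them and the a priori
   bounds apply; the first j + 4 tests then include [ts 0], ..., [ts j]. *)
pose Y n : test_pair := match n with
  | 0 => base_pair half0 | 1 => base_pair ltr01 | 2 => base_pair two0 | n.+3 => ts n end.
have CY n : CinftyE E (eta (Y n)) := (svalP (Y n)).1.
have CV n : Cinfty (vv (Y n)) := (svalP (Y n)).2.
have step j : exists mu : ('rV[R]_d -> R) * ('rV[R]_d -> R), [/\ CinftyE E mu.1, Cinfty mu.2 &
    forall n, (n < j.+4)%N ->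
    0 <= pairing h H (fun x => eta (Y n) x - mu.1 x) (fun x => vv (Y n) x - mu.2 x) mu.1 mu.2].
  have [l Sl Hl] := @galerkin_solution R d E hE h h_op h_reg H H_smooth A_mono j.+3
    (fun i => eta (Y i)) (fun i => vv (Y i)) (fun i => CY i) (fun i => CV i).
  exists (comb l (fun i : 'I_j.+4 => eta (Y i)), comb l (fun i : 'I_j.+4 => vv (Y i))); split.
  - by apply: (CinftyE_comb hE Sl) => i; exact: CY.
  - by apply: Cinfty_comb => i; exact: CV.
  - by move=> n nj; exact: (Hl (Ordinal nj)).
have /choice[mu Hmu] := step.
have [K HK] := apriori_bounds hE h_op h_reg H_smooth g_cont g_struct H_grow.
have bnd j : [/\ (eint (fun x => ((mu j).1 x * comp_g h g1 (mu j).1 x)%:E) <= K%:E)%E, tint (mu j).1 <= K,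
      tint (fun x => enorm (grad (mu j).2 x) `^ gamma) <= K & `|tint (mu j).2| <= K].
  have [a b Hj] := Hmu j; apply: (HK _ _ a b) => s.
  by case=> [->|[->|->]]; [exact: (Hj 0%N)|exact: (Hj 1%N)|exact: (Hj 2%N)].
have [Kp Kp0 HKp] := poincare d (ltW gam1).
have gam0 : 0 <= gamma by apply: ltW; apply: lt_trans gam1.
have K0 : 0 <= K by have [_ _ _ /(le_trans (normr_ge0 _))] := bnd 0%N.
have D j i : tint (fun x => `|partial i (mu j).2 x| `^ gamma) <= K.
  have [_ _ B _] := bnd j; have [_ C _] := Hmu j; apply: le_trans B; apply: le_tint.
  - by apply: powR_cper_tintegrable => //; exact: (Cinfty_cper (Cinfty_partial i C)).
  - have := powR_cper_tintegrable gam0 (cper_enorm_grad C).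
    by congr tintegrable; apply/funext => x; rewrite ger0_norm// sqrtr_ge0.
  - move=> x; apply: ge0_ler_powR; rewrite ?nnegrE ?sqrtr_ge0//.
    rewrite -sqrtr_sqr ler_sqrt; last by apply: sumr_ge0 => k _; exact: sqr_ge0.
    by rewrite (bigD1 i)//= mxE lerDl sumr_ge0// => k _; exact: sqr_ge0.
(* The second summand is the Poincare bound for u itself, from its mean and its gradient. *)
pose K' := K + Kp * (K `^ gamma + \sum_(i < d) K).
have S0 : 0 <= Kp * (K `^ gamma + \sum_(i < d) K).
  by rewrite mulr_ge0// addr_ge0 ?powR_ge0// sumr_ge0.
exists (fun j => (mu j).1), (fun j => (mu j).2), K'; split.
- by move=> j; have [a b _] := Hmu j.
- by move=> j; have [a _ _ _] := bnd j; apply: (le_trans a); rewrite lee_fin lerDl.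
- move=> j [i|] /=; first by rewrite (le_trans (D j i))// lerDl.
  have [_ C _] := Hmu j; have [_ _ _ U] := bnd j.
  apply: (le_trans (HKp _ C)); apply: (@le_trans _ _ (Kp * (K `^ gamma + \sum_(i < d) K))); last by rewrite lerDr.
  rewrite ler_wpM2l// lerD//; first by apply: ge0_ler_powR; rewrite ?nnegrE.
  by apply: ler_sum => i _; exact: D.
- move=> j n nj; have [a b Hj] := Hmu j.
  have := Hj n.+3 (nj : (n.+3 < j.+4)%N) => Hn.
  have [Cn1 Cn2] := svalP (ts n).
  rewrite -(pairingB hE h_op h_reg H_smooth Cn1.1 Cn2 a.1 b Cn1 Cn2).
  (* The Galerkin inequality has [A] at the approximate solution; monotonicity moves it to the test
     pair. *)
  apply: (le_trans Hn).
  exact: (pairing_monotone hE h_op h_reg H_smooth A_mono Cn1 Cn2 a b).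
Qed.

(** Only the [u_j] are combined convexly, while the densities converge weakly along the sequence
    itself. This mismatch is harmless: once the density is replaced by its limit, with an error
    uniform on a tail, the inequality is affine in u alone. *)
Lemma limit_solution (ts : nat -> test_pair) : exists m0 u0 : 'rV[R]_d -> R,
  [/\ Mac m0, sobolev 1 gamma u0 &
    forall n, 0 <= PA (eta (ts n)) (vv (ts n)) (ts n) - PA m0 u0 (ts n)].
Proof.
have [m_ [u_ [K [C_ mK uK VI]]]] := galerkin_sequence ts.
have [|sigma [m0 [hs Lm0 W]]] := g_comp (fun j => CinftyE_MacE hE (C_ j).1).
  by apply: (@le_lt_trans _ _ K%:E); [apply: ub_ereal_sup => _ [j _ <-]; exact: mK|exact: ltry].
have sj j : (j <= sigma j)%N.
  by elim: j => // j IH; apply: (leq_ltn_trans IH); exact: hs.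
pose mj j := m_ (sigma j); pose uj j := u_ (sigma j).
have Cm j : Cinfty (mj j) := (C_ (sigma j)).1.1.
have Cu j : Cinfty (uj j) := (C_ (sigma j)).2.
have [z [w [Hz Lw Hw]]] := hull_limit gam1 Cu (fun j i => uK (sigma j) i).
pose u0 := w None.
have Iw i := torusLp_tintegrable (ltW gam1) (Lw i).
have Cz n : Cinfty (z n) := tail_hull_Cinfty Cu (Hz n).
have Im0 := torusLp_tintegrable (lexx 1) Lm0.
exists m0, u0; split.
- split=> //; apply: (weak_limit_ge0 Cm _ Lm0 W) => j x.
  by apply: (E_ge0 hE); exact: (C_ (sigma j)).1.2.
- split; first exact: Lw.
  move=> [|i [|//]] _.
    by exists u0; split; [exact: Lw|move=> phi _; rewrite expr0 mul1r].
  exists (w (Some i)); split; first exact: Lw.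
  (* Integration by parts holds for each smooth [z n], and both sides converge since functions and
     partial derivatives converge in L^1. *)
  move=> phi Cphi; rewrite expr1 mulN1r.
  have L1 := tint_test_limit (fun n => Cinfty_tintegrable (Cz n)) (Iw None)
    (Cinfty_cper (Cinfty_partial i Cphi)) (Hw None).
  have L2 := tint_test_limit (fun n => Cinfty_tintegrable (Cinfty_partial i (Cz n))) (Iw (Some i))
    (Cinfty_cper Cphi) (Hw (Some i)).
  apply/eqP; rewrite -subr_eq0 opprK -normr_le0; apply/ler_addgt0Pr => e e0.
  have e2 : 0 < e / 2 by rewrite divr_gt0.
  have [N1 HN1] := L1 _ e2; have [N2 HN2] := L2 _ e2.
  have B1 := HN1 _ (leq_maxl N1 N2); have B2 := HN2 _ (leq_maxr N1 N2).
  rewrite (tint_parts i (Cz _) Cphi) in B1.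
  rewrite add0r [leRHS]splitr; apply: le_trans (lerD B1 B2).
  rewrite -[X in `|X|]opprK normrN.
  exact: norm_oppD_le.
- move=> n; set y := ts n.
  have [B B0 AB] := cper_bounded (cA2 y).
  apply/ler_addgt0Pr => e e0.
  have e2 : 0 < e / 2 by rewrite divr_gt0.
  have [B1 _ AB1] := cper_bounded (cA1 y).
  have Lpsi : torusLp +oo%E (A1y y).
    by apply: (bounded_torusLoo (cA1 y).2 _ AB1); exact: cper_tmeas.
  have /cvgrPdist_le/(_ _ e2)[J0 _ HJ0] := W _ Lpsi.
  pose J := maxn J0 n.
  have hullb f : tail_hull uj J f ->
      tint (fun x => f x * A2y y x) <= PA (eta y) (vv y) y - tint (fun x => m0 x * A1y y x) + e / 2.
    elim=> [_ [j Jj ->]|k l Hk IHk Hl IHl].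
      have nj : (n <= sigma j)%N.
        by apply: leq_trans (sj j); apply: leq_trans Jj; exact: leq_maxr.
      have V := VI _ _ nj; have := HJ0 j (leq_trans (leq_maxl _ _) Jj).
      rewrite /= ler_norml => /andP[_ V0].
      exact: test_base_le V0 V.
    have Ck := tail_hull_Cinfty Cu Hk; have Cl := tail_hull_Cinfty Cu Hl.
    have Ik := tintegrableM_cper (Cinfty_tintegrable Ck) (cA2 y).
    have Il := tintegrableM_cper (Cinfty_tintegrable Cl) (cA2 y).
    have -> : tint (fun x => (k x + l x) / 2 * A2y y x) =
        2^-1 * (tint (fun x => k x * A2y y x) + tint (fun x => l x * A2y y x)).
      rewrite -tintD// -tintZ; last exact: tintegrableD.
      by apply: eq_tint => x; ring.
    exact: half_sum_le.
  have [N HN] := tint_test_limit (fun n => Cinfty_tintegrable (Cz n)) (Iw None) (cA2 y) (Hw None) e2.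
  (* Late enough for [z N'] to be close to [u0] and to lie in the hull of the tail starting at
     [J]. *)
  pose N' := maxn N J.
  have zJ : tail_hull uj J (z N').
    apply: (midpoint_hullS _ (Hz N')) => k [j Nj ->]; exists j => //.
    by apply: leq_trans Nj; exact: leq_maxr.
  have Z1 := hullb _ zJ; have := HN N' (leq_maxl _ _); rewrite ler_norml => /andP[Z2 _].
  exact: test_limit_ge Z2 Z1.
Qed.

End existence.

Lemma dense_test_le (R : realType) (e' M U a a' p p' q q' : R) :
  0 <= a' - (p' + q') -> `|p - p'| <= M -> `|q - q'| <= U -> `|a - a'| <= e' ->
  0 <= a - (p + q) + (e' + M + U).
Proof. by rewrite !ler_norml => ? /andP[? ?] /andP[? ?] /andP[? ?]; lra. Qed.

(** * Extension to all test pairs, and the total mass *)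

Section existence_all_tests.
Context {R : realType} {d : nat}.
Context (E : set R) (hE : E = [set m | 0 < m] \/ E = [set m | 0 <= m]).
Context (H : Hamiltonian R d) (h : ('rV[R]_d -> R) -> 'rV[R]_d -> R).
Context (g g1 g2 : 'rV[R]_d -> R -> R -> R) (gamma tau : R).
Context (h_op : operator_Mac_C h) (g_cont : g_continuous E g).
Context (h_reg : h_regularity h) (g_struct : g_structure E h g g1 g2).
Context (g_comp : g_compactness E h g1) (H_grow : H_growth E h H g gamma tau).
Context (H_smooth : H_smoothness E H) (A_mono : A_monotone E h H).
Implicit Types m u eta v : 'rV[R]_d -> R.

Lemma existence_all_tests : exists m0 u0 : 'rV[R]_d -> R, [/\ Mac m0, sobolev 1 gamma u0 &
  forall eta v, CinftyE E eta -> Cinfty v ->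
    0 <= pairing h H eta v eta v - pairing h H m0 u0 eta v].
Proof.
pose T := @test_pair R d E.
pose F1 (y : T) := A1 h H (sval y).1 (sval y).2; pose F2 (y : T) := A2 h H (sval y).1 (sval y).2.
pose a (y : T) := pairing h H (sval y).1 (sval y).2 (sval y).1 (sval y).2.
have c1 y : cper (F1 y) := Cinfty_cper (Cinfty_A1 hE h_op h_reg H_smooth (svalP y).1 (svalP y).2).
have c2 y : cper (F2 y) := Cinfty_cper (Cinfty_A2 hE h_op h_reg H_smooth (svalP y).1 (svalP y).2).
have [ts Hts] := countable_uniform_dense (base_pair hE ltr01) a c1 c2.
have [m0 [u0 [Mm0 Su0 VI]]] :=
  limit_solution hE h_op g_cont h_reg g_struct g_comp H_grow H_smooth A_mono ts.
exists m0, u0; split=> // eta v CE Cv.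
have gam1 : 1 <= gamma by have [/ltW] := H_grow.
have Im := torusLp_tintegrable (lexx 1) Mm0.1; have Iu := torusLp_tintegrable gam1 Su0.1.
pose y : T := exist _ (eta, v) (conj CE Cv).
pose M := tint (fun x => `|m0 x|); pose U := tint (fun x => `|u0 x|).
have M0 : 0 <= M by apply: tint_ge0 => x; exact: normr_ge0.
have U0 : 0 <= U by apply: tint_ge0 => x; exact: normr_ge0.
apply/ler_addgt0Pr => e e0.
have S0 : 0 < 1 + M + U by rewrite ltr_wpDr// ltr_wpDr.
(* Replacing the test by a nearby one changes the inequality by at most the distance times 1 + M +
   U, where M and U are the L^1 norms of the limits. *)
have [n [n1 n2 n3]] := Hts y _ (divr_gt0 e0 S0).
move: (VI n) n1 n2 n3; set e' := e / _; set y' := ts n => V n1 n2 n3.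
have D (f phi phi' : 'rV[R]_d -> R) : tintegrable f -> cper phi -> cper phi' -> (forall x, `|phi x - phi' x| <= e') ->
    `|tint (fun x => f x * phi x) - tint (fun x => f x * phi' x)| <= e' * tint (fun x => `|f x|).
  move=> If cphi cphi' He; rewrite -tintB; [|exact: tintegrableM_cper|exact: tintegrableM_cper].
  rewrite (@eq_tint _ _ _ (fun x => f x * (phi x - phi' x))); last by move=> x; rewrite mulrBr.
  by apply: tint_le_mul => //; exact: cperB.
have D1 := D _ _ _ Im (c1 y) (c1 y') n1; have D2 := D _ _ _ Iu (c2 y) (c2 y') n2.
have eE : e = e' + e' * M + e' * U by rewrite /e'; field; rewrite gt_eqF.
rewrite eE.
exact: (dense_test_le V D1 D2 n3).
Qed.

Lemma grad_cst (t : R) : grad (fun _ : 'rV[R]_d => t) = fun=> 0.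
Proof. by apply/funext => x; apply/rowP => i; rewrite !mxE partial_cst. Qed.

Lemma hess_cst (t : R) : hess (fun _ : 'rV[R]_d => t) = fun=> 0.
Proof. by apply/funext => x; apply/matrixP => i j; rewrite !mxE /= !partial_cst. Qed.

(** Test with [eta = 1] and [v = t]. The first component of [A] depends on t through the summand -t,
    the second not at all, and the latter has integral 0. The inequality is affine in t with slope
    [tint m0 - 1], and t is an arbitrary real number. *)
Lemma unit_mass m0 u0 : tintegrable m0 -> tintegrable u0 ->
  (forall eta v, CinftyE E eta -> Cinfty v ->
    0 <= pairing h H eta v eta v - pairing h H m0 u0 eta v) -> tint m0 = 1.
Proof.
move=> Im Iu VI.
pose one : 'rV[R]_d -> R := fun=> 1.
have C1 : CinftyE E one by split; [exact: Cinfty_cst|move=> x; exact: (E_gt0 hE ltr01)].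
have Cc (t : R) : Cinfty (fun _ : 'rV[R]_d => t) := Cinfty_cst t.
pose B1 := A1 h H one (fun=> 0); pose B2 := A2 h H one (fun=> 0).
have A1E (t : R) : A1 h H one (fun=> t) = fun x => - t + B1 x.
  by apply/funext => x; rewrite /B1 /A1 !grad_cst !hess_cst oppr0 add0r.
have A2E (t : R) : A2 h H one (fun=> t) = B2.
  by apply/funext => x; rewrite /B2 /A2 !grad_cst !hess_cst.
have cB1 : cper B1 := Cinfty_cper (Cinfty_A1 hE h_op h_reg H_smooth C1 (Cc 0)).
have cB2 : cper B2 := Cinfty_cper (Cinfty_A2 hE h_op h_reg H_smooth C1 (Cc 0)).
have IB2 := cper_tintegrable cB2; have IB1 := cper_tintegrable cB1.
have It (t : R) : tintegrable (fun _ : 'rV[R]_d => t) := cper_tintegrable (cper_cst t).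
(* Testing with the constant 1 removes the divergence terms, and [eta - 1] vanishes. *)
have B20 : tint B2 = 0.
  have := tint_weak_A2 hE h_op h_reg H_smooth (Cc 1) C1 (Cc 0).
  rewrite (@eq_tint _ _ _ B2) => [->|x]; last by rewrite mul1r.
  rewrite (@eq_tint _ _ _ (fun=> 0)) ?tint_cst// => x; rewrite /weak_A2.
  rewrite big1 => [|i _]; last by rewrite partial_cst mul0r.
  rewrite big1 => [|i _]; last by rewrite big1// => j _; rewrite /= !partial_cst mul0r.
  by rewrite mul1r !addr0 subrr.
have ImB1 := tintegrableM_cper Im cB1.
have {VI}VI (t : R) : 0 <= (tint (fun x => one x * (- t + B1 x)) + tint (fun x => t * B2 x))
    - (tint (fun x => m0 x * (- t + B1 x)) + tint (fun x => u0 x * B2 x)).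
  by have := VI _ _ C1 (Cc t); rewrite /pairing A2E A1E.
move: A1E A2E => _ _; clearbody B1 B2.
have L (t : R) : 0 <= (tint B1 - tint (fun x => m0 x * B1 x) - tint (fun x => u0 x * B2 x)) + t * (tint m0 - 1).
  have E1 : tint (fun x => one x * (- t + B1 x)) = - t + tint B1.
    rewrite (@eq_tint _ _ _ (fun x => - t + B1 x)); last by move=> x; rewrite mul1r.
    by rewrite (tintD (It (- t)) IB1) tint_cst.
  have E2 : tint (fun x => t * B2 x) = 0 by rewrite (tintZ t IB2) B20 mulr0.
  have E3 : tint (fun x => m0 x * (- t + B1 x)) = - t * tint m0 + tint (fun x => m0 x * B1 x).
    rewrite (@eq_tint _ _ _ (fun x => - t * m0 x + m0 x * B1 x)).
      by rewrite (tintD (tintegrableZ (- t) Im) ImB1) (tintZ (- t) Im).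
    by move=> x; rewrite mulrDr [m0 x * - t]mulrC.
  have := VI t; rewrite E1 E2 E3.
  set b := tint B1; set w := tint m0; set p := tint _; set q := tint _.
  by have -> : b - p - q + t * (w - 1) = - t + b + 0 - (- t * w + p + q) by ring.
by apply/eqP; rewrite -subr_eq0; apply/eqP; exact: linear_ge0_coef L.
Qed.

End existence_all_tests.

Theorem theorem1p1 (R : realType) (d : nat) (d_ge1 : (1 <= d)%N)
  (E : set R) (hE : E = [set m | 0 < m] \/ E = [set m | 0 <= m])
  (H : Hamiltonian R d) (h : ('rV[R]_d -> R) -> 'rV[R]_d -> R)
  (g g1 g2 : 'rV[R]_d -> R -> R -> R) (gamma tau : R)
  (h_op : operator_Mac_C h) (g_cont : g_continuous E g)
  (h_reg : h_regularity h) (g_struct : g_structure E h g g1 g2)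
  (g_comp : g_compactness E h g1) (H_grow : H_growth E h H g gamma tau)
  (H_smooth : H_smoothness E H) (A_mono : A_monotone E h H) :
  exists m u : ('rV[R]_d -> R) -> R,
    weak_solution E h H m u /\
    exists m0 u0 : 'rV[R]_d -> R,
    [/\ Mac m0 /\ regular_distribution m0 m,
        sobolev 1 gamma u0 /\ regular_distribution u0 u &
        tint m0 = 1].
Proof.
have [m0 [u0 [Mm0 Su0 VI]]] :=
  existence_all_tests hE h_op g_cont h_reg g_struct g_comp H_grow H_smooth A_mono.
have gam1 : 1 <= gamma by have [/ltW] := H_grow.
have Im := torusLp_tintegrable (lexx 1) Mm0.1.
have Iu := torusLp_tintegrable gam1 Su0.1.
exists (fun phi => tint (fun x => m0 x * phi x)), (fun phi => tint (fun x => u0 x * phi x)).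
split; last first.
  exists m0, u0; split; [by split|by split|].
  exact: (unit_mass hE h_op h_reg H_smooth Im Iu VI).
split.
- exact: distribution_of_tint.
- exact: distribution_of_tint.
- move=> phi Cphi phi0; rewrite -(@tint_cst R d 0).
  apply: le_ae_tint.
  + exact: cper_tintegrable (cper_cst 0).
  + exact: tintegrableM_cper Im (Cinfty_cper Cphi).
  + by apply: ae_torusS Mm0.2 => x m0x; rewrite mulr_ge0.
- move=> eta v CE Cv; have := VI _ _ CE Cv.
  by rewrite /pairing opprD addrACA.
Qed.
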